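(* Let $(\mathfrak g=\mathfrak l\oplus\mathfrak u_+\oplus\mathfrak u_-,\ t\in S^2(\mathfrak g)^{\mathfrak g})$ be a quadratic polarized Lie algebra, nondegenerate as a polarized Lie algebra, with $t=t_{\mathfrak l}+s+s^{2,1}$, $t_{\mathfrak l}\in S^2(\mathfrak l)$, $s\in\mathfrak u_+\otimes\mathfrak u_-$. Let $\Phi$ be a Lie associator, $c\in\mathbb C$, $\hbar$ a formal parameter, $\kappa=\hbar c$, and $\Phi_\kappa^{-1}(A,B)=\Phi(\kappa A,\kappa B)^{-1}$. Set $$\bar J=\Phi_\kappa^{-1}\big(t^{1,2},\,t_{\mathfrak l}^{2,3}-s^{1,2}-m(\bar s)^{(2)}\big)\,J_{\mathfrak l}^{\mathfrak g},\qquad \bar s=s^{2,1}.$$ Then $\bar J\in U(\mathfrak g)^{\otimes2}\widehat\otimes\widehat U_{\mathfrak l}[[\hbar]]$ is a solution of the dynamical pseudotwist equation $$\bar J^{12,3,4}\bar J^{1,2,34}=\Phi_\kappa^{-1}(t^{1,2},t^{2,3})\,\bar J^{1,23,4}\bar J^{2,3,4}.$$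
   Context: All Lie algebras are finite dimensional over $\mathbb C$. Polarized: $\mathfrak l,\mathfrak u_\pm$ Lie subalgebras, $[\mathfrak l,\mathfrak u_\pm]\subset\mathfrak u_\pm$; nondegenerate: for generic $\lambda\in\mathfrak l^*$ the form $(x,y)\mapsto\lambda([x,y]_{\mathfrak l})$ on $\mathfrak u_+\oplus\mathfrak u_-$ is nondegenerate ($[\cdot]_{\mathfrak l}$: projection to $\mathfrak l$ along $\mathfrak u_+\oplus\mathfrak u_-$). $t$ need not be nondegenerate. $d'=\dim\mathfrak u_\pm$; $D_0'\in S^{d'}(\mathfrak l)$ is the determinant of $([x_i,y_j]_{\mathfrak l})$ for bases $(x_i)$ of $\mathfrak u_+$, $(y_j)$ of $\mathfrak u_-$. $\widehat U_{\mathfrak l}$ is Springer's microlocalization of $U(\mathfrak l)$ at a lift $D'\in U(\mathfrak l)_{\le d'}$ of $D_0'$: the complete separated $\mathbb Z$-filtered algebra containing $U(\mathfrak l)$, in which $D'$ is invertible, with associated graded $S^\cdot(\mathfrak l)[1/D'_0]$, universal for filtered morphisms to complete separated filtered algebras inverting $D'$. For a vector space $V$, $V\widehat\otimes\widehat U_{\mathfrak l}=\varprojlim_k(V\otimes\widehat U_{\mathfrak l})/(V\otimes(\widehat U_{\mathfrak l})_{\le k})$. The coproduct extends to $\Delta:\widehat U_{\mathfrak l}\to U(\mathfrak l)\widehat\otimes\widehat U_{\mathfrak l}$ (and to $\widehat U_{\mathfrak l}\to\widehat U_{\mathfrak l}\widehat\otimes U(\mathfrak l)$), the antipode $S$ extends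 to $\widehat U_{\mathfrak l}$; Sweedler notation $\Delta(x)=\sum x^{(1)}\otimes x^{(2)}$. $H:U(\mathfrak g)\to U(\mathfrak l)$, $H(x_+x_0x_-)=\varepsilon(x_+)\varepsilon(x_-)x_0$ ($x_\pm\in U(\mathfrak u_\pm)$, $x_0\in U(\mathfrak l)$). $K=\sum_ia_i\otimes b_i\otimes\ell_i\in(U(\mathfrak u_+)\otimes U(\mathfrak u_-))\widehat\otimes\widehat U_{\mathfrak l}$ is the unique element with $\sum_iH(xa_i)\ell_iH(b_iy)=H(xy)$ for all $x\in U(\mathfrak l\oplus\mathfrak u_-)$, $y\in U(\mathfrak l\oplus\mathfrak u_+)$, and $J_{\mathfrak l}^{\mathfrak g}=\sum_ia_i\otimes S(b_i)S(\ell_i^{(2)})\otimes S(\ell_i^{(1)})$. Notation: $m$ is the product map of $U(\mathfrak g)$; $x^{(i)}$ is $x$ in the $i$-th tensor factor and $y^{i,j}$ places the two legs of $y$ in factors $i,j$. For $X\in U(\mathfrak g)^{\otimes2}\widehat\otimes\widehat U_{\mathfrak l}$: $X^{12,3,4},X^{1,23,4},X^{1,2,34}$ are obtained by applying the coproduct to the first, second, third factor (for the third, $\Delta:\widehat U_{\mathfrak l}\to U(\mathfrak l)\widehat\otimes\widehat U_{\mathfrak l}$), $X^{2,3,4}=1\otimes X$. A Lie associator (Drinfeld) is a group-like formal series $\Phi(A,B)$ in noncommuting variables $A,B$ (the exponential of a Lie series whose terms all have positive degree in both $A$ and $B$) satisfying $\Phi(B,A)=\Phi(A,B)^{-1}$,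 the hexagon relations (with parameter as for the Knizhnik-Zamolodchikov (KZ) associator), and the pentagon relation $\Phi(\tau_{12},\tau_{23}+\tau_{24})\Phi(\tau_{13}+\tau_{23},\tau_{34})=\Phi(\tau_{23},\tau_{34})\Phi(\tau_{12}+\tau_{13},\tau_{24}+\tau_{34})\Phi(\tau_{12},\tau_{23})$ in the completed algebra generated by $\tau_{ij}=\tau_{ji}$, $1\le i\ne j\le4$, with $[\tau_{ij},\tau_{kl}]=0$ for distinct $i,j,k,l$ and $[\tau_{ij}+\tau_{ik},\tau_{jk}]=0$ for distinct $i,j,k$. An example is the KZ associator, the renormalized holonomy from $0$ to $1$ of $dF/dz=(A/z+B/(z-1))F$. *)

(* Defs.v *)
From HB Require Import structures.
From mathcomp Require Import all_boot all_order all_algebra.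
From mathcomp Require Import generic_quotient complex.
From mathcomp Require Import boolp classical_sets reals trigo.

Set Implicit Arguments.
Unset Strict Implicit.
Unset Printing Implicit Defensive.

Import Order.TTheory GRing.Theory Num.Theory.
Local Open Scope ring_scope.
Local Open Scope quotient_scope.

Section Functional.
Variables (K : fieldType) (V : lmodType K).

Definition subspace (W : V -> Prop) : Prop :=
  W 0 /\ forall a u v, W u -> W v -> W (a *: u + v).

Lemma functional_ex (W : V -> Prop) (v : V) : subspace W -> ~ W v ->
  exists f : V -> K^o, [/\ linear f, forall w, W w -> f w = 0 & f v = 1].
Proof.
move=> [W0 WL] Wv.
pose T := {X : V -> Prop | [/\ subspace X, forall w, W w -> X w & ~ X v]}.
pose le (X Y : T) := `[< forall w, sval X w -> sval Y w >].
have leR X : le X X by apply/asboolP.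
have leT X Y Z : le X Y -> le Y Z -> le X Z.
  by move=> /asboolP xy /asboolP yz; apply/asboolP=> w /xy /yz.
have leA X Y : le X Y -> le Y X -> X = Y.
  case: X Y => [X hX] [Y hY] /asboolP/= xy /asboolP/= yx.
  by apply: eq_exist; apply/funext=> w; apply/propext; split=> [/xy|/yx].
have chain (A : set T) : total_on A le -> exists t, forall s, A s -> le s t.
  move=> tA.
  have [[X0 AX0]|nA] := pselect (exists X, A X); last first.
    have h : [/\ subspace W, forall w, W w -> W w & ~ W v] by split.
    by exists (exist _ W h) => s As; case: nA; exists s.
  pose Y w := exists2 X, A X & sval X w.
  have hY : [/\ subspace Y, forall w, W w -> Y w & ~ Y v].
    split.
    - split; first by exists X0 => //; case: (svalP X0) => [[]].
      move=> a u w [X AX Xu] [X' AX' X'w].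
      have [/asboolP h|/asboolP h] := tA _ _ AX AX'.
        by exists X' => //; case: (svalP X') => -[_ L] _ _; apply: L => //; apply: h.
      by exists X => //; case: (svalP X) => -[_ L] _ _; apply: L => //; apply: h.
    - by move=> w Ww; exists X0 => //; case: (svalP X0) => _ + _; apply.
    - by move=> [X AX]; case: (svalP X).
  by exists (exist _ Y hY) => s As; apply/asboolP=> w sw; exists s.
have [[X [sX WX Xv]] maxX] := Zorn leR leT leA chain.
have X0 : X 0 := sX.1.
have XL a u w : X u -> X w -> X (a *: u + w) := sX.2 a u w.
have XZ a u : X u -> X (a *: u) by move=> Xu; rewrite -[_ *: _]addr0; apply: (XL).
have XD u w : X u -> X w -> X (u + w) by move=> *; rewrite -[u]scale1r; apply: (XL).
have XN u : X u -> X (- u) by move=> *; rewrite -scaleN1r; apply: (XZ).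
have key u : exists a, X (u - a *: v).
  have [Xu|nXu] := pselect (X u); first by exists 0; rewrite scale0r subr0.
  pose Y w := exists b, X (w - b *: u).
  have [[b Xb]|nYv] := pselect (Y v).
    have b0 : b != 0.
      by apply/eqP=> b0; apply: (Xv); move: Xb; rewrite b0 scale0r subr0.
    exists b^-1; have := XZ (- b^-1) _ Xb.
    by rewrite scalerBr scalerA mulNr mulVf // scaleN1r opprK scaleNr addrC.
  have sY : [/\ subspace Y, forall w, W w -> Y w & ~ Y v].
    split=> //; last by move=> w Ww; exists 0; rewrite scale0r subr0; exact: (WX _ Ww).
    split; first by exists 0; rewrite scale0r subr0.
    move=> a x y [b Xb] [c Xc]; exists (a * b + c).
    have -> : a *: x + y - (a * b + c) *: u =
              a *: (x - b *: u) + (y - c *: u).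
      by rewrite scalerBr scalerDl scalerA opprD addrACA.
    exact: (XL).
  have eqXY : exist _ Y sY = exist _ X (And3 sX WX Xv) :> T.
    apply: maxX; apply/asboolP => w /= Xw.
    by exists 0; rewrite scale0r subr0.
  case: nXu; move/(congr1 (fun S : T => sval S u)): eqXY => /= <-.
  by exists 1; rewrite scale1r subrr.
have uniq u a b : X (u - a *: v) -> X (u - b *: v) -> a = b.
  move=> Xa Xb; apply/eqP/negPn/negP; rewrite -subr_eq0 => ab; apply: (Xv).
  have := XZ (a - b)^-1 _ (XD _ _ Xb (XN _ Xa)).
  have -> : u - b *: v - (u - a *: v) = (a - b) *: v.
    by rewrite opprB addrC addrA subrK scalerBl.
  by rewrite scalerA mulVf // scale1r.
pose f u : K^o := sval (cid (key u)).
have fP u : X (u - f u *: v) by rewrite /f; case: cid.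
exists f; split.
- move=> a x y; apply: (uniq (a *: x + y)); first exact: fP.
  have -> : a *: x + y - (a *: f x + f y) *: v =
            a *: (x - f x *: v) + (y - f y *: v).
    by rewrite scalerBr scalerDl scalerA opprD addrACA.
  by apply: (XL); exact: fP.
- move=> w Ww; apply: (uniq w); first exact: fP.
  by rewrite scale0r subr0; exact: (WX _ Ww).
- by apply: (uniq v); [exact: fP | rewrite scale1r subrr].
Qed.

End Functional.

(* A presentation is a type of generators together with the class of the
   evaluations of the generators, in arbitrary algebras, that satisfy the
   relations; [pres_ok] makes the presented algebra nonzero, as [algType]
   requires. *)
Record presentation (K : fieldType) := Presentation {
  pgen : Type;
  prel : forall A : algType K, (pgen -> A) -> Prop;
  pres_ok : exists (A : algType K) (f : pgen -> A), prel f }.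

Section Presented.
Variables (K : fieldType).

Inductive term (X : Type) : Type :=
| TGen of X | TCst of K | TAdd of term X & term X | TMul of term X & term X.

HB.instance Definition _ X := gen_eqMixin (term X).
HB.instance Definition _ X := gen_choiceMixin (term X).

Fixpoint teval X (A : algType K) (f : X -> A) (t : term X) : A :=
  match t with
  | TGen x => f x
  | TCst c => c%:A
  | TAdd s t => teval f s + teval f t
  | TMul s t => teval f s * teval f t
  end.

Variable P : presentation K.

Definition term_eq (s t : term (pgen P)) : bool :=
  `[< forall (A : algType K) (f : pgen P -> A), prel f -> teval f s = teval f t >].

Lemma term_eq_equiv : equiv_class_of term_eq.
Proof.
split=> [x|x y|y x z].
- by apply/asboolP.
- by apply/asboolP/asboolP=> h A f hf; rewrite h.
- by move=> /asboolP h1 /asboolP h2; apply/asboolP=> A f hf; rewrite h1 ?h2.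
Qed.
Canonical term_equiv := EquivRelPack term_eq_equiv.

Definition palg : Type := {eq_quot term_equiv}.
HB.instance Definition _ := Choice.on palg.

Definition pcls (t : term (pgen P)) : palg := \pi_({eq_quot term_equiv}) t.
Definition pgenr (x : pgen P) : palg := pcls (TGen x).

(* Only meaningful when f satisfies the relations; see [plift_cls]. *)
Definition plift (A : algType K) (f : pgen P -> A) (u : palg) : A :=
  teval f (repr (u : {eq_quot term_equiv})).

Lemma plift_cls (A : algType K) (f : pgen P -> A) t :
  prel f -> plift f (pcls t) = teval f t.
Proof.
move=> hf; have : term_eq (repr (pcls t : {eq_quot term_equiv})) t.
  by apply/eqmodP; rewrite reprK.
by move/asboolP; apply.
Qed.

Lemma palg_ext (u v : palg) :
  (forall (A : algType K) (f : pgen P -> A), prel f -> plift f u = plift f v) ->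
  u = v.
Proof.
move=> h; rewrite -[u](@reprK _ {eq_quot term_equiv}).
rewrite -[v](@reprK _ {eq_quot term_equiv}); apply/eqmodP/asboolP.
exact: h.
Qed.

Let rp (u : palg) : term (pgen P) := repr (u : {eq_quot term_equiv}).
Let pzero := pcls (TCst _ 0).
Let pone := pcls (TCst _ 1).
Let padd u v := pcls (TAdd (rp u) (rp v)).
Let pmul u v := pcls (TMul (rp u) (rp v)).
Let popp u := pcls (TMul (TCst _ (- 1)) (rp u)).
Let pscale c u := pcls (TMul (TCst _ c) (rp u)).

Section Eval.
Variables (A : algType K) (f : pgen P -> A) (hf : prel f).
Fact pl0 : plift f pzero = 0. Proof. by rewrite plift_cls //= scale0r. Qed.
Fact pl1 : plift f pone = 1. Proof. by rewrite plift_cls //= scale1r. Qed.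
Fact plD u v : plift f (padd u v) = plift f u + plift f v.
Proof. by rewrite plift_cls. Qed.
Fact plM u v : plift f (pmul u v) = plift f u * plift f v.
Proof. by rewrite plift_cls. Qed.
Fact plN u : plift f (popp u) = - plift f u.
Proof. by rewrite plift_cls //= mulr_algl scaleN1r. Qed.
Fact plZ c u : plift f (pscale c u) = c *: plift f u.
Proof. by rewrite plift_cls //= mulr_algl. Qed.
Definition plE := (pl0, pl1, plD, plM, plN, plZ).
End Eval.

Let paddA : associative padd.
Proof. by move=> x y z; apply: palg_ext => A f hf; rewrite !(plE hf) addrA. Qed.
Let paddC : commutative padd.
Proof. by move=> x y; apply: palg_ext => A f hf; rewrite !(plE hf) addrC. Qed.
Let padd0 : left_id pzero padd.
Proof. by move=> x; apply: palg_ext => A f hf; rewrite !(plE hf) add0r. Qed.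
Let paddN : left_inverse pzero popp padd.
Proof. by move=> x; apply: palg_ext => A f hf; rewrite !(plE hf) addNr. Qed.
HB.instance Definition _ := GRing.isZmodule.Build palg paddA paddC padd0 paddN.

Let pmulA : associative pmul.
Proof. by move=> x y z; apply: palg_ext => A f hf; rewrite !(plE hf) mulrA. Qed.
Let pmul1 : left_id pone pmul.
Proof. by move=> x; apply: palg_ext => A f hf; rewrite !(plE hf) mul1r. Qed.
Let pmulr1 : right_id pone pmul.
Proof. by move=> x; apply: palg_ext => A f hf; rewrite !(plE hf) mulr1. Qed.
Let pmulDl : left_distributive pmul +%R.
Proof. by move=> x y z; apply: palg_ext => A f hf; rewrite !(plE hf) mulrDl. Qed.
Let pmulDr : right_distributive pmul +%R.
Proof. by move=> x y z; apply: palg_ext => A f hf; rewrite !(plE hf) mulrDr. Qed.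
Let pone0 : pone != 0.
Proof.
apply/eqP=> /= h; have [A [f hf]] := pres_ok P.
have := congr1 (plift f) h; rewrite !(plE hf) => /eqP.
by rewrite (negbTE (oner_neq0 _)).
Qed.
HB.instance Definition _ := GRing.Zmodule_isNzRing.Build palg
  pmulA pmul1 pmulr1 pmulDl pmulDr pone0.

Let pscaleA a b u : pscale a (pscale b u) = pscale (a * b) u.
Proof. by apply: palg_ext => A f hf; rewrite !(plE hf) scalerA. Qed.
Let pscale1 : left_id 1 pscale.
Proof. by move=> x; apply: palg_ext => A f hf; rewrite !(plE hf) scale1r. Qed.
Let pscaleDr : right_distributive pscale +%R.
Proof. by move=> a x y; apply: palg_ext => A f hf; rewrite !(plE hf) scalerDr. Qed.
Let pscaleDl u : {morph pscale^~ u : a b / a + b}.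
Proof. by move=> a b; apply: palg_ext => A f hf; rewrite !(plE hf) scalerDl. Qed.
HB.instance Definition _ := GRing.Zmodule_isLmodule.Build K palg
  pscaleA pscale1 pscaleDr pscaleDl.

Let pscaleAl a (u v : palg) : a *: (u * v) = (a *: u) * v.
Proof. by apply: palg_ext => A f hf; rewrite !(plE hf) scalerAl. Qed.
HB.instance Definition _ := GRing.Lmodule_isLalgebra.Build K palg pscaleAl.
Let pscaleAr a (u v : palg) : a *: (u * v) = u * (a *: v).
Proof. by apply: palg_ext => A f hf; rewrite !(plE hf) scalerAr. Qed.
HB.instance Definition _ := GRing.Lalgebra_isAlgebra.Build K palg pscaleAr.

End Presented.

Definition bilin (K : fieldType) (V W P : lmodType K) (b : V -> W -> P) : Prop :=
  (forall v, linear (b v)) /\ (forall w, linear (b^~ w)).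

Section Tensor.
Variables (K : fieldType) (V W : lmodType K).

Definition tsum (P : lmodType K) (b : V -> W -> P) (s : seq (V * W)) : P :=
  \sum_(p <- s) b p.1 p.2.

Definition tens_eq (s s' : seq (V * W)) : bool :=
  `[< forall (P : lmodType K) (b : V -> W -> P), bilin b -> tsum b s = tsum b s' >].

Lemma tens_eq_equiv : equiv_class_of tens_eq.
Proof.
split=> [x|x y|y x z].
- by apply/asboolP.
- by apply/asboolP/asboolP=> h P b hb; rewrite h.
- by move=> /asboolP h1 /asboolP h2; apply/asboolP=> P b hb; rewrite h1 ?h2.
Qed.
Canonical tens_equiv := EquivRelPack tens_eq_equiv.

(* Formal sums of pairs, modulo having the same value under all bilinear maps. *)
Definition tens : Type := {eq_quot tens_equiv}.
HB.instance Definition _ := Choice.on tens.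

Definition tcls (s : seq (V * W)) : tens := \pi_({eq_quot tens_equiv}) s.
Definition tpure (v : V) (w : W) : tens := tcls [:: (v, w)].

(* Only meaningful when b is bilinear; see [tlift_cls]. *)
Definition tlift (P : lmodType K) (b : V -> W -> P) (z : tens) : P :=
  tsum b (repr (z : {eq_quot tens_equiv})).

Lemma tlift_cls (P : lmodType K) (b : V -> W -> P) s :
  bilin b -> tlift b (tcls s) = tsum b s.
Proof.
move=> hb; have : tens_eq (repr (tcls s : {eq_quot tens_equiv})) s.
  by apply/eqmodP; rewrite reprK.
by move/asboolP; apply.
Qed.

Lemma tens_ext (z z' : tens) :
  (forall (P : lmodType K) (b : V -> W -> P), bilin b -> tlift b z = tlift b z') ->
  z = z'.
Proof.
move=> h; rewrite -[z](@reprK _ {eq_quot tens_equiv}).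
rewrite -[z'](@reprK _ {eq_quot tens_equiv}); apply/eqmodP/asboolP.
exact: h.
Qed.

Let rp (z : tens) : seq (V * W) := repr (z : {eq_quot tens_equiv}).
Let tzero := tcls [::].
Let tadd z z' := tcls (rp z ++ rp z').
Let tscale c z := tcls [seq (c *: p.1, p.2) | p <- rp z].
Let topp z := tscale (-1) z.

Section Eval.
Variables (P : lmodType K) (b : V -> W -> P) (hb : bilin b).
Fact tl0 : tlift b tzero = 0. Proof. by rewrite tlift_cls // /tsum big_nil. Qed.
Fact tlD u v : tlift b (tadd u v) = tlift b u + tlift b v.
Proof. by rewrite tlift_cls // /tsum big_cat. Qed.
Fact tlZ c u : tlift b (tscale c u) = c *: tlift b u.
Proof.
rewrite tlift_cls // /tsum big_map scaler_sumr.
apply: eq_bigr => p _ /=.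
have h0 : b 0 p.2 = 0.
  by have := hb.2 p.2 (-1) 0 0; rewrite /= scaler0 addr0 scaleN1r addNr.
by have := hb.2 p.2 c p.1 0; rewrite /= h0 !addr0.
Qed.
Definition tlE := (tl0, tlD, tlZ).
End Eval.

Let taddA : associative tadd.
Proof. by move=> x y z; apply: tens_ext => P b hb; rewrite !(tlE hb) addrA. Qed.
Let taddC : commutative tadd.
Proof. by move=> x y; apply: tens_ext => P b hb; rewrite !(tlE hb) addrC. Qed.
Let tadd0 : left_id tzero tadd.
Proof. by move=> x; apply: tens_ext => P b hb; rewrite !(tlE hb) add0r. Qed.
Let taddN : left_inverse tzero topp tadd.
Proof.
by move=> x; apply: tens_ext => P b hb; rewrite !(tlE hb) scaleN1r addNr.
Qed.
HB.instance Definition _ := GRing.isZmodule.Build tens taddA taddC tadd0 taddN.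

Let tscaleA a b u : tscale a (tscale b u) = tscale (a * b) u.
Proof. by apply: tens_ext => P f hf; rewrite !(tlE hf) scalerA. Qed.
Let tscale1 : left_id 1 tscale.
Proof. by move=> x; apply: tens_ext => P f hf; rewrite !(tlE hf) scale1r. Qed.
Let tscaleDr : right_distributive tscale +%R.
Proof. by move=> a x y; apply: tens_ext => P f hf; rewrite !(tlE hf) scalerDr. Qed.
Let tscaleDl u : {morph tscale^~ u : a b / a + b}.
Proof. by move=> a b; apply: tens_ext => P f hf; rewrite !(tlE hf) scalerDl. Qed.
HB.instance Definition _ := GRing.Zmodule_isLmodule.Build K tens
  tscaleA tscale1 tscaleDr tscaleDl.

Lemma tlift_linear (P : lmodType K) (b : V -> W -> P) :
  bilin b -> linear (tlift b : tens -> P).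
Proof. by move=> hb a x y; rewrite !(tlE hb). Qed.

Lemma tlift_pure (P : lmodType K) (b : V -> W -> P) v w :
  bilin b -> tlift b (tpure v w) = b v w.
Proof. by move=> hb; rewrite tlift_cls // /tsum big_seq1. Qed.

Lemma tpure_bilin : bilin tpure.
Proof.
split=> u a x y; apply: tens_ext => P b hb; rewrite (tlift_linear hb) !tlift_pure //.
- exact: hb.1.
- exact: (hb.2 u).
Qed.

End Tensor.

Section TensorMaps.
Variable K : fieldType.

Definition tmap (V W V' W' : lmodType K) (f : V -> V') (g : W -> W')
  : tens V W -> tens V' W' := tlift (fun v w => tpure (f v) (g w)).

Definition tflip (V W : lmodType K) : tens V W -> tens W V :=
  tlift (fun v w => tpure w v).

End TensorMaps.

Section TensorAlgebra.
Variables (K : fieldType) (A B : algType K).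
Local Notation T := (tens A B).

Definition tmul (z z' : T) : T :=
  tlift (fun a b => tlift (fun a' b' => tpure (a * a') (b * b')) z') z.

Let in1 (P : lmodType K) (b : A -> B -> P) x y : bilin b ->
  bilin (fun x' y' => b (x * x') (y * y')).
Proof.
move=> hb; split=> u c v w; rewrite /= mulrDr -scalerAr.
- exact: hb.1.
- exact: (hb.2 (y * u)).
Qed.

Let in2 (P : lmodType K) (b : A -> B -> P) x' y' : bilin b ->
  bilin (fun x y => b (x * x') (y * y')).
Proof.
move=> hb; split=> u c v w; rewrite /= mulrDl -scalerAl.
- exact: hb.1.
- exact: (hb.2 (u * y')).
Qed.

Let out (P : lmodType K) (b : A -> B -> P) (z : T) : bilin b ->
  bilin (fun x y => tlift (fun x' y' => b (x * x') (y * y')) z).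
Proof.
move=> hb; split=> u c v w; rewrite /tlift /tsum scaler_sumr -big_split /=;
  apply: eq_bigr => p _.
- exact: (in2 p.1 p.2 hb).1.
- exact: ((in2 p.1 p.2 hb).2 u).
Qed.

Let tliftM (P : lmodType K) (b : A -> B -> P) z z' : bilin b ->
  tlift b (tmul z z') =
  tlift (fun x y => tlift (fun x' y' => b (x * x') (y * y')) z') z.
Proof.
move=> hb; have lin := tlift_linear hb.
have lD u v : tlift b (u + v) = tlift b u + tlift b v.
  by have := lin 1 u v; rewrite !scale1r.
have l0 : tlift b 0 = 0.
  by have := lin (-1) 0 0; rewrite /= scaler0 addr0 scaleN1r addNr.
have lsum (I : Type) (s : seq I) F :
    tlift b (\sum_(i <- s) F i) = \sum_(i <- s) tlift b (F i).
  by elim: s => [|i s IH]; rewrite ?big_nil // !big_cons lD IH.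
rewrite [tmul _ _]/(tsum _ _) [RHS]/(tsum _ _) /tsum lsum; apply: eq_bigr => p _.
rewrite [X in tlift b X]/(tsum _ _) [RHS]/(tsum _ _) /tsum lsum.
by apply: eq_bigr => q _; rewrite tlift_pure.
Qed.

Section Lin.
Variables (P : lmodType K) (b : A -> B -> P) (hb : bilin b).
Fact tliftD (u v : T) : tlift b (u + v) = tlift b u + tlift b v.
Proof. by have := tlift_linear hb 1 u v; rewrite !scale1r. Qed.
Fact tlift0 : tlift b (0 : T) = 0.
Proof. by have := tlift_linear hb (-1) 0 0; rewrite /= scaler0 addr0 scaleN1r addNr. Qed.
Fact tliftZ c (u : T) : tlift b (c *: u) = c *: tlift b u.
Proof. by have := tlift_linear hb c u 0; rewrite !addr0 tlift0 addr0. Qed.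
Definition tliftL := (tliftD, tliftZ).
End Lin.

Let tmulA : associative tmul.
Proof.
move=> x y z; apply: tens_ext => P b hb; rewrite !tliftM //; last exact: out.
rewrite {1 3}/tlift; apply: eq_bigr => p _.
rewrite tliftM; last exact: in1.
rewrite {1 3}/tlift; apply: eq_bigr => q _.
by rewrite /tlift; apply: eq_bigr => r _; rewrite !mulrA.
Qed.
Let tmul1 : left_id (tpure 1 1) tmul.
Proof.
move=> x; apply: tens_ext => P b hb; rewrite tliftM // tlift_pure; last exact: out.
by rewrite /tlift; apply: eq_bigr => p _; rewrite !mul1r.
Qed.
Let tmulr1 : right_id (tpure 1 1) tmul.
Proof.
move=> x; apply: tens_ext => P b hb; rewrite tliftM // /tlift.
by apply: eq_bigr => p _; rewrite -/(tlift _ _) tlift_pure ?mulr1 //; exact: in1.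
Qed.
Let tmulDl : left_distributive tmul +%R.
Proof.
move=> x y z; apply: tens_ext => P b hb.
by rewrite (tliftL hb) !tliftM // (tliftL (out z hb)).
Qed.
Let tmulDr : right_distributive tmul +%R.
Proof.
move=> x y z; apply: tens_ext => P b hb; rewrite (tliftL hb) !tliftM //.
rewrite {1 3 5}/tlift /tsum -big_split; apply: eq_bigr => p _ /=.
by rewrite (tliftL (in1 p.1 p.2 hb)).
Qed.

Let tone0 : tpure 1 1 != 0 :> T.
Proof.
apply/eqP=> h.
have s0 (E : lmodType K) : subspace (fun v : E => v = 0).
  by split=> // a u v -> ->; rewrite scaler0 addr0.
have [f [fL _ f1]] := functional_ex (s0 A) (elimN eqP (oner_neq0 A)).
have [g [gL _ g1]] := functional_ex (s0 B) (elimN eqP (oner_neq0 B)).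
have hb : bilin (fun x y => f x * g y : K^o).
  split=> u a x y /=; rewrite ?fL ?gL; first by rewrite mulrDr -scalerAr.
  by rewrite mulrDl -scalerAl.
have := congr1 (tlift (fun x y => f x * g y : K^o)) h.
rewrite tlift_pure // f1 g1 mulr1.
have -> : tlift (fun x y => f x * g y : K^o) (0 : T) = 0.
  by have := tlift_linear hb (-1) 0 0; rewrite /= scaler0 addr0 scaleN1r addNr.
by move/eqP; rewrite oner_eq0.
Qed.
HB.instance Definition _ := GRing.Zmodule_isNzRing.Build T
  tmulA tmul1 tmulr1 tmulDl tmulDr tone0.

Let tscaleAl a (u v : T) : a *: (u * v) = (a *: u) * v.
Proof.
apply: tens_ext => P b hb; rewrite (tliftL hb) [LHS]/=.
by rewrite /GRing.mul /= !tliftM // (tliftL (out v hb)).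
Qed.
HB.instance Definition _ := GRing.Lmodule_isLalgebra.Build K T tscaleAl.
Let tscaleAr a (u v : T) : a *: (u * v) = u * (a *: v).
Proof.
apply: tens_ext => P b hb; rewrite (tliftL hb) /GRing.mul /= !tliftM //.
rewrite {1 3}/tlift /tsum scaler_sumr; apply: eq_bigr => p _ /=.
by rewrite (tliftL (in1 p.1 p.2 hb)).
Qed.
HB.instance Definition _ := GRing.Lalgebra_isAlgebra.Build K T tscaleAr.

Lemma tpureM a b a' b' : tpure a b * tpure a' b' = tpure (a * a') (b * b') :> T.
Proof.
apply: tens_ext => P h hh; rewrite /GRing.mul /= tliftM // !tlift_pure //.
- exact: in1.
- exact: out.
Qed.

End TensorAlgebra.

HB.mixin Record isFiltered (K : fieldType) A of GRing.Algebra K A := {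
  fil : int -> A -> Prop;
  fil_0 : forall n, fil n 0;
  fil_L : forall n a x y, fil n x -> fil n y -> fil n (a *: x + y);
  fil_mono : forall m n x, m <= n -> fil m x -> fil n x;
  fil_M : forall m n x y, fil m x -> fil n y -> fil (m + n) (x * y);
  fil_1 : fil 0 1;
  fil_exh : forall x, exists n, fil n x;
  fil_sep1 : exists n, ~ fil n 1 }.

(* Exhaustive increasing Z-filtrations; the last axiom says that the
   separated completion is nonzero. *)
#[short(type="filAlgType")]
HB.structure Definition FilteredAlgebra (K : fieldType) :=
  { A of isFiltered K A & GRing.Algebra K A }.

Definition fil_cvg (K : fieldType) (A : filAlgType K) (x : nat -> A) (y : A) :=
  forall k : int, exists N, forall n, (N <= n)%N -> fil k (x n - y).

Definition fil_cauchy (K : fieldType) (A : filAlgType K) (x : nat -> A) :=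
  forall k : int, exists N, forall m n, (N <= m)%N -> (N <= n)%N ->
    fil k (x m - x n).

HB.mixin Record isFilComplete (K : fieldType) A of FilteredAlgebra K A := {
  fil_sep : forall x : A, (forall k, fil k x) -> x = 0;
  fil_cpl : forall x : nat -> A, fil_cauchy x -> exists y, fil_cvg x y }.

#[short(type="compFilAlgType")]
HB.structure Definition CompleteFilteredAlgebra (K : fieldType) :=
  { A of isFilComplete K A & FilteredAlgebra K A }.

Section FilTheory.
Variables (K : fieldType) (E : filAlgType K).
Implicit Types x y : E.

Lemma fil_D k x y : fil k x -> fil k y -> fil k (x + y).
Proof. by move=> hx hy; rewrite -[x]scale1r; apply: fil_L. Qed.
Lemma fil_Z k a x : fil k x -> fil k (a *: x).
Proof. by move=> hx; rewrite -[_ *: _]addr0; apply: fil_L => //; apply: fil_0. Qed.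
Lemma fil_N k x : fil k x -> fil k (- x).
Proof. by move=> hx; rewrite -scaleN1r; apply: fil_Z. Qed.
Lemma fil_B k x y : fil k x -> fil k y -> fil k (x - y).
Proof. by move=> hx hy; apply: fil_D => //; apply: fil_N. Qed.
Lemma fil_Bsym k x y : fil k (x - y) -> fil k (y - x).
Proof. by move=> h; rewrite -opprB; apply: fil_N. Qed.
Lemma fil_trans k x y z : fil k (x - y) -> fil k (y - z) -> fil k (x - z).
Proof. by move=> h1 h2; rewrite -(subrK y x) -addrA; apply: fil_D. Qed.

Lemma cauchy_bounded (x : nat -> E) : fil_cauchy x ->
  exists d N, forall n, (N <= n)%N -> fil d (x n).
Proof.
move=> /(_ 0) [N hN]; have [e he] := fil_exh (x N).
exists (Order.max e 0), N => n Nn; rewrite -(subrK (x N) (x n)).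
apply: fil_D; [apply: (@fil_mono _ _ 0) | apply: (@fil_mono _ _ e)] => //.
- by rewrite le_max lexx orbT.
- exact: hN.
- by rewrite le_max lexx.
Qed.

End FilTheory.

Section Completion.
Variables (K : fieldType) (E : filAlgType K).

Definition cseq := {x : nat -> E | fil_cauchy x}.
HB.instance Definition _ := gen_eqMixin cseq.
HB.instance Definition _ := gen_choiceMixin cseq.

Definition cnull (x y : cseq) : bool :=
  `[< fil_cvg (fun n => sval x n - sval y n) 0 >].

Let cvg0 (x : nat -> E) : (forall n, x n = 0) -> fil_cvg x 0.
Proof. by move=> h k; exists 0%N => n _; rewrite h subr0; apply: fil_0. Qed.

Lemma cnull_equiv : equiv_class_of cnull.
Proof.
split=> [x|x y|y x z].
- by apply/asboolP; apply: cvg0 => n; rewrite subrr.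
- apply/asboolP/asboolP=> h k; have [N hN] := h k; exists N => n /hN;
    by rewrite !subr0; apply: fil_Bsym.
- move=> /asboolP h1 /asboolP h2; apply/asboolP=> k.
  have [N1 H1] := h1 k; have [N2 H2] := h2 k; exists (maxn N1 N2) => n.
  rewrite geq_max => /andP[/H1 + /H2]; rewrite !subr0; exact: fil_trans.
Qed.
Canonical cnull_equivr := EquivRelPack cnull_equiv.

(* Cauchy sequences modulo null sequences, i.e. the limit of the quotients of E
   by its filtration steps. *)
Definition completion : Type := {eq_quot cnull_equivr}.
HB.instance Definition _ := Choice.on completion.

Definition ccls (x : cseq) : completion := \pi_({eq_quot cnull_equivr}) x.
Definition crep (X : completion) : cseq := repr (X : {eq_quot cnull_equivr}).
Definition crepr (X : completion) : nat -> E := sval (crep X).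

Let crepK X : ccls (crep X) = X. Proof. exact: reprK. Qed.
Let cclsE x y : ccls x = ccls y <-> fil_cvg (fun n => sval x n - sval y n) 0.
Proof.
split=> [h|h]; last by apply/eqmodP/asboolP.
by apply/asboolP; move/eqmodP: h.
Qed.
Let crepr_ccls x : fil_cvg (fun n => crepr (ccls x) n - sval x n) 0.
Proof. by apply/cclsE; rewrite crepK. Qed.
Let cext X Y : fil_cvg (fun n => crepr X n - crepr Y n) 0 -> X = Y.
Proof. by move=> h; rewrite -[X]crepK -[Y]crepK; apply/cclsE. Qed.

Let cauchy_cst (x : E) : fil_cauchy (fun _ : nat => x).
Proof. by move=> k; exists 0%N => *; rewrite subrr; apply: fil_0. Qed.
Let cauchy_L a (x y : nat -> E) : fil_cauchy x -> fil_cauchy y ->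
  fil_cauchy (fun n => a *: x n + y n).
Proof.
move=> hx hy k; have [N1 H1] := hx k; have [N2 H2] := hy k.
exists (maxn N1 N2) => m n; rewrite !geq_max => /andP[m1 m2] /andP[n1 n2].
rewrite opprD addrACA -scalerBr; apply: fil_L; [exact: H1|exact: H2].
Qed.
Let bounded2 (x y : nat -> E) : fil_cauchy x -> fil_cauchy y ->
  exists d N, forall n, (N <= n)%N -> fil d (x n) /\ fil d (y n).
Proof.
move=> /cauchy_bounded[d1 [N1 H1]] /cauchy_bounded[d2 [N2 H2]].
exists (Order.max d1 d2), (maxn N1 N2) => n.
rewrite geq_max => /andP[/H1 h1 /H2 h2]; split.
- by apply: fil_mono h1; rewrite le_max lexx.
- by apply: fil_mono h2; rewrite le_max lexx orbT.
Qed.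
Let cauchy_M (x y : nat -> E) : fil_cauchy x -> fil_cauchy y ->
  fil_cauchy (fun n => x n * y n).
Proof.
move=> hx hy k; have [d [N0 H0]] := bounded2 hx hy.
have [N1 H1] := hx (k - d); have [N2 H2] := hy (k - d).
exists (maxn N0 (maxn N1 N2)) => m n; rewrite !geq_max.
move=> /and3P[m0 m1 m2] /and3P[n0 n1 n2].
rewrite -(subrK (x n * y m) (x m * y m)) -mulrBl -addrA -mulrBr.
apply: fil_D.
- by rewrite -(subrK d k); apply: fil_M; [exact: H1 | have [] := H0 _ m0].
- rewrite -(subrK d k) addrC; apply: fil_M; last exact: H2.
  by have [] := H0 _ n0.
Qed.

Definition ccst (x : E) : cseq := exist _ _ (cauchy_cst x).
Let cL a (x y : cseq) : cseq := exist _ _ (cauchy_L a (svalP x) (svalP y)).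
Let cM (x y : cseq) : cseq := exist _ _ (cauchy_M (svalP x) (svalP y)).

Definition cin (x : E) : completion := ccls (ccst x).

Let czero := cin 0.
Let cadd X Y := ccls (cL 1 (crep X) (crep Y)).
Let copp X := ccls (cL (-1) (crep X) (ccst 0)).
Let cscale a X := ccls (cL a (crep X) (ccst 0)).
Let cmul X Y := ccls (cM (crep X) (crep Y)).

Let eqL a x y x' y' : ccls x = ccls x' -> ccls y = ccls y' ->
  ccls (cL a x y) = ccls (cL a x' y').
Proof.
move=> /cclsE hx /cclsE hy; apply/cclsE => k /=.
have [N1 H1] := hx k; have [N2 H2] := hy k; exists (maxn N1 N2) => n.
rewrite geq_max => /andP[/H1 h1 /H2 h2]; move: h1 h2; rewrite !subr0 => h1 h2.
by rewrite opprD addrACA -scalerBr; apply: fil_L.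
Qed.
Let eqM x y x' y' : ccls x = ccls x' -> ccls y = ccls y' ->
  ccls (cM x y) = ccls (cM x' y').
Proof.
move=> /cclsE hx /cclsE hy; apply/cclsE => k /=.
have [d [N0 H0]] := bounded2 (svalP x') (svalP y).
have [N1 H1] := hx (k - d); have [N2 H2] := hy (k - d).
exists (maxn N0 (maxn N1 N2)) => n; rewrite !geq_max => /and3P[n0 n1 n2].
have := H1 _ n1; have := H2 _ n2; have [b1 b2] := H0 _ n0; rewrite !subr0 => h2 h1.
rewrite -(subrK (sval x' n * sval y n) (sval x n * sval y n)).
rewrite -mulrBl -addrA -mulrBr; apply: fil_D.
- by rewrite -(subrK d k); apply: fil_M.
- by rewrite -(subrK d k) addrC; apply: fil_M.
Qed.

Let eqcls (x y : cseq) : (forall n, sval x n = sval y n) -> ccls x = ccls y.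
Proof. by move=> h; apply/cclsE; apply: cvg0 => n; rewrite h subrr. Qed.
Let caddE x y : cadd (ccls x) (ccls y) = ccls (cL 1 x y).
Proof. by apply: eqL; rewrite crepK. Qed.
Let cscaleE a x : cscale a (ccls x) = ccls (cL a x (ccst 0)).
Proof. by apply: eqL; rewrite ?crepK. Qed.
Let cmulE x y : cmul (ccls x) (ccls y) = ccls (cM x y).
Proof. by apply: eqM; rewrite crepK. Qed.
Let cW (P : completion -> Prop) : (forall x, P (ccls x)) -> forall X, P X.
Proof. by move=> h X; rewrite -[X]crepK. Qed.

Let caddA : associative cadd.
Proof.
elim/cW=> x; elim/cW=> y; elim/cW=> z; rewrite !caddE; apply: eqcls => n /=.
by rewrite !scale1r addrA.
Qed.
Let caddC : commutative cadd.
Proof.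
by elim/cW=> x; elim/cW=> y; rewrite !caddE; apply: eqcls => n /=; rewrite !scale1r addrC.
Qed.
Let cadd0 : left_id czero cadd.
Proof. by elim/cW=> x; rewrite caddE; apply: eqcls => n /=; rewrite scale1r add0r. Qed.
Let caddN : left_inverse czero copp cadd.
Proof.
elim/cW=> x; rewrite /copp -/(cscale _ _) cscaleE caddE; apply: eqcls => n /=.
by rewrite scale1r scaleN1r addr0 addNr.
Qed.
HB.instance Definition _ := GRing.isZmodule.Build completion caddA caddC cadd0 caddN.

Let cmulA : associative cmul.
Proof.
elim/cW=> x; elim/cW=> y; elim/cW=> z; rewrite !cmulE; apply: eqcls => n /=.
by rewrite mulrA.
Qed.
Let cmul1 : left_id (cin 1) cmul.
Proof. by elim/cW=> x; rewrite cmulE; apply: eqcls => n /=; rewrite mul1r. Qed.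
Let cmulr1 : right_id (cin 1) cmul.
Proof. by elim/cW=> x; rewrite cmulE; apply: eqcls => n /=; rewrite mulr1. Qed.
Let cmulDl : left_distributive cmul cadd.
Proof.
elim/cW=> x; elim/cW=> y; elim/cW=> z; rewrite !(caddE, cmulE); apply: eqcls => n /=.
by rewrite !scale1r mulrDl.
Qed.
Let cmulDr : right_distributive cmul cadd.
Proof.
elim/cW=> x; elim/cW=> y; elim/cW=> z; rewrite !(caddE, cmulE); apply: eqcls => n /=.
by rewrite !scale1r mulrDr.
Qed.
Let cone0 : cin 1 != czero.
Proof.
apply/eqP => /cclsE h; have [k nk] := @fil_sep1 K E; have [N /(_ N (leqnn N))] := h k.
by rewrite /= !subr0.
Qed.
HB.instance Definition _ := GRing.Zmodule_isNzRing.Build completion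
  cmulA cmul1 cmulr1 cmulDl cmulDr cone0.

Let cscaleA a b X : cscale a (cscale b X) = cscale (a * b) X.
Proof.
elim/cW: X => x; rewrite !cscaleE; apply: eqcls => n /=.
by rewrite !addr0 scalerA.
Qed.
Let cscale1 : left_id 1 cscale.
Proof. by elim/cW=> x; rewrite !cscaleE; apply: eqcls => n /=; rewrite addr0 scale1r. Qed.
Let cscaleDr : right_distributive cscale cadd.
Proof.
move=> a; elim/cW=> x; elim/cW=> y; rewrite !(caddE, cscaleE, caddE); apply: eqcls => n /=.
by rewrite !addr0 !scale1r scalerDr.
Qed.
Let cscaleDl X a b : cscale (a + b) X = cadd (cscale a X) (cscale b X).
Proof.
elim/cW: X => x; rewrite !(cscaleE, caddE); apply: eqcls => n /=.
by rewrite !addr0 !scale1r scalerDl.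
Qed.
HB.instance Definition _ := GRing.Zmodule_isLmodule.Build K completion
  cscaleA cscale1 cscaleDr cscaleDl.

Let cscaleAl a (X Y : completion) : cscale a (cmul X Y) = cmul (cscale a X) Y.
Proof.
elim/cW: X => x; elim/cW: Y => y; rewrite !(cscaleE, cmulE, cscaleE).
by apply: eqcls => n /=; rewrite !addr0 scalerAl.
Qed.
HB.instance Definition _ := GRing.Lmodule_isLalgebra.Build K completion cscaleAl.
Let cscaleAr a (X Y : completion) : cscale a (cmul X Y) = cmul X (cscale a Y).
Proof.
elim/cW: X => x; elim/cW: Y => y; rewrite !(cscaleE, cmulE, cscaleE).
by apply: eqcls => n /=; rewrite !addr0 scalerAr.
Qed.
HB.instance Definition _ := GRing.Lalgebra_isAlgebra.Build K completion cscaleAr.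

Definition cfil (k : int) (X : completion) : Prop :=
  exists N, forall n, (N <= n)%N -> fil k (crepr X n).

Let cfilE k x : cfil k (ccls x) <-> exists N, forall n, (N <= n)%N -> fil k (sval x n).
Proof.
have [N1 H1] := crepr_ccls x k.
split=> -[N H]; exists (maxn N1 N) => n; rewrite geq_max => /andP[/H1 h1 /H h];
  move: h1; rewrite subr0 => h1.
- by rewrite -(subKr (crepr (ccls x) n) (sval x n)); apply: fil_B.
- by rewrite -(subrK (sval x n) (crepr _ n)); apply: fil_D.
Qed.

Let caddr x y : (ccls x + ccls y)%R = ccls (cL 1 x y). Proof. exact: caddE. Qed.
Let cscaler a x : (a *: ccls x)%R = ccls (cL a x (ccst 0)). Proof. exact: cscaleE. Qed.
Let cmulr x y : (ccls x * ccls y)%R = ccls (cM x y). Proof. exact: cmulE. Qed.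

Let cfil_0 k : cfil k 0.
Proof. by apply/cfilE; exists 0%N => n _ /=; apply: fil_0. Qed.
Let cfil_L k a X Y : cfil k X -> cfil k Y -> cfil k (a *: X + Y).
Proof.
elim/cW: X => x; elim/cW: Y => y /cfilE[N1 H1] /cfilE[N2 H2].
rewrite cscaler caddr; apply/cfilE; exists (maxn N1 N2) => n /=.
rewrite geq_max => /andP[/H1 h1 /H2 h2]; rewrite scale1r addr0; exact: fil_L.
Qed.
Let cfil_mono m n X : m <= n -> cfil m X -> cfil n X.
Proof. by move=> mn [N H]; exists N => i /H; apply: fil_mono. Qed.
Let cfil_M m n X Y : cfil m X -> cfil n Y -> cfil (m + n) (X * Y).
Proof.
elim/cW: X => x; elim/cW: Y => y /cfilE[N1 H1] /cfilE[N2 H2].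
rewrite cmulr; apply/cfilE; exists (maxn N1 N2) => i /=.
by rewrite geq_max => /andP[/H1 h1 /H2 h2]; exact: fil_M.
Qed.
Let cfil_1 : cfil 0 1.
Proof. by apply/cfilE; exists 0%N => n _ /=; apply: fil_1. Qed.
Let cfil_exh X : exists n, cfil n X.
Proof. exact: (cauchy_bounded (svalP (crep X))). Qed.
Let cfil_sep1 : exists n, ~ cfil n 1.
Proof.
have [k nk] := @fil_sep1 K E; exists k => /cfilE[N /(_ N (leqnn N))].
by rewrite /=.
Qed.
HB.instance Definition _ := isFiltered.Build K completion
  cfil_0 cfil_L cfil_mono cfil_M cfil_1 cfil_exh cfil_sep1.

Let cfilB k x y : cfil k (ccls x - ccls y) <->
  exists N, forall n, (N <= n)%N -> fil k (sval x n - sval y n).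
Proof.
rewrite -scaleN1r addrC cscaler caddr; split=> [/cfilE|] [N H].
  by exists N => n /H /=; rewrite addr0 scaleN1r scale1r addrC.
by apply/cfilE; exists N => n /H /=; rewrite addr0 scaleN1r scale1r addrC.
Qed.

Let cfil_sep (X : completion) : (forall k, fil k X) -> X = 0.
Proof.
elim/cW: X => x H; apply/cclsE => k; have /cfilE[N HN] := H k.
by exists N => n /HN; rewrite /= !subr0.
Qed.
Let cfil_cpl (X : nat -> completion) : fil_cauchy X -> exists Y, fil_cvg X Y.
Proof.
move=> HX.
have tail n : exists N, forall i j, (N <= i)%N -> (N <= j)%N ->
    fil (- n%:Z) (crepr (X n) i - crepr (X n) j) by exact: (svalP (crep (X n))).
pose t n := sval (cid (tail n)).
have tP n i j : (t n <= i)%N -> (t n <= j)%N ->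
    fil (- n%:Z) (crepr (X n) i - crepr (X n) j) by rewrite /t; case: cid => N; apply.
pose y n := crepr (X n) (t n).
have near k : exists N, forall m n, (N <= m)%N -> (N <= n)%N ->
    fil k (y m - y n) /\
    (exists M, forall i, (M <= i)%N -> fil k (crepr (X m) i - y n)).
  have [N0 H0] := HX k; exists (maxn N0 `|k|%N) => m n.
  rewrite !geq_max => /andP[m0 mk] /andP[n0 nk].
  have [M HM] : exists M, forall i, (M <= i)%N ->
      fil k (crepr (X m) i - crepr (X n) i).
    by apply/cfilB; rewrite !crepK; exact: H0.
  have small i : (`|k| <= i)%N -> - i%:Z <= k.
    move=> ki; rewrite lerNl; apply: le_trans (_ : `|k|%:Z <= _).
      by rewrite abszE -normrN ler_norm.
    by rewrite lez_nat.
  have cmp i : (maxn M (maxn (t m) (t n)) <= i)%N ->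
      fil k (crepr (X m) i - y n) /\ fil k (y m - crepr (X m) i).
    rewrite !geq_max => /and3P[Mi mi ni].
    have yi : fil k (crepr (X n) i - y n).
      by apply: fil_mono (small _ nk) _; apply: tP.
    split; last by apply: fil_mono (small _ mk) _; apply: tP.
    exact: fil_trans (HM _ Mi) yi.
  split; last by exists (maxn M (maxn (t m) (t n))) => i hi;
    have [] := cmp i hi.
  by have [h1 h2] := cmp _ (leqnn _); exact: fil_trans h2 h1.
have yC : fil_cauchy y.
  by move=> k; have [N H] := near k; exists N => m n mN nN; have [] := H m n mN nN.
exists (ccls (exist _ y yC)) => k; have [N H] := near k; exists N => m mN.
rewrite -[X m]crepK; apply/cfilB => /=.
have [_ [M HM]] := H m N mN (leqnn N).
exists (maxn M N) => n; rewrite geq_max => /andP[Mn Nn].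
have [h _] := H N n (leqnn N) Nn.
exact: fil_trans (HM _ Mn) h.
Qed.
HB.instance Definition _ := isFilComplete.Build K completion cfil_sep cfil_cpl.

End Completion.

(* The extension of phi by continuity; only meaningful when phi maps Cauchy
   sequences to convergent ones, e.g. when phi is linear and shifts the
   filtrations by a bounded amount. *)
Definition cext (K : fieldType) (E B : filAlgType K) (phi : E -> B)
    (X : completion E) : B :=
  xget 0 [set y | fil_cvg (fun n => phi (crepr X n)) y].

Section CompletedTensor.
Variables (K : fieldType) (A : algType K) (M : compFilAlgType K).

(* A (x) M, filtered by the A (x) fil k. *)
Definition ftens : Type := tens A M.
HB.instance Definition _ := GRing.Algebra.on ftens.

Definition tfil (k : int) (z : ftens) : Prop :=
  exists s : seq (A * M), (forall p, p \in s -> fil k p.2) /\ z = tcls s.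

Let tclsE (s : seq (A * M)) : tcls s = \sum_(p <- s) tpure p.1 p.2.
Proof.
elim: s => [|p s IH]; first by rewrite big_nil.
rewrite big_cons -IH; apply: tens_ext => P b hb.
rewrite (tliftD hb) tlift_pure // !tlift_cls //.
by rewrite /tsum big_cons.
Qed.
Let tfilE k z : tfil k z <-> exists s : seq (A * M),
  (forall p, p \in s -> fil k p.2) /\ z = \sum_(p <- s) (tpure p.1 p.2 : ftens).
Proof. by split=> -[s [h ->]]; exists s; split=> //; rewrite tclsE. Qed.

Let tfil_0 k : tfil k 0. Proof. by exists [::]; split. Qed.
Let tfil_L k a x y : tfil k x -> tfil k y -> tfil k (a *: x + y).
Proof.
move=> /tfilE[s [hs ->]] /tfilE[t [ht ->]]; apply/tfilE.
exists ([seq (a *: p.1, p.2) | p <- s] ++ t); split.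
  by move=> p; rewrite mem_cat => /orP[/mapP[q /hs qs ->]|/ht].
rewrite big_cat big_map /= scaler_sumr; congr (_ + _); apply: eq_bigr => p _.
apply: tens_ext => P b hb; rewrite (tliftZ hb) !tlift_pure //.
have h0 : b 0 p.2 = 0.
  by have := hb.2 p.2 (-1) 0 0; rewrite /= scaler0 addr0 scaleN1r addNr.
by have := hb.2 p.2 a p.1 0; rewrite /= h0 !addr0.
Qed.
Let tfil_mono m n x : m <= n -> tfil m x -> tfil n x.
Proof. by move=> mn [s [h ->]]; exists s; split=> // p /h; apply: fil_mono. Qed.
Let tfil_M m n x y : tfil m x -> tfil n y -> tfil (m + n) (x * y).
Proof.
move=> /tfilE[s [hs ->]] /tfilE[t [ht ->]]; apply/tfilE.
exists [seq (p.1 * q.1, p.2 * q.2) | p <- s, q <- t]; split.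
  by move=> p /allpairsP[[q r] /= [/hs hq /ht hr ->]]; apply: fil_M.
rewrite big_allpairs_dep mulr_suml; apply: eq_bigr => p _.
by rewrite mulr_sumr; apply: eq_bigr => q _; rewrite -tpureM.
Qed.
Let tfil_1 : tfil 0 1.
Proof.
by exists [:: (1, 1)]; split=> // p; rewrite inE => /eqP ->; apply: fil_1.
Qed.
Let tfil_exh x : exists n, tfil n x.
Proof.
have -> : x = tcls (repr (x : {eq_quot tens_equiv A M})).
  by rewrite /tcls reprK.
elim: (repr _) => [|p s [n hn]]; first by exists 0; apply: tfil_0.
have [m hm] := fil_exh p.2; exists (Order.max m n).
rewrite tclsE big_cons -tclsE -[tpure _ _]scale1r; apply: tfil_L.
  exists [:: p]; split; last by case: (p).
  move=> q; rewrite inE => /eqP ->; apply: (@fil_mono _ _ m) => //.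
  by rewrite le_max lexx.
by apply: (@tfil_mono n) => //; rewrite le_max lexx orbT.
Qed.
Let tfil_sep1 : exists n, ~ tfil n 1.
Proof.
have [k nk] := @fil_sep1 K M; exists k => -[s [hs h]].
have sF : subspace (@fil K M k).
  by split; [exact: fil_0 | move=> a u v; exact: fil_L].
have [g [gL g0 g1]] := functional_ex sF nk.
have s0 : subspace (fun v : A => v = 0).
  by split=> // a u v -> ->; rewrite scaler0 addr0.
have [f [fL _ f1]] := functional_ex s0 (elimN eqP (oner_neq0 A)).
have hb : bilin (fun x y => f x * g y : K^o).
  split=> u a x y /=; rewrite ?fL ?gL; first by rewrite mulrDr -scalerAr.
  by rewrite mulrDl -scalerAl.
have := congr1 (tlift (fun x y => f x * g y : K^o)) h.
rewrite (tlift_pure 1 1 hb) f1 g1 mulr1 tlift_cls // /tsum big_seq big1.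
  by move/eqP; rewrite oner_eq0.
by move=> p /hs hp; rewrite (g0 _ hp) mulr0.
Qed.
HB.instance Definition _ := isFiltered.Build K ftens
  tfil_0 tfil_L tfil_mono tfil_M tfil_1 tfil_exh tfil_sep1.

Definition ctens : Type := completion ftens.
HB.instance Definition _ := CompleteFilteredAlgebra.on ctens.

Definition cpure (a : A) (x : M) : ctens := cin (tpure a x : ftens).

(* The continuous linear map that is b on pure tensors. *)
Definition clift (B : filAlgType K) (b : A -> M -> B) : ctens -> B :=
  @cext K ftens B (tlift b).

End CompletedTensor.

Definition cmapl (K : fieldType) (A A' : algType K) (M : compFilAlgType K)
  (f : A -> A') : ctens A M -> ctens A' M := clift (fun a x => cpure (f a) x).

HB.mixin Record isLie (K : fieldType) L of Vector K L := {
  lie : L -> L -> L;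
  lie_bilin : bilin lie;
  lie_alt : forall x, lie x x = 0;
  lie_jacobi : forall x y z,
    lie x (lie y z) + lie y (lie z x) + lie z (lie x y) = 0 }.

#[short(type="lieAlgType")]
HB.structure Definition LieAlgebra (K : fieldType) := { L of isLie K L & Vector K L }.

Section SubLie.
Variables (K : fieldType) (L : lieAlgType K).

Record lieSub := LieSub {
  lsv :> {vspace L};
  lsv_closed : forall x y, x \in lsv -> y \in lsv -> lie x y \in lsv }.

Variable h : lieSub.
Definition lie_of : Type := subvs_of h.
HB.instance Definition _ := Vector.on lie_of.

Definition lval (x : lie_of) : L := vsval x.
Definition slie (x y : lie_of) : lie_of := vsproj h (lie (lval x) (lval y)).

Let slieE x y : lval (slie x y) = lie (lval x) (lval y).
Proof. by rewrite /lval /slie vsprojK // lsv_closed ?subvsP. Qed.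
Let lvalL a (x y : lie_of) : lval (a *: x + y) = a *: lval x + lval y.
Proof. exact: linearP. Qed.
Let lvalD (x y : lie_of) : lval (x + y) = lval x + lval y.
Proof. exact: raddfD. Qed.
Let lval_inj : injective lval.
Proof. exact: subvs_inj. Qed.

Let slie_bilin : bilin slie.
Proof.
split=> u a x y; apply: lval_inj; rewrite ?(slieE, lvalL).
- exact: (@lie_bilin K L).1.
- exact: ((@lie_bilin K L).2 (lval u)).
Qed.
Let slie_alt x : slie x x = 0.
Proof. by apply: lval_inj; rewrite slieE lie_alt. Qed.
Let slie_jacobi x y z : slie x (slie y z) + slie y (slie z x) + slie z (slie x y) = 0.
Proof.
apply: lval_inj; have := lie_jacobi (lval x) (lval y) (lval z).
by rewrite !lvalD !slieE => ->; rewrite /lval raddf0.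
Qed.
HB.instance Definition _ := isLie.Build K lie_of slie_bilin slie_alt slie_jacobi.

End SubLie.

Section Enveloping.
Variable K : fieldType.

Definition lie_rel (L : lieAlgType K) (A : algType K) (f : L -> A) : Prop :=
  linear f /\ forall x y, f (lie x y) = f x * f y - f y * f x.

Lemma lie_rel_ok (L : lieAlgType K) :
  exists (A : algType K) (f : L -> A), lie_rel f.
Proof.
exists (K^o : algType K), (fun _ => 0); split=> [a x y|x y].
- by rewrite scaler0 addr0.
- by rewrite mulr0 subrr.
Qed.

Definition lie_pres (L : lieAlgType K) : presentation K :=
  Presentation (lie_rel_ok L).

Definition env (L : lieAlgType K) : Type := palg (lie_pres L).
HB.instance Definition _ L := GRing.Algebra.on (env L).

Definition ugen (L : lieAlgType K) (x : L) : env L := @pgenr K (lie_pres L) x.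
Definition ulift (L : lieAlgType K) (A : algType K) (f : L -> A) : env L -> A :=
  @plift K (lie_pres L) A f.
Definition umap (L L' : lieAlgType K) (f : L -> L') : env L -> env L' :=
  ulift (fun x => ugen (f x)).
Definition uincl (L : lieAlgType K) (h : lieSub L) : env (lie_of h) -> env L :=
  umap (@lval K L h).

Definition ucop (L : lieAlgType K) : env L -> tens (env L) (env L) :=
  ulift (fun x => tpure (ugen x) 1 + tpure 1 (ugen x)).
Definition ueps (L : lieAlgType K) : env L -> K^o := ulift (fun _ => 0).

Fixpoint rev_term X (t : term K X) : term K X :=
  match t with
  | TGen x => TMul (TCst X (-1)) (TGen K x)
  | TCst c => TCst X c
  | TAdd s t => TAdd (rev_term s) (rev_term t)
  | TMul s t => TMul (rev_term t) (rev_term s)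
  end.

(* The anti-automorphism equal to -1 on L. *)
Definition uant (L : lieAlgType K) (u : env L) : env L :=
  @pcls K (lie_pres L) (rev_term (repr (u : {eq_quot term_equiv (lie_pres L)}))).

(* Linear combinations of products of at most n, resp. exactly n, values of f. *)
Definition degle (V : Type) (A : algType K) (f : V -> A) (n : int) (u : A) : Prop :=
  exists s : seq (K * seq V), all (fun p => (size p.2)%:Z <= n) s /\
    u = \sum_(p <- s) p.1 *: \prod_(v <- p.2) f v.
Definition degeq (V : Type) (A : algType K) (f : V -> A) (n : int) (u : A) : Prop :=
  exists s : seq (K * seq V), all (fun p => (size p.2)%:Z == n) s /\
    u = \sum_(p <- s) p.1 *: \prod_(v <- p.2) f v.

Definition ufil (L : lieAlgType K) : int -> env L -> Prop := degle (@ugen L).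

End Enveloping.

Section Polarized.
Variables (K : fieldType) (g : lieAlgType K).

(* pl, pu and pv are l, u+ and u-. *)
Record polarized := Polarized {
  pl : lieSub g;
  pu : lieSub g;
  pv : lieSub g;
  p_full : (pl + pu + pv)%VS = fullv;
  p_direct : directv (pl + pu + pv);
  p_lu : forall x y, x \in pl -> y \in pu -> lie x y \in pu;
  p_lv : forall x y, x \in pl -> y \in pv -> lie x y \in pv }.

Let lie_D x y z : lie x (y + z) = lie x y + lie x z :> g.
Proof. by have := (@lie_bilin K g).1 x 1 y z; rewrite !scale1r. Qed.
Let lie_Dl x y z : lie (x + y) z = lie x z + lie y z :> g.
Proof. by have := (@lie_bilin K g).2 z 1 x y; rewrite /= !scale1r. Qed.
Let lie_anti x y : lie x y = - lie y x :> g.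
Proof.
apply/eqP; rewrite -addr_eq0; apply/eqP.
by have := lie_alt (x + y); rewrite lie_D !lie_Dl !lie_alt add0r addr0 addrC.
Qed.

Lemma sum_closed (a b : lieSub g) :
  (forall x y, x \in lsv a -> y \in lsv b -> lie x y \in lsv b) ->
  forall x y, x \in (a + b)%VS -> y \in (a + b)%VS -> lie x y \in (a + b)%VS.
Proof.
move=> ab x y /memv_addP[x1 hx1 [x2 hx2 ->]] /memv_addP[y1 hy1 [y2 hy2 ->]].
rewrite lie_Dl !lie_D.
rewrite rpredD // rpredD //.
- by apply: (subvP (addvSl _ _)); apply: lsv_closed.
- by apply: (subvP (addvSr _ _)); apply: ab.
- by rewrite lie_anti rpredN; apply: (subvP (addvSr _ _)); apply: ab.
- by apply: (subvP (addvSr _ _)); apply: lsv_closed.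
Qed.

Variable P : polarized.

Definition plu : lieSub g := LieSub (sum_closed (@p_lu P)).
Definition plv : lieSub g := LieSub (sum_closed (@p_lv P)).

(* The projection to l along the sum of u+ and u-. *)
Definition lproj (x : g) : lie_of (pl P) :=
  vsproj (pl P) (daddv_pi (pl P) (pu P + pv P)%VS x).

Definition nondeg_at (lam : 'Hom(lie_of (pl P), K^o)) : Prop :=
  forall x, x \in (pu P + pv P)%VS ->
    (forall y, y \in (pu P + pv P)%VS -> lam (lproj (lie x y)) = 0) -> x = 0.

End Polarized.

Section Generic.
Variables (K : fieldType) (V : vectType K).

Inductive polyfun : ('Hom(V, K^o) -> K) -> Prop :=
| PCst (c : K) : polyfun (fun _ => c)
| PEval (v : V) : polyfun (fun lam => lam v)
| PAdd p q : polyfun p -> polyfun q -> polyfun (fun lam => p lam + q lam)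
| PMul p q : polyfun p -> polyfun q -> polyfun (fun lam => p lam * q lam).

End Generic.

(* Generic: on a nonempty principal Zariski-open subset of the dual of l. *)
Definition pol_nondegenerate (K : fieldType) (g : lieAlgType K) (P : polarized g) : Prop :=
  exists p : 'Hom(lie_of (pl P), K^o) -> K,
    [/\ polyfun p, exists lam, p lam != 0 &
        forall lam, p lam != 0 -> @nondeg_at K g P lam].

(* t = tl + s + s^{2,1} with t invariant and symmetric, tl in S^2(l) and s in
   u+ (x) u-. *)
Definition pol_quadratic (K : fieldType) (g : lieAlgType K) (P : polarized g)
    (t : tens g g) (tl : tens (lie_of (pl P)) (lie_of (pl P)))
    (s : tens (lie_of (pu P)) (lie_of (pv P))) : Prop :=
  let s' : tens g g := tmap (@lval _ _ _) (@lval _ _ _) s in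
  [/\ tflip t = t,
      forall x : g, tmap (lie x) id t + tmap id (lie x) t = 0,
      tflip tl = tl &
      t = tmap (@lval _ _ _) (@lval _ _ _) tl + s' + tflip s'].

Section Microlocalization.
Variables (K : fieldType) (g : lieAlgType K) (P : polarized g).
Local Notation l := (lie_of (pl P)).
Variables (d : nat) (x y : d.-tuple g).

Definition detD (A : algType K) (f : l -> A) : A :=
  \det (\matrix_(i < d, j < d) f (lproj P (lie (tnth x i) (tnth y j)))).

(* The class of [detD (@ugen l)] in gr^d U(l) = S^d(l) is the determinant
   D_0', whatever the order of the factors in the Leibniz formula. *)
Definition is_lift (D : env l) : Prop := ufil (d%:Z - 1) (D - detD (@ugen K l)).

Definition invertible (A : algType K) (a : A) : Prop :=
  exists b, b * a = 1 /\ a * b = 1.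

(* S = S(l)[1/D_0'], the universal commutative algebra with a linear map from l
   making D_0' invertible. *)
Definition is_loc_sym (S : comAlgType K) (i : l -> S) : Prop :=
  [/\ linear i, invertible (detD i) &
      forall (B : comAlgType K) (f : l -> B), linear f -> invertible (detD f) ->
        exists F : {lrmorphism S -> B}, (forall z, F (i z) = f z) /\
          forall F' : {lrmorphism S -> B}, (forall z, F' (i z) = f z) -> F' =1 F].

(* The degree n part of S(l)[1/D_0']. *)
Definition loc_deg (S : comAlgType K) (i : l -> S) (n : int) (a : S) : Prop :=
  exists m : nat, degeq i (n + (m * d)%:Z) (a * detD i ^+ m).

(* An isomorphism gr M = S(l)[1/D_0'] of graded algebras, given by the symbol
   maps sigma n : fil n -> S(l)[1/D_0'], and compatible with gr U(l) = S(l). *)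
Definition is_symbol (M : filAlgType K) (j : env l -> M)
    (S : comAlgType K) (i : l -> S) (sigma : int -> M -> S) : Prop :=
  [/\ forall n a u v, fil n u -> fil n v ->
        sigma n (a *: u + v) = a *: sigma n u + sigma n v,
      forall n u, fil n u -> (sigma n u = 0 <-> fil (n - 1) u),
      forall n a, loc_deg i n a <-> exists2 u, fil n u & sigma n u = a,
      sigma 0 1 = 1 /\ forall m n u v, fil m u -> fil n v ->
        sigma (m + n) (u * v) = sigma m u * sigma n v &
      forall z : l, sigma 1 (j (ugen z)) = i z].

(* f is filtered and inverts D; a filtered map out of the microlocalization
   sends the inverse of D, of degree -d, to degree -d. *)
Definition inverts (B : filAlgType K) (f : env l -> B) (D : env l) : Prop :=
  (forall n u, ufil n u -> fil n (f u)) /\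
  exists b, [/\ b * f D = 1, f D * b = 1 & fil (- d%:Z) b].

Definition is_microloc (M : compFilAlgType K) (j : {lrmorphism env l -> M})
    (D : env l) : Prop :=
  [/\ injective j,
      inverts j D,
      exists (S : comAlgType K) (i : l -> S) (sigma : int -> M -> S),
        is_loc_sym i /\ is_symbol j i sigma &
      forall (B : compFilAlgType K) (f : {lrmorphism env l -> B}), inverts f D ->
        exists F : {lrmorphism M -> B},
          [/\ forall n u, fil n u -> fil n (F u), forall u, F (j u) = f u &
              forall F' : {lrmorphism M -> B},
                (forall n u, fil n u -> fil n (F' u)) ->
                (forall u, F' (j u) = f u) -> F' =1 F]].

End Microlocalization.

Section HopfExtensions.
Variables (K : fieldType) (l : lieAlgType K) (M : compFilAlgType K).
Variable j : env l -> M.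

(* Extension to M of delta : U(l) -> U(l) (x) U(l). *)
Definition is_cop_ext (delta : env l -> tens (env l) (env l))
    (Delta : {lrmorphism M -> ctens (env l) M}) : Prop :=
  (forall n u, fil n u -> fil n (Delta u)) /\
  forall u, Delta (j u) = cin (tmap id j (delta u) : ftens (env l) M).

Definition is_ant_ext (S : M -> M) : Prop :=
  [/\ linear S, S 1 = 1, forall u v, S (u * v) = S v * S u,
      forall n u, fil n u -> fil n (S u) & forall u, S (j u) = j (uant u)].

End HopfExtensions.

Section KJ.
Variables (K : fieldType) (g : lieAlgType K) (P : polarized g).
Variable M : compFilAlgType K.
Local Notation l := (lie_of (pl P)).
Local Notation up := (lie_of (pu P)).
Local Notation um := (lie_of (pv P)).

Definition is_HC (H : env g -> env l) : Prop :=
  linear H /\ forall (xp : env up) (x0 : env l) (xm : env um),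
    H (uincl xp * uincl x0 * uincl xm) = (ueps xp * ueps xm : K) *: x0.

Definition is_K (j : env l -> M) (H : env g -> env l)
    (k : ctens (tens (env up) (env um)) M) : Prop :=
  forall (x : env (lie_of (plv P))) (y : env (lie_of (plu P))),
    fil_cvg (fun n => tlift (fun z m =>
        tlift (fun a b => j (H (uincl x * uincl a)) * m * j (H (uincl b * uincl y))) z)
      (crepr k n))
      (j (H (uincl x * uincl y))).

Local Notation U := (env g).
Local Notation W2 := (ctens (tens U U) M).

(* sum_i a_i (x) S(b_i) S(m_i^(2)) (x) S(m_i^(1)) for k = sum_i a_i (x) b_i (x) m_i,
   where DeltaR has values in the completion of U(l) (x) M, i.e. gives
   sum m^(2) (x) m^(1), with m^(1) in M and m^(2) in U(l). *)
Definition Jlg (DeltaR : M -> ctens (env l) M) (S : M -> M)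
    (k : ctens (tens (env up) (env um)) M) : W2 :=
  clift (fun z m =>
    cpure (tmap (@uincl K g (pu P)) (fun b => uant (uincl b)) z) (1 : M) *
    clift (fun m2 m1 => cpure (tpure 1 (uant (uincl m2))) (S m1) : W2) (DeltaR m)) k.

End KJ.

Section Series.
Variables (K : fieldType) (A : algType K).
Implicit Types f g : nat -> A.

Definition sone : nat -> A := fun n => (n == 0%N)%:R.
Definition smul f g : nat -> A := fun n => \sum_(i < n.+1) f i * g (n - i)%N.
(* The geometric series of 1 - f; the inverse of f when f 0 = 1. *)
Definition sinv f : nat -> A := fun n =>
  \sum_(k < n.+1) iter k (smul (fun m => sone m - f m)) sone n.
Definition sexp (a : A) : nat -> A := fun n => (n`!%:R : K)^-1 *: a ^+ n.

(* Noncommutative series in A (= false) and B (= true), as coefficients of words. *)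
Definition ncs := seq bool -> K.
Definition ncev (Phi : ncs) (a b : A) : nat -> A := fun n =>
  \sum_(w : n.-tuple bool) Phi w *: \prod_(c <- w) (if c then b else a).

End Series.

Section Associators.

Section NC.
Variable K : fieldType.
Implicit Types f g : ncs K.

Definition ncone : ncs K := fun w => (w == [::])%:R.
Definition ncmul f g : ncs K := fun w =>
  \sum_(i < (size w).+1) f (take i w) * g (drop i w).
Definition ncexp f : ncs K := fun w =>
  \sum_(k < (size w).+1) (k`!%:R)^-1 * iter k (ncmul f) ncone w.

Inductive lie_poly : ncs K -> Prop :=
| LPGen c : lie_poly (fun w => (w == [:: c])%:R)
| LPLin a f g : lie_poly f -> lie_poly g -> lie_poly (fun w => a * f w + g w)
| LPLie f g : lie_poly f -> lie_poly g ->
    lie_poly (fun w => ncmul f g w - ncmul g f w).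

Definition lie_series f : Prop :=
  forall n, lie_poly (fun w => if size w == n then f w else 0).

(* The algebra generated by the tau_ij, i != j, for n strands; tau_ii is set to 0. *)
Definition dk_rel n (A : algType K) (t : 'I_n * 'I_n -> A) : Prop :=
  [/\ forall i, t (i, i) = 0,
      forall i j, t (i, j) = t (j, i),
      forall i j k l, uniq [:: i; j; k; l] -> t (i, j) * t (k, l) = t (k, l) * t (i, j) &
      forall i j k, uniq [:: i; j; k] ->
        (t (i, j) + t (i, k)) * t (j, k) = t (j, k) * (t (i, j) + t (i, k))].

Lemma dk_rel_ok n : exists (A : algType K) (t : 'I_n * 'I_n -> A), dk_rel t.
Proof.
by exists (K^o : algType K), (fun _ => 0); split=> // *; rewrite ?addr0 !mulr0.
Qed.

Definition dk n : Type := palg (Presentation (dk_rel_ok n)).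
HB.instance Definition _ n := GRing.Algebra.on (dk n).

(* Strands are numbered from 1. *)
Definition tau n (i j : nat) : dk n.+1 :=
  @pgenr K (Presentation (dk_rel_ok n.+1)) (inord i.-1, inord j.-1).

End NC.

Variable R : realType.
Local Notation C := (R[i]).

(* An identity in the completion of the graded algebra [dk n] is an identity
   between the sequences of homogeneous components. *)
Record associator (Phi : ncs C) : Prop := Associator {
  assoc_grouplike : exists phi : ncs C,
    [/\ lie_series phi,
        forall w, phi w != 0 -> (false \in w) && (true \in w) &
        Phi = ncexp phi];
  assoc_skew : let Phi' := fun w => Phi (map negb w) in
    ncmul Phi' Phi = @ncone C /\ ncmul Phi Phi' = @ncone C;
  assoc_hexagon1 :
    let t := @tau C 2 in
    let e a := sexp (Complex 0 pi *: a) in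
    let Ph := ncev Phi in
    e (t 1 3 + t 2 3) =
    smul (Ph (t 1 3) (t 1 2)) (smul (e (t 1 3))
      (smul (sinv (Ph (t 1 3) (t 2 3))) (smul (e (t 2 3)) (Ph (t 1 2) (t 2 3)))));
  assoc_hexagon2 :
    let t := @tau C 2 in
    let e a := sexp (Complex 0 pi *: a) in
    let Ph := ncev Phi in
    e (t 1 2 + t 1 3) =
    smul (sinv (Ph (t 2 3) (t 1 3))) (smul (e (t 1 3))
      (smul (Ph (t 1 2) (t 1 3)) (smul (e (t 1 2)) (sinv (Ph (t 1 2) (t 2 3))))));
  assoc_pentagon :
    let t := @tau C 3 in
    let Ph := ncev Phi in
    smul (Ph (t 1 2) (t 2 3 + t 2 4)) (Ph (t 1 3 + t 2 3) (t 3 4)) =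
    smul (Ph (t 2 3) (t 3 4))
      (smul (Ph (t 1 2 + t 1 3) (t 2 4 + t 3 4)) (Ph (t 1 2) (t 2 3))) }.

End Associators.

Section Pseudotwist.
Variables (K : fieldType) (g : lieAlgType K) (P : polarized g).
Variable M : compFilAlgType K.
Local Notation l := (lie_of (pl P)).
Local Notation U := (env g).
Local Notation U2 := (tens U U).
Local Notation U3 := (tens U U2).
Local Notation W2 := (ctens U2 M).
Local Notation W3 := (ctens U3 M).

(* Phi(kappa a, kappa b)^-1 with kappa = hbar c, as a series in hbar. *)
Definition Phi_inv (A : algType K) (Phi : ncs K) (c : K) (a b : A) : nat -> A :=
  sinv (fun n => c ^+ n *: ncev Phi a b n).

Definition leg12 (z : U2) : U3 := tlift (fun a b => tpure a (tpure b 1)) z.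
Definition leg23 (z : U2) : U3 := tpure 1 z.

Definition X_12_3_4 : W2 -> W3 :=
  cmapl (tlift (fun a b => leg12 (ucop a) * tpure 1 (tpure 1 b))).
Definition X_1_23_4 : W2 -> W3 := cmapl (tmap id (@ucop K g)).
Definition X_2_3_4 : W2 -> W3 := cmapl leg23.
Definition X_1_2_34 (DeltaL : M -> ctens (env l) M) : W2 -> W3 :=
  clift (fun z m => cpure (leg12 z) (1 : M) *
    cmapl (fun u => tpure 1 (tpure 1 (uincl u))) (DeltaL m)).

Definition ugen2 (t : tens g g) : U2 := tmap (@ugen K g) (@ugen K g) t.

(* tl^{2,3} - s^{1,2} - m(s^{2,1})^{(2)} *)
Definition B_arg (j : env l -> M) (tl : tens l l)
    (s : tens (lie_of (pu P)) (lie_of (pv P))) : W2 :=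
  let s' : tens g g := tmap (@lval _ _ _) (@lval _ _ _) s in
  tlift (fun x y => cpure (tpure 1 (ugen (lval x))) (j (ugen y)) : W2) tl
  - cpure (ugen2 s') (1 : M)
  - cpure (tpure 1 (tlift (fun a b => a * b) (ugen2 (tflip s')))) (1 : M).

Definition Jbar (j : env l -> M) (Phi : ncs K) (c : K) (t : tens g g)
    (tl : tens l l) (s : tens (lie_of (pu P)) (lie_of (pv P))) (J : W2) : nat -> W2 :=
  fun n => Phi_inv Phi c (cpure (ugen2 t) (1 : M)) (B_arg j tl s) n * J.

Definition pseudotwist (DeltaL : M -> ctens (env l) M) (Phi : ncs K) (c : K)
    (t : tens g g) (J : nat -> W2) : Prop :=
  smul (fun n => X_12_3_4 (J n)) (fun n => X_1_2_34 DeltaL (J n)) =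
  smul (Phi_inv Phi c (cpure (leg12 (ugen2 t)) (1 : M)) (cpure (leg23 (ugen2 t)) (1 : M)))
    (smul (fun n => X_1_23_4 (J n)) (fun n => X_2_3_4 (J n))).

End Pseudotwist.

(* Main.v *)
From HB Require Import structures.
Require Import Defs.
From mathcomp Require Import all_boot all_order all_algebra.
From mathcomp Require Import fingroup perm generic_quotient complex ring.
From mathcomp Require Import boolp classical_sets reals trigo.

Set Implicit Arguments.
Unset Strict Implicit.
Unset Printing Implicit Defensive.

Import Order.TTheory GRing.Theory Num.Theory.
Local Open Scope ring_scope.
Local Open Scope quotient_scope.

(** The theorem is the pentagon for $\Phi$ dressed by the dynamical twist equation for $J$.

    Three facts are combined in [pseudotwist_assembly]. First, the twist equation
    $J^{12,3,4}J^{1,2,34}=J^{1,23,4}J^{2,3,4}$ ([twist_cocycle], [cocycle_W3]). Second, exchange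
    relations: $J^{12,3,4}$ commutes with $t^{1,2}$ and $J^{1,23,4}$ with $t^{2,3}$, while
    $J^{12,3,4}B^{1,2,34}=(B^{1,2,34}+s^{2,3})J^{12,3,4}$ ([K1_barg]) and
    $J^{1,23,4}B^{2,3,4}=(B^{2,3,4}-s^{1,3})J^{1,23,4}$ ([K3_barg]). Third, the four-strand
    relations hold ([dk_map_rel]) for $\tau_{ij}=t^{i,j}$, $i,j\le3$, and $\tau_{i4}=t_{\mathfrak
    l}^{i,4}-\sum s_-^{(i)}(s_+^{(1)}+s_+^{(2)}+s_+^{(3)})$. For these elements
    $\tau_{34}=B^{12,3,4}=B^{2,3,4}-s^{1,3}$, $\tau_{24}+\tau_{34}=B^{1,23,4}$ and
    $\tau_{23}+\tau_{24}=B^{1,2,34}+s^{2,3}$. Moving the factors $J$ to the right therefore turns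
    the five series in the equation into the five factors of the inverted pentagon ([pentagon_inv]),
    and what remains on the right is the twist equation.

    The relations for $J$ rest on a duality. For $x\in U(\mathfrak u_-)$ the map $a\otimes Z\mapsto
    H(xa)\cdot Z$ tests elements of completed products that have $U(\mathfrak u_+)$ as a leg, and
    only 0 is killed by all these tests ([nondegenerate]). The proof lowers the degree of such an
    element step by step: inverting $D_0'$ inverts the matrix $([x_i,y_j]_{\mathfrak l})$ up to
    lower degree ([dual_family]), and this inverse builds an Euler operator that multiplies words of
    length $n$ in $\mathfrak u_+$ by $n$, up to shorter words ([euler]).

    Tested against $u$, the canonical element $K$ becomes explicit: [rho] sends $u$ to $\sum
    b\otimes H(ua)\ell$, which is read off from the triangular decomposition of $u$ ([rho_tri_val]),
    and [kap] does the same on the other side. Identities with $U(\mathfrak u_+)$ as first leg, such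
    as [Jp_barg] and [twist_cocycle], thus become identities between functions of $u$ that are
    checked letter by letter. When the first leg of $K$ is spread by the coproduct, as in
    $J^{12,3,4}$, the additional tool is the invariance of $K$ under $\mathfrak u_-$ ([invariance]),
    transported along a linear family by [push_invariance]. With the $\mathfrak l$-invariance of $J$
    ([Jp_ad], [J_comm]) and the invariance of $t$ it yields [J1_barg] and the twist equation. *)

Section LinearPredicate.

(** * Linear maps, subspaces and spans as predicates *)

Variables (K : fieldType).
Implicit Types V W X Y : lmodType K.

Lemma lin0 V W (f : V -> W) : linear f -> f 0 = 0.
Proof. by move=> h; have := h (-1) 0 0; rewrite scaler0 addr0 scaleN1r addNr. Qed.
Lemma linZ V W (f : V -> W) : linear f -> forall c u, f (c *: u) = c *: f u.
Proof. by move=> h c u; have := h c u 0; rewrite !addr0 (lin0 h) addr0. Qed.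
Lemma linD V W (f : V -> W) : linear f -> forall u v, f (u + v) = f u + f v.
Proof. by move=> h u v; have := h 1 u v; rewrite !scale1r. Qed.
Lemma linN V W (f : V -> W) : linear f -> forall u, f (- u) = - f u.
Proof. by move=> h u; rewrite -scaleN1r (linZ h) scaleN1r. Qed.
Lemma linB V W (f : V -> W) : linear f -> forall u v, f (u - v) = f u - f v.
Proof. by move=> h u v; rewrite (linD h) (linN h). Qed.
Lemma lin_sum V W (f : V -> W) : linear f ->
  forall (I : Type) (s : seq I) (P : pred I) F,
  f (\sum_(i <- s | P i) F i) = \sum_(i <- s | P i) f (F i).
Proof.
move=> h I s P F; elim: s => [|x s IH]; first by rewrite !big_nil (lin0 h).
by rewrite !big_cons; case: (P x); rewrite -IH // (linD h).
Qed.
Lemma lin_lin V W (f : {linear V -> W}) : linear f.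
Proof. exact: linearP. Qed.
Lemma lin_id V : linear (@id V). Proof. by []. Qed.
Lemma lin_cst0 V W : linear (fun _ : V => 0 : W).
Proof. by move=> a u v; rewrite scaler0 addr0. Qed.
Lemma lin_comp V W X (f : W -> X) (h : V -> W) : linear f -> linear h ->
  linear (fun x => f (h x)).
Proof. by move=> hf hh a u v; rewrite hh hf. Qed.
Lemma lin_D V W (f h : V -> W) : linear f -> linear h -> linear (fun x => f x + h x).
Proof. by move=> hf hh a u v; rewrite hf hh scalerDr addrACA. Qed.
Lemma lin_N V W (f : V -> W) : linear f -> linear (fun x => - f x).
Proof. by move=> hf a u v; rewrite hf opprD scalerN. Qed.
Lemma lin_B V W (f h : V -> W) : linear f -> linear h -> linear (fun x => f x - h x).
Proof. by move=> hf hh; apply: lin_D => //; apply: lin_N. Qed.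
Lemma lin_Z V W c (f : V -> W) : linear f -> linear (fun x => c *: f x).
Proof. by move=> hf a u v; rewrite hf scalerDr !scalerA mulrC. Qed.
Lemma lin_Mr V (A : algType K) (f : V -> A) c : linear f -> linear (fun x => f x * c).
Proof. by move=> hf a u v; rewrite hf mulrDl scalerAl. Qed.
Lemma lin_Ml V (A : algType K) (f : V -> A) c : linear f -> linear (fun x => c * f x).
Proof. by move=> hf a u v; rewrite hf mulrDr scalerAr. Qed.
Lemma lin_sumf V W (I : Type) (s : seq I) (F : I -> V -> W) :
  (forall i, linear (F i)) -> linear (fun x => \sum_(i <- s) F i x).
Proof.
by move=> h a u v; rewrite scaler_sumr -big_split; apply: eq_bigr => i _; rewrite h.
Qed.

Lemma bilin_comp V W X Y (f : X -> Y) (b : V -> W -> X) : linear f -> bilin b ->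
  bilin (fun v w => f (b v w)).
Proof. by move=> hf [h1 h2]; split=> u; apply: lin_comp => //; apply: h2. Qed.
Lemma bilin_comp2 V W V' W' X (b : V -> W -> X) (f : V' -> V) (h : W' -> W) :
  linear f -> linear h -> bilin b -> bilin (fun v w => b (f v) (h w)).
Proof.
move=> hf hh [h1 h2]; split=> u; first exact: (lin_comp (h1 _) hh).
exact: (lin_comp (h2 (h u)) hf).
Qed.
Lemma bilin_mul V W (A : algType K) (f : V -> A) (h : W -> A) :
  linear f -> linear h -> bilin (fun v w => f v * h w).
Proof. by move=> hf hh; split=> u; [apply: lin_Ml | apply: lin_Mr]. Qed.
Lemma bilin_mul_op V W (A : algType K) (f : V -> A) (h : W -> A) :
  linear f -> linear h -> bilin (fun v w => h w * f v).
Proof. by move=> hf hh; split=> u; [apply: lin_Mr | apply: lin_Ml]. Qed.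
Lemma bilin_D V W X (b b' : V -> W -> X) : bilin b -> bilin b' ->
  bilin (fun v w => b v w + b' v w).
Proof. by move=> [h1 h2] [h1' h2']; split=> u; apply: lin_D => //; exact: h2 || exact: h2'. Qed.

(** Shaped like a list of scaled generators, so that induction on membership peels off one generator
    at a time. *)
Inductive spanned V (S : V -> Prop) : V -> Prop :=
| spanned0 : spanned S 0
| spannedL a u v : S u -> spanned S v -> spanned S (a *: u + v).

Lemma spanned_gen V (S : V -> Prop) u : S u -> spanned S u.
Proof. by move=> h; rewrite -[u]addr0 -[u]scale1r; apply: spannedL => //; constructor. Qed.
Lemma spanned_sub V (S : V -> Prop) : subspace (spanned S).
Proof.
split; first by constructor.
move=> a u v hu hv; elim: hu => [|b x y Sx _ IH]; first by rewrite scaler0 add0r.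
by rewrite scalerDr scalerA -addrA; apply: spannedL.
Qed.
Lemma sub_D V (S : V -> Prop) : subspace S -> forall u v, S u -> S v -> S (u + v).
Proof. by move=> [_ h] u v Su Sv; rewrite -[u]scale1r; apply: h. Qed.
Lemma sub_Z V (S : V -> Prop) : subspace S -> forall a u, S u -> S (a *: u).
Proof. by move=> [h0 h] a u Su; rewrite -[_ *: _]addr0; apply: h. Qed.
Lemma sub_N V (S : V -> Prop) : subspace S -> forall u, S u -> S (- u).
Proof. by move=> h u Su; rewrite -scaleN1r; apply: sub_Z. Qed.
Lemma sub_B V (S : V -> Prop) : subspace S -> forall u v, S u -> S v -> S (u - v).
Proof. by move=> h u v Su Sv; apply: sub_D => //; apply: sub_N. Qed.
Lemma sub_sum V (S : V -> Prop) : subspace S -> forall (I : eqType) (s : seq I) F,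
  (forall i, i \in s -> S (F i)) -> S (\sum_(i <- s) F i).
Proof.
move=> h I s F hF; rewrite big_seq; elim/big_ind: _ => //; first exact: h.1.
exact: sub_D.
Qed.
Lemma spanned_mono V (S T : V -> Prop) : subspace T -> (forall u, S u -> T u) ->
  forall u, spanned S u -> T u.
Proof. by move=> hT h u; elim=> [|a x y /h Tx _ Ty]; [exact: hT.1|exact: hT.2]. Qed.
Lemma spanned_lin V W (S : V -> Prop) (T : W -> Prop) (f : V -> W) :
  linear f -> subspace T -> (forall u, S u -> T (f u)) ->
  forall u, spanned S u -> T (f u).
Proof.
move=> hf hT h; apply: spanned_mono => //; split; first by rewrite (lin0 hf); exact: hT.1.
by move=> a u v Tu Tv; rewrite hf; apply: hT.2.
Qed.
Lemma spanned_ext V W (S : V -> Prop) (f h : V -> W) :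
  linear f -> linear h -> (forall u, S u -> f u = h u) ->
  forall u, spanned S u -> f u = h u.
Proof.
move=> hf hh e; apply: spanned_mono => //; split; first by rewrite (lin0 hf) (lin0 hh).
by move=> a u v eu ev; rewrite hf hh eu ev.
Qed.

End LinearPredicate.

(* Identities between sums of opaque vectors are checked on linear forms, where
   [ring] applies. *)
Lemma by_forms (K : fieldType) (V : lmodType K) (u v : V) :
  (forall f : V -> K, (forall x y, f (x + y) = f x + f y) ->
    (forall x, f (- x) = - f x) -> f 0 = 0 -> (forall c x, f (c *: x) = c * f x) ->
    f u = f v) -> u = v.
Proof.
move=> h; apply/eqP; rewrite -subr_eq0; apply/negPn/negP => /eqP uv.
have s0 : subspace (fun w : V => w = 0).
  by split=> // a x y -> ->; rewrite scaler0 addr0.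
have [f [fl _ f1]] := functional_ex s0 uv.
have e := h f (linD fl) (linN fl) (lin0 fl) (linZ fl); move: f1.
by rewrite (linB fl) e subrr => /eqP; rewrite eq_sym oner_eq0.
Qed.

Ltac zmod_tac :=
  apply: by_forms; let f := fresh "f" in let hD := fresh in let hN := fresh in
  let h0 := fresh in let hZ := fresh in
  move=> f hD hN h0 hZ; rewrite ?(hD, hN, hZ, h0);
  repeat match goal with |- context [f ?x] =>
    let y := fresh "y" in set y := (f x); clearbody y end; ring.

(** * Tensor products and homomorphisms of algebras *)

Section TensorTheory.
Variables (K : fieldType).
Implicit Types V W X Y : lmodType K.

Lemma tpureDl V W (v v' : V) (w : W) : tpure (v + v') w = tpure v w + tpure v' w.
Proof. exact: (linD ((tpure_bilin V W).2 w)). Qed.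
Lemma tpureDr V W (v : V) (w w' : W) : tpure v (w + w') = tpure v w + tpure v w'.
Proof. exact: (linD ((tpure_bilin V W).1 v)). Qed.
Lemma tpureNl V W (v : V) (w : W) : tpure (- v) w = - tpure v w.
Proof. exact: (linN ((tpure_bilin V W).2 w)). Qed.
Lemma tpureNr V W (v : V) (w : W) : tpure v (- w) = - tpure v w.
Proof. exact: (linN ((tpure_bilin V W).1 v)). Qed.
Lemma lin_tpurel V W (w : W) : linear (fun v : V => tpure v w).
Proof. exact: ((tpure_bilin V W).2 w). Qed.
Lemma lin_tpurer V W (v : V) : linear (fun w : W => tpure v w).
Proof. exact: ((tpure_bilin V W).1 v). Qed.

Lemma tensE V W (z : tens V W) : exists s, z = \sum_(p <- s) tpure p.1 p.2.
Proof.
exists (repr (z : {eq_quot tens_equiv V W})); apply: tens_ext => P b hb.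
rewrite (lin_sum (tlift_linear hb)) {1}/tlift; apply: eq_bigr => p _.
by rewrite tlift_pure.
Qed.

Lemma tens_ind V W (P : tens V W -> Prop) : subspace P ->
  (forall v w, P (tpure v w)) -> forall z, P z.
Proof.
move=> hP h z; have [s ->] := tensE z; elim/big_ind: _ => //; first exact: hP.1.
exact: (sub_D hP).
Qed.

Lemma tens_lin_ext V W X (f h : tens V W -> X) : linear f -> linear h ->
  (forall v w, f (tpure v w) = h (tpure v w)) -> f =1 h.
Proof.
move=> hf hh e; apply: tens_ind => //; split; first by rewrite (lin0 hf) (lin0 hh).
by move=> a u v eu ev; rewrite hf hh eu ev.
Qed.

Lemma tlift_comp V W X Y (f : X -> Y) (b : V -> W -> X) : linear f -> bilin b ->
  forall z, f (tlift b z) = tlift (fun v w => f (b v w)) z.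
Proof.
move=> hf hb; apply: tens_lin_ext.
- by apply: lin_comp => //; apply: tlift_linear.
- by apply: tlift_linear; apply: bilin_comp.
- by move=> v w; rewrite !tlift_pure //; apply: bilin_comp.
Qed.

Lemma tmap_bilin V W V' W' (f : V -> V') (h : W -> W') : linear f -> linear h ->
  bilin (fun v w => tpure (f v) (h w)).
Proof. by move=> hf hh; apply: bilin_comp2 => //; apply: tpure_bilin. Qed.
Lemma tmap_pure V W V' W' (f : V -> V') (h : W -> W') : linear f -> linear h ->
  forall v w, tmap f h (tpure v w) = tpure (f v) (h w).
Proof. by move=> hf hh v w; rewrite /tmap tlift_pure //; apply: tmap_bilin. Qed.
Lemma tmap_lin V W V' W' (f : V -> V') (h : W -> W') : linear f -> linear h ->
  linear (tmap f h).
Proof. by move=> hf hh; apply: tlift_linear; apply: tmap_bilin. Qed.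
Lemma tlift_tmap V W V' W' X (f : V -> V') (h : W -> W') (b : V' -> W' -> X) :
  linear f -> linear h -> bilin b ->
  forall z, tlift b (tmap f h z) = tlift (fun v w => b (f v) (h w)) z.
Proof.
move=> hf hh hb z; rewrite /tmap (tlift_comp (tlift_linear hb)); last exact: tmap_bilin.
by congr (tlift _ z); apply/funext=> v; apply/funext=> w; rewrite tlift_pure.
Qed.
Lemma tflip_bilin V W : bilin (fun (v : V) (w : W) => tpure w v).
Proof. by split=> u; [apply: lin_tpurel | apply: lin_tpurer]. Qed.
Lemma tflip_pure V W (v : V) (w : W) : tflip (tpure v w) = tpure w v.
Proof. by rewrite /tflip tlift_pure //; apply: tflip_bilin. Qed.
Lemma tflip_lin V W : linear (@tflip K V W).
Proof. by apply: tlift_linear; apply: tflip_bilin. Qed.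
Lemma tlift_flip V W X (b : W -> V -> X) : bilin b ->
  forall z : tens V W, tlift b (tflip z) = tlift (fun v w => b w v) z.
Proof.
move=> hb z; rewrite /tflip (tlift_comp (tlift_linear hb)); last exact: tflip_bilin.
by congr (tlift _ z); apply/funext=> v; apply/funext=> w; rewrite tlift_pure.
Qed.
Lemma tlift_eq V W X (b b' : V -> W -> X) z :
  (forall v w, b v w = b' v w) -> tlift b z = tlift b' z.
Proof. by move=> h; rewrite /tlift /tsum; apply: eq_bigr => p _; rewrite h. Qed.
Lemma tlift_add V W X (b b' : V -> W -> X) z :
  tlift (fun v w => b v w + b' v w) z = tlift b z + tlift b' z.
Proof. by rewrite /tlift /tsum big_split. Qed.

(** A predicate on bare functions: the maps below come from [plift], [tlift] and [clift], and their
    multiplicativity holds under side conditions that are proved case by case. *)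
Definition alg_hom (A B : algType K) (f : A -> B) :=
  [/\ linear f, f 1 = 1 & forall x y, f (x * y) = f x * f y].
Definition alg_antihom (A B : algType K) (f : A -> B) :=
  [/\ linear f, f 1 = 1 & forall x y, f (x * y) = f y * f x].

Lemma alg_hom_lrm (A B : algType K) (f : {lrmorphism A -> B}) : alg_hom f.
Proof. by split; [exact: linearP | exact: rmorph1 | exact: rmorphM]. Qed.
Lemma alg_hom_id (A : algType K) : alg_hom (@id A). Proof. by []. Qed.
Lemma alg_hom_comp (A B C : algType K) (f : B -> C) (h : A -> B) :
  alg_hom f -> alg_hom h -> alg_hom (fun x => f (h x)).
Proof.
move=> [fl f1 fM] [hl h1 hM]; split; first exact: lin_comp.
- by rewrite h1.
- by move=> x y; rewrite hM.
Qed.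
Lemma alg_antihom_comp (A B C : algType K) (f : B -> C) (h : A -> B) :
  alg_antihom f -> alg_hom h -> alg_antihom (fun x => f (h x)).
Proof.
move=> [fl f1 fM] [hl h1 hM]; split; first exact: lin_comp.
- by rewrite h1.
- by move=> x y; rewrite hM.
Qed.
Lemma alg_hom_anticomp (A B C : algType K) (f : B -> C) (h : A -> B) :
  alg_hom f -> alg_antihom h -> alg_antihom (fun x => f (h x)).
Proof.
move=> [fl f1 fM] [hl h1 hM]; split; first exact: lin_comp.
- by rewrite h1.
- by move=> x y; rewrite hM.
Qed.

Section Alg.
Variables A B : algType K.
Lemma tens1 : (1 : tens A B) = tpure 1 1. Proof. by []. Qed.

(** In a product of two pure tensors the image of $b$ has to pass that of $a'$, which is where the
    commutation of the two images enters. *)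
Lemma tens_hom (C : algType K) (f : A -> C) (h : B -> C) : alg_hom f -> alg_hom h ->
  (forall a b, f a * h b = h b * f a) -> alg_hom (tlift (fun a b => f a * h b)).
Proof.
move=> [fl f1 fM] [hl h1 hM] cm.
have bl : bilin (fun a b => f a * h b) by exact: bilin_mul.
split; first exact: tlift_linear.
- by rewrite tens1 tlift_pure // f1 h1 mulr1.
- move=> x y; move: x; apply: tens_lin_ext.
  + by apply: (lin_comp (tlift_linear bl)); apply: lin_Mr; exact: lin_id.
  + by apply: lin_Mr; exact: tlift_linear.
  + move=> a b; move: y; apply: tens_lin_ext.
    * by apply: (lin_comp (tlift_linear bl)); apply: lin_Ml; exact: lin_id.
    * by apply: lin_Ml; exact: tlift_linear.
    * move=> a' b'; rewrite tpureM !tlift_pure // fM hM !mulrA; congr (_ * _).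
      by rewrite -!mulrA cm.
Qed.

Lemma tpurel_hom : alg_hom (fun a : A => tpure a (1 : B)).
Proof. by split=> [||x y]; [exact: lin_tpurel | | rewrite tpureM mulr1]. Qed.
Lemma tpurer_hom : alg_hom (fun b : B => tpure (1 : A) b).
Proof. by split=> [||x y]; [exact: lin_tpurer | | rewrite tpureM mulr1]. Qed.

End Alg.

Lemma tmap_hom (A B C D : algType K) (f : A -> C) (h : B -> D) :
  alg_hom f -> alg_hom h -> alg_hom (tmap f h).
Proof.
move=> [fl f1 fM] [hl h1 hM].
have -> : tmap f h = tlift (fun a b => tpure (f a) 1 * tpure 1 (h b)).
  apply/funext=> z; apply: tlift_eq => a b; by rewrite tpureM mulr1 mul1r.
apply: tens_hom.
- exact: (alg_hom_comp (tpurel_hom C D)).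
- exact: (alg_hom_comp (tpurer_hom C D)).
- by move=> a b; rewrite !tpureM !mulr1 !mul1r.
Qed.

Lemma tens_hom_ext (A B C : algType K) (f h : tens A B -> C) : alg_hom f -> alg_hom h ->
  (forall a, f (tpure a 1) = h (tpure a 1)) -> (forall b, f (tpure 1 b) = h (tpure 1 b)) ->
  f =1 h.
Proof.
move=> [fl _ fM] [hl _ hM] e1 e2; apply: tens_lin_ext => // a b.
have -> : tpure a b = tpure a 1 * tpure 1 b by rewrite tpureM mulr1 mul1r.
by rewrite fM hM e1 e2.
Qed.

End TensorTheory.

(** * Presented algebras *)

Section PresentedAlgebra.
Variables (K : fieldType) (P : presentation K).
Local Notation pa := (palg P).

Lemma palgE (u : pa) : exists t, u = pcls t.
Proof. by exists (repr (u : {eq_quot term_equiv P})); rewrite /pcls reprK. Qed.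

Section Eval.
Variables (A : algType K) (f : pgen P -> A) (hf : prel f).
Lemma plift1 : plift f (1 : pa) = 1. Proof. exact: pl1. Qed.
Lemma pliftD (u v : pa) : plift f (u + v) = plift f u + plift f v. Proof. exact: plD. Qed.
Lemma pliftM (u v : pa) : plift f (u * v) = plift f u * plift f v. Proof. exact: plM. Qed.
Lemma pliftN (u : pa) : plift f (- u) = - plift f u. Proof. exact: plN. Qed.
Lemma pliftZ c (u : pa) : plift f (c *: u) = c *: plift f u. Proof. exact: plZ. Qed.
Definition pliftE := (plift1, pliftD, pliftM, pliftN, pliftZ).
Lemma plift_hom : alg_hom (plift f : pa -> A).
Proof. by split=> [a u v||u v]; rewrite !pliftE. Qed.
End Eval.

Lemma plift_gen (A : algType K) (f : pgen P -> A) x : prel f -> plift f (pgenr x) = f x.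
Proof. by move=> hf; rewrite /pgenr plift_cls. Qed.

Lemma pcls_add s t : pcls (TAdd s t) = pcls s + pcls t :> pa.
Proof.
apply: palg_ext => A f hf.
by rewrite (pliftE hf) !plift_cls.
Qed.
Lemma pcls_mul s t : pcls (TMul s t) = pcls s * pcls t :> pa.
Proof.
apply: palg_ext => A f hf.
by rewrite (pliftE hf) !plift_cls.
Qed.
Lemma pcls_cst c : pcls (TCst _ c) = c%:A :> pa.
Proof.
apply: palg_ext => A f hf.
by rewrite !(pliftE hf) plift_cls.
Qed.

Lemma palg_ind (S : pa -> Prop) : subspace S -> S 1 ->
  (forall u v, S u -> S v -> S (u * v)) -> (forall x, S (pgenr x)) -> forall u, S u.
Proof.
move=> hS S1 SM Sg u; have [t ->] := palgE u.
elim: t => [x|c|s IHs t IHt|s IHs t IHt]; first exact: Sg.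
- by rewrite pcls_cst; exact: sub_Z.
- by rewrite pcls_add; exact: sub_D.
- by rewrite pcls_mul; exact: SM.
Qed.

(** Stability under left multiplication by generators propagates to left multiplication by every
    $u$; applied to 1 this gives $u$ itself. *)
Lemma palg_ind_l (S : pa -> Prop) : subspace S -> S 1 ->
  (forall x v, S v -> S (pgenr x * v)) -> forall u, S u.
Proof.
move=> hS S1 Sg u; suff h v : S v -> S (u * v) by rewrite -[u]mulr1; exact: h.
elim/palg_ind: u v => [|v Sv|u v IHu IHv w Sw|x v Sv].
- split=> [v _|a u v Su Sv w Sw]; first by rewrite mul0r; exact: hS.1.
  by rewrite mulrDl -scalerAl; apply: hS.2; [apply: Su|apply: Sv].
- by rewrite mul1r.
- by rewrite -mulrA; apply: IHu; apply: IHv.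
- exact: Sg.
Qed.

Lemma palg_ind_r (S : pa -> Prop) : subspace S -> S 1 ->
  (forall x v, S v -> S (v * pgenr x)) -> forall u, S u.
Proof.
move=> hS S1 Sg u; suff h v : S v -> S (v * u) by rewrite -[u]mul1r; exact: h.
elim/palg_ind: u v => [|v Sv|u v IHu IHv w Sw|x v Sv].
- split=> [v _|a u v Su Sv w Sw]; first by rewrite mulr0; exact: hS.1.
  by rewrite mulrDr -scalerAr; apply: hS.2; [apply: Su|apply: Sv].
- by rewrite mulr1.
- by rewrite mulrA; apply: IHv; apply: IHu.
- exact: Sg.
Qed.

Lemma palg_hom_ext (A : algType K) (f h : pa -> A) : alg_hom f -> alg_hom h ->
  (forall x, f (pgenr x) = h (pgenr x)) -> f =1 h.
Proof.
move=> [fl f1 fM] [hl h1 hM] e; apply: palg_ind => //.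
- by split=> [|a u v eu ev]; [rewrite (lin0 fl) (lin0 hl) | rewrite fl hl eu ev].
- by rewrite f1 h1.
- by move=> u v eu ev; rewrite fM hM eu ev.
Qed.
Lemma palg_antihom_ext (A : algType K) (f h : pa -> A) : alg_antihom f -> alg_antihom h ->
  (forall x, f (pgenr x) = h (pgenr x)) -> f =1 h.
Proof.
move=> [fl f1 fM] [hl h1 hM] e; apply: palg_ind => //.
- by split=> [|a u v eu ev]; [rewrite (lin0 fl) (lin0 hl) | rewrite fl hl eu ev].
- by rewrite f1 h1.
- by move=> u v eu ev; rewrite fM hM eu ev.
Qed.

End PresentedAlgebra.

(* The opposite algebra. *)
Section Opposite.
Variables (K : fieldType) (A : algType K).
Definition oppalg : Type := A.
HB.instance Definition _ := GRing.Lmodule.on oppalg.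
Let omul (x y : oppalg) : oppalg := (y : A) * x.
Let omulA : associative omul. Proof. by move=> x y z; rewrite /omul mulrA. Qed.
Let omul1 : left_id (1 : A) omul. Proof. by move=> x; rewrite /omul mulr1. Qed.
Let omulr1 : right_id (1 : A) omul. Proof. by move=> x; rewrite /omul mul1r. Qed.
Let omulDl : left_distributive omul +%R. Proof. by move=> x y z; rewrite /omul mulrDr. Qed.
Let omulDr : right_distributive omul +%R. Proof. by move=> x y z; rewrite /omul mulrDl. Qed.
Let o10 : (1 : A) != 0. Proof. exact: oner_neq0. Qed.
HB.instance Definition _ := GRing.Zmodule_isNzRing.Build oppalg
  omulA omul1 omulr1 omulDl omulDr o10.
Let oscaleAl a (u v : oppalg) : (a *: (u * v : oppalg) : oppalg) = (a *: u : oppalg) * v.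
Proof. exact: (scalerAr a (v : A) (u : A)). Qed.
HB.instance Definition _ := GRing.Lmodule_isLalgebra.Build K oppalg oscaleAl.
Let oscaleAr a (u v : oppalg) : (a *: (u * v : oppalg) : oppalg) = u * (a *: v : oppalg).
Proof. exact: (scalerAl a (v : A) (u : A)). Qed.
HB.instance Definition _ := GRing.Lalgebra_isAlgebra.Build K oppalg oscaleAr.
Lemma oppM (x y : A) : (x : oppalg) * (y : oppalg) = (y : A) * (x : A) :> A.
Proof. by []. Qed.
End Opposite.

(** * Enveloping algebras: coproduct, counit, antipode, derivations *)

Section EnvTheory.
Variables (K : fieldType).
Implicit Types L : lieAlgType K.

Lemma ugen_rel L : lie_rel (@ugen K L).
Proof.
split=> [a x y|x y]; apply: palg_ext => A f hf; have [fl fb] := (hf : lie_rel f).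
- by rewrite !(pliftE hf) !plift_cls //= fl.
- by rewrite !(pliftE hf) !plift_cls //= fb.
Qed.
Lemma lin_ugen L : linear (@ugen K L). Proof. exact: (ugen_rel L).1. Qed.
Lemma ugen_lie L (x y : L) : ugen (lie x y) = ugen x * ugen y - ugen y * ugen x.
Proof. exact: (ugen_rel L).2. Qed.
Lemma ugen_swap L (x y : L) : ugen x * ugen y = ugen y * ugen x + ugen (lie x y).
Proof. by rewrite ugen_lie addrC subrK. Qed.

Lemma ulift_hom L (A : algType K) (f : L -> A) : lie_rel f -> alg_hom (ulift f).
Proof. by move=> hf; exact: plift_hom. Qed.
Lemma ulift_gen L (A : algType K) (f : L -> A) x : lie_rel f -> ulift f (ugen x) = f x.
Proof. by move=> hf; exact: plift_gen. Qed.

Lemma env_ind_l L (S : env L -> Prop) : subspace S -> S 1 ->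
  (forall x v, S v -> S (ugen x * v)) -> forall u, S u.
Proof. exact: palg_ind_l. Qed.
Lemma env_ind_r L (S : env L -> Prop) : subspace S -> S 1 ->
  (forall x v, S v -> S (v * ugen x)) -> forall u, S u.
Proof. exact: palg_ind_r. Qed.
Lemma env_hom_ext L (A : algType K) (f h : env L -> A) : alg_hom f -> alg_hom h ->
  (forall x, f (ugen x) = h (ugen x)) -> f =1 h.
Proof. exact: palg_hom_ext. Qed.
Lemma env_antihom_ext L (A : algType K) (f h : env L -> A) :
  alg_antihom f -> alg_antihom h ->
  (forall x, f (ugen x) = h (ugen x)) -> f =1 h.
Proof. exact: palg_antihom_ext. Qed.

Lemma hom_lie L (A : algType K) (f : env L -> A) : alg_hom f ->
  lie_rel (fun x => f (ugen x)).
Proof.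
move=> [fl f1 fM]; split; first exact: (lin_comp fl (@lin_ugen L)).
by move=> x y; rewrite ugen_lie (linB fl) !fM.
Qed.

Lemma lvalL L (h : lieSub L) : linear (@lval K L h).
Proof. by move=> a x y; exact: linearP. Qed.
Lemma lval_lie L (h : lieSub L) (x y : lie_of h) : lval (lie x y) = lie (lval x) (lval y).
Proof. by rewrite /lie /= /slie /lval vsprojK // lsv_closed ?subvsP. Qed.
Lemma lval_inj L (h : lieSub L) : injective (@lval K L h).
Proof. exact: subvs_inj. Qed.
Lemma lval_in L (h : lieSub L) (x : lie_of h) : lval x \in lsv h.
Proof. exact: subvsP. Qed.

Lemma uincl_rel L (h : lieSub L) : lie_rel (fun x : lie_of h => ugen (lval x)).
Proof.
split; first exact: (lin_comp (@lin_ugen L) (@lvalL L h)).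
by move=> x y; rewrite lval_lie ugen_lie.
Qed.
Lemma uincl_hom L (h : lieSub L) : alg_hom (@uincl K L h).
Proof. exact: (ulift_hom (uincl_rel h)). Qed.
Lemma uincl_gen L (h : lieSub L) x : @uincl K L h (ugen x) = ugen (lval x).
Proof. exact: (ulift_gen _ (uincl_rel h)). Qed.

Lemma prim_rel L (A : algType K) (f h : L -> A) : lie_rel f -> lie_rel h ->
  (forall x y, f x * h y = h y * f x) -> lie_rel (fun x => f x + h x).
Proof.
move=> [fl fb] [hl hb] cm; split; first exact: lin_D.
move=> x y; rewrite fb hb !mulrDl !mulrDr !cm; zmod_tac.
Qed.

End EnvTheory.

Section EnvMaps.
Variables (K : fieldType).
Implicit Types L : lieAlgType K.

Lemma lie_Dr L (x y z : L) : lie x (y + z) = lie x y + lie x z.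
Proof. exact: (linD ((@lie_bilin K L).1 x)). Qed.
Lemma lie_Dl L (x y z : L) : lie (x + y) z = lie x z + lie y z.
Proof. exact: (linD ((@lie_bilin K L).2 z)). Qed.
Lemma lin_lier L (x : L) : linear (lie x).
Proof. exact: ((@lie_bilin K L).1 x). Qed.
Lemma lin_liel L (x : L) : linear (fun y => lie y x).
Proof. exact: ((@lie_bilin K L).2 x). Qed.
Lemma lie_anti L (x y : L) : lie x y = - lie y x.
Proof.
apply/eqP; rewrite -addr_eq0; apply/eqP.
by have := lie_alt (x + y); rewrite lie_Dr !lie_Dl !lie_alt add0r addr0 addrC.
Qed.
Lemma lie_der L (z x y : L) : lie z (lie x y) = lie (lie z x) y + lie x (lie z y).
Proof.
have := lie_jacobi z x y; rewrite (lie_anti x (lie y z)) (lie_anti y z).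
rewrite (linN (lin_liel x)) opprK (lie_anti y (lie z x)) => h.
rewrite (lie_anti x (lie z y)); apply/eqP; rewrite -subr_eq0 -h; apply/eqP; zmod_tac.
Qed.

Lemma ucop_rel L : lie_rel (fun x : L => tpure (ugen x) 1 + tpure 1 (ugen x) : tens (env L) (env L)).
Proof.
apply: prim_rel.
- exact: (hom_lie (tpurel_hom (env L) (env L))).
- exact: (hom_lie (tpurer_hom (env L) (env L))).
- by move=> x y; rewrite !tpureM !mulr1 !mul1r.
Qed.
Lemma ucop_hom L : alg_hom (@ucop K L). Proof. exact: ulift_hom (ucop_rel L). Qed.
Lemma ucop_gen L (x : L) : ucop (ugen x) = tpure (ugen x) 1 + tpure 1 (ugen x).
Proof. exact: (ulift_gen _ (ucop_rel L)). Qed.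

Lemma ueps_rel L : lie_rel (fun _ : L => 0 : K^o).
Proof. by split=> [|x y]; [exact: lin_cst0 | rewrite !mulr0 subrr]. Qed.
Lemma ueps_hom L : alg_hom (@ueps K L). Proof. exact: ulift_hom (ueps_rel L). Qed.
Lemma ueps_gen L (x : L) : ueps (ugen x) = 0.
Proof. exact: (ulift_gen _ (ueps_rel L)). Qed.
Lemma ueps_1 L : ueps (1 : env L) = 1 :> K. Proof. by case: (ueps_hom L). Qed.
Lemma ueps_genl L (x : L) u : ueps (ugen x * u) = 0 :> K.
Proof. by case: (ueps_hom L) => _ _ ->; rewrite ueps_gen mul0r. Qed.
Lemma ueps_genr L (x : L) u : ueps (u * ugen x) = 0 :> K.
Proof. by case: (ueps_hom L) => _ _ ->; rewrite ueps_gen mulr0. Qed.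

Lemma opp_lie_rel L (A : algType K) (f : L -> A) : lie_rel f ->
  lie_rel (fun x => - f x : oppalg A).
Proof.
move=> [fl fb]; split; first exact: (lin_N fl).
by move=> x y; rewrite fb !oppM !mulrNN opprB.
Qed.

(** Reversing products while negating generators amounts to evaluating in the opposite algebra,
    where $-f$ is again compatible with brackets. *)
Lemma rev_termE L (A : algType K) (f : L -> A) (t : term K L) :
  teval f (rev_term t) = teval (fun x => - f x : oppalg A) t.
Proof.
elim: t => [x|c|s IHs t IHt|s IHs t IHt] //=.
- by rewrite mulr_algl scaleN1r.
- by rewrite IHs IHt.
- by rewrite IHs IHt.
Qed.

(** [uant] reverses a chosen representative. Any other representative has the same value under every
    Lie map, in particular under $-f$ into the opposite algebra, so the choice is immaterial. *)
Lemma uant_cls L (t : term K L) :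
  uant (@pcls K (lie_pres L) t) = @pcls K (lie_pres L) (rev_term t).
Proof.
apply: palg_ext => A f hf; rewrite !plift_cls //.
rewrite !rev_termE; set r := repr _.
have : term_eq (P := lie_pres L) r t by apply/eqmodP; rewrite reprK.
by move/asboolP=> /(_ (oppalg A) (fun x => - f x)); apply; exact: opp_lie_rel.
Qed.

Lemma uant_antihom L : alg_antihom (@uant K L).
Proof.
have clsE (u : env L) : exists t, u = @pcls K (lie_pres L) t by exact: palgE.
split=> [a u v||u v].
- have [s ->] := clsE u; have [t ->] := clsE v.
  have -> : a *: (@pcls K (lie_pres L) s : env L) + @pcls K (lie_pres L) t =
    @pcls K (lie_pres L) (TAdd (TMul (TCst _ a) s) t).
    by rewrite pcls_add pcls_mul pcls_cst mulr_algl.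
  by rewrite !uant_cls /= pcls_add pcls_mul pcls_cst mulr_algr.
- have e : (1 : env L) = @pcls K (lie_pres L) (TCst _ 1) by rewrite pcls_cst scale1r.
  by rewrite e uant_cls.
- have [s ->] := clsE u; have [t ->] := clsE v.
  by rewrite -pcls_mul !uant_cls /= pcls_mul.
Qed.
Lemma uant_gen L (x : L) : uant (ugen x) = - ugen x.
Proof. by rewrite uant_cls /= pcls_mul pcls_cst mulr_algl scaleN1r. Qed.
Lemma uantK L : involutive (@uant K L).
Proof.
have [ul u1 uM] := uant_antihom L.
apply: env_hom_ext; last by move=> x; rewrite uant_gen (linN ul) uant_gen opprK.
  split; [exact: lin_comp | by rewrite !u1 | by move=> u v; rewrite !uM].
exact: alg_hom_id.
Qed.
Lemma uant_uincl L (h : lieSub L) (u : env (lie_of h)) :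
  uant (uincl u) = uincl (uant u).
Proof.
move: u; apply: env_antihom_ext.
- exact: alg_antihom_comp (uant_antihom L) (uincl_hom h).
- exact: alg_hom_anticomp (uincl_hom h) (uant_antihom _).
- move=> x; rewrite uincl_gen !uant_gen (linN (let: And3 a _ _ := uincl_hom h in a)).
  by rewrite uincl_gen.
Qed.
Lemma uant_ueps L (u : env L) : ueps (uant u) = ueps u :> K.
Proof.
move: u; apply: (env_antihom_ext (A := K^o)).
- exact: alg_hom_anticomp (ueps_hom L) (uant_antihom L).
- case: (ueps_hom L) => el e1 eM; split=> // u v; rewrite eM; exact: mulrC.
- by move=> x; rewrite uant_gen (linN (let: And3 a _ _ := ueps_hom L in a)) ueps_gen oppr0.
Qed.

Section SquareZero.
Variables (L : lieAlgType K) (T : algType K) (i : env L -> T) (e : T).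
Hypotheses (hi : alg_hom i) (ce : forall u, e * i u = i u * e) (ee : e * e = 0).
Variables (D : T -> env L).
Hypotheses (Dl : linear D) (DE : forall u v, D (i u + i v * e) = v).

(* A derivation is a homomorphism to the algebra extended by a square-zero element. *)
Lemma square_zero_derivation (d : L -> L) : linear d ->
  (forall x y, d (lie x y) = lie (d x) y + lie x (d y)) ->
  exists D : env L -> env L, [/\ linear D, D 1 = 0,
    forall u v, D (u * v) = D u * v + u * D v & forall x, D (ugen x) = ugen (d x)].
Proof.
move=> dl dd; have [il i1 iM] := hi; have [fl fb] := hom_lie hi.
pose f x := i (ugen x) + i (ugen (d x)) * e.
have cm u v : u * e * i v = u * i v * e by rewrite -!mulrA ce.
have ee' u : u * e * e = 0 by rewrite -mulrA ee mulr0.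
have hf : lie_rel f.
  split; first by apply: lin_D => //; apply: lin_Mr; exact: (lin_comp fl dl).
  move=> x y; rewrite /f fb dd (linD fl) !fb.
  rewrite !mulrDr !mulrDl !mulrA !cm !ee' !mulNr; zmod_tac.
have [Fl F1 FM] := ulift_hom hf; set F := ulift f in Fl F1 FM.
have prod u v u' v' : (i u + i v * e) * (i u' + i v' * e) =
    i (u * u') + i (v * u' + u * v') * e.
  rewrite (linD il) !iM !mulrDr !mulrDl !mulrA !cm !ee'; zmod_tac.
(* [F] keeps the form $u\mapsto u+D(u)e$ because $e$ is central on the image of [i] and squares to
   zero; the coefficient of $e$ is the derivation. *)
have FE u : F u = i u + i (D (F u)) * e.
  move: u; apply: env_ind_l => [||x v IH].
  - split; first by rewrite (lin0 Fl) (lin0 Dl) !(lin0 il) mul0r addr0.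
    move=> a u v eu ev; rewrite Fl Dl !il {1}eu {1}ev scalerDr mulrDl -scalerAl; zmod_tac.
  - have -> : F 1 = i 1 + i 0 * e by rewrite F1 i1 (lin0 il) mul0r addr0.
    by rewrite DE.
  - have e1 : F (ugen x * v) =
      i (ugen x * v) + i (ugen (d x) * v + ugen x * D (F v)) * e.
      by rewrite FM {1}/F (ulift_gen _ hf) {1}IH /f prod.
    by rewrite e1 DE.
exists (fun u => D (F u)); split.
- exact: lin_comp.
- have -> : F 1 = i 1 + i 0 * e by rewrite F1 i1 (lin0 il) mul0r addr0.
  by rewrite DE.
- by move=> u v; rewrite FM {1}(FE u) {1}(FE v) prod DE.
- by move=> x; rewrite /F (ulift_gen _ hf) /f DE.
Qed.

End SquareZero.

Lemma env_derivation L (d : L -> L) : linear d ->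
  (forall x y, d (lie x y) = lie (d x) y + lie x (d y)) ->
  exists D : env L -> env L, [/\ linear D, D 1 = 0,
    forall u v, D (u * v) = D u * v + u * D v & forall x, D (ugen x) = ugen (d x)].
Proof.
(* $2\times2$ matrices contain the dual numbers through the nilpotent [N], and the upper right entry
   reads off the coefficient of [N]. *)
pose B : algType K := 'M[K]_2; pose N : B := delta_mx 0 1.
have NN : N * N = 0 by rewrite /N [LHS]mul_delta_mx_0.
pose D (z : tens (env L) B) : env L := tlift (fun u (m : B) => (m : 'M[K]_2) 0 1 *: u) z.
have Db : bilin (fun u (m : B) => (m : 'M[K]_2) 0 1 *: u : env L).
  split=> u a v w; first by rewrite /= !mxE scalerDl scalerA.
  by rewrite /= scalerDr !scalerA mulrC.
have Dl : linear D by exact: (tlift_linear Db).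
have DP u m : D (tpure u m) = (m : 'M[K]_2) 0 1 *: u by exact: (tlift_pure _ _ Db).
apply: (@square_zero_derivation L _ (fun u => tpure u 1) (tpure 1 N) _ _ _ D) => //.
- exact: tpurel_hom.
- by move=> u; rewrite !tpureM !mulr1 !mul1r.
- by rewrite tpureM NN (lin0 (lin_tpurer _)).
- by move=> u v; rewrite tpureM mulr1 mul1r (linD Dl) !DP /N !mxE /= scale0r add0r scale1r.
Qed.

Lemma degle_sub (V : Type) (A : algType K) (f : V -> A) n : subspace (degle f n).
Proof.
split; first by exists [::]; rewrite big_nil.
move=> a u v [s [hs ->]] [t [ht ->]].
exists ([seq (a * p.1, p.2) | p <- s] ++ t); split.
  by rewrite all_cat ht andbT all_map.
rewrite big_cat big_map /= scaler_sumr; congr (_ + _); apply: eq_bigr => p _.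
by rewrite scalerA.
Qed.
Lemma degle_mono (V : Type) (A : algType K) (f : V -> A) m n u :
  m <= n -> degle f m u -> degle f n u.
Proof.
move=> mn [s [hs ->]]; exists s; split=> //; apply: sub_all hs => p h.
exact: le_trans mn.
Qed.
Lemma degle_gen (V : Type) (A : algType K) (f : V -> A) v : degle f 1 (f v).
Proof. by exists [:: (1, [:: v])]; rewrite /= !big_seq1 scale1r. Qed.
Lemma degle_1 (V : Type) (A : algType K) (f : V -> A) : degle f 0 1.
Proof. by exists [:: (1, [::])]; rewrite /= !big_seq1 scale1r /= big_nil. Qed.
Lemma degle_M (V : eqType) (A : algType K) (f : V -> A) m n u v :
  degle f m u -> degle f n v -> degle f (m + n) (u * v).
Proof.
move=> [s [hs ->]] [t [ht ->]].
exists [seq (p.1 * q.1, p.2 ++ q.2) | p <- s, q <- t]; split.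
  apply/allP => p /allpairsP[[q r] /= [/(allP hs) hq /(allP ht) hr ->]] /=.
  by rewrite size_cat PoszD lerD.
rewrite big_allpairs_dep mulr_suml; apply: eq_bigr => p _.
rewrite mulr_sumr; apply: eq_bigr => q _ /=.
by rewrite big_cat /= -scalerAl -scalerAr scalerA.
Qed.
Lemma degle_exh L (u : env L) : exists n : nat, degle (@ugen K L) n%:Z u.
Proof.
elim/env_ind_l: u => [||x v [n hn]].
- split; first by exists 0%N; exact: (degle_sub _ _).1.
  move=> a u v [m hm] [n hn]; exists (maxn m n); apply: (degle_sub _ _).2.
    by apply: degle_mono hm; rewrite lez_nat leq_maxl.
  by apply: degle_mono hn; rewrite lez_nat leq_maxr.
- by exists 0%N; exact: degle_1.
- by exists n.+1; rewrite -add1n PoszD; apply: degle_M => //; exact: degle_gen.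
Qed.

End EnvMaps.

(** * Completions: arithmetic on representing sequences *)

Section CompletionTheory.
Variables (K : fieldType) (E : filAlgType K).
Local Notation Eh := (completion E).

Lemma ccls_eq (s s' : cseq E) :
  ccls s = ccls s' <-> fil_cvg (fun n => sval s n - sval s' n) 0.
Proof.
split=> [h|h]; last by apply/eqmodP/asboolP.
by apply/asboolP; move/eqmodP: h.
Qed.
Lemma crep_ccls (X : Eh) : ccls (crep X) = X. Proof. exact: reprK. Qed.
Lemma crepr_ccls (s : cseq E) : fil_cvg (fun n => crepr (ccls s) n - sval s n) 0.
Proof. by apply/ccls_eq; rewrite crep_ccls. Qed.

Lemma fil_ccls k (s : cseq E) :
  fil k (ccls s) <-> exists N, forall n, (N <= n)%N -> fil k (sval s n).
Proof.
have [N1 H1] := crepr_ccls s k.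
split=> -[N H]; exists (maxn N1 N) => n; rewrite geq_max => /andP[/H1 h1 /H h];
  move: h1; rewrite subr0 => h1.
- by rewrite -(subKr (crepr (ccls s) n) (sval s n)); apply: fil_B.
- by rewrite -(subrK (sval s n) (crepr _ n)); apply: fil_D.
Qed.

(** By conversion the operations of the completion are termwise on chosen representatives;
    [ccls_add] and [ccls_mul] then free them from that choice. *)
Lemma completion_add (X Y : Eh) : exists s : cseq E, X + Y = ccls s /\
  forall n, sval s n = 1 *: crepr X n + crepr Y n.
Proof. by eexists; split; [reflexivity | move=> n]. Qed.
Lemma completion_scale a (X : Eh) : exists s : cseq E, a *: X = ccls s /\
  forall n, sval s n = a *: crepr X n + 0.
Proof. by eexists; split; [reflexivity | move=> n]. Qed.
Lemma completion_mul (X Y : Eh) : exists s : cseq E, X * Y = ccls s /\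
  forall n, sval s n = crepr X n * crepr Y n.
Proof. by eexists; split; [reflexivity | move=> n]. Qed.

Lemma eventually2 (P Q : nat -> Prop) : (exists N, forall n, (N <= n)%N -> P n) ->
  (exists N, forall n, (N <= n)%N -> Q n) ->
  exists N, forall n, (N <= n)%N -> P n /\ Q n.
Proof.
move=> [N h] [N' h']; exists (maxn N N') => n; rewrite geq_max => /andP[n1 n2].
by split; [apply: h | apply: h'].
Qed.

Lemma ccls_add (s s' : cseq E) a (t : cseq E) :
  (forall n, sval t n = a *: sval s n + sval s' n) -> ccls t = a *: ccls s + ccls s'.
Proof.
move=> h; have [u [-> hu]] := completion_add (a *: ccls s) (ccls s').
have [v [ev hv]] := completion_scale a (ccls s).
apply/ccls_eq => k; have := crepr_ccls s k; have := crepr_ccls s' k.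
have := crepr_ccls v k => h1 h2 h3.
have [N HN] := eventually2 h1 (eventually2 h2 h3).
exists N => n /HN; rewrite !subr0 => -[f1 [f2 f3]].
rewrite hu h scale1r ev.
have -> : a *: sval s n + sval s' n - (crepr (ccls v) n + crepr (ccls s') n) =
  - ((crepr (ccls v) n - sval v n) + (a *: (crepr (ccls s) n - sval s n)
     + (crepr (ccls s') n - sval s' n))).
  by rewrite hv addr0; zmod_tac.
apply: fil_N; apply: fil_D => //; exact: fil_L.
Qed.
Lemma ccls_mul (s s' t : cseq E) :
  (forall n, sval t n = sval s n * sval s' n) -> ccls t = ccls s * ccls s'.
Proof.
move=> h; have [u [-> hu]] := completion_mul (ccls s) (ccls s').
apply/ccls_eq => k.
have [d [N0 H0]] := cauchy_bounded (svalP (crep (ccls s))).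
have [d' [N1 H1]] := cauchy_bounded (svalP s').
have h2 := crepr_ccls s (k - d'); have h3 := crepr_ccls s' (k - d).
have [N HN] := eventually2 h2 (eventually2 h3 (eventually2
  (ex_intro _ N0 H0) (ex_intro _ N1 H1))).
exists N => n /HN; rewrite !subr0 => -[f1 [f2 [f3 f4]]].
rewrite h hu.
rewrite -[_ - _]opprK opprB.
have -> : crepr (ccls s) n * crepr (ccls s') n - sval s n * sval s' n =
  crepr (ccls s) n * (crepr (ccls s') n - sval s' n) +
  (crepr (ccls s) n - sval s n) * sval s' n.
  by rewrite mulrBr mulrBl addrA subrK.
apply: fil_N; apply: fil_D.
- by rewrite -(subrK d k) addrC; apply: fil_M.
- by rewrite -(subrK d' k); apply: fil_M.
Qed.

Lemma cin_fil k (x : E) : fil k x -> fil k (cin x).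
Proof. by move=> h; apply/fil_ccls; exists 0%N. Qed.
Lemma lin_cin : linear (@cin K E).
Proof. by move=> a x y; apply: ccls_add => n. Qed.
Lemma cinM (x y : E) : cin (x * y) = cin x * cin y.
Proof. by apply: ccls_mul => n. Qed.
Lemma cin1 : cin (1 : E) = 1. Proof. by []. Qed.
Lemma cin_hom : alg_hom (@cin K E).
Proof. by split; [exact: lin_cin | exact: cin1 | exact: cinM]. Qed.

Lemma cin_approx (X : Eh) k :
  exists N, forall n, (N <= n)%N -> fil k (X - cin (crepr X n)).
Proof.
have [N HN] := svalP (crep X) k; exists N => n Nn.
have c : fil_cauchy (fun m => -1 *: crepr X n + crepr X m).
  move=> q; have [M HM] := svalP (crep X) q; exists M => a b Ma Mb.
  by rewrite opprD addrACA subrr add0r; apply: HM.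
rewrite addrC -scaleN1r -[X in _ + X]crep_ccls.
rewrite -(@ccls_add _ _ _ (exist _ _ c)) //.
apply/fil_ccls; exists N => m Nm /=; rewrite scaleN1r addrC; exact: HN.
Qed.
Lemma fil_crepr (X : Eh) q : fil q X -> exists N, forall n, (N <= n)%N -> fil q (crepr X n).
Proof. by []. Qed.

End CompletionTheory.

(** * Maps of bounded degree and their extension by continuity *)

Section Bounded.
Variable K : fieldType.
Implicit Types A B C : filAlgType K.

(** A shift [d] uniform over the whole filtration is the form of continuity that survives
    composition, products and completion. *)
Definition bdd A B (d : int) (f : A -> B) :=
  linear f /\ forall q x, fil q x -> fil (q + d) (f x).
Definition bnd A B (f : A -> B) := exists d, bdd d f.

Lemma bdd_lin A B d (f : A -> B) : bdd d f -> linear f. Proof. by case. Qed.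
Lemma bnd_lin A B (f : A -> B) : bnd f -> linear f. Proof. by case=> d []. Qed.
Lemma bdd_bnd A B d (f : A -> B) : bdd d f -> bnd f. Proof. by exists d. Qed.
Lemma bdd_mono A B d e (f : A -> B) : d <= e -> bdd d f -> bdd e f.
Proof.
move=> de [fl h]; split=> // q x /h; apply: fil_mono; by rewrite lerD2l.
Qed.
Lemma bdd_id A : bdd 0 (@id A). Proof. by split=> // q x; rewrite addr0. Qed.
Lemma bnd_id A : bnd (@id A). Proof. by exists 0; exact: bdd_id. Qed.
Lemma bdd_comp A B C d e (f : B -> C) (h : A -> B) : bdd d f -> bdd e h ->
  bdd (d + e) (fun x => f (h x)).
Proof.
move=> [fl fb] [hl hb]; split; first exact: lin_comp.
by move=> q x /hb /fb; rewrite -addrA (addrC e).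
Qed.
Lemma bnd_comp A B C (f : B -> C) (h : A -> B) : bnd f -> bnd h -> bnd (fun x => f (h x)).
Proof. by move=> [d fb] [e hb]; exists (d + e); exact: bdd_comp. Qed.
Lemma bnd_D A B (f h : A -> B) : bnd f -> bnd h -> bnd (fun x => f x + h x).
Proof.
move=> [d fb] [e hb]; exists (Order.max d e).
have [fl fb'] : bdd (Order.max d e) f by apply: bdd_mono fb; rewrite le_max lexx.
have [hl hb'] : bdd (Order.max d e) h by apply: bdd_mono hb; rewrite le_max lexx orbT.
split; first exact: lin_D.
by move=> q x qx; apply: fil_D; [apply: fb' | apply: hb'].
Qed.
Lemma bnd_N A B (f : A -> B) : bnd f -> bnd (fun x => - f x).
Proof.
move=> [d [fl fb]]; exists d; split; first exact: lin_N.
by move=> q x qx; apply: fil_N; apply: fb.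
Qed.
Lemma bnd_B A B (f h : A -> B) : bnd f -> bnd h -> bnd (fun x => f x - h x).
Proof. by move=> hf hh; apply: bnd_D => //; exact: bnd_N. Qed.
Lemma bnd_Ml A B (c : B) (f : A -> B) : bnd f -> bnd (fun x => c * f x).
Proof.
move=> [d [fl fb]]; have [e he] := fil_exh c; exists (d + e); split; first exact: lin_Ml.
by move=> q x /fb h; rewrite addrA addrC; apply: fil_M.
Qed.
Lemma bnd_Mr A B (c : B) (f : A -> B) : bnd f -> bnd (fun x => f x * c).
Proof.
move=> [d [fl fb]]; have [e he] := fil_exh c; exists (d + e); split; first exact: lin_Mr.
by move=> q x /fb h; rewrite addrA; apply: fil_M.
Qed.
Lemma bnd_sum A B (I : Type) (s : seq I) (F : I -> A -> B) :
  (forall i, bnd (F i)) -> bnd (fun x => \sum_(i <- s) F i x).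
Proof.
move=> h; elim: s => [|i s IH].
  rewrite (_ : (fun x => _) = fun=> 0); last by apply/funext=> x; rewrite big_nil.
  by exists 0; split; [exact: lin_cst0 | move=> *; exact: fil_0].
rewrite (_ : (fun x => _) = fun x => F i x + \sum_(j <- s) F j x).
  exact: bnd_D.
by apply/funext=> x; rewrite big_cons.
Qed.
Lemma bdd_cin A : bdd 0 (@cin K A).
Proof. by split; [exact: lin_cin | move=> q x; rewrite addr0; exact: cin_fil]. Qed.

(** The image of [cin] is dense, bounded maps are continuous and the target is separated. *)
Lemma bnd_ext A (B : compFilAlgType K) (f h : completion A -> B) : bnd f -> bnd h ->
  (forall x, f (cin x) = h (cin x)) -> f =1 h.
Proof.
move=> [d [fl fb]] [e [hl hb]] eq X; apply/eqP; rewrite -subr_eq0; apply/eqP.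
apply: fil_sep => k.
have [N1 H1] := cin_approx X (k - d); have [N2 H2] := cin_approx X (k - e).
have {}H1 := H1 (maxn N1 N2) (leq_maxl _ _); have {}H2 := H2 (maxn N1 N2) (leq_maxr _ _).
have -> : f X - h X = f (X - cin (crepr X (maxn N1 N2))) -
   h (X - cin (crepr X (maxn N1 N2))).
  by rewrite (linB fl) (linB hl) eq; zmod_tac.
by apply: fil_B; [rewrite -(subrK d k) | rewrite -(subrK e k)]; [apply: fb | apply: hb].
Qed.

Lemma cvg_unique (B : compFilAlgType K) (u : nat -> B) x y :
  fil_cvg u x -> fil_cvg u y -> x = y.
Proof.
move=> hx hy; apply/eqP; rewrite -subr_eq0; apply/eqP; apply: fil_sep => k.
have [N HN] := eventually2 (hx k) (hy k); have [h1 h2] := HN N (leqnn N).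
exact: fil_trans (fil_Bsym h1) h2.
Qed.

Section Extension.
Variables (A : filAlgType K) (B : compFilAlgType K) (phi : A -> B) (d : int).
Hypothesis hphi : bdd d phi.

(** A bounded map preserves Cauchy sequences, so a limit exists and [xget] does not fall back on its
    default value 0. *)
Lemma cext_cvg X : fil_cvg (fun n => phi (crepr X n)) (cext phi X).
Proof.
have [pl pb] := hphi.
have c : fil_cauchy (fun n => phi (crepr X n)).
  move=> k; have [N HN] := svalP (crep X) (k - d); exists N => m n Nm Nn.
  by rewrite -(linB pl) -(subrK d k); apply: pb; apply: HN.
have [y hy] := fil_cpl _ c.
exact: (@xgetPex _ 0 [set y | fil_cvg (fun n => phi (crepr X n)) y] (ex_intro _ y hy)).
Qed.

Lemma cext_eq X y : fil_cvg (fun n => phi (crepr X n)) y -> cext phi X = y.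
Proof. by apply: cvg_unique; exact: cext_cvg. Qed.

Lemma cext_lim (s : cseq A) y : fil_cvg (fun n => phi (sval s n)) y ->
  cext phi (ccls s) = y.
Proof.
have [pl pb] := hphi; move=> h; apply: cext_eq => k.
have [N HN] := eventually2 (h k) (crepr_ccls s (k - d)).
exists N => n /HN; rewrite subr0 => -[h1 h2].
rewrite -(subrK (phi (sval s n)) (phi (crepr _ n))) -addrA; apply: fil_D => //.
by rewrite -(linB pl) -(subrK d k); apply: pb.
Qed.

Lemma cext_cin x : cext phi (cin x) = phi x.
Proof. by apply: cext_lim => k; exists 0%N => n _ /=; rewrite subrr; exact: fil_0. Qed.

Lemma cext_bdd : bdd d (cext phi).
Proof.
have [pl pb] := hphi; split.
- move=> a X Y.
  have c : fil_cauchy (fun n => a *: crepr X n + crepr Y n).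
    move=> q; have [N1 H1] := svalP (crep X) q; have [N2 H2] := svalP (crep Y) q.
    exists (maxn N1 N2) => m n; rewrite !geq_max => /andP[m1 m2] /andP[n1 n2].
    rewrite opprD addrACA -scalerBr; apply: fil_L; [exact: H1|exact: H2].
  have -> : a *: X + Y = ccls (exist _ _ c).
    by rewrite -[X in LHS]crep_ccls -[Y in LHS]crep_ccls; apply/esym; apply: ccls_add.
  apply: cext_lim => k /=.
  have [N HN] := eventually2 (cext_cvg X k) (cext_cvg Y k).
  exists N => n /HN [h1 h2]; rewrite pl.
  by rewrite opprD addrACA -scalerBr; apply: fil_L.
- move=> q X /fil_crepr [N HN]; have [N' HN'] := cext_cvg X (q + d).
  have h1 := HN (maxn N N') (leq_maxl _ _); have h2 := HN' (maxn N N') (leq_maxr _ _).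
  by rewrite -(subKr (phi (crepr X (maxn N N'))) (cext phi X)); apply: fil_B => //; apply: pb.
Qed.

End Extension.
End Bounded.

(** * Completed tensor products *)

Section CompletedTensorTheory.
Variables (K : fieldType) (M : compFilAlgType K).
Implicit Types A : algType K.

Lemma tens_hom_tcls A (s : seq (A * M)) :
  tcls s = \sum_(p <- s) tpure p.1 p.2.
Proof.
apply: tens_ext => P b hb.
rewrite (lin_sum (tlift_linear hb)) tlift_cls //; apply: eq_bigr => p _.
by rewrite tlift_pure.
Qed.

Lemma fil_ftens A k (z : ftens A M) : fil k z <-> exists s : seq (A * M),
  (forall p, p \in s -> fil k p.2) /\ z = \sum_(p <- s) (tpure p.1 p.2 : ftens A M).
Proof. by split=> -[s [h ->]]; exists s; split=> //; rewrite tens_hom_tcls. Qed.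

(** Only the completed factor carries a filtration, so the shift [d] has to be the same for all
    [a]. *)
Definition bbd A (B : filAlgType K) (d : int) (b : A -> M -> B) :=
  bilin b /\ forall a q m, fil q m -> fil (q + d) (b a m).

Section Lift.
Variables (A : algType K) (B : filAlgType K) (d : int) (b : A -> M -> B).
Hypothesis hb : bbd d b.
Lemma tlift_bdd : bdd d (tlift b : ftens A M -> B).
Proof.
have [bl bf] := hb; split; first exact: tlift_linear.
move=> q z /fil_ftens[s [hs ->]]; rewrite (lin_sum (tlift_linear bl)).
rewrite big_seq; elim/big_ind: _ => //; first exact: fil_0.
- by move=> u v; exact: fil_D.
- by move=> p /hs hp; rewrite tlift_pure //; apply: bf.
Qed.
End Lift.

Section CLift.
Variables (A : algType K) (B : compFilAlgType K) (d : int) (b : A -> M -> B).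
Hypothesis hb : bbd d b.
Lemma clift_bdd : bdd d (clift b). Proof. exact: (cext_bdd (tlift_bdd hb)). Qed.
Lemma clift_bnd : bnd (clift b). Proof. exact: bdd_bnd clift_bdd. Qed.
Lemma clift_pure a m : clift b (cpure a m) = b a m.
Proof.
by rewrite /clift /cpure (cext_cin (tlift_bdd hb)) tlift_pure //; case: hb.
Qed.
Lemma clift_eq (X : ctens A M) y : fil_cvg (fun n => tlift b (crepr X n)) y -> clift b X = y.
Proof. exact: (cext_eq (tlift_bdd hb)). Qed.
End CLift.

Lemma cpure_bilin A : bilin (@cpure K A M).
Proof.
have h := @bilin_comp K A M _ _ _ (@tpure K A M) (@lin_cin K (ftens A M)) (tpure_bilin A M).
exact: h.
Qed.
Lemma cpure_fil A (a : A) q (m : M) : fil q m -> fil q (cpure a m).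
Proof.
move=> h; apply: cin_fil; apply/fil_ftens; exists [:: (a, m)]; split.
  by move=> p; rewrite inE => /eqP ->.
by rewrite big_seq1.
Qed.
Lemma cpureM A (a a' : A) (m m' : M) : cpure a m * cpure a' m' = cpure (a * a') (m * m').
Proof. by rewrite /cpure -cinM tpureM. Qed.
Lemma cpure1 A : cpure (1 : A) (1 : M) = 1.
Proof. reflexivity. Qed.
Lemma lin_cpurel A (m : M) : linear (fun a : A => cpure a m).
Proof. exact: ((cpure_bilin A).2 m). Qed.
Lemma lin_cpurer A (a : A) : linear (fun m : M => cpure a m).
Proof. exact: ((cpure_bilin A).1 a). Qed.
Lemma bdd_cpurer A (a : A) : bdd 0 (fun m : M => cpure a m).
Proof. by split; [exact: lin_cpurer | move=> q m qm; rewrite addr0; exact: cpure_fil]. Qed.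
Lemma cpurel_hom A : alg_hom (fun a : A => cpure a (1 : M)).
Proof. by split=> [||x y]; [exact: lin_cpurel | exact: cpure1 | rewrite cpureM mulr1]. Qed.
Lemma cpurer_hom A : alg_hom (fun m : M => cpure (1 : A) m).
Proof. by split=> [||x y]; [exact: lin_cpurer | exact: cpure1 | rewrite cpureM mulr1]. Qed.
Lemma cpure_split A (a : A) (m : M) : cpure a m = cpure a 1 * cpure 1 m.
Proof. by rewrite cpureM mulr1 mul1r. Qed.
Lemma cpure_comm A (a : A) (m : M) : cpure 1 m * cpure a 1 = cpure a 1 * cpure 1 m.
Proof. by rewrite !cpureM !mulr1 !mul1r. Qed.

(** The uniqueness principle behind most identities below: pure tensors span a dense subspace. *)
Lemma ctens_ext A (B : compFilAlgType K) (f h : ctens A M -> B) : bnd f -> bnd h ->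
  (forall a m, f (cpure a m) = h (cpure a m)) -> f =1 h.
Proof.
move=> hf hh e; apply: bnd_ext => // x.
have hl : linear (fun x : tens A M => f (cin (x : ftens A M))).
  exact: (lin_comp (bnd_lin hf) (@lin_cin K (ftens A M))).
have hl' : linear (fun x : tens A M => h (cin (x : ftens A M))).
  exact: (lin_comp (bnd_lin hh) (@lin_cin K (ftens A M))).
exact: (tens_lin_ext hl hl' e).
Qed.

Lemma ctens2_ext A A' (B : compFilAlgType K) (f h : ctens (tens A A') M -> B) :
  bnd f -> bnd h ->
  (forall a a' m, f (cpure (tpure a a') m) = h (cpure (tpure a a') m)) -> f =1 h.
Proof.
move=> hf hh e; apply: ctens_ext => // z m; move: z; apply: tens_lin_ext.
- exact: (lin_comp (bnd_lin hf) (lin_cpurel m)).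
- exact: (lin_comp (bnd_lin hh) (lin_cpurel m)).
- by move=> a a'; exact: e.
Qed.

(** Reduces degree estimates on the completion to pure tensors, without raising the degree of the
    coefficients. *)
Lemma ctens_approx A (X : ctens A M) q k : fil q X -> exists s : seq (A * M),
  (forall p, p \in s -> fil q p.2) /\ fil k (X - \sum_(p <- s) cpure p.1 p.2).
Proof.
move=> /fil_crepr h; have [N HN] := eventually2 h (cin_approx X k).
have [/fil_ftens[s [hs e]] h2] := HN N (leqnn N); exists s; split=> //.
by move: h2; rewrite e (lin_sum (@lin_cin K (ftens A M))).
Qed.

Lemma bnd_mult A (B : compFilAlgType K) (f : ctens A M -> B) : bnd f ->
  (forall a m a' m', f (cpure (a * a') (m * m')) = f (cpure a m) * f (cpure a' m')) ->
  forall X Y, f (X * Y) = f X * f Y.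
Proof.
move=> hf e X Y; move: X; apply: ctens_ext.
- by apply: (bnd_comp hf); apply: bnd_Mr; exact: bnd_id.
- exact: bnd_Mr.
- move=> a m; move: Y; apply: ctens_ext.
  + by apply: (bnd_comp hf); apply: bnd_Ml; exact: bnd_id.
  + exact: bnd_Ml.
  + by move=> a' m'; rewrite cpureM e.
Qed.

Lemma cmapl_bbd A A' (f : A -> A') : linear f -> bbd 0 (fun a (m : M) => cpure (f a) m).
Proof.
move=> hf; split; last by move=> a q m qm; rewrite addr0; exact: cpure_fil.
exact: (bilin_comp2 hf (@lin_id K M) (cpure_bilin A')).
Qed.
Lemma cmapl_bdd A A' (f : A -> A') : linear f -> bdd 0 (@cmapl K A A' M f).
Proof. by move=> hf; exact: clift_bdd (cmapl_bbd hf). Qed.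
Lemma cmapl_bnd A A' (f : A -> A') : linear f -> bnd (@cmapl K A A' M f).
Proof. by move=> hf; exact: clift_bnd (cmapl_bbd hf). Qed.
Lemma cmapl_pure A A' (f : A -> A') a m : linear f -> cmapl f (cpure a (m : M)) = cpure (f a) m.
Proof. by move=> hf; rewrite /cmapl (clift_pure (cmapl_bbd hf)). Qed.
Lemma cmapl_hom A A' (f : A -> A') : alg_hom f -> alg_hom (@cmapl K A A' M f).
Proof.
move=> [fl f1 fM]; split; first exact: bdd_lin (cmapl_bdd fl).
- by rewrite -(cpure1 A) cmapl_pure // f1 cpure1.
- apply: bnd_mult; first exact: cmapl_bnd.
  by move=> a m a' m'; rewrite !cmapl_pure // fM cpureM.
Qed.

Lemma ctens_hom A (B : compFilAlgType K) d (f : A -> B) (h : M -> B) :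
  alg_hom f -> alg_hom h -> (forall a, fil 0 (f a)) -> bdd d h ->
  (forall a m, f a * h m = h m * f a) -> alg_hom (clift (fun a m => f a * h m)).
Proof.
move=> [fl f1 fM] [hl h1 hM] f0 hb cm.
have hbb : bbd d (fun a m => f a * h m).
  split; first exact: bilin_mul.
  by move=> a q m qm; rewrite -[q + d]add0r; apply: fil_M => //; apply: hb.2.
split; first exact: bdd_lin (clift_bdd hbb).
- by rewrite -(cpure1 A) (clift_pure hbb) f1 h1 mulr1.
- apply: bnd_mult; first exact: clift_bnd hbb.
  move=> a m a' m'; rewrite !(clift_pure hbb) fM hM !mulrA; congr (_ * _).
  by rewrite -!mulrA cm.
Qed.

End CompletedTensorTheory.

(** * Triangular decomposition and the map H *)

Section Triangular.
Variables (K : fieldType) (g : lieAlgType K) (P : polarized g).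
Local Notation Lp := (lie_of (pu P)).
Local Notation Lm := (lie_of (pv P)).
Local Notation Ll := (lie_of (pl P)).
Local Notation U := (env g).
Local Notation ip := (@uincl K g (pu P)).
Local Notation im := (@uincl K g (pv P)).
Local Notation il := (@uincl K g (pl P)).
Local Notation vp := (@lval K g (pu P)).
Local Notation vm := (@lval K g (pv P)).
Local Notation vl := (@lval K g (pl P)).

Lemma lval_ex (h : lieSub g) x : x \in lsv h -> exists e : lie_of h, x = lval e.
Proof. by move=> hx; exists (vsproj h x); rewrite /lval vsprojK. Qed.

Lemma lval_uniq (h : lieSub g) : linear (@lval K g h). Proof. exact: lvalL. Qed.

Lemma p_direct_l : (pl P :&: (pu P + pv P) = 0)%VS.
Proof.
have : directv (pl P + (pu P + pv P)).
  by rewrite directvE /= addvA addnA; have := p_direct P; rewrite directvE.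
by rewrite directv_addE => /and3P[_ _ /eqP].
Qed.

Lemma polarized_decomp (z : g) : exists e f, z = vp e + vl (lproj P z) + vm f.
Proof.
have zin : z \in (pl P + (pu P + pv P))%VS by rewrite addvA p_full memvf.
have e1 := daddv_pi_add p_direct_l zin.
have -> : vl (lproj P z) = daddv_pi (pl P) (pu P + pv P)%VS z.
  by rewrite /lval /lproj vsprojK // memv_pi.
have : daddv_pi (pu P + pv P)%VS (pl P) z \in (pu P + pv P)%VS by apply: memv_pi.
move=> /memv_addP[u uP [v vP e2]].
have [e he] := lval_ex uP; have [f hf] := lval_ex vP.
by exists e, f; rewrite -[z in LHS]e1 e2 he hf addrCA addrA.
Qed.

Lemma lie_lp (x : Ll) (e : Lp) : exists e', lie (vl x) (vp e) = vp e'.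
Proof. by apply: lval_ex; apply: p_lu; exact: lval_in. Qed.
Lemma lie_lm (x : Ll) (f : Lm) : exists f', lie (vl x) (vm f) = vm f'.
Proof. by apply: lval_ex; apply: p_lv; exact: lval_in. Qed.

Let lin_ip : linear ip. Proof. by case: (uincl_hom (pu P)). Qed.
Let lin_im : linear im. Proof. by case: (uincl_hom (pv P)). Qed.
Let lin_il : linear il. Proof. by case: (uincl_hom (pl P)). Qed.
Let ip1 : ip 1 = 1. Proof. by case: (uincl_hom (pu P)). Qed.
Let im1 : im 1 = 1. Proof. by case: (uincl_hom (pv P)). Qed.
Let il1 : il 1 = 1. Proof. by case: (uincl_hom (pl P)). Qed.
Let ipM u v : ip (u * v) = ip u * ip v. Proof. by case: (uincl_hom (pu P)). Qed.
Let imM u v : im (u * v) = im u * im v. Proof. by case: (uincl_hom (pv P)). Qed.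
Let ilM u v : il (u * v) = il u * il v. Proof. by case: (uincl_hom (pl P)). Qed.

(** The correction is $\mathrm{ad}(x)(a)$, again in $U(\mathfrak u_+)$ and made of words of positive
    length. Its vanishing counit is what makes $H$ linear over $U(\mathfrak l)$. *)
Lemma comm_l_p (x : Ll) (a : env Lp) : exists a' : env Lp,
  ugen (vl x) * ip a = ip a * ugen (vl x) + ip a' /\ ueps a' = 0 :> K.
Proof.
move: a; apply: env_ind_l => [||e a [a' [IH e0]]].
- split.
    exists 0; rewrite (lin0 lin_ip) mulr0 mul0r addr0; split=> //.
    exact: (lin0 (let: And3 a _ _ := ueps_hom _ in a)).
  move=> c u v [u' [hu e1]] [v' [hv e2]]; exists (c *: u' + v'); split.
    rewrite !lin_ip mulrDr mulrDl -scalerAr -scalerAl hu hv scalerDr; zmod_tac.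
  by have [el _ _] := ueps_hom Lp; rewrite el e1 e2 scaler0 addr0.
- exists 0; rewrite ip1 mulr1 mul1r (lin0 lin_ip) addr0; split=> //.
  exact: (lin0 (let: And3 a _ _ := ueps_hom _ in a)).
- have [e' he] := lie_lp x e; exists (ugen e' * a + ugen e * a'); split.
    rewrite (linD lin_ip) !ipM !uincl_gen mulrA ugen_swap he mulrDl -mulrA IH mulrDr !mulrA.
    zmod_tac.
  by have [el _ _] := ueps_hom Lp; rewrite (linD el) !ueps_genl addr0.
Qed.

Lemma comm_m_l (f : Lm) (h : env Ll) :
  spanned (fun u => exists h' f', u = il h' * ugen (vm f')) (ugen (vm f) * il h).
Proof.
move: h f; apply: env_ind_l => [||x h IH] => [|f|f].
- split=> [f|c u v hu hv f]; first by rewrite (lin0 lin_il) mulr0; constructor.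
  rewrite lin_il mulrDr -scalerAr; exact: (spanned_sub _).2 (hu f) (hv f).
- by rewrite il1 mulr1; apply: spanned_gen; exists 1, f; rewrite il1 mul1r.
- have [f' hf] := lie_lm x f; rewrite ilM uincl_gen mulrA ugen_swap mulrDl.
  have -> : lie (vm f) (vl x) = vm (- f').
    by rewrite lie_anti hf (linN (@lvalL _ g (pv P))).
  apply: (sub_D (spanned_sub _)); last exact: IH.
  rewrite -mulrA; move: (IH f).
  apply: (spanned_lin (f := fun u => ugen (vl x) * u)); last first.
  + by move=> u [h' [f'' ->]]; apply: spanned_gen; exists (ugen x * h'), f'';
      rewrite ilM uincl_gen mulrA.
  + exact: spanned_sub.
  + by apply: lin_Ml; exact: lin_id.
Qed.

Lemma comm_m_l_r (b : env Lm) (x : Ll) : exists b' : env Lm,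
  im b * ugen (vl x) = ugen (vl x) * im b + im b' /\ ueps b' = 0 :> K.
Proof.
move: b; apply: env_ind_l => [||f b [b' [IH e0]]].
- split.
    exists 0; rewrite (lin0 lin_im) mulr0 mul0r addr0; split=> //.
    exact: (lin0 (let: And3 a _ _ := ueps_hom _ in a)).
  move=> c u v [u' [hu e1]] [v' [hv e2]]; exists (c *: u' + v'); split.
    rewrite !lin_im mulrDr mulrDl -scalerAr -scalerAl hu hv scalerDr; zmod_tac.
  by have [el _ _] := ueps_hom Lm; rewrite el e1 e2 scaler0 addr0.
- exists 0; rewrite im1 mulr1 mul1r (lin0 lin_im) addr0; split=> //.
  exact: (lin0 (let: And3 a _ _ := ueps_hom _ in a)).
- have [f' hf] := lie_lm x f; exists (ugen f * b' - ugen f' * b); split.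
    rewrite (linB lin_im) !imM !uincl_gen -mulrA IH mulrDr mulrA ugen_swap lie_anti hf.
    rewrite (linN (@lin_ugen _ g)) mulrDl mulNr mulrA; zmod_tac.
  by have [el _ _] := ueps_hom Lm; rewrite (linB el) !ueps_genl subr0.
Qed.

(* Straightening one letter of u- past U(u+). *)
Definition straight (u : U) := [\/ exists a, u = ip a, exists a x, u = ip a * ugen (vl x)
  | exists a f, u = ip a * ugen (vm f)].

Lemma comm_m_p (f : Lm) (a : env Lp) : spanned straight (ugen (vm f) * ip a).
Proof.
move: a f; apply: env_ind_l => [||e a IH] => [|f|f].
- split=> [f|c u v hu hv f]; first by rewrite (lin0 lin_ip) mulr0; constructor.
  rewrite lin_ip mulrDr -scalerAr; exact: (spanned_sub _).2 (hu f) (hv f).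
- rewrite ip1 mulr1; apply: spanned_gen; apply: Or33; exists 1, f; by rewrite ip1 mul1r.
- rewrite ipM uincl_gen mulrA ugen_swap mulrDl; apply: (sub_D (spanned_sub _)).
    rewrite -mulrA; move: (IH f).
    apply: (spanned_lin (f := fun u => ugen (vp e) * u)).
    + by apply: lin_Ml; exact: lin_id.
    + exact: spanned_sub.
    + move=> u [[b ->]|[b [x ->]]|[b [x ->]]]; apply: spanned_gen.
      * by apply: Or31; exists (ugen e * b); rewrite ipM uincl_gen.
      * by apply: Or32; exists (ugen e * b), x; rewrite ipM uincl_gen mulrA.
      * by apply: Or33; exists (ugen e * b), x; rewrite ipM uincl_gen mulrA.
  have [e' [f' ->]] := polarized_decomp (lie (vm f) (vp e)); set x := lproj P _.
  rewrite !(linD (@lin_ugen _ g)) !mulrDl.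
  apply: (sub_D (spanned_sub _)); last exact: IH.
  apply: (sub_D (spanned_sub _)).
    by apply: spanned_gen; apply: Or31; exists (ugen e' * a); rewrite ipM uincl_gen.
  have [a' [-> _]] := comm_l_p x a; apply: (sub_D (spanned_sub _)); apply: spanned_gen.
    by apply: Or32; exists a, x.
  by apply: Or31; exists a'.
Qed.

Definition trimul (u : U) := exists a h b, u = ip a * il h * im b.

(** The spanning half of the triangular decomposition: left multiplication by each of the three
    parts of $\mathfrak g$ preserves the span. Linear identities on $U(\mathfrak g)$ are checked on
    such products from here on. *)
Lemma tri_span (u : U) : spanned trimul u.
Proof.
move: u; apply: env_ind_l => [||z u IH].
- exact: spanned_sub.
- by apply: spanned_gen; exists 1, 1, 1; rewrite ip1 il1 im1 !mulr1.
- have [e [f ->]] := polarized_decomp z; set x := lproj P z.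
  rewrite !(linD (@lin_ugen _ g)) !mulrDl.
  have SD := sub_D (spanned_sub trimul).
  have X v : (exists y : Ll, exists a h b, v = ugen (vl y) * (ip a * il h * im b)) ->
     spanned trimul v.
    move=> [y [a [h [b ->]]]].
    have [a' [ea _]] := comm_l_p y a; rewrite !mulrA ea !mulrDl; apply: (SD).
    + apply: spanned_gen; exists a, (ugen y * h), b; by rewrite ilM uincl_gen !mulrA.
    + by apply: spanned_gen; exists a', h, b.
  apply: (SD); first apply: (SD).
  + move: IH; apply: (spanned_lin (f := fun u => ugen (vp e) * u)).
    * by apply: lin_Ml; exact: lin_id.
    * exact: spanned_sub.
    * move=> v [a [h [b ->]]]; apply: spanned_gen; exists (ugen e * a), h, b.
      by rewrite ipM uincl_gen !mulrA.
  + move: IH; apply: (spanned_lin (f := fun u => ugen (vl x) * u)).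
    * by apply: lin_Ml; exact: lin_id.
    * exact: spanned_sub.
    * by move=> v [a [h [b ->]]]; apply: X; exists x, a, h, b.
  + move: IH; apply: (spanned_lin (f := fun u => ugen (vm f) * u)).
    * by apply: lin_Ml; exact: lin_id.
    * exact: spanned_sub.
    move=> v [a [h [b ->]]]; rewrite !mulrA; move: (comm_m_p f a).
    apply: (spanned_lin (f := fun u => u * il h * im b)).
    * by do 2 apply: lin_Mr; exact: lin_id.
    * exact: spanned_sub.
    move=> w [[c ->]|[c [y ->]]|[c [k ->]]].
    * by apply: spanned_gen; exists c, h, b.
    * by apply: spanned_gen; exists c, (ugen y * h), b; rewrite ilM uincl_gen !mulrA.
    * rewrite -(mulrA (ip c)); move: (comm_m_l k h).
      apply: (spanned_lin (f := fun u => ip c * u * im b)).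
      - by apply: lin_Mr; apply: lin_Ml; exact: lin_id.
      - exact: spanned_sub.
      - move=> r [h' [k' ->]]; apply: spanned_gen; exists c, h', (ugen k' * b).
        by rewrite imM uincl_gen !mulrA.
Qed.

Section HC.
Variables (H : U -> env Ll).
Hypothesis hH : is_HC H.
Let Hl : linear H. Proof. by case: hH. Qed.
Let HE a h b : H (ip a * il h * im b) = (ueps a * ueps b : K) *: h.
Proof. by case: hH => _ ->. Qed.

Lemma HC_lin : linear H. Proof. exact: Hl. Qed.

Lemma HC_gen_r y (x : Ll) : H (y * ugen (vl x)) = H y * ugen x.
Proof.
move: (tri_span y); apply: (spanned_ext (f := fun y => H (y * _)) (h := fun y => H y * _)).
- by apply: (lin_comp Hl); apply: lin_Mr; exact: lin_id.
- exact: lin_Mr.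
- move=> u [a [h [b ->]]]; have [b' [e e0]] := comm_m_l_r b x.
  rewrite /= -(mulrA (ip a * il h)) e mulrDr (linD Hl) -uincl_gen mulrA -(mulrA (ip a)) -ilM !HE e0 mulr0.
  by rewrite scale0r addr0 scalerAl.
Qed.
Lemma HC_gen_l y (x : Ll) : H (ugen (vl x) * y) = ugen x * H y.
Proof.
move: (tri_span y); apply: (spanned_ext (f := fun y => H (_ * y)) (h := fun y => _ * H y)).
- by apply: (lin_comp Hl); apply: lin_Ml; exact: lin_id.
- exact: lin_Ml.
- move=> u [a [h [b ->]]]; have [a' [e e0]] := comm_l_p x a.
  rewrite !mulrA e !mulrDl (linD Hl) -uincl_gen -(mulrA (ip a) (il (ugen x)) (il h)) -ilM !HE e0 mul0r.
  by rewrite scale0r addr0 scalerAr.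
Qed.
Lemma HC_r y (u : env Ll) : H (y * il u) = H y * u.
Proof.
move: u y; apply: env_ind_r => [||x u IH] => [|y|y].
- split=> [y|c u v hu hv y]; first by rewrite (lin0 lin_il) !mulr0 (lin0 Hl).
  by rewrite lin_il !mulrDr -!scalerAr Hl hu hv.
- by rewrite il1 !mulr1.
- by rewrite ilM mulrA uincl_gen HC_gen_r IH mulrA.
Qed.
Lemma HC_l y (u : env Ll) : H (il u * y) = u * H y.
Proof.
move: u y; apply: env_ind_l => [||x u IH] => [|y|y].
- split=> [y|c u v hu hv y]; first by rewrite (lin0 lin_il) !mul0r (lin0 Hl).
  by rewrite lin_il !mulrDl -!scalerAl Hl hu hv.
- by rewrite il1 !mul1r.
- by rewrite ilM -mulrA uincl_gen HC_gen_l IH mulrA.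
Qed.
Lemma HC_m y (f : Lm) : H (y * ugen (vm f)) = 0.
Proof.
move: (tri_span y); apply: (spanned_ext (f := fun y => H (y * _)) (h := fun y => 0)).
- by apply: (lin_comp Hl); apply: lin_Mr; exact: lin_id.
- exact: lin_cst0.
- move=> u [a [h [b ->]]].
  by rewrite -uincl_gen -(mulrA (ip a * il h)) -imM HE ueps_genr mulr0 scale0r.
Qed.
Lemma HC_p y (e : Lp) : H (ugen (vp e) * y) = 0.
Proof.
move: (tri_span y); apply: (spanned_ext (f := fun y => H (_ * y)) (h := fun y => 0)).
- by apply: (lin_comp Hl); apply: lin_Ml; exact: lin_id.
- exact: lin_cst0.
- move=> u [a [h [b ->]]].
  by rewrite -uincl_gen !mulrA -ipM HE ueps_genl mul0r scale0r.
Qed.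
Lemma HC_1 : H 1 = 1.
Proof. by rewrite -[1](mulr1 1) -{1}[1](mulr1 1) -{1}ip1 -{1}il1 -im1 HE !ueps_1 mulr1 scale1r. Qed.
Lemma HC_1p y (a : env Lp) : H (ip a * y) = (ueps a : K) *: H y.
Proof.
move: (tri_span y); apply: (spanned_ext (f := fun y => H (_ * y)) (h := fun y => _ *: H y)).
- by apply: (lin_comp Hl); apply: lin_Ml; exact: lin_id.
- exact: lin_Z.
- move=> u [a' [h [b ->]]]; rewrite !mulrA -ipM !HE scalerA mulrA.
  by have [_ _ ->] := ueps_hom Lp.
Qed.
Lemma HC_1m y (b : env Lm) : H (y * im b) = (ueps b : K) *: H y.
Proof.
move: (tri_span y); apply: (spanned_ext (f := fun y => H (y * _)) (h := fun y => _ *: H y)).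
- by apply: (lin_comp Hl); apply: lin_Mr; exact: lin_id.
- exact: lin_Z.
- move=> u [a' [h [b' ->]]]; rewrite -(mulrA (ip a' * il h)) -imM !HE scalerA; congr (_ *: _).
  by have [_ _ ->] := ueps_hom Lm; rewrite mulrA mulrC.
Qed.

(** A letter of $\mathfrak u_-$ pushed through [a] disappears, becomes one letter of $\mathfrak l$
    at the right end, or reaches the right end and is killed by $H$. Each letter thus costs at most
    one degree, however long [a] is; this uniformity lets the tests extend to completions. *)
Lemma HC_bound (w : seq Lm) (a : env Lp) :
  ufil (size w)%:Z (H (im (\prod_(f <- w) ugen f) * ip a)).
Proof.
elim/last_ind: w a => [|w f IH] a.
  rewrite big_nil im1 mul1r.
  have -> : H (ip a) = (ueps a : K) *: 1 by rewrite -[ip a]mulr1 HC_1p HC_1.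
  by apply: (sub_Z (degle_sub _ _)); exact: degle_1.
have mono u : ufil (size w)%:Z u -> ufil (size (rcons w f))%:Z u.
  by apply: degle_mono; rewrite size_rcons lez_nat.
rewrite big_rcons imM uincl_gen /= -mulrA; move: (comm_m_p f a).
apply: (spanned_lin (f := fun u => H (_ * u))).
- by apply: (lin_comp Hl); apply: lin_Ml; exact: lin_id.
- exact: degle_sub.
- move=> u [[b ->]|[b [x ->]]|[b [x ->]]].
  + exact/mono/IH.
  + rewrite mulrA HC_gen_r size_rcons -addn1 PoszD; apply: degle_M; first exact: IH.
    exact: degle_gen.
  + by rewrite mulrA HC_m; exact: (degle_sub _ _).1.
Qed.

End HC.

End Triangular.

Section Swap.
Variables (K : fieldType) (g : lieAlgType K) (P : polarized g).
Lemma swap_full : (pl P + pv P + pu P)%VS = fullv.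
Proof. by rewrite -addvA (addvC (pv P)) addvA p_full. Qed.
Lemma swap_direct : directv (pl P + pv P + pu P).
Proof.
have := p_direct P; rewrite !directvE /= -addvA (addvC (pu P)) addvA => /eqP ->.
by rewrite -!addnA (addnC (\dim (pu P))).
Qed.
Definition swap := Polarized swap_full swap_direct (@p_lv _ _ P) (@p_lu _ _ P).

Lemma lproj_swap z : lproj swap z = lproj P z.
Proof. by rewrite /lproj /= (addvC (pv P)). Qed.

(** The antipode reverses products, hence exchanges the outer factors of a triangular product.
    Statements about the right side of $K$ are obtained from those about the left side in this
    way. *)
Lemma HC_swap (H : env g -> env (lie_of (pl P))) :
  is_HC H -> is_HC (P := swap) (fun u => uant (H (uant u))).
Proof.
move=> [Hl HE]; have [al a1 aM] := uant_antihom g; have [al' a1' aM'] := uant_antihom (lie_of (pl P)).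
split; first by apply: (lin_comp al'); apply: (lin_comp Hl).
move=> xp x0 xm; rewrite !aM !uant_uincl mulrA HE (linZ al') uantK.
by rewrite !uant_ueps mulrC.
Qed.
End Swap.

(** * Moving a letter of $\mathfrak u_-$ through a word in $\mathfrak u_+$ *)

Section Words.
Variables (K : fieldType) (g : lieAlgType K) (P : polarized g).
Local Notation Lp := (lie_of (pu P)).
Local Notation Lm := (lie_of (pv P)).
Local Notation Ll := (lie_of (pl P)).
Local Notation U := (env g).
Local Notation ip := (@uincl K g (pu P)).
Local Notation vp := (@lval K g (pu P)).
Local Notation vm := (@lval K g (pv P)).
Local Notation vl := (@lval K g (pl P)).

Definition wprod (L : lieAlgType K) (w : seq L) : env L := \prod_(e <- w) ugen e.
Lemma wprod_cons (L : lieAlgType K) (e : L) w : wprod (e :: w) = ugen e * wprod w.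
Proof. by rewrite /wprod big_cons. Qed.

(* The ways of extracting one letter from a word. *)
Fixpoint del (T : Type) (w : seq T) : seq (T * seq T) :=
  if w is e :: w' then (e, w') :: [seq (p.1, e :: p.2) | p <- del w'] else [::].

Lemma size_del (T : Type) (w : seq T) : size (del w) = size w.
Proof. by elim: w => //= e w <-; rewrite size_map. Qed.
Lemma size_del_mem (T : eqType) (w : seq T) p : p \in del w -> (size p.2).+1 = size w.
Proof.
elim: w p => // e w IH p /=; rewrite inE => /orP[/eqP -> //|/mapP[q /IH h ->]] /=.
by rewrite h.
Qed.

Definition short (L : lieAlgType K) n (u : env L) := exists2 w, (size w <= n)%N & u = wprod w.

Lemma short_mono (L : lieAlgType K) m n (u : env L) : (m <= n)%N -> spanned (short m) u -> spanned (short n) u.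
Proof.
move=> mn; apply: spanned_mono; first exact: spanned_sub.
by move=> v [w hw ->]; apply: spanned_gen; exists w => //; exact: leq_trans mn.
Qed.
Lemma short_cons (L : lieAlgType K) n (u : env L) (e : L) : spanned (short n) u -> spanned (short n.+1) (ugen e * u).
Proof.
apply: (spanned_lin (f := fun u => ugen e * u)).
- by apply: lin_Ml; exact: lin_id.
- exact: spanned_sub.
- by move=> v [w hw ->]; apply: spanned_gen; exists (e :: w) => //; rewrite wprod_cons.
Qed.
Lemma short_exh (L : lieAlgType K) (u : env L) : exists n, spanned (short n) u.
Proof.
move: u; apply: env_ind_l => [||e u [n hn]].
- split; first by exists 0%N; constructor.
  move=> a u v [m hm] [n hn]; exists (maxn m n); apply: (spanned_sub _).2.
    by apply: short_mono hm; rewrite leq_maxl.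
  by apply: short_mono hn; rewrite leq_maxr.
- by exists 0%N; apply: spanned_gen; exists [::] => //; rewrite /wprod big_nil.
- by exists n.+1; apply: short_cons.
Qed.

(** Bringing the extracted letter to the front only creates brackets, each of which shortens the
    word by one. *)
Lemma del_front (L : lieAlgType K) (w : seq L) p : p \in del w ->
  spanned (short (size w).-1) (wprod (p.1 :: p.2) - wprod w).
Proof.
elim: w p => // e w IH p; rewrite inE => /orP[/eqP ->|/mapP[q qw ->]] /=.
  by rewrite subrr; constructor.
rewrite !wprod_cons mulrA ugen_swap mulrDl -mulrA.
have -> (a b c d : env L) : a * b + c - a * d = a * (b - d) + c.
  by rewrite mulrBr; zmod_tac.
apply: (sub_D (spanned_sub _)).
  have sz := size_del_mem qw; rewrite -wprod_cons.
  by have := short_cons e (IH _ qw); rewrite prednK // -sz.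
apply: spanned_gen; exists (lie q.1 e :: q.2); last by rewrite wprod_cons.
by rewrite /= (size_del_mem qw).
Qed.

Lemma comm_l_word (x : Ll) (w : seq Lp) :
  spanned (fun u => exists2 v, (size v <= size w)%N & u = ip (wprod v))
    (ugen (vl x) * ip (wprod w) - ip (wprod w) * ugen (vl x)).
Proof.
have [lin_ip ip1 ipM] := uincl_hom (pu P).
elim: w => [|e w IH].
  by rewrite /wprod big_nil ip1 mulr1 mul1r subrr; constructor.
have [e' he] := lie_lp x e.
rewrite wprod_cons ipM uincl_gen mulrA ugen_swap he mulrDl.
have -> (a b c d : U) : a * b * c + d - a * c * b = a * (b * c - c * b) + d.
  by rewrite mulrBr !mulrA; zmod_tac.
apply: (sub_D (spanned_sub _)).
  move: IH; apply: (spanned_lin (f := fun u => ugen (vp e) * u)).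
  - by apply: lin_Ml; exact: lin_id.
  - exact: spanned_sub.
  - move=> u [v hv ->]; apply: spanned_gen; exists (e :: v) => //.
    by rewrite wprod_cons ipM uincl_gen.
by apply: spanned_gen; exists (e' :: w) => //; rewrite wprod_cons ipM uincl_gen.
Qed.

(** The terms that are negligible beside the leading part of $f\cdot w$ for a word of length $m$: a
    letter of $\mathfrak l$ after a word at least two letters shorter, a word without a letter of
    $\mathfrak l$, or a final letter of $\mathfrak u_-$, which $H$ kills. *)
Inductive junk (m : nat) : U -> Prop :=
| Junk1 w x : (size w + 2 <= m)%N -> junk m (ip (wprod w) * ugen (vl x))
| Junk2 w : (size w <= m)%N -> junk m (ip (wprod w))
| Junk3 w f : junk m (ip (wprod w) * ugen (vm f)).

Lemma junk_mono m n u : (m <= n)%N -> junk m u -> junk n u.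
Proof.
move=> mn [w x h|w h|w f]; [apply: Junk1|apply: Junk2|apply: Junk3];
  exact: leq_trans mn.
Qed.

Lemma junk_cons m (e : Lp) u : spanned (junk m) u -> spanned (junk m.+1) (ugen (vp e) * u).
Proof.
have [lin_ip ip1 ipM] := uincl_hom (pu P).
apply: (spanned_lin (f := fun u => ugen (vp e) * u)).
- by apply: lin_Ml; exact: lin_id.
- exact: spanned_sub.
- move=> v [w x h|w h|w f]; rewrite ?mulrA -uincl_gen -ipM -wprod_cons;
    apply: spanned_gen; [exact: Junk1|exact: Junk2|exact: Junk3].
Qed.

(** The Leibniz rule, with each bracket $[f,e]$ split into its three components. The $\mathfrak
    l$-component yields the displayed sum, since moving it to the right end of the word costs only
    words without a letter of $\mathfrak l$. *)
Lemma lift_word (f : Lm) (w : seq Lp) : spanned (junk (size w))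
  (ugen (vm f) * ip (wprod w) - \sum_(p <- del w)
     ip (wprod p.2) * ugen (vl (lproj P (lie (vm f) (vp p.1))))).
Proof.
have [lin_ip ip1 ipM] := uincl_hom (pu P).
elim: w f => [|e w IH] f.
  rewrite big_nil subr0 /wprod big_nil ip1 mulr1; apply: spanned_gen.
  by have := Junk3 0 [::] f; rewrite /wprod big_nil ip1 mul1r.
rewrite big_cons big_map wprod_cons ipM uincl_gen mulrA ugen_swap mulrDl.
under eq_bigr do rewrite /= wprod_cons ipM uincl_gen -mulrA.
rewrite -mulr_sumr /=.
have [e' [f' dec]] := polarized_decomp P (lie (vm f) (vp e)).
set x := lproj P _ in dec *; set Sg := \sum_(p <- _) _ in IH *.
rewrite dec !(linD (@lin_ugen _ g)) !mulrDl.
have -> (a b c d h k l q : U) : a * b * c + (d + h + k) - (l + a * q) =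
    a * (b * c - q) + d + (h - l) + k.
  by rewrite mulrBr mulrA; zmod_tac.
have SD := sub_D (spanned_sub (junk (size (e :: w)))).
apply: (SD); first apply: (SD); first apply: (SD).
- exact: junk_cons.
- apply: spanned_gen; rewrite -uincl_gen -ipM -wprod_cons; exact: Junk2.
- move: (comm_l_word x w); apply: spanned_mono; first exact: spanned_sub.
  by move=> u [v hv ->]; apply: spanned_gen; apply: Junk2; exact: leqW.
(* The new letter $f'$ has already consumed $e$; its own leading part removes one more letter, which
   leaves words two letters shorter than the whole one. *)
- rewrite -[_ * _](subrK (\sum_(p <- del w)
     ip (wprod p.2) * ugen (vl (lproj P (lie (vm f') (vp p.1)))))).
  apply: (SD).
    move: (IH f'); apply: spanned_mono; first exact: spanned_sub.
    by move=> u hu; apply: spanned_gen; exact: junk_mono hu.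
  apply: (sub_sum (spanned_sub _)) => p pw; apply: spanned_gen; apply: Junk1.
  by rewrite addn2 /= ltnS (size_del_mem pw).
Qed.

End Words.

(** * Nondegeneracy of the tests by $U(\mathfrak u_-)$ *)

Section Nondegeneracy.
Variables (K : fieldType) (g : lieAlgType K) (P : polarized g).
Local Notation Lp := (lie_of (pu P)).
Local Notation Lm := (lie_of (pv P)).
Local Notation Ll := (lie_of (pl P)).
Local Notation U := (env g).
Local Notation ip := (@uincl K g (pu P)).
Local Notation im := (@uincl K g (pv P)).
Local Notation vp := (@lval K g (pu P)).
Local Notation vm := (@lval K g (pv P)).
Local Notation vl := (@lval K g (pl P)).
Variables (H : U -> env Ll) (E C : compFilAlgType K).
Variables (in1 : env Lp -> E) (in2 : C -> E) (act : env Ll -> C -> C) (Pr : U -> E -> C).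
Hypothesis char0 : forall n, n.+1%:R != 0 :> K.
Hypothesis hH : is_HC H.
Hypotheses (in1h : alg_hom in1) (in10 : forall a, fil 0 (in1 a)).
Hypotheses (in2h : alg_hom in2) (in2b : bdd 0 in2).
Hypothesis in12 : forall a Z, in1 a * in2 Z = in2 Z * in1 a.
Hypotheses (actl : forall Z, linear (act^~ Z)).
Hypotheses (act1 : forall Z, act 1 Z = Z)
  (actM : forall u v Z, act (u * v) Z = act u (act v Z)).
Hypothesis actb : forall n q u Z, ufil n u -> fil q Z -> fil (q + n) (act u Z).
Hypothesis Prl : forall x, linear (Pr x).
Hypothesis PrE : forall x a Z, Pr x (in1 a * in2 Z) = act (H (x * ip a)) Z.
Hypothesis Prb : forall w q X, fil q X ->
  fil (q + (size w)%:Z) (Pr (im (wprod w)) X).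
Hypothesis approx : forall q X, fil q X -> exists s : seq (env Lp * C),
  (forall p, p \in s -> fil q p.2) /\
  fil (q - 1) (X - \sum_(p <- s) in1 p.1 * in2 p.2).
Variables (n : nat) (eb : 'I_n -> Lp) (fb : 'I_n -> Lm) (c : 'I_n -> 'I_n -> C).
Variable co : Lp -> 'I_n -> K.
Hypothesis coE : forall a, a = \sum_k co a k *: eb k.
Hypothesis cfil1 : forall k i, fil (-1) (c k i).
Hypothesis cE : forall a k q Z, fil q Z -> fil (q - 1) (\sum_i c k i *
   act (ugen (lproj P (lie (vm (fb i)) (vp a)))) Z - co a k *: Z).

Definition emb (a : env Lp) (Z : C) : E := in1 a * in2 Z.
Let in1l : linear in1. Proof. by case: in1h. Qed.
Let in2l : linear in2. Proof. by case: in2h. Qed.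
Let emb_l Z : linear (emb^~ Z). Proof. exact: (lin_Mr (in2 Z) in1l). Qed.
Let emb_r a : linear (emb a). Proof. exact: (lin_Ml (in1 a) in2l). Qed.
Let emb_fil q a Z : fil q Z -> fil q (emb a Z).
Proof.
move=> hZ; have := in2b.2 _ _ hZ; rewrite addr0 => h.
by rewrite /emb -[q]add0r; apply: fil_M.
Qed.
Let embM a b Z Z' : in1 a * in2 Z' * emb b Z = emb (a * b) (Z' * Z).
Proof.
have [_ _ M1] := in1h; have [_ _ M2] := in2h.
by rewrite /emb M1 M2 -!mulrA; congr (_ * _); rewrite !mulrA in12.
Qed.

(* Combinations of words of length at most m in u+, with coefficients of degree q. *)
Definition wd m q (X : E) := spanned (fun Y => exists w Z,
  [/\ (size w <= m)%N, fil q Z & Y = emb (wprod w) Z]) X.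

Lemma wd_mono m m' q X : (m <= m')%N -> wd m q X -> wd m' q X.
Proof.
move=> mm; apply: spanned_mono; first exact: spanned_sub.
move=> Y [w [Z [hw hZ ->]]]; apply: spanned_gen; exists w, Z; split=> //.
exact: leq_trans mm.
Qed.
Lemma wd_short m q u Z : fil q Z -> spanned (short m) u -> wd m q (emb u Z).
Proof.
move=> hZ; apply: (spanned_lin (f := emb^~ Z)) => //; first exact: spanned_sub.
by move=> v [w hw ->]; apply: spanned_gen; exists w, Z.
Qed.
Lemma wd_approx q X : fil q X -> exists m X', wd m q X' /\ fil (q - 1) (X - X').
Proof.
move=> /approx [s [hs hX]].
suff [m hm] : exists m, wd m q (\sum_(p <- s) emb p.1 p.2).
  by exists m, (\sum_(p <- s) emb p.1 p.2).
elim: s hs {hX} => [|p s IH] hs; first by exists 0%N; rewrite big_nil; constructor.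
have [|m hm] := IH; first by move=> r rs; apply: hs; rewrite inE rs orbT.
have [m' hm'] := short_exh p.1; exists (maxn m m'); rewrite big_cons.
apply: (sub_D (spanned_sub _)).
  apply: (@wd_mono m'); first by rewrite leq_maxr.
  by apply: wd_short => //; apply: hs; rewrite inE eqxx.
by apply: wd_mono hm; rewrite leq_maxl.
Qed.

(** Puts the letter $e_k$ in front of a word and lowers the degree of the coefficient by one; it
    compensates the removal of a letter by a lift. *)
Definition eop k i := in1 (ugen (eb k)) * in2 (c k i).
Lemma wd_op m q w Z k i : (size w < m)%N -> fil (q + 1) Z ->
  wd m q (eop k i * emb (wprod w) Z).
Proof.
move=> hw hZ; apply: spanned_gen; exists (eb k :: w), (c k i * Z).
split=> //; last by rewrite /eop embM wprod_cons.
by have := fil_M _ _ _ _ (cfil1 k i) hZ; rewrite addrC addrK.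
Qed.

(** Transposition: a letter of $\mathfrak u_-$ passes from the test element to the tested one. *)
Definition lifts (f : Lm) (X Y : E) :=
  forall x, Pr (x * ugen (vm f)) X = Pr x Y.

(** Only [Junk1] contributes to [Y1]. The bound on [eop k i * Y1] is stated separately because
    [m.-2] and [m.-1] are truncated: for $m<2$ it does not follow from the first bound, but then no
    [Junk1] occurs and [Y1] is 0. *)
Lemma lift_junk m q u Z : fil q Z -> spanned (@junk K g P m) u ->
  exists Y1 Y0, [/\ wd m.-2 (q + 1) Y1, forall k i, wd m.-1 q (eop k i * Y1), fil q Y0 &
    forall x, act (H (x * u)) Z = Pr x (Y1 + Y0)].
Proof.
have Hl := HC_lin hH.
move=> hZ; elim=> [|a v v' hv _ [Y1 [Y0 [h1 h2 h0 e]]]].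
  exists 0, 0; split; [by constructor | | exact: fil_0 | move=> x].
    by move=> k i; rewrite mulr0; constructor.
  by rewrite mulr0 (lin0 Hl) (lin0 (actl Z)) addr0 (lin0 (Prl x)).
suff [Y1' [Y0' [h1' h2' h0' e']]] : exists Y1 Y0, [/\ wd m.-2 (q + 1) Y1,
    forall k i, wd m.-1 q (eop k i * Y1), fil q Y0 &
    forall x, act (H (x * v)) Z = Pr x (Y1 + Y0)].
  exists (a *: Y1' + Y1), (a *: Y0' + Y0); split.
  - exact: (spanned_sub _).2.
  - by move=> k i; rewrite mulrDr -scalerAr; exact: ((spanned_sub _).2 a _ _ (h2' k i) (h2 k i)).
  - exact: fil_L.
  - move=> x; rewrite mulrDr -scalerAr Hl actl e e' -Prl scalerDr; congr (Pr x _); zmod_tac.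
case: hv => {a v v' Y1 Y0 h1 h2 h0 e} [w x hw|w hw|w f].
- exists (emb (wprod w) (act (ugen x) Z)), 0.
  have hx : fil (q + 1) (act (ugen x) Z) by apply: actb => //; exact: degle_gen.
  split; last 2 first.
  + exact: fil_0.
  + by move=> y; rewrite mulrA HC_gen_r // actM -PrE addr0.
  + apply: spanned_gen; exists w, (act (ugen x) Z); split=> //.
    by case: m hw => [|[|m]]; rewrite addn2.
  + move=> k i; apply: wd_op => //; by case: m hw => [|[|m]]; rewrite addn2.
- exists 0, (emb (wprod w) Z); split; [by constructor | | exact: emb_fil | move=> x].
    by move=> k i; rewrite mulr0; constructor.
  by rewrite add0r PrE.
- exists 0, 0; split; [by constructor | | exact: fil_0 | move=> x].
    by move=> k i; rewrite mulr0; constructor.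
  by rewrite mulrA HC_m // (lin0 (actl Z)) addr0 (lin0 (Prl x)).
Qed.

(* The operators [sum_k e_k c_(k,i)] turn the leading parts of the lifts of the
   f_i X into the Euler operator, which multiplies words of length m by m. *)
Lemma euler m q X : wd m.+1 q X -> exists (Y1 Y0 : 'I_n -> E) R,
  [/\ forall i, wd m (q + 1) (Y1 i), forall i, fil q (Y0 i),
      forall i, lifts (fb i) X (Y1 i + Y0 i),
      fil (q - 1) R &
      wd m q (m.+1%:R *: X - \sum_k \sum_i eop k i * Y1 i + R)].
Proof.
elim=> [|a X1 X2 hX1 _ [Y1 [Y0 [R [h1 h0 e hR h]]]]].
  exists (fun=> 0), (fun=> 0), 0; split=> //.
  - by move=> i; constructor.
  - by move=> i; exact: fil_0.
  - by move=> i x; rewrite addr0 !(lin0 (Prl _)).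
  - exact: fil_0.
  - rewrite scaler0 addr0 big1 ?subr0; first by constructor.
    by move=> k _; rewrite big1 // => i _; rewrite mulr0.
suff [Y1' [Y0' [R' [h1' h0' e' hR' h']]]] : exists (Y1 Y0 : 'I_n -> E) R,
  [/\ forall i, wd m (q + 1) (Y1 i), forall i, fil q (Y0 i),
      forall i, lifts (fb i) X1 (Y1 i + Y0 i),
      fil (q - 1) R &
      wd m q (m.+1%:R *: X1 - \sum_k \sum_i eop k i * Y1 i + R)].
  exists (fun i => a *: Y1' i + Y1 i), (fun i => a *: Y0' i + Y0 i), (a *: R' + R); split.
  - by move=> i; exact: ((spanned_sub _).2 a _ _ (h1' i) (h1 i)).
  - by move=> i; exact: fil_L.
  - move=> i x; rewrite [X in _ = Pr x X](_ : _ = a *: (Y1' i + Y0' i) + (Y1 i + Y0 i)).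
      by rewrite !Prl (e i x) (e' i x).
    by rewrite scalerDr; zmod_tac.
  - exact: fil_L.
  - have := (spanned_sub _).2 a _ _ h' h; congr (wd m q _).
    have -> : \sum_k \sum_i eop k i * (a *: Y1' i + Y1 i) =
      a *: (\sum_k \sum_i eop k i * Y1' i) +
      \sum_k \sum_i eop k i * Y1 i.
      rewrite scaler_sumr -big_split; apply: eq_bigr => k _.
      rewrite scaler_sumr -big_split; apply: eq_bigr => i _.
      by rewrite mulrDr scalerAr.
    set S1 := \sum_k _; set S2 := \sum_k _; zmod_tac.
case: hX1 => w [Z [hw hZ ->]] {a X1 X2 Y1 Y0 R h1 h0 e hR h}.
pose xi i p := lproj P (lie (vm (fb i)) (vp p)).
pose main i := \sum_(p <- del w) emb (wprod p.2) (act (ugen (xi i p.1)) Z).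
have low i := lift_junk hZ (lift_word (fb i) w).
pose Yl i := sval (cid (low i)); pose Y0 i := sval (cid (svalP (cid (low i)))).
have lowP i : [/\ wd (size w).-2 (q + 1) (Yl i), forall k j, wd (size w).-1 q (eop k j * Yl i),
   fil q (Y0 i) &
   forall x, act (H (x * (ugen (vm (fb i)) * ip (wprod w) - \sum_(p <- del w)
     ip (wprod p.2) * ugen (vl (xi i p.1))))) Z = Pr x (Yl i + Y0 i)].
  exact: (svalP (cid (svalP (cid (low i))))).
have hxi i p : fil (q + 1) (act (ugen (xi i p)) Z) by apply: actb => //; exact: degle_gen.
exists (fun i => main i + Yl i), Y0.
(* The error made by treating the matrix $c$ as an exact inverse of the pairing; by [cE] it has
   degree $q-1$. *)
pose Rp p := \sum_k emb (ugen (eb k) * wprod p.2)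
    (\sum_i c k i * act (ugen (xi i p.1)) Z - co p.1 k *: Z).
exists (\sum_(p <- del w) Rp p); split.
- move=> i; apply: (sub_D (spanned_sub _)).
    apply: (sub_sum (spanned_sub _)) => p pw; apply: spanned_gen.
    exists p.2, (act (ugen (xi i p.1)) Z); split=> //.
    by rewrite -ltnS (size_del_mem pw).
  have [h _ _ _] := lowP i; apply: wd_mono h; rewrite -ltnS.
  by case: (size w) hw => [|[|r]] //= hr; exact: (ltn_trans (ltnSn r) hr).
- by move=> i; case: (lowP i).
- move=> i x; have [_ _ _ e] := lowP i; rewrite -addrA (linD (Prl x)) -e.
  rewrite (lin_sum (Prl x)) PrE mulrBr (linB (HC_lin hH)) (linB (actl Z)) mulrA addrC.
  rewrite mulr_sumr (lin_sum (HC_lin hH)) (lin_sum (actl Z)).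
  rewrite [X in _ + X](_ : _ = \sum_(p <- del w) act (H (x * (ip (wprod p.2) *
     ugen (vl (xi i p.1))))) Z); first by rewrite subrK.
  by apply: eq_bigr => p _; rewrite mulrA HC_gen_r // actM -PrE.
- rewrite big_seq; elim/big_ind: _ => [||p pw]; [exact: fil_0 | exact: fil_D |].
  rewrite /Rp; elim/big_ind: _ => [||k _]; [exact: fil_0 | exact: fil_D |].
  by apply: emb_fil; exact: cE.
- set XZ := emb (wprod w) Z.
  have e1 : \sum_k \sum_i eop k i * main i =
     \sum_(p <- del w) (Rp p + emb (wprod (p.1 :: p.2)) Z).
    transitivity (\sum_(p <- del w) \sum_k emb (ugen (eb k) * wprod p.2)
      (\sum_i c k i * act (ugen (xi i p.1)) Z)).
      rewrite [RHS]exchange_big; apply: eq_bigr => k _ /=.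
      transitivity (\sum_i \sum_(p <- del w)
         emb (ugen (eb k) * wprod p.2) (c k i * act (ugen (xi i p.1)) Z)).
        by apply: eq_bigr => i _; rewrite mulr_sumr; apply: eq_bigr => p _; rewrite embM.
      by rewrite exchange_big; apply: eq_bigr => p _; rewrite (lin_sum (emb_r _)).
    apply: eq_bigr => p _; rewrite wprod_cons [in RHS](coE p.1) (lin_sum (@lin_ugen _ _)).
    rewrite mulr_suml (lin_sum (emb_l Z)) -big_split; apply: eq_bigr => k _ /=.
    rewrite (linZ (@lin_ugen _ _)) -scalerAl (linZ (emb_l Z)) -(linZ (emb_r _)).
    by rewrite -(linD (emb_r _)) subrK.
  have -> : \sum_k \sum_i eop k i * (main i + Yl i) =
    \sum_(p <- del w) (Rp p + emb (wprod (p.1 :: p.2)) Z) +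
    \sum_k \sum_i eop k i * Yl i.
    rewrite -e1 -big_split; apply: eq_bigr => k _ /=.
    by rewrite -big_split; apply: eq_bigr => i _ /=; rewrite mulrDr.
  rewrite big_split /=.
  (* A word has as many deletions as letters, so it is counted [size w] times. The other $m+1-|w|$
     copies vanish if $|w|=m+1$, and otherwise involve only words of length at most $m$. *)
  have -> : m.+1%:R *: XZ = (m.+1 - size w)%N%:R *: XZ + \sum_(p <- del w) XZ.
    rewrite big_const_seq count_predT size_del -Monoid.iteropE /=.
    have -> : iterop (size w) +%R XZ 0 = (size w)%:R *: XZ.
      by rewrite scaler_nat.
    by rewrite -scalerDl -natrD subnK.
  set S1 := \sum_(p <- _) Rp p; set S3 := \sum_k _.
  have -> (z1 z2 z3 z4 z5 : E) : z1 + z2 - (z3 + z4 + z5) + z3 = z1 - (z4 - z2) - z5.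
    by zmod_tac.
  have SB := sub_B (spanned_sub (fun Y => exists w Z,
     [/\ (size w <= m)%N, fil q Z & Y = emb (wprod w) Z])).
  apply: (SB); first apply: (SB).
  + case: (ltngtP (size w) m.+1) hw => // [hw _|hw _]; last first.
      by rewrite hw subnn scale0r; constructor.
    apply: (sub_Z (spanned_sub _)); apply: spanned_gen; exists w, Z; split=> //.
  + rewrite -sumrB; apply: (sub_sum (spanned_sub _)) => p pw.
    rewrite -(linB (emb_l Z)); apply: wd_short => //.
    apply: short_mono (del_front pw).
    by rewrite -subn1 leq_subLR add1n.
  + apply: (sub_sum (spanned_sub _)) => k _; apply: (sub_sum (spanned_sub _)) => i _.
    have [_ h _ _] := lowP i; apply: wd_mono (h k i).
    by rewrite -subn1 leq_subLR add1n.
Qed.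

Lemma wd_fil m q X : wd m q X -> fil q X.
Proof.
apply: (spanned_mono (T := fil q)); last by move=> Y [w [Z [_ hZ ->]]]; exact: emb_fil.
by split; [exact: fil_0 | move=> a u v; exact: fil_L].
Qed.

(** Induction on the length of words. The lifts of the $f_iX$ inherit small tests, hence drop in
    degree; applying $\sum e_kc_{k,i}$ to them recovers $(m+1)X$ up to lower degree and shorter
    words, which drop by induction. Characteristic zero allows division by $m+1$. *)
Lemma degree_drop m q X : wd m q X ->
  (forall w, fil (q + (size w)%:Z - 1) (Pr (im (wprod w)) X)) -> fil (q - 1) X.
Proof.
have [_ im1 imM] := uincl_hom (pv P).
elim: m q X => [|m IH] q X hX hP.
  have [Z hZ] : exists Z, X = in2 Z.
    elim: hX {hP} => [|a Y1 Y2 [w [Z [+ _ ->]]] _ [Z2 ->]].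
      by exists 0; rewrite (lin0 in2l).
    rewrite leqn0 => /nilP ->; exists (a *: Z + Z2); rewrite in2l /emb /wprod big_nil.
    by case: in1h => _ -> _; rewrite mul1r.
  have := hP [::]; rewrite /wprod big_nil im1 addr0 hZ.
  have -> : Pr 1 (in2 Z) = Z.
    have := PrE 1 1 Z; have [_ -> _] := in1h; have [_ -> _] := uincl_hom (pu P).
    by rewrite !mul1r HC_1 // act1.
  by move=> hz; have := in2b.2 _ _ hz; rewrite addr0.
have [Y1 [Y0 [R [h1 h0 e hR h]]]] := euler hX.
have hY i : fil q (Y1 i).
  (* The induction hypothesis is used in degree $q+1$: a test by one more letter $f_i$ has weight
     one more. *)
  rewrite -[q](addrK 1); apply: IH => // w.
  have := hP (rcons w (fb i)); rewrite /wprod big_rcons /= imM uincl_gen e.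
  rewrite (linD (Prl _)) size_rcons -addn1 PoszD => hp.
  have hp0 := Prb w (h0 i).
  have -> : q + 1 + (size w)%:Z - 1 = q + (size w)%:Z by rewrite addrAC addrK.
  rewrite addrA addrK in hp.
  by rewrite -[Pr _ (Y1 i)](addrK (Pr (im (\prod_(f <- w) ugen f)) (Y0 i))); apply: fil_B.
set X' := _ + R in h.
have hXX : fil (q - 1) (m.+1%:R *: X - X').
  rewrite /X'; set S1 := \sum_k _.
  have -> : m.+1%:R *: X - (m.+1%:R *: X - S1 + R) = S1 - R by zmod_tac.
  apply: fil_B => //; rewrite /S1; elim/big_ind: _ => [||k _]; [exact: fil_0 | exact: fil_D |].
  elim/big_ind: _ => [||i _]; [exact: fil_0 | exact: fil_D |].
  rewrite addrC; apply: fil_M; last exact: hY.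
  rewrite -[-1]add0r; apply: fil_M => //.
  by have := in2b.2 _ _ (cfil1 k i); rewrite addr0.
have hX' : fil (q - 1) X'.
  apply: (IH q X' h) => w.
  have -> : X' = m.+1%:R *: X - (m.+1%:R *: X - X') by rewrite subKr.
  rewrite (linB (Prl _)) (linZ (Prl _)); apply: fil_B; first exact/fil_Z/hP.
  by have := Prb w hXX; rewrite addrAC.
have : fil (q - 1) (m.+1%:R *: X) by rewrite -[_ *: X](subrK X'); apply: fil_D.
by move=> /(fil_Z m.+1%:R^-1); rewrite scalerA mulVf // scale1r.
Qed.

(** If all tests vanish, [degree_drop] applies in every degree, and separatedness of the filtration
    leaves only 0. *)
Lemma nondegenerate X : (forall w, Pr (im (wprod w)) X = 0) -> X = 0.
Proof.
move=> hX; have drop q : fil q X -> fil (q - 1) X.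
  move=> /[dup] hq /wd_approx [m [X' [h hXX]]].
  rewrite -[X](subrK X'); apply: fil_D => //; apply: degree_drop h _ => w.
  have -> : X' = X - (X - X') by rewrite subKr.
  by rewrite (linB (Prl _)) hX sub0r addrAC; apply: fil_N; exact: Prb.
have [q hq] := fil_exh X.
have hn (k : nat) : fil (q - k%:Z) X.
  elim: k => [|k IH]; first by rewrite subr0.
  by rewrite -addn1 PoszD opprD addrA; apply: drop.
apply: fil_sep => k; apply: fil_mono (hn `|q - k|%N).
by rewrite lerBlDr -lerBlDl abszE ler_norm.
Qed.

End Nondegeneracy.

(** * Inverting the pairing matrix through symbols *)

Section Symbols.
Variables (K : fieldType) (g : lieAlgType K) (P : polarized g).
Local Notation Lp := (lie_of (pu P)).
Local Notation Lm := (lie_of (pv P)).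
Local Notation Ll := (lie_of (pl P)).
Variables (d : nat) (x y : d.-tuple g).
Variables (M : compFilAlgType K) (j : env Ll -> M).
Variables (S : comAlgType K) (i : Ll -> S) (sigma : int -> M -> S).
Hypothesis jh : alg_hom j.
Hypothesis jf : forall n u, ufil n u -> fil n (j u).
Hypotheses (hS : is_loc_sym x y i) (hsig : is_symbol x y j i sigma).

Lemma degeq_sub (V : Type) (A : algType K) (f : V -> A) n : subspace (degeq f n).
Proof.
split; first by exists [::]; rewrite big_nil.
move=> a u v [s [hs ->]] [t [ht ->]].
exists ([seq (a * p.1, p.2) | p <- s] ++ t); split.
  by rewrite all_cat ht andbT all_map.
rewrite big_cat big_map /= scaler_sumr; congr (_ + _); apply: eq_bigr => p _.
by rewrite scalerA.
Qed.

Lemma degeq_det n (v : 'I_n -> 'I_n -> Ll) (A : 'M[S]_n) :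
  (forall r c, A r c = i (v r c)) -> degeq i n%:Z (\det A).
Proof.
move=> hA; rewrite /determinant; apply: (sub_sum (degeq_sub i _)) => /= s _.
exists [:: ((-1) ^+ odd_perm s, [seq v r ((s : {perm 'I_n}) r) | r <- enum 'I_n])]; split.
  by rewrite /= size_map size_enum_ord eqxx.
rewrite big_seq1 /= big_map big_enum /= -mulr_algl; congr (_ * _).
  by case: (odd_perm s); rewrite ?expr1 ?expr0 ?scaleN1r ?scale1r.
by apply: eq_bigr => r _; rewrite hA.
Qed.

(** The associated graded algebra is commutative, so the symbol of a commutator vanishes. *)
Lemma gr_comm p q (u v : M) : fil p u -> fil q v -> fil (p + q - 1) (u * v - v * u).
Proof.
have [sl s0 _ [s1 sM] sj] := hsig => hu hv.
have huv : fil (p + q) (u * v) by exact: fil_M.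
have hvu : fil (p + q) (v * u) by rewrite addrC; exact: fil_M.
apply/(s0 (p + q)); first exact: fil_B.
rewrite [u * v - _]addrC -scaleN1r sl // (sM p q u v) // (addrC p) (sM q p v u) //.
by rewrite scaleN1r mulrC addNr.
Qed.

Definition pairing (r c : 'I_d) : Ll := lproj P (lie (tnth x r) (tnth y c)).

(** Over $S(\mathfrak l)[1/D_0']$ the matrix of symbols has the inverse $\mathrm{adj}(A)/D_0'$, with
    entries of degree $(d-1)-d=-1$. Any lifts of these entries invert the pairing matrix on both
    sides up to degree $-1$. *)
Lemma dual_family : exists B : 'I_d -> 'I_d -> M, [/\ forall r c, fil (-1) (B r c),
  forall l k, fil (-1) (\sum_r B r k * j (ugen (pairing l r)) - (l == k)%:R) &
  forall l k, fil (-1) (\sum_r B k r * j (ugen (pairing r l)) - (l == k)%:R)].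
Proof.
have [sl s0 ssurj [s1 sM] sj] := hsig; have [il [dinv [dV _]] _] := hS.
pose A : 'M[S]_d := \matrix_(r, c) i (pairing r c).
have detE : detD x y i = \det A by [].
have surj r c : exists u, fil (-1) u /\ sigma (-1) u = dinv * (\adj A) r c.
  have [|u hu e] := (ssurj (-1) (dinv * (\adj A) r c)).1; last by exists u.
  exists 1%N; rewrite expr1 mul1n detE mulrAC -detE dV mul1r mxE /cofactor.
  rewrite (_ : -1 + d%:Z = d.-1%:Z); last first.
    have d0 : (0 < d)%N := leq_ltn_trans (leq0n r) (ltn_ord r).
    by rewrite -{1}(prednK d0) -addn1 PoszD addrC addrK.
  set D := \det _; have : degeq i d.-1%:Z D.
    apply: (@degeq_det _ (fun r' c' => pairing (lift c r') (lift r c'))) => r' c'.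
    by rewrite !mxE.
  by rewrite -signr_odd; case: odd; rewrite ?expr1 ?expr0 ?mulN1r ?mul1r //; exact: sub_N (degeq_sub _ _) _.
pose B r c := sval (cid (surj r c)); exists B.
have BP r c : fil (-1) (B r c) /\ sigma (-1) (B r c) = dinv * (\adj A) r c.
  by rewrite /B; case: cid.
have gen1 z : fil 1 (j (ugen z)) by apply: jf; exact: degle_gen.
have sigD n u v : fil n u -> fil n v -> sigma n (u + v) = sigma n u + sigma n v.
  by move=> hu hv; rewrite -[u]scale1r sl // !scale1r.
have sig0 n : sigma n 0 = 0 by apply/s0; exact: fil_0.
have sigsum n (F : 'I_d -> M) : (forall r, fil n (F r)) ->
    fil n (\sum_r F r) /\ sigma n (\sum_r F r) = \sum_r sigma n (F r).
  move=> hF; elim/big_ind2: _ => [|u1 v1 u2 v2 [h1 e1] [h2 e2]|r _].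
  - by split; [exact: fil_0 | exact: sig0].
  - by split; [exact: fil_D | rewrite sigD // e1 e2].
  - by split; [exact: hF |].
have sig1 (b : bool) : fil 0 (b%:R : M) /\ sigma 0 b%:R = b%:R.
  by case: b; [split; [exact: fil_1|] | split; [exact: fil_0|]].
have fin (F : 'I_d -> M) (G : 'I_d -> S) (b : bool) : (forall r, fil 0 (F r)) ->
    (forall r, sigma 0 (F r) = G r) -> \sum_r G r = b%:R ->
    fil (-1) (\sum_r F r - b%:R).
  move=> hF hG e; have [h1 e1] := sigsum 0 F hF; have [h2 e2] := sig1 b.
  rewrite -[-1]sub0r; apply/(s0 0); first exact: fil_B.
  rewrite [_ - b%:R]addrC -scaleN1r sl // e1 e2 (eq_bigr G) // e.
  by rewrite scaleN1r addNr.
have Aji r c : i (pairing r c) = A r c by rewrite mxE.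
split.
- by move=> r c; case: (BP r c).
- move=> l k; apply: (fin _ (fun r => dinv * (A l r * (\adj A) r k))).
  + by move=> r; rewrite -[0](addNr 1); apply: fil_M => //; case: (BP r k).
  + move=> r; have [h e] := BP r k; rewrite -[0](addNr 1) sM // e sj Aji.
    by rewrite -mulrA [X in _ * X]mulrC.
  + rewrite -mulr_sumr; have := mul_mx_adj A; move/matrixP/(_ l k); rewrite !mxE => ->.
    by rewrite -detE mulrnAr dV.
- move=> l k; apply: (fin _ (fun r => dinv * ((\adj A) k r * A r l))).
  + by move=> r; rewrite -[0](addNr 1); apply: fil_M => //; case: (BP k r).
  + by move=> r; have [h e] := BP k r; rewrite -[0](addNr 1) sM // e sj Aji -mulrA.
  + rewrite -mulr_sumr; have := mul_adj_mx A; move/matrixP/(_ k l); rewrite !mxE => ->.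
    by rewrite -detE mulrnAr dV eq_sym.
Qed.

End Symbols.

(** * Trilinear maps extended to completed tensor products *)

Section Trilinear.
Variables (K : fieldType) (M : compFilAlgType K) (A A' : algType K).

Definition tri (B : compFilAlgType K) d (f : A -> A' -> M -> B) :=
  [/\ forall a m, linear (fun a' => f a a' m), forall a' m, linear (fun a => f a a' m),
      forall a a', linear (f a a') &
      forall a a' q m, fil q m -> fil (q + d) (f a a' m)].

Definition clift3 (B : compFilAlgType K) (f : A -> A' -> M -> B) : ctens (tens A A') M -> B :=
  clift (fun z m => tlift (fun a a' => f a a' m) z).

Section Filtered.
Variables (B : compFilAlgType K) (d : int) (f : A -> A' -> M -> B).
Hypothesis hf : tri d f.
Lemma tri_bilin m : bilin (fun a a' => f a a' m).
Proof. by have [h1 h2 _ _] := hf; split=> u. Qed.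
Lemma tri_bbd : bbd d (fun z m => tlift (fun a a' => f a a' m) z).
Proof.
have [h1 h2 h3 h4] := hf; split.
  split=> [z|m]; last exact: tlift_linear (tri_bilin m).
  have [s ->] := tensE z => a u v.
  rewrite !(lin_sum (tlift_linear (tri_bilin _))) scaler_sumr -big_split.
  by apply: eq_bigr => p _; rewrite !(tlift_pure _ _ (tri_bilin _)) h3.
move=> z q m qm; have [s ->] := tensE z.
rewrite (lin_sum (tlift_linear (tri_bilin _))); elim/big_ind: _ => [||p _].
- exact: fil_0.
- exact: fil_D.
- by rewrite (tlift_pure _ _ (tri_bilin _)); exact: h4.
Qed.
End Filtered.

Lemma clift3_bdd (B : compFilAlgType K) d (f : A -> A' -> M -> B) : tri d f -> bdd d (clift3 f).
Proof. by move=> hf; exact: clift_bdd (tri_bbd hf). Qed.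
Lemma clift3_bnd (B : compFilAlgType K) d (f : A -> A' -> M -> B) : tri d f -> bnd (clift3 f).
Proof. by move=> hf; exact: clift_bnd (tri_bbd hf). Qed.
Lemma clift3_pure (B : compFilAlgType K) d (f : A -> A' -> M -> B) : tri d f ->
  forall a a' m, clift3 f (cpure (tpure a a') m) = f a a' m.
Proof.
by move=> hf a a' m; rewrite /clift3 (clift_pure (tri_bbd hf)) (tlift_pure _ _ (tri_bilin hf _)).
Qed.

Lemma tri_comp (B : compFilAlgType K) d e (B' : compFilAlgType K) (F : B -> B') (f : A -> A' -> M -> B) :
  bdd e F -> tri d f -> tri (d + e) (fun a a' m => F (f a a' m)).
Proof.
move=> [Fl Fb] [h1 h2 h3 h4]; split=> *.
- exact: lin_comp.
- exact: lin_comp.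
- exact: lin_comp.
- by rewrite addrA; apply: Fb; apply: h4.
Qed.
Lemma clift3_comp (B : compFilAlgType K) d e (B' : compFilAlgType K) (F : B -> B') (f : A -> A' -> M -> B) :
  bdd e F -> tri d f ->
  forall X, F (clift3 f X) = clift3 (fun a a' m => F (f a a' m)) X.
Proof.
move=> hF hf; apply: ctens2_ext.
- exact: bnd_comp (bdd_bnd hF) (clift3_bnd hf).
- exact: clift3_bnd (tri_comp hF hf).
- by move=> a a' m; rewrite (clift3_pure hf) (clift3_pure (tri_comp hF hf)).
Qed.
Lemma tri_lin (B : compFilAlgType K) d (f h : A -> A' -> M -> B) c : tri d f -> tri d h ->
  tri d (fun a a' m => c *: f a a' m + h a a' m).
Proof.
move=> [h1 h2 h3 h4] [h1' h2' h3' h4']; split=> *.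
- by apply: lin_D => //; apply: lin_Z.
- by apply: lin_D => //; apply: lin_Z.
- by apply: lin_D; [apply: lin_Z; apply: h3 | apply: h3'].
- by apply: fil_L; [apply: h4 | apply: h4'].
Qed.
Lemma clift3_lin (B : compFilAlgType K) d (f h : A -> A' -> M -> B) c : tri d f -> tri d h ->
  forall X, clift3 (fun a a' m => c *: f a a' m + h a a' m) X = c *: clift3 f X + clift3 h X.
Proof.
move=> hf hh; have hfh := tri_lin c hf hh; apply: ctens2_ext.
- exact: clift3_bnd hfh.
- apply: bnd_D; last exact: clift3_bnd hh.
  have [fl fb] := clift3_bdd hf; exists d; split; first exact: lin_Z.
  by move=> q x qx; apply: fil_Z; apply: fb.
- by move=> a a' m; rewrite (clift3_pure hfh) (clift3_pure hf) (clift3_pure hh).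
Qed.
Lemma tri_D (B : compFilAlgType K) d (f h : A -> A' -> M -> B) : tri d f -> tri d h ->
  tri d (fun a a' m => f a a' m + h a a' m).
Proof.
move=> [h1 h2 h3 h4] [h1' h2' h3' h4']; split=> *.
- exact: lin_D.
- exact: lin_D.
- by apply: lin_D; [apply: h3 | apply: h3'].
- by apply: fil_D; [apply: h4 | apply: h4'].
Qed.
Lemma clift3_D (B : compFilAlgType K) d (f h : A -> A' -> M -> B) : tri d f -> tri d h ->
  forall X, clift3 (fun a a' m => f a a' m + h a a' m) X = clift3 f X + clift3 h X.
Proof.
move=> hf hh X; have := clift3_lin 1 hf hh X; rewrite scale1r => <-.
by congr (clift3 _ X); do 3 apply/funext=> ?; rewrite scale1r.
Qed.
Lemma clift3_eq (B : compFilAlgType K) (f h : A -> A' -> M -> B) X : (forall a a' m, f a a' m = h a a' m) ->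
  clift3 f X = clift3 h X.
Proof. by move=> e; congr (clift3 _ X); do 3 apply/funext=> ?. Qed.
Lemma tri_mono (B : compFilAlgType K) d e (f : A -> A' -> M -> B) : d <= e -> tri d f -> tri e f.
Proof.
move=> de [h1 h2 h3 h4]; split=> // a a' q m /h4 h; apply: fil_mono (h a a').
by rewrite lerD2l.
Qed.

End Trilinear.

(** * The tests on $U(\mathfrak u_+)\otimes W\widehat\otimes\widehat U_{\mathfrak l}$ *)

Section Instance.
Variables (K : fieldType) (g : lieAlgType K) (P : polarized g).
Local Notation Lp := (lie_of (pu P)).
Local Notation Lm := (lie_of (pv P)).
Local Notation Ll := (lie_of (pl P)).
Local Notation U := (env g).
Local Notation ip := (@uincl K g (pu P)).
Local Notation im := (@uincl K g (pv P)).
Local Notation il := (@uincl K g (pl P)).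
Local Notation vp := (@lval K g (pu P)).
Local Notation vm := (@lval K g (pv P)).
Variables (H : U -> env Ll) (M : compFilAlgType K) (j : env Ll -> M) (W : algType K).
Hypothesis char0 : forall n, n.+1%:R != 0 :> K.
Hypothesis hH : is_HC H.
Hypothesis jh : alg_hom j.
Hypothesis jf : forall n u, ufil n u -> fil n (j u).
Hypothesis Mcomm : forall p q (u v : M), fil p u -> fil q v -> fil (p + q - 1) (u * v - v * u).
Local Notation C := (ctens W M).
Local Notation E := (ctens (tens (env Lp) W) M).
Variables (n : nat) (eb : 'I_n -> Lp) (fb : 'I_n -> Lm) (c0 : 'I_n -> 'I_n -> M).
Variable co : Lp -> 'I_n -> K.
Hypothesis coE : forall a, a = \sum_k co a k *: eb k.
Hypothesis c0f : forall k i, fil (-1) (c0 k i).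
Hypothesis c0E : forall a k, fil (-1)
  (\sum_i c0 k i * j (ugen (lproj P (lie (vm (fb i)) (vp a)))) - (co a k)%:A).
Variables (act : env Ll -> C -> C) (eps : K).
Hypothesis eps2 : eps * eps = 1.
Hypotheses (actl : forall Z, linear (act^~ Z)) (actr : forall u, linear (act u)).
Hypotheses (act1 : forall Z, act 1 Z = Z)
  (actM : forall u v Z, act (u * v) Z = act u (act v Z)).
Hypothesis actb : forall n q u Z, ufil n u -> fil q Z -> fil (q + n) (act u Z).
Hypothesis actE : forall x q Z, fil q Z ->
  fil q (act (ugen x) Z - eps *: (cpure 1 (j (ugen x)) * Z)).

(** By [tri_span] the factors of $x$ from $U(\mathfrak u_+)$ and $U(\mathfrak l)$ come out of $H$,
    and [HC_bound] handles the one from $U(\mathfrak u_-)$. The bound is again uniform in $a$. *)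
Lemma HC_bound_gen (x : U) : exists n : nat, forall a, ufil n%:Z (H (x * ip a)).
Proof.
have Hl := HC_lin hH; have [imL im1 imM] := uincl_hom (pv P).
have mono m m' u : (m <= m')%N -> @ufil K Ll m%:Z u -> ufil m'%:Z u.
  by move=> mm; apply: degle_mono; rewrite lez_nat.
move: (tri_span P x).
apply: (spanned_mono (T := fun x => exists n : nat, forall a, ufil n%:Z (H (x * ip a)))).
  split.
    by exists 0%N => a; rewrite mul0r (lin0 Hl); exact: (degle_sub _ _).1.
  move=> c u v [m hm] [m' hm']; exists (maxn m m') => a.
  rewrite mulrDl -scalerAl Hl; apply: (degle_sub _ _).2.
    by apply: (mono _ _ _ _ (hm a)); rewrite leq_maxl.
  by apply: (mono _ _ _ _ (hm' a)); rewrite leq_maxr.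
move=> u [a' [h [b ->]]]; have [m1 h1] := degle_exh h; have [m2 h2] := short_exh b.
exists (m1 + m2)%N => a; rewrite -!mulrA HC_1p // HC_l //.
apply: (sub_Z (degle_sub _ _)); rewrite PoszD; apply: degle_M => //.
move: h2; apply: (spanned_lin (f := fun b => H (im b * ip a))).
- by apply: (lin_comp Hl); apply: lin_Mr.
- exact: degle_sub.
- by move=> v [w hw ->]; exact: (mono _ _ _ hw (HC_bound hH w a)).
Qed.

Definition pr (x : U) : E -> C := clift3 (fun a w m => act (H (x * ip a)) (cpure w m)).

Lemma pr_tri x m : (forall a, ufil m%:Z (H (x * ip a))) ->
  tri m%:Z (fun a (w : W) (m : M) => act (H (x * ip a)) (cpure w m)).
Proof.
move=> hm; have Hl := HC_lin hH; have [ipL _ _] := uincl_hom (pu P); split.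
- by move=> a m'; apply: (lin_comp (actr _)); exact: lin_cpurel.
- move=> w m'; apply: (lin_comp (actl _)); apply: (lin_comp Hl).
  exact: lin_Ml.
- by move=> a w; apply: (lin_comp (actr _)); exact: lin_cpurer.
- by move=> a w q m' qm; apply: actb; [exact: hm | exact: cpure_fil].
Qed.
Lemma pr_triE x : exists m : nat, tri m%:Z (fun a (w : W) (m : M) => act (H (x * ip a)) (cpure w m)).
Proof. by have [m hm] := HC_bound_gen x; exists m; exact: pr_tri. Qed.
Lemma pr_bnd x : bnd (pr x).
Proof. by have [m hm] := pr_triE x; exact: clift3_bnd hm. Qed.
Lemma pr_pure x a w m : pr x (cpure (tpure a w) m) = act (H (x * ip a)) (cpure w m).
Proof. by have [m' hm] := pr_triE x; exact: (clift3_pure hm). Qed.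

Definition in1 (a : env Lp) : E := cpure (tpure a (1 : W)) (1 : M).
Definition in2 : C -> E := cmapl (fun w => tpure (1 : env Lp) w).

Lemma in1_hom : alg_hom in1.
Proof. exact: (alg_hom_comp (cpurel_hom M _) (tpurel_hom (env Lp) W)). Qed.
Lemma in2_hom : alg_hom in2.
Proof. exact: (cmapl_hom M (tpurer_hom (env Lp) W)). Qed.
Lemma in2_bdd : bdd 0 in2.
Proof. exact: (cmapl_bdd M (@lin_tpurer _ (env Lp) W 1)). Qed.
Lemma in2_pure w m : in2 (cpure w m) = cpure (tpure 1 w) m.
Proof. exact: (cmapl_pure _ _ (@lin_tpurer _ (env Lp) W 1)). Qed.
Lemma in1_fil a : fil 0 (in1 a). Proof. by apply: cpure_fil; exact: fil_1. Qed.
Lemma in12_pure a w m : in1 a * in2 (cpure w m) = cpure (tpure a w) m.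
Proof. by rewrite in2_pure /in1 cpureM tpureM mulr1 !mul1r. Qed.
Lemma in12 a Z : in1 a * in2 Z = in2 Z * in1 a.
Proof.
move: Z; apply: ctens_ext.
- by apply: bnd_Ml; exact: (bdd_bnd in2_bdd).
- by apply: bnd_Mr; exact: (bdd_bnd in2_bdd).
- by move=> w m; rewrite in12_pure in2_pure /in1 cpureM tpureM !mulr1 mul1r.
Qed.
Lemma pr_in12 x a Z : pr x (in1 a * in2 Z) = act (H (x * ip a)) Z.
Proof.
move: Z; apply: ctens_ext.
- apply: (bnd_comp (pr_bnd x)); apply: bnd_Ml; exact: (bdd_bnd in2_bdd).
- have [m hm] := HC_bound_gen x; exists m%:Z; split; first exact: actr.
  by move=> q Z qZ; exact: actb.
- by move=> w m; rewrite in12_pure pr_pure.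
Qed.

Lemma cpure_comm_gr p q (m : M) (Z : C) : fil p m -> fil q Z ->
  fil (p + q - 1) (cpure 1 m * Z - Z * cpure 1 m).
Proof.
move=> hm hZ; have [s [hs hr]] := ctens_approx (q - 1) hZ.
rewrite -[Z](subrK (\sum_(p <- s) cpure p.1 p.2)).
set R := Z - _ in hr *; set S1 := \sum_(p <- s) _.
have -> (A : algType K) (a r b : A) : a * (r + b) - (r + b) * a = (a * r - r * a) + (a * b - b * a).
  by rewrite mulrDr mulrDl; zmod_tac.
apply: fil_D.
  apply: fil_B; first by rewrite -addrA; apply: fil_M => //; exact: cpure_fil.
  by rewrite -addrA addrC; apply: fil_M => //; exact: cpure_fil.
rewrite /S1 mulr_sumr mulr_suml -sumrB big_seq; elim/big_ind: _ => [||r rs].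
- exact: fil_0.
- exact: fil_D.
- rewrite !cpureM mul1r mulr1 -(linB (@lin_cpurer _ M _ _)); apply: cpure_fil.
  by apply: Mcomm => //; exact: hs.
Qed.

(** Up to lower degree a letter of $\mathfrak l$ acts as $\varepsilon=\pm1$ times left
    multiplication, so $\varepsilon c_0$ inverts the pairing for this action. The sign covers both
    left multiplication and right multiplication by an antipode. *)
Theorem nd X : (forall b, pr (im b) X = 0) -> X = 0.
Proof.
move=> hX; have [jl j1 jM] := jh.
apply: (@nondegenerate K g P H E C in1 in2 act pr char0 hH in1_hom in1_fil in2_hom in2_bdd
  in12 actl act1 actM actb _ _ _ _ n eb fb (fun k i => cpure 1 (eps *: c0 k i)) co coE).
- by move=> x; exact: bnd_lin (pr_bnd x).
- exact: pr_in12.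
- move=> w q Y qY; have hm := pr_tri (HC_bound hH w).
  exact (proj2 (clift3_bdd hm) q Y qY).
- move=> q Y qY; have [s [hs hr]] := ctens_approx (q - 1) qY.
  suff [s' [hs' e]] : exists s' : seq (env Lp * C), (forall p, p \in s' -> fil q p.2) /\
     \sum_(p <- s) cpure p.1 p.2 = \sum_(p <- s') in1 p.1 * in2 p.2.
    by exists s'; split=> //; rewrite -e.
  elim: s hs {hr} => [|p s IH] hs; first by exists [::]; rewrite !big_nil.
  have [|s1 [hs1 e1]] := IH; first by move=> r rs; apply: hs; rewrite inE rs orbT.
  have [s2 e2] := tensE p.1.
  exists ([seq (r.1, cpure r.2 p.2) | r <- s2] ++ s1); split.
    move=> r; rewrite mem_cat => /orP[/mapP[u us2 ->]|/hs1 //].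
    by apply: cpure_fil; apply: hs; rewrite inE eqxx.
  rewrite big_cons big_cat e1 big_map; congr (_ + _).
  rewrite {1}e2 (lin_sum (@lin_cpurel _ M _ _)); apply: eq_bigr => r _.
  by rewrite in12_pure.
- by move=> k i; apply: cpure_fil; exact: fil_Z.
- move=> a k q Z hZ.
  pose xi i := ugen (lproj P (lie (vm (fb i)) (vp a))).
  have key (A : algType K) (u v w z : A) :
    (eps *: u) * w = (eps *: u) * (w - eps *: (v * z)) + u * v * z.
    by rewrite mulrBr -[X in _ - X]scalerAl -scalerAr scalerA eps2 scale1r mulrA subrK.
  (* Replacing the action by its leading part leaves an error of degree $q$, which the factor [c0]
     of degree $-1$ lowers to $q-1$; the two signs multiply to 1. *)
  have -> : \sum_i cpure 1 (eps *: c0 k i) * act (xi i) Z - co a k *: Z =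
    \sum_i cpure 1 (eps *: c0 k i) * (act (xi i) Z - eps *: (cpure 1 (j (xi i)) * Z)) +
    cpure 1 (\sum_i c0 k i * j (xi i) - (co a k)%:A) * Z.
    rewrite (linB (@lin_cpurer _ M _ _)) (lin_sum (@lin_cpurer _ M _ _)).
    rewrite (linZ (@lin_cpurer _ M _ _)) cpure1 mulrBl mulr_algl addrA; congr (_ - _).
    rewrite mulr_suml -big_split; apply: eq_bigr => i _ /=.
    rewrite -[cpure 1 (c0 k i * _)](_ : cpure 1 (c0 k i) * cpure 1 (j (xi i)) = _).
      by rewrite (linZ (@lin_cpurer _ M _ _)); exact: key.
    by rewrite cpureM mulr1.
  apply: fil_D.
    elim/big_ind: _ => [||i _]; [exact: fil_0 | exact: fil_D |].
    rewrite addrC; apply: fil_M; last exact: actE.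
    by apply: cpure_fil; exact: fil_Z.
  rewrite addrC; apply: fil_M => //; apply: cpure_fil; exact: c0E.
- by move=> w; exact: hX.
Qed.

End Instance.

(** * Left and right nondegeneracy in the microlocalization *)

Section Duality.
Variables (K : fieldType) (g : lieAlgType K) (P : polarized g).
Local Notation Lp := (lie_of (pu P)).
Local Notation Lm := (lie_of (pv P)).
Local Notation Ll := (lie_of (pl P)).
Local Notation U := (env g).
Local Notation ip := (@uincl K g (pu P)).
Local Notation im := (@uincl K g (pv P)).
Local Notation il := (@uincl K g (pl P)).
Local Notation vp := (@lval K g (pu P)).
Local Notation vm := (@lval K g (pv P)).
Local Notation vl := (@lval K g (pl P)).
Variables (d : nat) (x y : d.-tuple g).
Variables (M : compFilAlgType K) (j : env Ll -> M).
Variables (S : comAlgType K) (i : Ll -> S) (sigma : int -> M -> S).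
Hypothesis char0 : forall n, n.+1%:R != 0 :> K.
Hypothesis jh : alg_hom j.
Hypothesis jf : forall n u, ufil n u -> fil n (j u).
Hypotheses (bx : basis_of (pu P) x) (byy : basis_of (pv P) y).
Hypotheses (hS : is_loc_sym x y i) (hsig : is_symbol x y j i sigma).
Variable H : U -> env Ll.
Hypothesis hH : is_HC H.

Lemma lin_lproj : linear (lproj P).
Proof. by move=> a u v; rewrite /lproj !linearP. Qed.

Lemma basis_lie (h : lieSub g) (z : d.-tuple g) (hz : basis_of h z) (a : lie_of h) :
  a = \sum_k coord z k (lval a) *: (vsproj h (tnth z k) : lie_of h).
Proof.
apply: (@lval_inj _ _ h); rewrite (lin_sum (@lvalL _ _ h)).
rewrite {1}(coord_basis hz (lval_in a)); apply: eq_bigr => k _.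
rewrite (linZ (@lvalL _ _ h)) (tnth_nth 0) /lval vsprojK //.
by apply: (basis_mem hz); apply: mem_nth; rewrite size_tuple.
Qed.
Lemma lval_basis (h : lieSub g) (z : d.-tuple g) (hz : basis_of h z) k :
  lval (vsproj h (tnth z k) : lie_of h) = tnth z k.
Proof. by rewrite /lval vsprojK //; apply: (basis_mem hz); exact: mem_tnth. Qed.

Section ND.
Variables (W : algType K).
Local Notation C := (ctens W M).
Variables (act : env Ll -> C -> C) (eps : K).
Hypothesis eps2 : eps * eps = 1.
Hypotheses (actl : forall Z, linear (act^~ Z)) (actr : forall u, linear (act u)).
Hypotheses (act1 : forall Z, act 1 Z = Z)
  (actM : forall u v Z, act (u * v) Z = act u (act v Z)).
Hypothesis actb : forall n q u Z, ufil n u -> fil q Z -> fil (q + n) (act u Z).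
Hypothesis actE : forall x q Z, fil q Z ->
  fil q (act (ugen x) Z - eps *: (cpure 1 (j (ugen x)) * Z)).

Let dual_sum (B c : 'I_d -> M) (co : 'I_d -> K) (A : 'I_d -> 'I_d -> Ll) (e : K) (X : 'I_d -> Ll) k :
  (forall l, fil (-1) (\sum_r B r * j (ugen (A l r)) - (l == k)%:R)) ->
  (forall r, c r = e *: B r) -> e * e = 1 -> (forall r, X r = e *: \sum_l co l *: A l r) ->
  fil (-1) (\sum_r c r * j (ugen (X r)) - (co k)%:A).
Proof.
have [jl j1 jM] := jh; have gl := lin_comp jl (@lin_ugen _ Ll).
move=> hB hc e1 hX.
have -> : \sum_r c r * j (ugen (X r)) - (co k)%:A =
   \sum_l co l *: (\sum_r B r * j (ugen (A l r)) - (l == k)%:R).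
  have -> : (co k)%:A = \sum_l co l *: (l == k)%:R :> M.
    rewrite (bigD1 k) //= eqxx big1 ?addr0 // => l /negbTE ->; by rewrite scaler0.
  under [RHS]eq_bigr do rewrite scalerBr; rewrite sumrB; congr (_ - _).
  transitivity (\sum_r \sum_l co l *: (B r * j (ugen (A l r)))).
    apply: eq_bigr => r _; rewrite hc hX (linZ gl) (lin_sum gl).
    rewrite -scalerAl -scalerAr scalerA e1 scale1r mulr_sumr; apply: eq_bigr => l _.
    by rewrite (linZ gl) -scalerAr.
  by rewrite exchange_big; apply: eq_bigr => l _; rewrite scaler_sumr.
elim/big_ind: _ => [||l _]; [exact: fil_0 | exact: fil_D |].
exact: fil_Z.
Qed.

(** The tests see $[f,e]$ while [pairing] is built on $[e,f]$; hence the sign and the exchanged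
    indices in the matrix passed to [nd]. *)
Lemma nd_left (X : ctens (tens (env Lp) W) M) :
  (forall b, pr H act (im b) X = 0) -> X = 0.
Proof.
have [B [Bf B1 B2]] := dual_family jf hS hsig.
apply: (@nd K g P H M j W char0 hH jh d
  (fun k => vsproj (pu P) (tnth x k)) (fun k => vsproj (pv P) (tnth y k))
  (fun k l => - B l k) (fun a k => coord x k (lval a)) _ _ _ act eps) => //.
- exact: basis_lie bx.
- by move=> k l; exact: fil_N.
- move=> a k; apply: (@dual_sum (B^~ k) _ (fun l => coord x l (lval a)) (pairing P x y) (-1)).
  + by move=> l; exact: B1.
  + by move=> r; rewrite scaleN1r.
  + by rewrite mulrNN mulr1.
  + move=> r; rewrite (lval_basis byy) {1}(coord_basis bx (lval_in a)).
    rewrite (lin_sum (lin_lier _)) (lin_sum lin_lproj) scaleN1r -sumrN.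
    apply: eq_bigr => l _; rewrite (linZ (lin_lier _)) (linZ lin_lproj) lie_anti.
    by rewrite (linN lin_lproj) scalerN /pairing !(tnth_nth 0).
Qed.

(** The same for the swapped polarization, where the bracket comes in the order of [pairing] and the
    other inverse relation of [dual_family] serves. *)
Lemma nd_right (X : ctens (tens (env Lm) W) M) :
  (forall a, pr (P := swap P) (fun u => uant (H (uant u))) act (ip a) X = 0) -> X = 0.
Proof.
have [B [Bf B1 B2]] := dual_family jf hS hsig.
apply: (@nd K g (swap P) _ M j W char0 (HC_swap hH) jh d
  (fun k => vsproj (pv P) (tnth y k)) (fun k => vsproj (pu P) (tnth x k))
  (fun k l => B k l) (fun a k => coord y k (lval a)) _ _ _ act eps) => //.
- exact: basis_lie byy.
- move=> a k; apply: (@dual_sum (B k) _ (fun l => coord y l (lval a))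
    (fun l r => pairing P x y r l) 1).
  + by move=> l; exact: B2.
  + by move=> r; rewrite scale1r.
  + by rewrite mulr1.
  + move=> r; rewrite (lval_basis bx) {1}(coord_basis byy (lval_in a)).
    rewrite (lin_sum (lin_lier _)) lproj_swap (lin_sum lin_lproj) scale1r.
    apply: eq_bigr => l _; rewrite (linZ (lin_lier _)) (linZ lin_lproj).
    by rewrite /pairing !(tnth_nth 0).
Qed.
End ND.

Section LeftAct.
Variable W : algType K.
Definition act_l (u : env Ll) (Z : ctens W M) := cpure (1 : W) (j u) * Z.
Lemma act_l_l Z : linear (act_l^~ Z).
Proof.
have [jl j1 jM] := jh.
by apply: lin_Mr; apply: (lin_comp (@lin_cpurer _ M W 1)).
Qed.
Lemma act_l_r u : linear (act_l u). Proof. exact: lin_Ml. Qed.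
Lemma act_l_b n q u Z : ufil n u -> fil q Z -> fil (q + n) (act_l u Z).
Proof.
move=> hu hZ; rewrite addrC; apply: fil_M => //.
by apply: cpure_fil; exact: jf.
Qed.
Lemma nd_l (X : ctens (tens (env Lp) W) M) :
  (forall b, pr H act_l (im b) X = 0) -> X = 0.
Proof.
have [jl j1 jM] := jh.
apply: (@nd_left W act_l 1); rewrite ?mulr1 //.
- exact: act_l_l.
- exact: act_l_r.
- by move=> Z; rewrite /act_l j1 cpure1 mul1r.
- by move=> u v Z; rewrite /act_l jM mulrA cpureM mulr1.
- exact: act_l_b.
- by move=> u q Z hZ; rewrite scale1r subrr; exact: fil_0.
Qed.
Lemma prl_bnd u : bnd (pr H act_l u).
Proof. exact: (pr_bnd hH act_l_l act_l_r act_l_b). Qed.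
Lemma prl_pure u a w m : pr H act_l u (cpure (tpure a w) m) = cpure w (j (H (u * ip a)) * m).
Proof.
by rewrite (pr_pure hH act_l_l act_l_r act_l_b) /act_l cpureM mul1r.
Qed.
End LeftAct.

Definition pL (u : U) : ctens (env Lp) M -> M := clift (fun a m => j (H (u * ip a)) * m).
Definition pR (u : U) : ctens (env Lm) M -> M := clift (fun b m => m * j (H (im b * u))).

Let Hl : linear H. Proof. exact: (HC_lin hH). Qed.
Let jl : linear j. Proof. by case: jh. Qed.
Let j1 : j 1 = 1. Proof. by case: jh. Qed.
Let jM u v : j (u * v) = j u * j v. Proof. by case: jh. Qed.
Let ipl : linear ip. Proof. by case: (uincl_hom (pu P)). Qed.
Let iml : linear im. Proof. by case: (uincl_hom (pv P)). Qed.
Let lHl u : linear (fun a => j (H (u * ip a))).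
Proof. by apply: (lin_comp jl); apply: (lin_comp Hl); apply: lin_Ml. Qed.
Let lHr u : linear (fun b => j (H (im b * u))).
Proof. by apply: (lin_comp jl); apply: (lin_comp Hl); apply: lin_Mr. Qed.

Lemma uant_degle (L : lieAlgType K) n (u : env L) : ufil n u -> ufil n (uant u).
Proof.
have [al a1 aM] := uant_antihom L.
move=> [s [hs ->]]; rewrite (lin_sum al) big_seq.
elim/big_ind: _ => [||p ps]; [exact: (degle_sub _ _).1 | exact: (sub_D (degle_sub _ _)) |].
rewrite (linZ al); apply: (sub_Z (degle_sub _ _)).
apply: (@degle_mono _ _ _ _ (size p.2)%:Z); first exact: (allP hs).
elim: (p.2) => [|v w IH]; first by rewrite big_nil a1; exact: degle_1.
rewrite big_cons aM uant_gen /= -addn1 PoszD; apply: degle_M => //.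
by apply: (sub_N (degle_sub _ _)); exact: degle_gen.
Qed.

Lemma HC_boundl u : exists n : nat, forall a, fil n%:Z (j (H (u * ip a))).
Proof. by have [n hn] := HC_bound_gen hH u; exists n => a; apply: jf. Qed.
Lemma HC_boundr u : exists n : nat, forall b, fil n%:Z (j (H (im b * u))).
Proof.
have [n hn] := HC_bound_gen (HC_swap hH) (uant u); exists n => b; apply: jf.
have [_ _ aM] := uant_antihom g.
have := uant_degle (hn (uant b)); rewrite uantK aM uantK.
by rewrite -(@uant_uincl _ _ (pv P)) uantK.
Qed.

Lemma pL_bbd u : exists n : nat, bbd n%:Z (fun a m => j (H (u * ip a)) * m).
Proof.
have [n hn] := HC_boundl u; exists n; split; first exact: (bilin_mul (lHl u) (@lin_id _ M)).
by move=> a q m qm; rewrite addrC; apply: fil_M.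
Qed.
Lemma pR_bbd u : exists n : nat, bbd n%:Z (fun b m => m * j (H (im b * u))).
Proof.
have [n hn] := HC_boundr u; exists n; split; first exact: (bilin_mul_op (lHr u) (@lin_id _ M)).
by move=> a q m qm; apply: fil_M.
Qed.
Lemma pL_bnd u : bnd (pL u). Proof. by have [n h] := pL_bbd u; exact: clift_bnd h. Qed.
Lemma pR_bnd u : bnd (pR u). Proof. by have [n h] := pR_bbd u; exact: clift_bnd h. Qed.
Lemma pL_pure u a m : pL u (cpure a m) = j (H (u * ip a)) * m.
Proof. by have [n h] := pL_bbd u; exact: (clift_pure h). Qed.
Lemma pR_pure u b m : pR u (cpure b m) = m * j (H (im b * u)).
Proof. by have [n h] := pR_bbd u; exact: (clift_pure h). Qed.

(** The nondegeneracy statements carry an auxiliary algebra $W$. Here $W$ is the ground field, and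
    [e1], [r1] identify $V$ with $V\otimes K$. *)
Let Ko : algType K := K^o.
Let e1 (V : algType K) (a : V) : tens V Ko := tpure a (1 : Ko).
Let e1l (V : algType K) : linear (@e1 V). Proof. exact: lin_tpurel. Qed.
Let r1 (V : algType K) (z : tens V Ko) : V := tlift (fun a (c : Ko) => (c : K) *: a) z.
Let r1b (V : algType K) : bilin (fun (a : V) (c : Ko) => (c : K) *: a).
Proof.
split=> u; last by apply: lin_Z.
by move=> a c c'; rewrite scalerDl scalerA.
Qed.
Let r1l (V : algType K) : linear (@r1 V). Proof. exact: (tlift_linear (@r1b V)). Qed.
Let r1P (V : algType K) (a : V) : r1 (e1 a) = a.
Proof. by apply: etrans (tlift_pure _ _ (@r1b V)) _; exact: scale1r. Qed.
Let re1 (V : algType K) (Y : ctens V M) : cmapl (@r1 V) (cmapl (@e1 V) Y) = Y.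
Proof.
move: Y; apply: ctens_ext.
- exact: (bnd_comp (cmapl_bnd M (@r1l V)) (cmapl_bnd M (@e1l V))).
- exact: bnd_id.
- move=> a m; rewrite (cmapl_pure _ _ (@e1l V)) (cmapl_pure _ _ (@r1l V)).
  by congr (cpure _ m); exact: r1P.
Qed.

Lemma ndL (X : ctens (env Lp) M) : (forall b, pL (im b) X = 0) -> X = 0.
Proof.
move=> hX; suff h : cmapl (@e1 _) X = 0.
  by rewrite -[X]re1 h (lin0 (bnd_lin (cmapl_bnd M (@r1l _)))).
apply: nd_l => b.
have -> : pr H (@act_l _) (im b) (cmapl (@e1 _) X) = cpure 1 (pL (im b) X).
  move: (X); apply: ctens_ext.
  - exact: (bnd_comp (prl_bnd _ _) (cmapl_bnd M (@e1l _))).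
  - exact: (bnd_comp (bdd_bnd (bdd_cpurer M _)) (pL_bnd _)).
  - by move=> a m; rewrite cmapl_pure // prl_pure pL_pure.
by rewrite hX (lin0 (@lin_cpurer _ M _ _)).
Qed.

Let act_r (u : env Ll) (Z : ctens Ko M) := Z * cpure (1 : Ko) (j (uant u)).
Let act_r_l Z : linear (act_r^~ Z).
Proof.
have [al _ _] := uant_antihom Ll.
apply: lin_Ml; apply: (lin_comp (@lin_cpurer _ M Ko 1)).
exact: (lin_comp jl al).
Qed.
Let act_r_r u : linear (act_r u). Proof. exact: lin_Mr. Qed.
Let act_r_b n q u Z : ufil n u -> fil q Z -> fil (q + n) (act_r u Z).
Proof.
move=> hu hZ; apply: fil_M => //; apply: cpure_fil; apply: jf; exact: uant_degle.
Qed.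

(** The antipode carries this to [nd_right] with $\mathfrak l$ acting by right multiplication by
    $S(z)=-z$. As the graded algebra is commutative, the leading part is minus left multiplication,
    so the sign is $-1$. *)
Lemma ndR (X : ctens (env Lm) M) : (forall a, pR (ip a) X = 0) -> X = 0.
Proof.
have [al a1 aM] := uant_antihom Ll; have [gl g1 gM] := uant_antihom g.
have [ml _ _] := uant_antihom Lm.
have ul : linear (fun b : env Lm => @e1 _ (uant b)) by exact: (lin_comp (@e1l _) ml).
move=> hX; suff h : cmapl (fun b => @e1 _ (uant b)) X = 0.
  have -> : X = cmapl (@uant _ _) (cmapl (@r1 _) (cmapl (fun b => @e1 _ (uant b)) X)).
    move: (X); apply: ctens_ext.
    - exact: bnd_id.
    - exact: (bnd_comp (cmapl_bnd M ml) (bnd_comp (cmapl_bnd M (@r1l _)) (cmapl_bnd M ul))).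
    - move=> b m; rewrite (cmapl_pure _ _ ul) (cmapl_pure _ _ (@r1l _)) (cmapl_pure _ _ ml).
      by congr (cpure _ m); rewrite -[LHS](@uantK _ Lm); congr uant; apply/esym; exact: r1P.
  rewrite h (lin0 (bnd_lin (cmapl_bnd M (@r1l _)))).
  by rewrite (lin0 (bnd_lin (cmapl_bnd M ml))).
have hH' := HC_swap hH.
apply: (@nd_right _ act_r (-1)) => //.
- by rewrite mulrNN mulr1.
- by move=> Z; rewrite /act_r a1 j1 cpure1 mulr1.
- by move=> u v Z; rewrite /act_r aM jM -mulrA cpureM mulr1.
- move=> u q Z hZ; rewrite /act_r uant_gen (linN jl) (linN (@lin_cpurer _ M _ _)).
  rewrite mulrN scaleN1r opprK addrC.
  have -> : q = 1 + q - 1 by rewrite addrC addrA addNr add0r.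
  apply: (@cpure_comm_gr _ M) => //; first by move=> *; exact: (gr_comm hsig).
  by apply: jf; exact: degle_gen.
- move=> a.
  have -> : pr (P := swap P) (fun u => uant (H (uant u))) act_r (ip a)
     (cmapl (fun b => @e1 _ (uant b)) X) = cpure 1 (pR (ip (uant a)) X).
    move: (X); apply: ctens_ext.
    - exact: (bnd_comp (pr_bnd hH' act_r_l act_r_r act_r_b _) (cmapl_bnd M ul)).
    - exact: (bnd_comp (bdd_bnd (bdd_cpurer M _)) (pR_bnd _)).
    - move=> b m; rewrite cmapl_pure // (pr_pure hH' act_r_l act_r_r act_r_b) pR_pure.
      rewrite /act_r cpureM mulr1 uantK gM /=.
      by rewrite (@uant_uincl _ _ (pv P)) uantK (@uant_uincl _ _ (pu P)).
  by rewrite hX (lin0 (@lin_cpurer _ M _ _)).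
Qed.

End Duality.

Lemma uincl_sub (K : fieldType) (g : lieAlgType K) (h h' : lieSub g) :
  (lsv h <= lsv h')%VS -> forall u : env (lie_of h), exists u', @uincl K g h' u' = @uincl K g h u.
Proof.
move=> hh; have [l1 l11 l1M] := uincl_hom h; have [l2 l21 l2M] := uincl_hom h'.
apply: env_ind_l => [||x u [u' hu]].
- split; first by exists 0; rewrite (lin0 l1) (lin0 l2).
  by move=> a u v [u' hu] [v' hv]; exists (a *: u' + v'); rewrite l1 l2 hu hv.
- by exists 1; rewrite l11 l21.
- have [x' hx] := lval_ex (subvP hh _ (lval_in x)).
  by exists (ugen x' * u'); rewrite l1M l2M !uincl_gen hu hx.
Qed.

(** * The canonical element K, its contractions and its invariance *)

Section Canonical.
Variables (K : fieldType) (g : lieAlgType K) (P : polarized g).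
Local Notation Lp := (lie_of (pu P)).
Local Notation Lm := (lie_of (pv P)).
Local Notation Ll := (lie_of (pl P)).
Local Notation U := (env g).
Local Notation ip := (@uincl K g (pu P)).
Local Notation im := (@uincl K g (pv P)).
Local Notation il := (@uincl K g (pl P)).
Local Notation vp := (@lval K g (pu P)).
Local Notation vm := (@lval K g (pv P)).
Local Notation vl := (@lval K g (pl P)).
Variables (d : nat) (x y : d.-tuple g).
Variables (M : compFilAlgType K) (j : env Ll -> M).
Variables (S : comAlgType K) (i : Ll -> S) (sigma : int -> M -> S).
Hypothesis char0 : forall n, n.+1%:R != 0 :> K.
Hypothesis jh : alg_hom j.
Hypothesis jf : forall n u, ufil n u -> fil n (j u).
Hypotheses (bx : basis_of (pu P) x) (byy : basis_of (pv P) y).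
Hypotheses (hS : is_loc_sym x y i) (hsig : is_symbol x y j i sigma).
Variable H : U -> env Ll.
Hypothesis hH : is_HC H.
Variable k : ctens (tens (env Lp) (env Lm)) M.
Hypothesis hk : is_K j H k.

Let Hl : linear H. Proof. exact: (HC_lin hH). Qed.
Let jl : linear j. Proof. by case: jh. Qed.
Let j1 : j 1 = 1. Proof. by case: jh. Qed.
Let jM u v : j (u * v) = j u * j v. Proof. by case: jh. Qed.
Let ipl : linear ip. Proof. by case: (uincl_hom (pu P)). Qed.
Let iml : linear im. Proof. by case: (uincl_hom (pv P)). Qed.
Let lHl u : linear (fun a => j (H (u * ip a))).
Proof. by apply: (lin_comp jl); apply: (lin_comp Hl); apply: lin_Ml. Qed.
Let lHr u : linear (fun b => j (H (im b * u))).
Proof. by apply: (lin_comp jl); apply: (lin_comp Hl); apply: lin_Mr. Qed.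

(** With $K=\sum a\otimes b\otimes\ell$, [rho] and [kap] are the two partial contractions, $\sum
    b\otimes H(ua)\ell$ and $\sum a\otimes\ell H(bu)$. Their computation makes $K$ explicit although
    it is given only by its tests. *)
Definition rho (u : U) : ctens (env Lm) M :=
  clift3 (fun a b m => cpure b (j (H (u * ip a)) * m)) k.
Definition kap (u : U) : ctens (env Lp) M :=
  clift3 (fun a b m => cpure a (m * j (H (im b * u)))) k.

Lemma rho_tri u : exists n : nat,
  tri n%:Z (fun a b (m : M) => cpure (b : env Lm) (j (H (u * ip a)) * m)).
Proof.
have [n hn] := HC_boundl jf hH u; exists n; split.
- by move=> a m; exact: lin_cpurel.
- by move=> b m; apply: (lin_comp (@lin_cpurer _ M _ _)); apply: lin_Mr.
- by move=> a b; apply: (lin_comp (@lin_cpurer _ M _ _)); apply: lin_Ml.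
- by move=> a b q m qm; apply: cpure_fil; rewrite addrC; apply: fil_M.
Qed.
Lemma kap_tri u : exists n : nat,
  tri n%:Z (fun a b (m : M) => cpure (a : env Lp) (m * j (H (im b * u)))).
Proof.
have [n hn] := HC_boundr jf hH u; exists n; split.
- by move=> a m; apply: (lin_comp (@lin_cpurer _ M _ _)); apply: lin_Ml.
- by move=> b m; exact: lin_cpurel.
- by move=> a b; apply: (lin_comp (@lin_cpurer _ M _ _)); apply: lin_Mr.
- by move=> a b q m qm; apply: cpure_fil; apply: fil_M.
Qed.

Lemma pL_kap u v : pL j H u (kap v) =
  clift3 (fun a b m => j (H (u * ip a)) * (m * j (H (im b * v)))) k.
Proof.
have [n hn] := kap_tri v; have [n' hn'] := pL_bbd jh jf hH u.
rewrite /kap /pL (clift3_comp (clift_bdd hn') hn); apply: clift3_eq => a b m.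
exact: (pL_pure jh jf hH).
Qed.
Lemma pR_rho u v : pR j H v (rho u) =
  clift3 (fun a b m => j (H (u * ip a)) * m * j (H (im b * v))) k.
Proof.
have [n hn] := rho_tri u; have [n' hn'] := pR_bbd jh jf hH v.
rewrite /rho /pR (clift3_comp (clift_bdd hn') hn); apply: clift3_eq => a b m.
exact: (pR_pure jh jf hH).
Qed.

Lemma pR_rho_basic b a : pR j H (ip a) (rho (im b)) = j (H (im b * ip a)).
Proof.
have [b' eb] : exists b', @uincl K g (plv P) b' = im b.
  by apply: uincl_sub; exact: addvSr.
have [a' ea] : exists a', @uincl K g (plu P) a' = ip a.
  by apply: uincl_sub; exact: addvSr.
have [n hn] := rho_tri (im b); have [n' hn'] := pR_bbd jh jf hH (ip a).
have ht := tri_comp (clift_bdd hn') hn.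
rewrite pR_rho /clift3; apply: (clift_eq (tri_bbd _)).
  move: ht; congr (tri _ _); do 3 apply/funext=> ?.
  exact: (pR_pure jh jf hH).
by rewrite -eb -ea; exact: hk.
Qed.

(** The defining property of $K$ gives both sides the same pairings with $U(\mathfrak u_+)$, and
    [ndR] concludes. *)
Lemma rho_m b : rho (im b) = cpure b 1.
Proof.
apply/eqP; rewrite -subr_eq0; apply/eqP.
apply: (ndR char0 jh jf bx byy hS hsig hH) => a.
rewrite (linB (bnd_lin (pR_bnd jh jf hH _))) pR_rho_basic (pR_pure jh jf hH) mul1r.
by rewrite subrr.
Qed.
Lemma rho_lin : linear rho.
Proof.
move=> c u v.
have [n1 h1] := rho_tri u; have [n2 h2] := rho_tri v.
pose n := maxn n1 n2.
have {}h1 := tri_mono (_ : n1%:Z <= n%:Z) h1; have {}h2 := tri_mono (_ : n2%:Z <= n%:Z) h2.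
rewrite /rho -(clift3_lin c (h1 _) (h2 _)) ?lez_nat ?leq_maxl ?leq_maxr //.
apply: clift3_eq => a b m; rewrite -(linZ (@lin_cpurer _ M _ _)) -(linD (@lin_cpurer _ M _ _)).
by rewrite mulrDl -scalerAl Hl jl mulrDl -scalerAl.
Qed.
Lemma rho_l u (h : env Ll) : rho (il h * u) = cpure 1 (j h) * rho u.
Proof.
have [n hn] := rho_tri u; have [e he] := fil_exh (j h).
have hb : bdd e (fun Z : ctens (env Lm) M => cpure 1 (j h) * Z).
  split; first by apply: lin_Ml; exact: lin_id.
  by move=> q Z hZ; rewrite addrC; apply: fil_M => //; exact: cpure_fil.
rewrite /rho (clift3_comp hb hn); apply: clift3_eq => a b m.
by rewrite -mulrA HC_l // jM cpureM mul1r mulrA.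
Qed.
Lemma clift3_0 (A A' : algType K) (B : compFilAlgType K) X :
  clift3 (fun (_ : A) (_ : A') (_ : M) => 0 : B) X = 0.
Proof.
have h : tri 0 (fun (_ : A) (_ : A') (_ : M) => 0 : B).
  by split=> *; [exact: lin_cst0|exact: lin_cst0|exact: lin_cst0|exact: fil_0].
move: X; apply: ctens2_ext; first exact: clift3_bnd h.
  by exists 0; split; [exact: lin_cst0 | move=> *; exact: fil_0].
by move=> a a' m; rewrite (clift3_pure h).
Qed.

Lemma rho_p u (e : Lp) : rho (ugen (vp e) * u) = 0.
Proof.
rewrite /rho -[RHS](clift3_0 (A := env Lp) (A' := env Lm) _ k); apply: clift3_eq => a b m.
by rewrite -mulrA HC_p // (lin0 jl) mul0r (lin0 (@lin_cpurer _ M _ _)).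
Qed.
Lemma kap_lin : linear kap.
Proof.
move=> c u v.
have [n1 h1] := kap_tri u; have [n2 h2] := kap_tri v.
pose n := maxn n1 n2.
have {}h1 := tri_mono (_ : n1%:Z <= n%:Z) h1; have {}h2 := tri_mono (_ : n2%:Z <= n%:Z) h2.
rewrite /kap -(clift3_lin c (h1 _) (h2 _)) ?lez_nat ?leq_maxl ?leq_maxr //.
apply: clift3_eq => a b m; rewrite -(linZ (@lin_cpurer _ M _ _)) -(linD (@lin_cpurer _ M _ _)).
by rewrite mulrDr -scalerAr Hl jl mulrDr -scalerAr.
Qed.
Lemma kap_r u (h : env Ll) : kap (u * il h) = kap u * cpure 1 (j h).
Proof.
have [n hn] := kap_tri u; have [e he] := fil_exh (j h).
have hb : bdd e (fun Z : ctens (env Lp) M => Z * cpure 1 (j h)).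
  split; first by apply: lin_Mr; exact: lin_id.
  by move=> q Z hZ; apply: fil_M => //; exact: cpure_fil.
rewrite /kap (clift3_comp hb hn); apply: clift3_eq => a b m.
by rewrite mulrA HC_r // jM cpureM mulr1 mulrA.
Qed.
Lemma kap_m u (f : Lm) : kap (u * ugen (vm f)) = 0.
Proof.
rewrite /kap -[RHS](clift3_0 (A := env Lp) (A' := env Lm) _ k); apply: clift3_eq => a b m.
by rewrite mulrA HC_m // (lin0 jl) mulr0 (lin0 (@lin_cpurer _ M _ _)).
Qed.

Lemma rho_1p a u : rho (ip a * u) = (ueps a : K) *: rho u.
Proof.
have [_ ip1 ipM] := uincl_hom (pu P); have [el _ _] := ueps_hom Lp.
move: a; apply: env_ind_l => [||e a IH].
- split; first by rewrite (lin0 ipl) mul0r (lin0 rho_lin) (lin0 el) scale0r.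
  by move=> c a b ea eb; rewrite ipl mulrDl -scalerAl rho_lin ea eb el scalerDl scalerA.
- by rewrite ip1 mul1r ueps_1 scale1r.
- by rewrite ipM uincl_gen -mulrA rho_p ueps_genl scale0r.
Qed.
Lemma kap_1m b u : kap (u * im b) = (ueps b : K) *: kap u.
Proof.
have [_ im1 imM] := uincl_hom (pv P); have [el _ _] := ueps_hom Lm.
move: b; apply: env_ind_r => [||f b IH].
- split; first by rewrite (lin0 iml) mulr0 (lin0 kap_lin) (lin0 el) scale0r.
  by move=> c a b ea eb; rewrite iml mulrDr -scalerAr kap_lin ea eb el scalerDl scalerA.
- by rewrite im1 mulr1 ueps_1 scale1r.
- by rewrite imM uincl_gen mulrA kap_m ueps_genr scale0r.
Qed.

(** So [rho] reads the factors from $U(\mathfrak l)$ and $U(\mathfrak u_-)$ off a triangular product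
    and applies the counit to the one from $U(\mathfrak u_+)$; [kap_tri_val] is the mirror image. *)
Lemma rho_tri_val a h b : rho (ip a * il h * im b) = (ueps a : K) *: cpure b (j h).
Proof. by rewrite -mulrA rho_1p rho_l rho_m cpureM mul1r mulr1. Qed.

Lemma rho_r u (f : Lm) : rho (u * ugen (vm f)) = rho u * cpure (ugen f) 1.
Proof.
have [_ im1 imM] := uincl_hom (pv P).
move: (tri_span P u).
apply: (spanned_ext (f := fun u => rho (u * ugen (vm f))) (h := fun u => rho u * _)).
- by apply: (lin_comp rho_lin); apply: lin_Mr; exact: lin_id.
- by apply: lin_Mr; exact: rho_lin.
- move=> v [a [h [b ->]]]; rewrite -(mulrA (ip a * il h)) -(@uincl_gen _ _ (pv P)) -imM.
  by rewrite !rho_tri_val -scalerAl cpureM mulr1.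
Qed.
Lemma rho_gen_l u (z : Ll) : rho (ugen (vl z) * u) = cpure 1 (j (ugen z)) * rho u.
Proof. by rewrite -(@uincl_gen _ _ (pl P)) rho_l. Qed.

(** The defining property of $K$, stated for $x\in U(\mathfrak l\oplus\mathfrak u_-)$ and $y\in
    U(\mathfrak l\oplus\mathfrak u_+)$, extends to all pairs: the double contraction may start from
    [rho], which is known on triangular products. *)
Lemma pL_kap_E u v : pL j H u (kap v) = j (H (u * v)).
Proof.
have -> : pL j H u (kap v) = pR j H v (rho u).
  by rewrite pL_kap pR_rho; apply: clift3_eq => a b m; rewrite mulrA.
move: (tri_span P u).
apply: (spanned_ext (f := fun u => pR j H v (rho u)) (h := fun u => j (H (u * v)))).
- exact: (lin_comp (bnd_lin (pR_bnd jh jf hH v)) rho_lin).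
- by apply: (lin_comp jl); apply: (lin_comp Hl); apply: lin_Mr; exact: lin_id.
- move=> w [a [h [b ->]]]; rewrite rho_tri_val (linZ (bnd_lin (pR_bnd jh jf hH v))).
  by rewrite (pR_pure jh jf hH) -!mulrA HC_1p // HC_l // (linZ jl) jM.
Qed.

Lemma kap_p a : kap (ip a) = cpure a 1.
Proof.
apply/eqP; rewrite -subr_eq0; apply/eqP.
apply: (ndL char0 jh jf bx byy hS hsig hH) => b.
rewrite (linB (bnd_lin (pL_bnd jh jf hH _))) pL_kap_E (pL_pure jh jf hH) mulr1.
by rewrite subrr.
Qed.
Lemma kap_tri_val a h b : kap (ip a * il h * im b) = (ueps b : K) *: cpure a (j h).
Proof. by rewrite kap_1m kap_r kap_p cpureM mul1r mulr1. Qed.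
Lemma kap_l (e : Lp) u : kap (ugen (vp e) * u) = cpure (ugen e) 1 * kap u.
Proof.
have [_ ip1 ipM] := uincl_hom (pu P).
move: (tri_span P u).
apply: (spanned_ext (f := fun u => kap (ugen (vp e) * u)) (h := fun u => _ * kap u)).
- by apply: (lin_comp kap_lin); apply: lin_Ml; exact: lin_id.
- by apply: lin_Ml; exact: kap_lin.
- move=> v [a [h [b ->]]]; rewrite !mulrA -(@uincl_gen _ _ (pu P)) -ipM.
  by rewrite !kap_tri_val -scalerAr cpureM mul1r.
Qed.
Lemma kap_gen_r u (z : Ll) : kap (u * ugen (vl z)) = kap u * cpure 1 (j (ugen z)).
Proof. by rewrite -(@uincl_gen _ _ (pl P)) kap_r. Qed.

(** Straightening $fa$ produces at most one letter of $\mathfrak l$. The bound does not depend on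
    $a$, as the extension of [lamf] to the completion requires. *)
Lemma kap_straight (f : Lm) a : fil 1 (kap (ugen (vm f) * ip a)).
Proof.
move: (comm_m_p f a); apply: (spanned_lin kap_lin).
  by split; [exact: fil_0 | move=> c u v; exact: fil_L].
have f0 b : fil 1 (cpure (b : env Lp) (1 : M)).
  by apply: cpure_fil; apply: (@fil_mono _ _ 0) => //; exact: fil_1.
move=> u [[b ->]|[b [z ->]]|[b [f' ->]]].
- by rewrite kap_p.
- rewrite kap_gen_r kap_p cpureM mulr1 mul1r; apply: cpure_fil; apply: jf; exact: degle_gen.
- by rewrite kap_m; exact: fil_0.
Qed.

Definition inl : ctens (env Lp) M -> ctens (tens (env Lp) (env Lm)) M :=
  cmapl (fun a => tpure a 1).
Lemma inl_bdd : bdd 0 inl. Proof. exact: (cmapl_bdd M (@lin_tpurel _ _ (env Lm) 1)). Qed.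
Lemma inl_pure a m : inl (cpure a m) = cpure (tpure a 1) m.
Proof. exact: (cmapl_pure _ _ (@lin_tpurel _ _ (env Lm) 1)). Qed.

Definition lamf (f : Lm) (a : env Lp) (b : env Lm) (m : M) : ctens (tens (env Lp) (env Lm)) M :=
  inl (kap (ugen (vm f) * ip a)) * cpure (tpure 1 b) m.
Definition mulf (c : env Lm) (a : env Lp) (b : env Lm) (m : M) :
  ctens (tens (env Lp) (env Lm)) M := cpure (tpure a (b * c)) m.

Lemma lam_tri (f : Lm) : tri 1 (lamf f).
Proof.
rewrite /lamf.
have [_ hb] := inl_bdd; split.
- move=> a m; apply: lin_Ml; apply: (lin_comp (lin_cpurel m)); exact: lin_tpurer.
- move=> b m; apply: lin_Mr; apply: (lin_comp (bdd_lin inl_bdd)).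
  by apply: (lin_comp kap_lin); apply: lin_Ml; exact: ipl.
- by move=> a b; apply: lin_Ml; exact: lin_cpurer.
- move=> a b q m qm; rewrite addrC; apply: fil_M; last exact: cpure_fil.
  by have := hb _ _ (kap_straight f a); rewrite addr0.
Qed.

Lemma clift3_id (A A' : algType K) (X : ctens (tens A A') M) :
  clift3 (fun a b m => cpure (tpure a b) m) X = X.
Proof.
have h : tri 0 (fun a b (m : M) => cpure (tpure (a : A) (b : A')) m).
  split=> *.
  - exact: (lin_comp (lin_cpurel _) (@lin_tpurer _ _ _ _)).
  - exact: (lin_comp (lin_cpurel _) (@lin_tpurel _ _ _ _)).
  - exact: lin_cpurer.
  - by rewrite addr0; exact: cpure_fil.
move: X; apply: ctens2_ext; [exact: clift3_bnd h | exact: bnd_id |].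
by move=> a b m; rewrite (clift3_pure h).
Qed.

Lemma mulr_tri (c : env Lm) : tri 0 (mulf c).
Proof.
rewrite /mulf.
split=> *.
- by apply: (lin_comp (lin_cpurel _)); apply: (lin_comp (@lin_tpurer _ _ _ _)); apply: lin_Mr.
- exact: (lin_comp (lin_cpurel _) (@lin_tpurel _ _ _ _)).
- exact: lin_cpurer.
- by rewrite addr0; exact: cpure_fil.
Qed.

(* The canonical element intertwines the two actions of [f]. *)
Lemma invariance (f : Lm) :
  clift3 (lamf f) k = clift3 (mulf (ugen f)) k.
Proof.
apply/eqP; rewrite -subr_eq0; apply/eqP.
apply: (nd_l char0 jh jf bx byy hS hsig hH) => b.
have prb : bnd (pr H (act_l j (W := env Lm)) (im b)) := prl_bnd jh jf hH _ _.
rewrite (linB (bnd_lin prb)); apply/eqP; rewrite subr_eq0; apply/eqP.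
have [e1 h1] := prb.
refine (eq_trans (clift3_comp h1 (lam_tri f) k) _).
refine (eq_trans _ (esym (clift3_comp h1 (mulr_tri (ugen f)) k))).
(* Tested against $b$, both sides are $\rho(bf)$: the left one by [pL_kap_E], the right one by
   [rho_r]. *)
transitivity (rho (im b * ugen (vm f))).
  rewrite /rho; apply: clift3_eq => a b' m.
  rewrite /lamf -mulrA -(pL_kap_E (im b)); move: (kap _); apply: ctens_ext.
  - apply: (bnd_comp prb); apply: bnd_Mr; exact: bdd_bnd inl_bdd.
  - apply: (bnd_comp (bdd_bnd (bdd_cpurer M b'))); apply: bnd_Mr.
    exact: (pL_bnd jh jf hH).
  - move=> a' m'; rewrite inl_pure cpureM tpureM mulr1 mul1r (prl_pure jh jf hH).
    by rewrite (pL_pure jh jf hH) mulrA.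
rewrite rho_r /rho; have [n hn] := rho_tri (im b).
have hb : bdd 0 (fun Z : ctens (env Lm) M => Z * cpure (ugen f) 1).
  split; first by apply: lin_Mr; exact: lin_id.
  by move=> q Z hZ; apply: fil_M => //; apply: cpure_fil; exact: fil_1.
rewrite (clift3_comp hb hn); apply: clift3_eq => a b' m.
by rewrite /mulf (prl_pure jh jf hH) cpureM mulr1.
Qed.

End Canonical.

Lemma sub_sums (V : zmodType) (I : Type) (s : seq I) (f h k : I -> V) :
  (forall i, f i - h i = k i) -> \sum_(i <- s) f i - \sum_(i <- s) h i = \sum_(i <- s) k i.
Proof. by move=> e; rewrite -sumrB; apply: eq_bigr => i _. Qed.
Lemma swap_op (K : fieldType) (A : algType K) (w e e' B c : A) : w * e = e * w + e' ->
  e * (- w * B + c) - (- w * (e * B)) = e * c + e' * B.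
Proof.
move=> h; rewrite mulrDr !mulNr opprK (mulrA w) h mulrDl mulrN mulrA; zmod_tac.
Qed.

(** * The twist as a function of its test element; exchange with $B^{2,3,4}$ *)

Section Theta.
Variables (K : fieldType) (g : lieAlgType K) (P : polarized g).
Local Notation Lp := (lie_of (pu P)).
Local Notation Lm := (lie_of (pv P)).
Local Notation Ll := (lie_of (pl P)).
Local Notation U := (env g).
Local Notation ip := (@uincl K g (pu P)).
Local Notation im := (@uincl K g (pv P)).
Local Notation il := (@uincl K g (pl P)).
Local Notation vp := (@lval K g (pu P)).
Local Notation vm := (@lval K g (pv P)).
Local Notation vl := (@lval K g (pl P)).
Variables (M : compFilAlgType K) (j : env Ll -> M) (H : U -> env Ll).
Variable k : ctens (tens (env Lp) (env Lm)) M.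
Hypothesis jh : alg_hom j.
Hypothesis jf : forall n u, ufil n u -> fil n (j u).
Hypothesis hH : is_HC H.
Local Notation rho := (rho j H k).
Hypothesis rho_val : forall a h b, rho (ip a * il h * im b) = (ueps a : K) *: cpure b (j h).

Variables (C : compFilAlgType K) (D : U -> C) (tau : M -> C) (e4 : Ll -> C).
Hypotheses (hD : alg_hom D) (D0 : forall u, fil 0 (D u)).
Hypotheses (htau : alg_antihom tau) (taub : bdd 0 tau).
Hypothesis tau_gen : forall z, tau (j (ugen z)) = - (D (ugen (vl z)) + e4 z).
Hypothesis e4D : forall z u, e4 z * D u = D u * e4 z.

Let Dl : linear D. Proof. by case: hD. Qed.
Let D1 : D 1 = 1. Proof. by case: hD. Qed.
Let DM u v : D (u * v) = D u * D v. Proof. by case: hD. Qed.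
Let tl : linear tau. Proof. by case: htau. Qed.
Let t1 : tau 1 = 1. Proof. by case: htau. Qed.
Let tM u v : tau (u * v) = tau v * tau u. Proof. by case: htau. Qed.
Let jl : linear j. Proof. by case: jh. Qed.
Let j1 : j 1 = 1. Proof. by case: jh. Qed.
Let jM u v : j (u * v) = j u * j v. Proof. by case: jh. Qed.
Let iml : linear im. Proof. by case: (uincl_hom (pv P)). Qed.
Let im1 : im 1 = 1. Proof. by case: (uincl_hom (pv P)). Qed.
Let imM u v : im (u * v) = im u * im v. Proof. by case: (uincl_hom (pv P)). Qed.
Let Sl : linear (@uant K g). Proof. by case: (uant_antihom g). Qed.
Let S1 : uant (1 : U) = 1. Proof. by case: (uant_antihom g). Qed.
Let SM (u v : U) : uant (u * v) = uant v * uant u. Proof. by case: (uant_antihom g). Qed.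

Definition beta (b : env Lm) : C := D (uant (im b)).
Definition cc (h : env Ll) : C := tau (j h).
Definition theta : ctens (env Lm) M -> C := clift (fun b m => beta b * tau m).
(** The value $\sum D(S(b))\,\tau(H(ua)\ell)$ of the twist tested against $u$. Here $D$ stands for
    the action of $\mathfrak g$ on the legs that receive $S(b)$, and $\tau$ for the antipode of
    $\widehat U_{\mathfrak l}$ spread over these legs and the dynamical one. *)
Definition Bh (u : U) : C := theta (rho u).

Lemma beta_lin : linear beta.
Proof. by apply: (lin_comp Dl); apply: (lin_comp Sl); exact: iml. Qed.
Lemma beta1 : beta 1 = 1. Proof. by rewrite /beta im1 S1 D1. Qed.
Lemma beta_r b f : beta (b * ugen f) = - D (ugen (vm f)) * beta b.
Proof. by rewrite /beta imM uincl_gen SM uant_gen DM (linN Dl). Qed.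
Lemma cc_antihom : alg_antihom cc.
Proof. exact: (alg_antihom_comp htau jh). Qed.
Lemma theta_bbd : bbd 0 (fun b m => beta b * tau m).
Proof.
split; first exact: (bilin_mul beta_lin tl).
move=> b q m /taub.2 h; rewrite -[q + 0]add0r addr0; rewrite addr0 in h.
by apply: fil_M => //; exact: D0.
Qed.
Lemma theta_bdd : bdd 0 theta. Proof. exact: clift_bdd theta_bbd. Qed.
Lemma theta_pure b m : theta (cpure b m) = beta b * tau m.
Proof. exact: (clift_pure theta_bbd). Qed.

Hypothesis rho_l : linear rho.
Lemma Bh_lin : linear Bh.
Proof. exact: (lin_comp (bdd_lin theta_bdd) rho_l). Qed.
Lemma Bh_val a h b : Bh (ip a * il h * im b) = (ueps a : K) *: (beta b * cc h).
Proof. by rewrite /Bh rho_val (linZ (bdd_lin theta_bdd)) theta_pure. Qed.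
Let ip1 : ip 1 = 1. Proof. by case: (uincl_hom (pu P)). Qed.
Let il1 : il 1 = 1. Proof. by case: (uincl_hom (pl P)). Qed.
Let ipM u v : ip (u * v) = ip u * ip v. Proof. by case: (uincl_hom (pu P)). Qed.
Let ilM u v : il (u * v) = il u * il v. Proof. by case: (uincl_hom (pl P)). Qed.
Lemma Bh_m b : Bh (im b) = beta b.
Proof.
have := Bh_val 1 1 b; rewrite ip1 il1 !mul1r ueps_1 scale1r => ->.
by case: cc_antihom => _ -> _; rewrite mulr1.
Qed.
Lemma Bh_1 : Bh 1 = 1. Proof. by rewrite -im1 Bh_m beta1. Qed.
Lemma Bh_1p a u : Bh (ip a * u) = (ueps a : K) *: Bh u.
Proof.
move: (tri_span P u); apply: (spanned_ext (f := fun u => Bh (ip a * u)) (h := fun u => _ *: Bh u)).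
- by apply: (lin_comp Bh_lin); apply: lin_Ml; exact: lin_id.
- by apply: lin_Z; exact: Bh_lin.
- move=> v [a' [h [b ->]]]; rewrite !mulrA -ipM !Bh_val scalerA.
  by have [_ _ ->] := ueps_hom Lp.
Qed.
Lemma Bh_f u f : Bh (u * ugen (vm f)) = - D (ugen (vm f)) * Bh u.
Proof.
move: (tri_span P u); apply: (spanned_ext (f := fun u => Bh (u * _)) (h := fun u => _ * Bh u)).
- by apply: (lin_comp Bh_lin); apply: lin_Mr; exact: lin_id.
- by apply: lin_Ml; exact: Bh_lin.
- move=> v [a [h [b ->]]]; rewrite -(@uincl_gen _ _ (pv P)) -(mulrA (ip a * il h)) -imM.
  by rewrite !Bh_val beta_r -scalerAr uincl_gen mulrA.
Qed.
Lemma Bh_xl u z : Bh (ugen (vl z) * u) = Bh u * cc (ugen z).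
Proof.
have [_ _ cM] := cc_antihom.
move: (tri_span P u); apply: (spanned_ext (f := fun u => Bh (_ * u)) (h := fun u => Bh u * _)).
- by apply: (lin_comp Bh_lin); apply: lin_Ml; exact: lin_id.
- by apply: lin_Mr; exact: Bh_lin.
- move=> v [a [h [b ->]]]; have [a' [ea e0]] := comm_l_p z a.
  rewrite !mulrA ea !mulrDl (linD Bh_lin) -(@uincl_gen _ _ (pl P)).
  rewrite -(mulrA (ip a) (il (ugen z)) (il h)) -ilM !Bh_val e0 scale0r addr0 cM -scalerAl.
  by rewrite mulrA.
Qed.
(** Moving $z$ past $b$ leaves a bracket whose image conjugates $D(S(b))$ by $D(z)$. Together with
    $\tau(z)=-(D(z)+e_4(z))$, where $e_4(z)$ commutes with $D$, this puts $\tau(z)$ on the left. *)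
Lemma Bh_xr u z : Bh (u * ugen (vl z)) = cc (ugen z) * Bh u.
Proof.
have [_ _ cM] := cc_antihom.
move: (tri_span P u); apply: (spanned_ext (f := fun u => Bh (u * _)) (h := fun u => _ * Bh u)).
- by apply: (lin_comp Bh_lin); apply: lin_Mr; exact: lin_id.
- by apply: lin_Ml; exact: Bh_lin.
- move=> v [a [h [b ->]]]; have [b' [eb _]] := comm_m_l_r b z.
  have eb' : beta b' = beta b * D (ugen (vl z)) - D (ugen (vl z)) * beta b.
    have -> : beta b' = D (uant (im b * ugen (vl z) - ugen (vl z) * im b)).
      by rewrite eb addrC addKr.
    rewrite (linB Sl) !SM uant_gen (linB Dl) !DM (linN Dl) /beta mulrN mulNr opprK.
    by rewrite addrC.
  rewrite -(mulrA (ip a * il h)) eb mulrDr (linD Bh_lin) -(@uincl_gen _ _ (pl P)).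
  rewrite mulrA -(mulrA (ip a) (il h) (il (ugen z))) -ilM !Bh_val cM eb' -scalerDr -scalerAr.
  congr (_ *: _); rewrite !mulrA -mulrDl; congr (_ * _).
  rewrite /cc tau_gen mulrN mulNr mulrDr mulrDl -/(beta b) {2}/beta e4D -/(beta b).
  zmod_tac.
Qed.

Lemma Bh_sum u :
  Bh u = clift3 (fun a b m => beta b * tau m * cc (H (u * ip a))) k.
Proof.
have [n hn] := rho_tri jh jf hH u.
refine (eq_trans (clift3_comp theta_bdd hn k) _); apply: clift3_eq => a b m.
by rewrite theta_pure tM mulrA.
Qed.

(* Bounds uniform in [a]. *)
Lemma Bh_bound u : exists q, forall a, fil q (Bh (u * ip a)).
Proof.
have [n hn] := HC_boundl jf hH u; have [q hq] := fil_exh k.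
exists (q + n%:Z) => a.
have ht : tri n%:Z (fun a' b (m : M) => cpure (b : env Lm) (j (H (u * ip a * ip a')) * m)).
  have Hl := HC_lin hH; have [ipl _ _] := uincl_hom (pu P); split.
  - by move=> a' m; exact: lin_cpurel.
  - move=> b m; apply: (lin_comp (@lin_cpurer _ M _ _)); apply: lin_Mr.
    by apply: (lin_comp jl); apply: (lin_comp Hl); apply: lin_Ml.
  - by move=> a' b; apply: (lin_comp (@lin_cpurer _ M _ _)); apply: lin_Ml.
  - move=> a' b r m rm; apply: cpure_fil; rewrite addrC; apply: fil_M => //.
    by rewrite -mulrA -ipM.
have [_ h1] := clift3_bdd ht; have [_ h2] := theta_bdd.
by have := h2 _ _ (h1 _ _ hq); rewrite addr0.
Qed.

Section Test.
Variables (E : compFilAlgType K) (in1 : env Lp -> E) (in2 : C -> E) (Pr : U -> E -> C).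
Hypotheses (in1h : alg_hom in1) (in10 : forall a, fil 0 (in1 a)).
Hypotheses (in2h : alg_hom in2) (in2b : bdd 0 in2).
Hypothesis in12 : forall a Z, in1 a * in2 Z = in2 Z * in1 a.
Hypothesis Prb : forall u, bnd (Pr u).
Hypothesis PrE : forall u a Z, Pr u (in1 a * in2 Z) = Z * cc (H (u * ip a)).

Let in1l : linear in1. Proof. by case: in1h. Qed.
Let in2l : linear in2. Proof. by case: in2h. Qed.
Let in2M u v : in2 (u * v) = in2 u * in2 v. Proof. by case: in2h. Qed.

Definition Jf (a : env Lp) (b : env Lm) (m : M) : E := in1 a * in2 (beta b) * in2 (tau m).
Lemma Jf_tri : tri 0 Jf.
Proof.
split; rewrite /Jf.
- by move=> a m; apply: lin_Mr; apply: lin_Ml; exact: (lin_comp in2l beta_lin).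
- by move=> b m; do 2 apply: lin_Mr.
- by move=> a b; apply: lin_Ml; exact: (lin_comp in2l tl).
- move=> a b q m qm; rewrite addr0 -[q]add0r; apply: fil_M; last first.
    by have := in2b.2 _ _ (taub.2 _ _ qm); rewrite !addr0.
  rewrite -[0]add0r; apply: fil_M => //.
  by have := in2b.2 _ _ (D0 (uant (im b))); rewrite addr0.
Qed.
Definition Jp : E := clift3 Jf k.

(** The test puts the image of $H(ua)$ at the far right, after $B$; the commutation brings it back
    to where [Bh] has it. *)
Lemma Pr_JB u B : (forall h, B * cc h = cc h * B) -> Pr u (Jp * in2 B) = Bh u * B.
Proof.
move=> hB; have [d hd] : bnd (fun X : E => Pr u (X * in2 B)).
  by apply: (bnd_comp (Prb u)); apply: bnd_Mr; exact: bnd_id.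
refine (eq_trans (clift3_comp hd Jf_tri k) _).
have [e he] : bnd (fun Z : C => Z * B) by apply: bnd_Mr; exact: bnd_id.
have [n hn] := rho_tri jh jf hH u.
have hn' := tri_comp theta_bdd hn.
refine (eq_trans _ (esym (congr1 (fun z => z * B) (clift3_comp theta_bdd hn k)))).
refine (eq_trans _ (esym (clift3_comp he hn' k))).
apply: clift3_eq => a b m; rewrite theta_pure tM /Jf -!(mulrA (in1 a)) -!in2M PrE.
by rewrite -!mulrA hB.
Qed.
Lemma Pr_J u : Pr u Jp = Bh u.
Proof.
have := @Pr_JB u 1; rewrite mulr1; case: in2h => _ -> _; rewrite mulr1; apply.
by move=> h; rewrite mul1r mulr1.
Qed.

Hypothesis Pr_in : forall u a Z Y, Pr u (in1 a * in2 Z * Y) = Z * Pr (u * ip a) Y.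
Hypothesis nd : forall X, (forall b, Pr (im b) X = 0) -> X = 0.

Lemma Pr_in2 u Z Y : Pr u (in2 Z * Y) = Z * Pr u Y.
Proof.
by have := Pr_in u 1 Z Y; rewrite ip1 mulr1; case: in1h => _ -> _; rewrite mul1r.
Qed.

(* Invariance of the dynamical twist under l. *)
Lemma Jp_ad z : exists Dz : env Lp -> env Lp, [/\ linear Dz,
  forall a, ip (Dz a) = ugen (vl z) * ip a - ip a * ugen (vl z) &
  clift3 (fun a b m => Jf (Dz a) b m) k = in2 (cc (ugen z)) * Jp - Jp * in2 (cc (ugen z))].
Proof.
have Hl := HC_lin hH; have [ipl _ _] := uincl_hom (pu P); have [cl c1 cM] := cc_antihom.
pose dz (e : Lp) : Lp := vsproj (pu P) (lie (vl z) (vp e)).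
have dzE e : vp (dz e) = lie (vl z) (vp e).
  by have [e' he] := lie_lp z e; rewrite /dz he /lval vsprojK //; exact: lval_in.
have dzl : linear dz.
  move=> a u v; apply: (@lval_inj _ _ (pu P)); rewrite dzE !(@lvalL _ _ (pu P)) !dzE.
  exact: (lin_lier (vl z)).
(* $\mathrm{ad}(z)$ preserves $\mathfrak u_+$ and is a derivation by the Jacobi identity, so it
   extends to $U(\mathfrak u_+)$. *)
have [Dz [Dl0 Dz1 DzM Dzg]] := @env_derivation _ _ dz dzl (fun u v =>
  @lval_inj _ _ (pu P) _ _ (etrans (dzE _) (etrans (congr1 _ (lval_lie u v))
   (etrans (lie_der _ _ _) (esym (etrans (linD (@lvalL _ _ (pu P)) _ _)
    (congr2 +%R (etrans (lval_lie _ _) (congr2 lie (dzE _) erefl))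
     (etrans (lval_lie _ _) (congr2 lie erefl (dzE _)))))))))).
have DzE a : ip (Dz a) = ugen (vl z) * ip a - ip a * ugen (vl z).
  move: a; apply: env_ind_l => [||e a IH].
  - split; first by rewrite (lin0 Dl0) (lin0 ipl) mulr0 mul0r subrr.
    move=> c u v eu ev; rewrite Dl0 !ipl eu ev mulrDr mulrDl -scalerAr -scalerAl scalerBr.
    zmod_tac.
  - by rewrite Dz1 (lin0 ipl) ip1 mulr1 mul1r subrr.
  - rewrite DzM Dzg (linD ipl) !ipM !uincl_gen IH dzE ugen_lie mulrBl mulrBr !mulrA.
    zmod_tac.
exists Dz; split=> //; apply/eqP; rewrite -subr_eq0; apply/eqP; apply: nd => b.
have Prl u : linear (Pr u) := bnd_lin (Prb u).
rewrite (linB (Prl _)) (linB (Prl _)) Pr_in2 Pr_J.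
have ht : tri 0 (fun a b m => Jf (Dz a) b m).
  have [h1 h2 h3 h4] := Jf_tri; split.
  - by move=> a m; exact: h1.
  - by move=> b' m; exact: (lin_comp (h2 b' m) Dl0).
  - by move=> a b'; exact: h3.
  - by move=> a b' q m; exact: h4.
have [d1 hd1] := Prb (im b).
have [d2 hd2] : bnd (fun X : E => Pr (im b) (X * in2 (cc (ugen z)))).
  by apply: (bnd_comp (Prb _)); apply: bnd_Mr; exact: bnd_id.
pose f1 a b' m : C := beta b' * tau m * cc (H (im b * ip (Dz a))).
pose f2 a b' m : C := beta b' * tau m * cc (ugen z) * cc (H (im b * ip a)).
have e1 : Pr (im b) (clift3 (fun a b m => Jf (Dz a) b m) k) = clift3 f1 k.
  refine (eq_trans (clift3_comp hd1 ht k) _); apply: clift3_eq => a b' m.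
  by rewrite /Jf -!(mulrA (in1 _)) -!in2M PrE.
have e2 : Pr (im b) (Jp * in2 (cc (ugen z))) = clift3 f2 k.
  refine (eq_trans (clift3_comp hd2 Jf_tri k) _); apply: clift3_eq => a b' m.
  by rewrite /Jf -!(mulrA (in1 _)) -!in2M PrE.
rewrite e1 e2.
have t1' : tri (0 + d1) f1.
  have := tri_comp hd1 ht; rewrite addrC; congr (tri _ _).
  do 3 apply/funext=> ?; by rewrite /f1 /Jf -!(mulrA (in1 _)) -!in2M PrE.
have t2' : tri (0 + d2) f2.
  have := tri_comp hd2 Jf_tri; rewrite addrC; congr (tri _ _).
  do 3 apply/funext=> ?; by rewrite /f2 /Jf -!(mulrA (in1 _)) -!in2M PrE.
have t1'' := tri_mono (_ : 0 + d1 <= Order.max (0 + d1) (0 + d2)) t1'.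
have t2'' := tri_mono (_ : 0 + d2 <= Order.max (0 + d1) (0 + d2)) t2'.
(* [f1] carries $H(b(za-az))$ and [f2] carries $H(ba)z=H(baz)$; what remains is $H(bza)$. *)
have e3 : clift3 f1 k + clift3 f2 k = Bh (im b * ugen (vl z)).
  rewrite -(clift3_D (t1'' _) (t2'' _)) ?le_max ?lexx ?orbT // Bh_sum.
  apply: clift3_eq => a b' m; rewrite /f1 /f2 -!mulrA -!mulrDr; congr (_ * (_ * _)).
  rewrite DzE mulrBr (linB Hl) (linB cl) mulrA (mulrA (im b) (ip a)) HC_gen_r // cM.
  by rewrite subrK.
by apply/eqP; rewrite opprB addrA subr_eq0 -Bh_xr -e3.
Qed.

Section Casimir.
Variables (e3 : U -> C) (tt : seq (g * g)) (ls : seq (Ll * Ll)) (ss : seq (Lp * Lm)).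
Hypothesis ttE : tt = [seq (vl p.1, vl p.2) | p <- ls] ++
  ([seq (vp p.1, vm p.2) | p <- ss] ++ [seq (vm p.2, vp p.1) | p <- ss]).
Hypothesis tinv : forall (V : lmodType K) (F : g -> g -> V), bilin F -> forall z,
  \sum_(p <- tt) (F (lie z p.1) p.2 + F p.1 (lie z p.2)) = 0.
Hypothesis lsym : forall (V : lmodType K) (F : Ll -> Ll -> V), bilin F ->
  \sum_(p <- ls) F p.1 p.2 = \sum_(p <- ls) F p.2 p.1.
Hypothesis he3 : alg_hom e3.
Hypothesis De3 : forall z w, D (ugen z) * e3 (ugen w) =
  e3 (ugen w) * D (ugen z) + e3 (ugen (lie z w)).
Hypothesis e43 : forall z u, e4 z * e3 u = e3 u * e4 z.
Hypothesis e4l : linear e4.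
Let e3l : linear (fun z => e3 (ugen z)).
Proof. by case: he3 => h _ _; exact: (lin_comp h (@lin_ugen _ g)). Qed.
Let Dgl : linear (fun z => D (ugen z)).
Proof. exact: (lin_comp Dl (@lin_ugen _ g)). Qed.

(** The invariant tensor $t$ with one leg on the strand [e3] and the other fed to the test function.
    In [qcas] the second leg goes through $D$ instead. *)
Definition tcas (x : U) : C := \sum_(p <- tt) e3 (ugen p.2) * Bh (x * ugen p.1).
Definition qcas : C := \sum_(p <- tt) e3 (ugen p.2) * D (ugen p.1).
(** When $D$ is the sum of the strands 2 and 3 and [e3] is the strand 3, this is $B^{2,3,4}$: the
    strand 2 in $D$ gives $s^{2,3}$ and the strand 3 gives $m(\bar s)^{(3)}$. *)
Definition barg : C := \sum_(p <- ls) e3 (ugen (vl p.1)) * e4 p.2 -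
  \sum_(p <- ss) e3 (ugen (vm p.2)) * D (ugen (vp p.1)).

(** Carrying $z$ from the end of the test element to the front of the value creates a bracket with
    either leg of $t$, and the two cancel by invariance of $t$. *)
Lemma tcas_r x z w : (forall x, Bh (x * ugen z) = - w * Bh x) ->
  (forall u, w * e3 (ugen u) = e3 (ugen u) * w + e3 (ugen (lie z u))) ->
  tcas (x * ugen z) = - w * tcas x.
Proof.
move=> hB hw.
have bl : bilin (fun u v => e3 (ugen v) * Bh (x * ugen u)).
  apply: bilin_mul_op => //.
  by apply: (lin_comp Bh_lin); apply: lin_Ml; exact: lin_ugen.
have inv := tinv bl z; rewrite big_split /= in inv.
apply/eqP; rewrite -subr_eq0; apply/eqP; apply: eq_trans inv.
have -> : - w * tcas x = \sum_(p <- tt) - w * (e3 (ugen p.2) * Bh (x * ugen p.1)).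
  exact: mulr_sumr.
pose f1 (p : g * g) := e3 (ugen p.2) * Bh (x * ugen (lie z p.1)).
pose f2 (p : g * g) := e3 (ugen (lie z p.2)) * Bh (x * ugen p.1).
refine (eq_trans (sub_sums (k := fun p => f1 p + f2 p) tt _) (big_split _ _ _ f1 f2)).
move=> p; rewrite /f1 /f2.
rewrite -(mulrA x) ugen_swap mulrDr (linD Bh_lin) (mulrA x) hB.
exact: (swap_op _ _ (hw _)).
Qed.
Lemma tcas_m x f : tcas (x * ugen (vm f)) = - D (ugen (vm f)) * tcas x.
Proof. by apply: tcas_r => [y|u]; [exact: Bh_f | exact: De3]. Qed.
Lemma tcas_xr x z : tcas (x * ugen (vl z)) = cc (ugen z) * tcas x.
Proof.
rewrite /cc tau_gen; apply: tcas_r => [y|u]; first by rewrite Bh_xr /cc tau_gen.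
by rewrite mulrDl De3 e43 mulrDr; zmod_tac.
Qed.
Lemma tcas_xl x z : tcas (ugen (vl z) * x) = tcas x * cc (ugen z).
Proof.
by rewrite /tcas mulr_suml; apply: eq_bigr => p _; rewrite -!mulrA Bh_xl.
Qed.
Lemma tcas_b b : tcas (im b) = beta b * tcas 1.
Proof.
move: b; apply: env_ind_r => [||f b IH].
- have tl' : linear (fun b => tcas (im b)).
    apply: lin_sumf => p; apply: lin_Ml; apply: (lin_comp Bh_lin).
    by apply: lin_Mr; exact: iml.
  split; first by rewrite (lin0 tl') (lin0 beta_lin) mul0r.
  by move=> c u v eu ev; rewrite tl' beta_lin mulrDl -scalerAl eu ev.
- by rewrite im1 beta1 mul1r.
- by rewrite imM uincl_gen tcas_m IH beta_r mulrA.
Qed.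
Lemma tcas_cc h : tcas 1 * cc h = cc h * tcas 1.
Proof.
have [cl c1 cM] := cc_antihom.
move: h; apply: env_ind_l => [||z h IH].
- split; first by rewrite (lin0 cl) mulr0 mul0r.
  by move=> c u v eu ev; rewrite cl mulrDr mulrDl -scalerAr -scalerAl eu ev.
- by rewrite c1 mulr1 mul1r.
- rewrite cM mulrA IH -!mulrA; congr (_ * _).
  by rewrite -tcas_xl -tcas_xr mul1r mulr1.
Qed.
Lemma qcas_D z : qcas * D (ugen z) = D (ugen z) * qcas.
Proof.
have bl : bilin (fun u v => e3 (ugen v) * D (ugen u)) by apply: bilin_mul_op.
have inv := tinv bl z; rewrite big_split /= in inv.
have [_ DB] := hom_lie hD.
apply/eqP; rewrite eq_sym -subr_eq0; apply/eqP; apply: eq_trans inv.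
rewrite /qcas mulr_sumr mulr_suml -big_split; apply: sub_sums => p /=.
rewrite mulrA De3 DB mulrDl mulrBr !mulrA; zmod_tac.
Qed.
Lemma qcas_Du u : qcas * D u = D u * qcas.
Proof.
move: u; apply: env_ind_l => [||z u IH].
- split; first by rewrite (lin0 Dl) mulr0 mul0r.
  by move=> c u v eu ev; rewrite Dl mulrDr mulrDl -scalerAr -scalerAl eu ev.
- by rewrite D1 mulr1 mul1r.
- by rewrite DM mulrA qcas_D -!mulrA IH.
Qed.
Lemma qcas_cc h : qcas * cc h = cc h * qcas.
Proof.
have [cl c1 cM] := cc_antihom.
have q4 z : qcas * e4 z = e4 z * qcas.
  rewrite /qcas mulr_sumr mulr_suml; apply: eq_bigr => p _.
  by rewrite mulrA e43 -!mulrA e4D.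
move: h; apply: env_ind_l => [||z h IH].
- split; first by rewrite (lin0 cl) mulr0 mul0r.
  by move=> c u v eu ev; rewrite cl mulrDr mulrDl -scalerAr -scalerAl eu ev.
- by rewrite c1 mulr1 mul1r.
- rewrite cM mulrA IH -!mulrA; congr (_ * _).
  by rewrite /cc tau_gen mulrN mulNr mulrDr mulrDl qcas_D q4.
Qed.
(** The letters of $\mathfrak l$ and $\mathfrak u_-$ at the end of the test element act in a known
    way; only the part of $t$ that ends in $\mathfrak u_+$ is left unevaluated. *)
Lemma tcas_split x w : (forall p, p \in ls -> Bh (x * ugen (vl p.1)) = cc (ugen p.1) * w) ->
  (forall p, p \in ss -> Bh (x * ugen (vm p.2)) = - D (ugen (vm p.2)) * w) ->
  tcas x = \sum_(p <- ss) e3 (ugen (vm p.2)) * Bh (x * ugen (vp p.1)) +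
    (\sum_(p <- ls) e3 (ugen (vl p.2)) * cc (ugen p.1) -
     \sum_(p <- ss) e3 (ugen (vp p.1)) * D (ugen (vm p.2))) * w.
Proof.
move=> h1 h2; rewrite /tcas ttE !big_cat !big_map /= mulrBl !mulr_suml.
rewrite (_ : \sum_(p <- ls) _ = \sum_(p <- ls) e3 (ugen (vl p.2)) * cc (ugen p.1) * w); last first.
  by rewrite big_seq [RHS]big_seq; apply: eq_bigr => p ps; rewrite h1 // mulrA.
rewrite addrCA; congr (_ + (_ + _)); rewrite -sumrN big_seq [RHS]big_seq.
by apply: eq_bigr => p ps; rewrite h2 // mulNr mulrN mulrA.
Qed.
Lemma tcas_1s : tcas 1 = \sum_(p <- ls) e3 (ugen (vl p.2)) * cc (ugen p.1) -
  \sum_(p <- ss) e3 (ugen (vp p.1)) * D (ugen (vm p.2)).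
Proof.
rewrite (@tcas_split 1 1); last 2 first.
- by move=> p _; rewrite Bh_xr Bh_1.
- by move=> p _; rewrite Bh_f Bh_1.
rewrite mulr1 big1 ?add0r // => p _.
rewrite mul1r -[ugen (vp _)]mulr1 -(@uincl_gen _ _ (pu P)) Bh_1p.
by rewrite ueps_gen scale0r mulr0.
Qed.
Lemma tcas_1 : tcas 1 = - (barg + qcas).
Proof.
rewrite tcas_1s.
rewrite /barg /qcas ttE !big_cat !big_map /=.
have -> : \sum_(p <- ls) e3 (ugen (vl p.2)) * cc (ugen p.1) =
  - (\sum_(p <- ls) e3 (ugen (vl p.1)) * e4 p.2) -
  \sum_(p <- ls) e3 (ugen (vl p.2)) * D (ugen (vl p.1)).
  have bl : bilin (fun u v => e3 (ugen (vl u)) * e4 v).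
    by apply: bilin_mul => //; exact: (lin_comp e3l (@lvalL _ _ _)).
  rewrite (lsym bl) -!sumrN -big_split; apply: eq_bigr => p _ /=.
  by rewrite /cc tau_gen mulrN mulrDr opprD addrC.
set s1 := \sum_(p <- ls) _; set s2 := \sum_(p <- ls) _; set s3 := \sum_(p <- ss) _.
by set s4 := \sum_(p <- ss) _; zmod_tac.
Qed.
Lemma bargE : barg = - qcas - tcas 1. Proof. by rewrite tcas_1; zmod_tac. Qed.
Lemma barg_cc h : barg * cc h = cc h * barg.
Proof. by rewrite bargE mulrBl mulrBr mulNr mulrN qcas_cc tcas_cc. Qed.

(* Moving the fourth-strand generator through J^{1,23,4}. *)
Theorem Jp_barg : Jp * in2 barg = in2 barg * Jp -
  (\sum_(p <- ss) in1 (ugen p.1) * in2 (e3 (ugen (vm p.2)))) * Jp.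
Proof.
apply/eqP; rewrite -subr_eq0; apply/eqP; apply: nd => b.
have Prl u : linear (Pr u) := bnd_lin (Prb u).
rewrite !(linB (Prl _)) Pr_in2 mulr_suml (lin_sum (Prl _)) (Pr_JB _ barg_cc) Pr_J Bh_m.
have -> : \sum_(p <- ss) Pr (im b) (in1 (ugen p.1) * in2 (e3 (ugen (vm p.2))) * Jp) =
  \sum_(p <- ss) e3 (ugen (vm p.2)) * Bh (im b * ugen (vp p.1)).
  by apply: eq_bigr => p _; rewrite Pr_in Pr_J uincl_gen.
(* [tcas (im b)] is computed in two ways, as $\beta(b)$ times its value at 1 and by splitting. The
   difference is the term in $s$, while [qcas] commutes with $\beta(b)$. *)
have h := tcas_split (fun p _ => etrans (Bh_xr (im b) p.1) (congr1 _ (Bh_m b)))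
  (fun p _ => etrans (Bh_f (im b) p.2) (congr1 _ (Bh_m b))).
rewrite -tcas_1s tcas_b in h; move/eqP: h; rewrite -subr_eq => /eqP <-.
rewrite bargE mulrDr mulrDl !mulrN !mulNr qcas_Du -/(beta b).
zmod_tac.
Qed.
End Casimir.

End Test.
End Theta.

(** * Pushing the invariance of K through a linear family; exchange with $B^{1,2,34}$ *)

Section Push.
Variables (K : fieldType) (g : lieAlgType K) (P : polarized g).
Local Notation Lp := (lie_of (pu P)).
Local Notation Lm := (lie_of (pv P)).
Local Notation Ll := (lie_of (pl P)).
Local Notation U := (env g).
Local Notation ip := (@uincl K g (pu P)).
Local Notation im := (@uincl K g (pv P)).
Local Notation il := (@uincl K g (pl P)).
Local Notation vp := (@lval K g (pu P)).
Local Notation vm := (@lval K g (pv P)).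
Local Notation vl := (@lval K g (pl P)).
Variables (d : nat) (x y : d.-tuple g).
Variables (M : compFilAlgType K) (j : env Ll -> M).
Variables (S : comAlgType K) (i : Ll -> S) (sigma : int -> M -> S).
Hypothesis char0 : forall n, n.+1%:R != 0 :> K.
Hypothesis jh : alg_hom j.
Hypothesis jf : forall n u, ufil n u -> fil n (j u).
Hypotheses (bx : basis_of (pu P) x) (byy : basis_of (pv P) y).
Hypotheses (hS : is_loc_sym x y i) (hsig : is_symbol x y j i sigma).
Variable H : U -> env Ll.
Hypothesis hH : is_HC H.
Variable k : ctens (tens (env Lp) (env Lm)) M.
Hypothesis hk : is_K j H k.

Section Family.
Variables (B : compFilAlgType K) (D3 : U -> B) (t4 : M -> B).
Hypotheses (hD3 : alg_hom D3) (D30 : forall u, fil 0 (D3 u)).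
Hypotheses (ht4 : alg_antihom t4) (t4b : bdd 0 t4).
Variables (N : env Lp -> B -> B) (e : int).
Hypotheses (Nl : forall Z, linear (N^~ Z)) (Nr : forall a, linear (N a)).
Hypothesis Nb : forall q a Z, fil q Z -> fil (q + e) (N a Z).

Let D3l : linear D3. Proof. by case: hD3. Qed.
Let t4l : linear t4. Proof. by case: ht4. Qed.
Let t4M u v : t4 (u * v) = t4 v * t4 u. Proof. by case: ht4. Qed.

Definition bmul (b : env Lm) (m : M) : B := D3 (uant (im b)) * t4 m.
(** Extends the family $a\mapsto N_a$ from $U(\mathfrak u_+)$ to $U(\mathfrak g)$ by straightening
    $u$ with [kap]: letters of $\mathfrak l$ act through [t4], and those of $\mathfrak u_-$ at the
    right end are killed. *)
Definition push (Z : B) (u : U) : B := clift (fun a m => N a (Z * t4 m)) (kap j H k u).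

Lemma bmul_l m : linear (bmul^~ m).
Proof.
have [iml _ _] := uincl_hom (pv P); have [Sl _ _] := uant_antihom g.
by apply: lin_Mr; apply: (lin_comp D3l); apply: (lin_comp Sl).
Qed.
Lemma bmul_r b : linear (bmul b). Proof. by apply: lin_Ml. Qed.
Lemma bmul_fil q b m : fil q m -> fil q (bmul b m).
Proof.
by move=> /t4b.2; rewrite addr0 => qm; rewrite -[q]add0r; apply: fil_M.
Qed.
Lemma bmul_gen f b m : bmul (b * ugen f) m = - D3 (ugen (vm f)) * bmul b m.
Proof.
have [_ _ imM] := uincl_hom (pv P); have [_ _ SM] := uant_antihom g.
have [_ _ D3M] := hD3.
by rewrite /bmul imM uincl_gen SM uant_gen D3M (linN D3l) mulrA.
Qed.

Lemma push_bbd q Z : fil q Z -> bbd (q + e) (fun a (m : M) => N a (Z * t4 m)).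
Proof.
move=> qZ; split; first split=> [a|m].
- by apply: (lin_comp (Nr a)); apply: lin_Ml.
- exact: Nl.
- move=> a r m /t4b.2; rewrite addr0 => rm.
  by rewrite addrA (addrC r); apply: Nb; apply: fil_M.
Qed.
Lemma push_bdd q Z : fil q Z -> bdd (q + e) (clift (fun a (m : M) => N a (Z * t4 m))).
Proof. by move=> qZ; exact: clift_bdd (push_bbd qZ). Qed.
Lemma push_pure Z a m : clift (fun a (m : M) => N a (Z * t4 m)) (cpure a m) = N a (Z * t4 m).
Proof. by have [q qZ] := fil_exh Z; exact: (clift_pure (push_bbd qZ)). Qed.
Lemma push_lin Z : linear (push Z).
Proof.
have [q qZ] := fil_exh Z.
exact: (lin_comp (bdd_lin (push_bdd qZ)) (kap_lin jh jf hH k)).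
Qed.
Lemma push_val Z a h b : push Z (ip a * il h * im b) = (ueps b : K) *: N a (Z * t4 (j h)).
Proof.
have [q qZ] := fil_exh Z.
rewrite /push (kap_tri_val char0 jh jf bx byy hS hsig hH hk).
by rewrite (linZ (bdd_lin (push_bdd qZ))) push_pure.
Qed.
Lemma push_p Z a : push Z (ip a) = N a Z.
Proof.
have [_ im1 _] := uincl_hom (pv P); have [_ il1 _] := uincl_hom (pl P).
have [_ j1 _] := jh; have [_ t41 _] := ht4.
have := push_val Z a 1 1; rewrite im1 il1 !mulr1 ueps_1 scale1r => ->.
by rewrite j1 t41 mulr1.
Qed.

Lemma fam_tri : tri e (fun a b m => N a (bmul b m)).
Proof.
split.
- by move=> a m; apply: (lin_comp (Nr a)); exact: bmul_l.
- by move=> b m; exact: Nl.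
- by move=> a b; apply: (lin_comp (Nr a)); exact: bmul_r.
- by move=> a b q m qm; apply: Nb; exact: bmul_fil.
Qed.
(** The image of [invariance] under the family: the letter $f$ to the right of $b$ becomes $-f$ to
    the left of $S(b)$. *)
Lemma push_invariance f :
  clift3 (fun a b m => push (bmul b m) (ugen (vm f) * ip a)) k =
  clift3 (fun a b m => N a (- D3 (ugen (vm f)) * bmul b m)) k.
Proof.
have hb := clift3_bdd fam_tri.
have inv := congr1 (clift3 (fun a b m => N a (bmul b m)))
  (invariance char0 jh jf bx byy hS hsig hH hk f).
have e1 := clift3_comp hb (lam_tri char0 jh jf bx byy hS hsig hH hk f) k.
have e2 := clift3_comp hb (@mulr_tri _ _ P M (ugen f)) k.
refine (eq_trans _ (eq_trans (eq_trans (esym e1) inv) (eq_trans e2 _))).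
  apply: clift3_eq => a b m; rewrite /push /lamf; move: (kap _ _ _ _).
  have [q qZ] := fil_exh (bmul b m).
  apply: ctens_ext.
  - by exists (q + e); exact: (push_bdd qZ).
  - have b1 : bnd (fun X : ctens (env Lp) M => inl (P := P) X * cpure (tpure 1 b) m).
      by apply: bnd_Mr; exact: bdd_bnd (@inl_bdd _ _ _ _).
    exact: (bnd_comp (bdd_bnd hb) b1).
  - move=> a' m'; rewrite push_pure inl_pure cpureM tpureM mulr1 mul1r.
    by rewrite (clift3_pure fam_tri) /bmul t4M mulrA.
by apply: clift3_eq => a b m; rewrite /mulf (clift3_pure fam_tri) bmul_gen.
Qed.

Lemma kap_gen_fil z a : fil 1 (kap j H k (ugen z * ip a)).
Proof.
have kl := kap_lin jh jf hH k; have [ipl _ ipM] := uincl_hom (pu P).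
have f1 b : fil 1 (cpure (b : env Lp) (1 : M)).
  by apply: cpure_fil; apply: (@fil_mono _ _ 0) => //; exact: fil_1.
have [z1 [z3 ->]] := polarized_decomp P z; move: (lproj P z) => z2.
rewrite !(linD (@lin_ugen _ g)) !mulrDl !(linD kl); apply: fil_D; first apply: fil_D.
- by rewrite -(@uincl_gen _ _ (pu P)) -ipM (kap_p char0 jh jf bx byy hS hsig hH hk).
- have [a' [ea _]] := comm_l_p z2 a; rewrite ea (linD kl) -(@uincl_gen _ _ (pl P)).
  rewrite (kap_r jh jf hH) !(kap_p char0 jh jf bx byy hS hsig hH hk).
  rewrite cpureM mul1r mulr1; apply: fil_D => //; apply: cpure_fil; apply: jf.
  exact: degle_gen.
- exact: (kap_straight char0 jh jf bx byy hS hsig hH hk).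
Qed.
Lemma push_tri z : tri (1 + e) (fun a b m => push (bmul b m) (ugen z * ip a)).
Proof.
have [ipl _ _] := uincl_hom (pu P); split.
- move=> a m c b b'; have [q hq] := fil_exh (bmul b m); have [r hr] := fil_exh (bmul b' m).
  rewrite (bmul_l m) /push; move: (kap _ _ _ _).
  have [s hs] := fil_exh (c *: bmul b m + bmul b' m).
  apply: ctens_ext.
  + by exists (s + e); exact: push_bdd.
  + apply: bnd_D; last by exists (r + e); exact: push_bdd.
    apply: (bnd_comp (f := fun Z => c *: Z)); last by exists (q + e); exact: push_bdd.
    exists 0; split; first by apply: lin_Z; exact: lin_id.
    by move=> n u nu; rewrite addr0; exact: fil_Z.
  + by move=> a' m'; rewrite !push_pure mulrDl -scalerAl Nr.
- move=> b m; apply: (lin_comp (push_lin _)); apply: lin_Ml; exact: ipl.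
- move=> a b c m m'; have [q hq] := fil_exh (bmul b m); have [r hr] := fil_exh (bmul b m').
  rewrite (bmul_r b) /push; move: (kap _ _ _ _).
  have [s hs] := fil_exh (c *: bmul b m + bmul b m').
  apply: ctens_ext.
  + by exists (s + e); exact: push_bdd.
  + apply: bnd_D; last by exists (r + e); exact: push_bdd.
    apply: (bnd_comp (f := fun Z => c *: Z)); last by exists (q + e); exact: push_bdd.
    exists 0; split; first by apply: lin_Z; exact: lin_id.
    by move=> n u nu; rewrite addr0; exact: fil_Z.
  + by move=> a' m''; rewrite !push_pure mulrDl -scalerAl Nr.
- move=> a b q m qm; have [_ hb] := push_bdd (bmul_fil b qm).
  by rewrite addrCA; exact: (hb _ _ (kap_gen_fil z a)).
Qed.
End Family.

Lemma clift3_sum (B : compFilAlgType K) (I : Type) (s : seq I) (n : int) (c : I -> B)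
    (F : I -> env Lp -> env Lm -> M -> B) : (forall p, tri n (F p)) ->
  clift3 (fun a b m => \sum_(p <- s) c p * F p a b m) k = \sum_(p <- s) c p * clift3 (F p) k.
Proof.
move=> hF.
have cE p : exists q, bdd q (fun Z : B => c p * Z).
  have [q hq] := fil_exh (c p); exists q; split; first by apply: lin_Ml; exact: lin_id.
  by move=> r Z rZ; rewrite addrC; exact: fil_M.
suff [q [_ e]] : exists q, tri q (fun a b m => \sum_(p <- s) c p * F p a b m) /\
  clift3 (fun a b m => \sum_(p <- s) c p * F p a b m) k = \sum_(p <- s) c p * clift3 (F p) k by [].
elim: s => [|p s [q [hq e]]].
  exists 0; split; last first.
    by rewrite big_nil -[RHS](@clift3_0 _ M _ _ B k); apply: clift3_eq => *; rewrite big_nil.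
  by split=> *; rewrite ?big_nil; [move=> ? ? ?|move=> ? ? ?|move=> ? ? ?|exact: fil_0];
    rewrite !big_nil scaler0 addr0.
have [r hr] := cE p.
pose u := Order.max (n + r) q.
have t1 : tri u (fun a b m => c p * F p a b m).
  by apply: (tri_mono _ (tri_comp hr (hF p))); rewrite le_max lexx.
have t2 : tri u (fun a b m => \sum_(p <- s) c p * F p a b m).
  by apply: (tri_mono _ hq); rewrite le_max lexx orbT.
exists u; split.
  have := tri_D t1 t2; congr (tri _ _); do 3 apply/funext=> ?; by rewrite big_cons.
rewrite big_cons -e (clift3_comp hr (hF p)) -(clift3_D t1 t2).
by apply: clift3_eq => *; rewrite big_cons.
Qed.

Section Star.
Variables (B : compFilAlgType K) (D1 e2 e3 : U -> B) (t4 : M -> B) (e4 : Ll -> B).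
Hypotheses (hD1 : alg_hom D1) (D10 : forall u, fil 0 (D1 u)).
Hypotheses (he2 : alg_hom e2).
Hypotheses (he3 : alg_hom e3) (e30 : forall u, fil 0 (e3 u)).
Hypotheses (ht4 : alg_antihom t4) (t4b : bdd 0 t4).
Hypothesis t4_gen : forall z, t4 (j (ugen z)) = - (e3 (ugen (vl z)) + e4 z).
Hypothesis D1e2 : forall z w, D1 (ugen z) * e2 (ugen w) =
  e2 (ugen w) * D1 (ugen z) + e2 (ugen (lie z w)).
Hypothesis D1e3 : forall u v, D1 u * e3 v = e3 v * D1 u.
Hypothesis e2e3 : forall u v, e2 u * e3 v = e3 v * e2 u.
Hypothesis e2t4 : forall u m, e2 u * t4 m = t4 m * e2 u.
Hypothesis D1t4 : forall u m, D1 u * t4 m = t4 m * D1 u.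
Local Notation bm := (bmul e3 t4).
Definition J1 : B := clift3 (fun a b m => D1 (ip a) * bm b m) k.
Hypothesis F2 : forall z, exists Dz : env Lp -> env Lp, [/\ linear Dz,
  forall a, ip (Dz a) = ugen (vl z) * ip a - ip a * ugen (vl z) &
  clift3 (fun a b m => D1 (ip (Dz a)) * bm b m) k = t4 (j (ugen z)) * J1 - J1 * t4 (j (ugen z))].
Variables (tt : seq (g * g)) (ls : seq (Ll * Ll)) (ss : seq (Lp * Lm)).
Hypothesis ttE : tt = [seq (vl p.1, vl p.2) | p <- ls] ++
  ([seq (vp p.1, vm p.2) | p <- ss] ++ [seq (vm p.2, vp p.1) | p <- ss]).
Hypothesis tinv : forall (V : lmodType K) (F : g -> g -> V), bilin F -> forall z,
  \sum_(p <- tt) (F (lie z p.1) p.2 + F p.1 (lie z p.2)) = 0.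

Let D1l : linear D1. Proof. by case: hD1. Qed.
Let D1M u v : D1 (u * v) = D1 u * D1 v. Proof. by case: hD1. Qed.
Let ipl : linear ip. Proof. by case: (uincl_hom (pu P)). Qed.
Let ipM u v : ip (u * v) = ip u * ip v. Proof. by case: (uincl_hom (pu P)). Qed.
Let e2l : linear (fun z => e2 (ugen z)).
Proof. by case: he2 => h _ _; exact: (lin_comp h (@lin_ugen _ g)). Qed.
Let N (a : env Lp) (Z : B) : B := D1 (ip a) * Z.
Let Nl Z : linear (N^~ Z). Proof. by apply: lin_Mr; exact: (lin_comp D1l ipl). Qed.
Let Nr a : linear (N a). Proof. by apply: lin_Ml; exact: lin_id. Qed.
Let Nb q a Z : fil q Z -> fil (q + 0) (N a Z).
Proof. by move=> qZ; rewrite addrC; exact: fil_M. Qed.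
Local Notation ps := (push t4 N).

Lemma ps_p Z a : ps Z (ip a) = D1 (ip a) * Z.
Proof. exact: (push_p ht4 t4b Nl Nr Nb). Qed.
Lemma ps_gen_r Z a z : ps Z (ip a * ugen (vl z)) = D1 (ip a) * Z * t4 (j (ugen z)).
Proof.
have [_ im1 _] := uincl_hom (pv P).
have := push_val ht4 t4b Nl Nr Nb Z a (ugen z) 1.
by rewrite im1 mulr1 ueps_1 scale1r uincl_gen => ->; rewrite /N mulrA.
Qed.
Lemma ps_l Z e u : ps Z (ugen (vp e) * u) = D1 (ugen (vp e)) * ps Z u.
Proof.
have pl := push_lin ht4 t4b Nl Nr Nb Z.
move: (tri_span P u).
apply: (spanned_ext (f := fun u => ps Z (ugen (vp e) * u)) (h := fun u => _ * ps Z u)).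
- by apply: (lin_comp pl); apply: lin_Ml; exact: lin_id.
- by apply: lin_Ml; exact: pl.
- move=> v [a [h [b ->]]]; rewrite !mulrA -(@uincl_gen _ _ (pu P)) -ipM.
  by rewrite !(push_val ht4 t4b Nl Nr Nb) /N ipM D1M -scalerAr !mulrA.
Qed.
(** The invariant tensor with its second leg put in front of the element to be pushed and its first
    leg on the strand [e2]. *)
Definition tsum2 (Z : B) (u : U) : B := \sum_(p <- tt) e2 (ugen p.1) * ps Z (ugen p.2 * u).
Definition barg2 : B := \sum_(p <- ls) e2 (ugen (vl p.1)) * (e3 (ugen (vl p.2)) + e4 p.2) -
  \sum_(p <- ss) e2 (ugen (vm p.2)) * D1 (ugen (vp p.1)).

(** $D_1$ contains the strand [e2], so $D_1(e)$ brackets with the first leg of $t$ while $e$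
    brackets with the second one; invariance of $t$ cancels both. *)
Lemma tsum2_l Z e u : tsum2 Z (ugen (vp e) * u) = D1 (ugen (vp e)) * tsum2 Z u.
Proof.
have pl := push_lin ht4 t4b Nl Nr Nb Z.
have bl : bilin (fun x y => e2 (ugen x) * ps Z (ugen y * u)).
  have hl : linear (fun y => ps Z (ugen y * u)).
    by apply: (lin_comp pl); apply: lin_Mr; exact: lin_ugen.
  exact: (bilin_mul e2l hl).
have inv := tinv bl (vp e); rewrite big_split /= in inv.
apply/eqP; rewrite eq_sym -subr_eq0; apply/eqP; apply: eq_trans inv.
have -> : D1 (ugen (vp e)) * tsum2 Z u =
  \sum_(p <- tt) D1 (ugen (vp e)) * (e2 (ugen p.1) * ps Z (ugen p.2 * u)).
  exact: mulr_sumr.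
pose f1 (p : g * g) := e2 (ugen (lie (vp e) p.1)) * ps Z (ugen p.2 * u).
pose f2 (p : g * g) := e2 (ugen p.1) * ps Z (ugen (lie (vp e) p.2) * u).
refine (eq_trans (sub_sums (k := fun p => f1 p + f2 p) tt _) (big_split _ _ _ f1 f2)).
move=> p; rewrite /f1 /f2 mulrA (mulrA _ _ u) (ugen_swap p.2).
rewrite mulrDl (linD pl) -(mulrA _ _ u) ps_l D1e2 (lie_anti p.2) (linN (@lin_ugen _ g)).
rewrite (mulNr (ugen (lie (vp e) p.2)) u) (linN pl).
move: (ps _ _) (ps _ _) => X Y; rewrite mulrDr mulrN mulrDl !mulrA; zmod_tac.
Qed.

Lemma tsum2_p Z a : tsum2 Z (ip a) = D1 (ip a) * tsum2 Z 1.
Proof.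
have [_ ip1 _] := uincl_hom (pu P); have [_ D11 _] := hD1.
move: a; apply: env_ind_l => [||e a IH].
- have tl : linear (fun a => tsum2 Z (ip a)).
    apply: lin_sumf => p; apply: lin_Ml.
    by apply: (lin_comp (push_lin ht4 t4b Nl Nr Nb Z)); apply: lin_Ml; exact: ipl.
  split; first by rewrite (lin0 tl) (lin0 ipl) (lin0 D1l) mul0r.
  by move=> c u v eu ev; rewrite tl eu ev ipl D1l mulrDl -scalerAl.
- by rewrite ip1 D11 mul1r.
- by rewrite ipM uincl_gen tsum2_l IH D1M mulrA.
Qed.
(** Pushed alone, a letter of $\mathfrak u_-$ gives 0, one of $\mathfrak u_+$ gives $D_1$, and one
    of $\mathfrak l$ gives [t4], that is minus its sum on the strands 3 and 4. These are the terms
    of $-B^{1,2,34}$. *)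
Lemma tsum2_1 b m : tsum2 (bm b m) 1 = - (bm b m * barg2).
Proof.
have [_ ip1 _] := uincl_hom (pu P); have [_ D11 _] := hD1.
have cm u : e2 u * bm b m = bm b m * e2 u by rewrite /bmul mulrA e2e3 -!mulrA e2t4.
have cD u : D1 u * bm b m = bm b m * D1 u by rewrite /bmul mulrA D1e3 -!mulrA D1t4.
have s1 : \sum_(p <- ls) e2 (ugen (vl p.1)) * ps (bm b m) (ugen (vl p.2) * 1) =
    - (bm b m * \sum_(p <- ls) e2 (ugen (vl p.1)) * (e3 (ugen (vl p.2)) + e4 p.2)).
  rewrite mulr_sumr -sumrN; apply: eq_bigr => p _.
  have -> : ps (bm b m) (ugen (vl p.2) * 1) = bm b m * t4 (j (ugen p.2)).
    by have := ps_gen_r (bm b m) 1 p.2; rewrite ip1 D11 !mul1r mulr1.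
  by rewrite t4_gen !mulrN mulrA cm -mulrA.
have s2 : \sum_(p <- ss) e2 (ugen (vp p.1)) * ps (bm b m) (ugen (vm p.2) * 1) = 0.
  apply: big1 => p _.
  have [_ imM im1] := uincl_hom (pv P).
  have := push_val ht4 t4b Nl Nr Nb (bm b m) 1 1 (ugen p.2).
  have [_ il1 _] := uincl_hom (pl P).
  by rewrite ip1 il1 !mul1r uincl_gen mulr1 ueps_gen scale0r => ->; rewrite mulr0.
have s3 : \sum_(p <- ss) e2 (ugen (vm p.2)) * ps (bm b m) (ugen (vp p.1) * 1) =
    bm b m * \sum_(p <- ss) e2 (ugen (vm p.2)) * D1 (ugen (vp p.1)).
  rewrite mulr_sumr; apply: eq_bigr => p _.
  have -> : ps (bm b m) (ugen (vp p.1) * 1) = D1 (ugen (vp p.1)) * bm b m.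
    by rewrite mulr1 -(@uincl_gen _ _ (pu P)) ps_p.
  by rewrite cD mulrA cm mulrA.
rewrite /tsum2 ttE !big_cat !big_map.
refine (eq_trans (congr2 +%R s1 (congr2 +%R s2 s3)) _).
by rewrite add0r /barg2 mulrBr opprB addrC.
Qed.

(** The twist with a letter $z$ inserted in front of $a$. It comes out as $D_1(z)$ on $\mathfrak
    u_+$, as $-e_3(z)$ on $\mathfrak u_-$ by invariance of $K$, and as the image of $z$ under [t4]
    on $\mathfrak l$ by $\mathfrak l$-invariance of the twist. *)
Let Q z := clift3 (fun a b m => ps (bm b m) (ugen z * ip a)) k.
Let trj : tri 0 (fun a b m => D1 (ip a) * bm b m) := fam_tri he3 e30 ht4 t4b Nl Nr Nb.
Let mulB (Z : B) : exists q, bdd q (fun Y : B => Z * Y).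
Proof.
have [q hq] := fil_exh Z; exists q; split; first by apply: lin_Ml; exact: lin_id.
by move=> r Y rY; rewrite addrC; exact: fil_M.
Qed.
Let mulBr (Z : B) : exists q, bdd q (fun Y : B => Y * Z).
Proof.
have [q hq] := fil_exh Z; exists q; split; first by apply: lin_Mr; exact: lin_id.
by move=> r Y rY; exact: fil_M.
Qed.
Let Q_m f : Q (vm f) = - e3 (ugen (vm f)) * J1.
Proof.
have [q hq] := mulB (- e3 (ugen (vm f))).
refine (eq_trans (push_invariance he3 e30 ht4 t4b Nl Nr Nb f) _).
refine (eq_trans _ (esym (clift3_comp hq trj k))); apply: clift3_eq => a b m.
by rewrite /N !mulNr mulrN !mulrA D1e3.
Qed.
Let Q_p e : Q (vp e) = D1 (ugen (vp e)) * J1.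
Proof.
have [q hq] := mulB (D1 (ugen (vp e))).
refine (eq_trans _ (esym (clift3_comp hq trj k))); apply: clift3_eq => a b m.
by rewrite ps_l ps_p.
Qed.
Let Q_l z : Q (vl z) = t4 (j (ugen z)) * J1.
Proof.
have [Dz [Dzl DzE e1]] := F2 z.
have [q hq] := mulBr (t4 (j (ugen z))).
have t1 := tri_comp hq trj.
have t2 : tri 0 (fun a b m => D1 (ip (Dz a)) * bm b m).
  have [h1 h2 h3 h4] := trj; split.
  - by move=> a m; exact: h1.
  - by move=> b' m; exact: (lin_comp (h2 b' m) Dzl).
  - by move=> a b'; exact: h3.
  - by move=> a b' r m; exact: h4.
have t1' := tri_mono (_ : 0 + q <= Order.max (0 + q) 0) t1.
have t2' := tri_mono (_ : 0 <= Order.max (0 + q) 0) t2.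
transitivity (J1 * t4 (j (ugen z)) + clift3 (fun a b m => D1 (ip (Dz a)) * bm b m) k).
  rewrite /J1 (clift3_comp hq trj) -(clift3_D (t1' _) (t2' _)) ?le_max ?lexx ?orbT //.
  apply: clift3_eq => a b m.
  have -> : ugen (vl z) * ip a = ip a * ugen (vl z) + ip (Dz a) by rewrite DzE addrC subrK.
  by rewrite (linD (push_lin ht4 t4b Nl Nr Nb _)) ps_gen_r ps_p.
by rewrite e1 addrC subrK.
Qed.

(** The sum of [e2 (ugen p.1) * Q p.2] over $t$ is computed twice: through [tsum2] it is
    $-J\,B^{1,2,34}$, and through the values of [Q] it is $-(B^{1,2,34}+s^{2,3})J$. *)
Theorem J1_barg : J1 * barg2 = barg2 * J1 +
  (\sum_(p <- ss) e2 (ugen (vp p.1)) * e3 (ugen (vm p.2))) * J1.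
Proof.
have [q hq] := mulBr (- barg2).
have e : J1 * - barg2 = \sum_(p <- tt) e2 (ugen p.1) * Q p.2.
  rewrite /J1 (clift3_comp hq trj).
  have ht p := push_tri he3 e30 ht4 t4b Nl Nr Nb (p : g * g).2.
  rewrite -(clift3_sum tt (fun p => e2 (ugen p.1)) ht); apply: clift3_eq => a b m.
  rewrite -/(tsum2 (bm b m) (ip a)) tsum2_p tsum2_1 !mulrN; congr (- _).
  exact: esym (mulrA _ _ _).
have s1 : \sum_(p <- ls) e2 (ugen (vl p.1)) * Q (vl p.2) =
    - (\sum_(p <- ls) e2 (ugen (vl p.1)) * (e3 (ugen (vl p.2)) + e4 p.2) * J1).
  by rewrite -sumrN; apply: eq_bigr => p _; rewrite Q_l t4_gen mulNr mulrN mulrA.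
have s2 : \sum_(p <- ss) e2 (ugen (vp p.1)) * Q (vm p.2) =
    - (\sum_(p <- ss) e2 (ugen (vp p.1)) * e3 (ugen (vm p.2)) * J1).
  by rewrite -sumrN; apply: eq_bigr => p _; rewrite Q_m mulNr mulrN mulrA.
have s3 : \sum_(p <- ss) e2 (ugen (vm p.2)) * Q (vp p.1) =
    \sum_(p <- ss) e2 (ugen (vm p.2)) * D1 (ugen (vp p.1)) * J1.
  by apply: eq_bigr => p _; rewrite Q_p mulrA.
rewrite ttE !big_cat !big_map in e.
have {s1 s2 s3}e := eq_trans e (congr2 +%R s1 (congr2 +%R s2 s3)).
rewrite -!mulr_suml mulrN in e; move/eqP: e; rewrite eqr_oppLR => /eqP ->.
by rewrite /barg2 mulrBl; zmod_tac.
Qed.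
End Star.
End Push.

Lemma lin_ucop (K : fieldType) (L : lieAlgType K) : linear (@ucop K L).
Proof. by case: (ucop_hom L). Qed.
Lemma ucop_M (K : fieldType) (L : lieAlgType K) (u v : env L) : ucop (u * v) = ucop u * ucop v.
Proof. by case: (ucop_hom L). Qed.
Lemma lin_tens_Mr (K : fieldType) (A B : algType K) (w : tens A B) :
  linear (fun z : tens A B => z * w).
Proof. by apply: lin_Mr; exact: lin_id. Qed.
Lemma lin_tens_Ml (K : fieldType) (A B : algType K) (w : tens A B) :
  linear (fun z : tens A B => w * z).
Proof. by apply: lin_Ml; exact: lin_id. Qed.

(** * The dynamical twist equation *)

Section Push.
Variables (K : fieldType) (g : lieAlgType K) (P : polarized g).
Local Notation Lp := (lie_of (pu P)).
Local Notation Lm := (lie_of (pv P)).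
Local Notation Ll := (lie_of (pl P)).
Local Notation U := (env g).
Local Notation ip := (@uincl K g (pu P)).
Local Notation im := (@uincl K g (pv P)).
Local Notation il := (@uincl K g (pl P)).
Local Notation vp := (@lval K g (pu P)).
Local Notation vm := (@lval K g (pv P)).
Local Notation vl := (@lval K g (pl P)).
Variables (d : nat) (xs ys : d.-tuple g).
Variables (M : compFilAlgType K) (j : env Ll -> M).
Variables (S : comAlgType K) (i : Ll -> S) (sigma : int -> M -> S).
Hypothesis char0 : forall n, n.+1%:R != 0 :> K.
Hypothesis jh : alg_hom j.
Hypothesis jf : forall n u, ufil n u -> fil n (j u).
Hypotheses (bx : basis_of (pu P) xs) (byy : basis_of (pv P) ys).
Hypotheses (hS : is_loc_sym xs ys i) (hsig : is_symbol xs ys j i sigma).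
Variable H : U -> env Ll.
Hypothesis hH : is_HC H.
Variable k : ctens (tens (env Lp) (env Lm)) M.
Hypothesis hk : is_K j H k.

Section Cocycle.
Variables (C E : compFilAlgType K) (e2 e3 DB : U -> C) (tA tB t34 : M -> C) (e4 : Ll -> C).
Hypotheses (he2 : alg_hom e2) (e20 : forall u, fil 0 (e2 u)).
Hypotheses (he3 : alg_hom e3) (e30 : forall u, fil 0 (e3 u)).
Hypotheses (hDB : alg_hom DB) (DB0 : forall u, fil 0 (DB u)).
Hypotheses (htA : alg_antihom tA) (tAb : bdd 0 tA).
Hypotheses (htB : alg_antihom tB) (tBb : bdd 0 tB).
Hypotheses (ht34 : alg_antihom t34) (t34b : bdd 0 t34).
Hypothesis DB_gen : forall z, DB (ugen z) = e2 (ugen z) + e3 (ugen z).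
Hypothesis tA_gen : forall z,
  tA (j (ugen z)) = - (e2 (ugen (vl z)) + (e3 (ugen (vl z)) + e4 z)).
Hypothesis t34_gen : forall z, t34 (j (ugen z)) = - (e3 (ugen (vl z)) + e4 z).
Hypothesis tAB : forall h, tA (j h) = tB (j h).
Hypothesis e3e2 : forall u v, e3 u * e2 v = e2 v * e3 u.
Hypothesis e4e2 : forall z u, e4 z * e2 u = e2 u * e4 z.
Hypothesis t34e2 : forall m u, t34 m * e2 u = e2 u * t34 m.
Variables (in1 : env Lp -> E) (in2 : C -> E) (Pr : U -> E -> C).
Hypotheses (in1h : alg_hom in1) (in10 : forall a, fil 0 (in1 a)).
Hypotheses (in2h : alg_hom in2) (in2b : bdd 0 in2).
Hypothesis Prb : forall u, bnd (Pr u).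
Hypothesis PrE : forall u a Z, Pr u (in1 a * in2 Z) = Z * tB (j (H (u * ip a))).
Hypothesis Pr_in : forall u a Z Y, Pr u (in1 a * in2 Z * Y) = Z * Pr (u * ip a) Y.
Hypothesis nd : forall X, (forall b, Pr (im b) X = 0) -> X = 0.
Local Notation J4 := (J1 k e2 e3 t34).
Hypothesis J4c : forall h, J4 * tB (j h) = tB (j h) * J4.

Let rv := rho_tri_val char0 jh jf bx byy hS hsig hH hk.
Let rl := rho_lin jh jf hH k.
Let e2l : linear e2. Proof. by case: he2. Qed.
Let e21 : e2 1 = 1. Proof. by case: he2. Qed.
Let e2M u v : e2 (u * v) = e2 u * e2 v. Proof. by case: he2. Qed.
Let ipl : linear ip. Proof. by case: (uincl_hom (pu P)). Qed.
Let ipM u v : ip (u * v) = ip u * ip v. Proof. by case: (uincl_hom (pu P)). Qed.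
Let in2l : linear in2. Proof. by case: in2h. Qed.
Let in2M u v : in2 (u * v) = in2 u * in2 v. Proof. by case: in2h. Qed.
Let in1l : linear in1. Proof. by case: in1h. Qed.
Local Notation BA := (Bh j H k e2 tA).
Local Notation bm := (bmul (P := P) (M := M) e3 t34).

Let BAl : linear BA. Proof. exact: (Bh_lin he2 e20 htA tAb rl). Qed.
Let BAf u f : BA (u * ugen (vm f)) = - e2 (ugen (vm f)) * BA u.
Proof. exact: (Bh_f rv he2 e20 htA tAb rl). Qed.
Let BAx u z : BA (u * ugen (vl z)) = tA (j (ugen z)) * BA u.
Proof.
apply: (Bh_xr jh rv he2 e20 htA tAb tA_gen _ rl) => w v.
by rewrite mulrDl mulrDr e3e2 e4e2.
Qed.

(* The left coproduct of the dynamical variable, tested against [x]. *)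
Definition cop_test (x : U) (Z : C) (z : tens U U) : C :=
  tlift (fun u v => e2 v * Z * BA (x * u)) z.
Let ct_bilin x Z : bilin (fun u v => e2 v * Z * BA (x * u)).
Proof.
apply: (bilin_mul_op (f := fun u => BA (x * u)) (h := fun v => e2 v * Z)).
  by apply: (lin_comp BAl); apply: lin_Ml; exact: lin_id.
by apply: lin_Mr.
Qed.
Let ct_lin x Z : linear (cop_test x Z). Proof. exact: tlift_linear (ct_bilin x Z). Qed.
Let ct_pure x Z u v : cop_test x Z (tpure u v) = e2 v * Z * BA (x * u).
Proof. exact: tlift_pure (ct_bilin x Z). Qed.
Let ct_Z x z : linear (cop_test x ^~ z).
Proof.
move=> c Y Y'; move: z; apply: tens_lin_ext; first exact: ct_lin.
  by apply: lin_D; [apply: lin_Z|]; exact: ct_lin.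
by move=> u v; rewrite !ct_pure mulrDr mulrDl -scalerAr -scalerAl.
Qed.
Let ucl : linear (@ucop K g) := @lin_ucop K g.
Let ucM := @ucop_M K g.
Let commutes (Z : C) := forall u, Z * e2 u = e2 u * Z.

(** The letter $f$ on the tested leg comes out as $-e_2(f)$, which cancels the other term of its
    coproduct. *)
Let ct_f x Z z f : commutes Z ->
  cop_test x Z (z * (tpure (ugen (vm f)) 1 + tpure 1 (ugen (vm f)))) = 0.
Proof.
move=> cZ; move: z; apply: (tens_lin_ext (h := fun=> 0)).
- exact: (lin_comp (ct_lin x Z) (lin_tens_Mr _)).
- exact: lin_cst0.
- move=> u v; rewrite mulrDr !tpureM !mulr1 (linD (ct_lin x Z)) !ct_pure (mulrA x) BAf e2M.
  by rewrite mulNr mulrN -(mulrA (e2 v) _ Z) -(cZ (ugen (vm f))) !mulrA addNr.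
Qed.
(** The tested leg gives $-(e_2+e_3+e_4)$ and the other leg of the coproduct gives $e_2$; what
    remains is the antipode on the strands 3 and 4. *)
Let ct_x x Z z w : commutes Z ->
  cop_test x Z (z * (tpure (ugen (vl w)) 1 + tpure 1 (ugen (vl w)))) =
  cop_test x (Z * t34 (j (ugen w))) z.
Proof.
move=> cZ; move: z; apply: tens_lin_ext.
- exact: (lin_comp (ct_lin x Z) (lin_tens_Mr _)).
- exact: ct_lin.
- move=> u v; rewrite mulrDr !tpureM !mulr1 (linD (ct_lin x Z)) !ct_pure (mulrA x) BAx e2M.
  rewrite -(mulrA (e2 v) _ Z) -(cZ (ugen (vl w))) tA_gen t34_gen.
  set b := BA _; set q := e2 (ugen _); set r := e3 _ + e4 _.
  rewrite !mulrA -mulrDl; congr (_ * _); rewrite -!mulrA -!mulrDr; congr (_ * (_ * _)).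
  zmod_tac.
Qed.
Let commM Z h : commutes Z -> commutes (Z * t34 (j h)).
Proof. by move=> cZ u; rewrite -mulrA t34e2 mulrA cZ mulrA. Qed.
Let ct_im x Z u b : commutes Z ->
  cop_test x Z (ucop (u * im b)) = (ueps b : K) *: cop_test x Z (ucop u).
Proof.
move=> cZ; have [iml im1 imM] := uincl_hom (pv P); have [el _ _] := ueps_hom Lm.
move: b; apply: env_ind_r => [||f b IH].
- split; first by rewrite (lin0 iml) mulr0 (lin0 ucl) (lin0 (ct_lin x Z)) (lin0 el) scale0r.
  move=> c v w ev ew; rewrite iml mulrDr -scalerAr ucl (ct_lin x Z) ev ew el.
  by rewrite scalerDl scalerA.
- by rewrite im1 mulr1 ueps_1 scale1r.
- by rewrite imM uincl_gen mulrA ucM ucop_gen ct_f // ueps_genr scale0r.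
Qed.
Let ct_il x Z u h : commutes Z ->
  cop_test x Z (ucop (u * il h)) = cop_test x (Z * t34 (j h)) (ucop u).
Proof.
have [ill il1 ilM] := uincl_hom (pl P); have [tl t1 tM] := ht34; have [jl j1 jM] := jh.
move: h Z; apply: (env_ind_r (S := fun h => forall Z, commutes Z ->
  cop_test x Z (ucop (u * il h)) = cop_test x (Z * t34 (j h)) (ucop u))) => [||z h IH Z cZ].
- split=> [Z cZ|c v w ev ew Z cZ].
    rewrite (lin0 ill) mulr0 (lin0 ucl) (lin0 (ct_lin x Z)) (lin0 jl) (lin0 tl) mulr0.
    by rewrite (lin0 (ct_Z x _)).
  rewrite ill mulrDr -scalerAr ucl (ct_lin x Z) ev // ew // jl tl mulrDr -scalerAr.
  by rewrite (ct_Z x).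
- by move=> Z cZ; rewrite il1 mulr1 j1 t1 mulr1.
- rewrite ilM uincl_gen mulrA ucM ucop_gen ct_x // IH; last exact: commM.
  by rewrite jM tM mulrA.
Qed.

Let N x (a : env Lp) (Z : C) : C := cop_test x Z (ucop (ip a)).
Let Nl x Z : linear (N x ^~ Z).
Proof. exact: (lin_comp (ct_lin x Z) (lin_comp ucl ipl)). Qed.
Let Nr x a : linear (N x a). Proof. exact: ct_Z. Qed.
Let ucop_ip a : ucop (ip a) = tmap ip ip (ucop a).
Proof.
have hh := uincl_hom (pu P).
apply: (env_hom_ext (f := fun a => ucop (ip a)) (h := fun a => tmap ip ip (ucop a))).
- exact: alg_hom_comp (ucop_hom g) hh.
- exact: alg_hom_comp (tmap_hom hh hh) (ucop_hom _).
- have [_ ip1 _] := hh; move=> e; rewrite uincl_gen !ucop_gen (linD (tmap_lin ipl ipl)).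
  by rewrite !tmap_pure // uincl_gen ip1.
Qed.
Let Nb x : exists q, forall r a Z, fil r Z -> fil (r + q) (N x a Z).
Proof.
have [q hq] := Bh_bound k jh jf hH he2 e20 htA tAb x; exists q => r a Z rZ.
rewrite /N ucop_ip; move: (ucop a); apply: tens_ind.
  have tl := tmap_lin ipl ipl.
  split; first by rewrite (lin0 tl) (lin0 (ct_lin x Z)); exact: fil_0.
  by move=> c u v eu ev; rewrite tl (ct_lin x Z); exact: fil_L.
move=> u v; rewrite tmap_pure // ct_pure; apply: fil_M => //.
by rewrite -[r]add0r; exact: fil_M.
Qed.

Let commbm b m : commutes (bm b m).
Proof. by move=> u; rewrite /bmul -mulrA t34e2 mulrA e3e2 mulrA. Qed.

(** By [ct_im] and [ct_il], the test of a coproduct transforms under right multiplication by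
    $U(\mathfrak l)$ and $U(\mathfrak u_-)$ as [push] does, and both agree on $U(\mathfrak u_+)$. *)
Lemma push_cop x b m u : push j H k t34 (N x) (bm b m) u = cop_test x (bm b m) (ucop u).
Proof.
have [q hq] := Nb x.
have pl := push_lin jh jf hH k ht34 t34b (Nl x) (Nr x) hq (bm b m).
move: (tri_span P u).
apply: (spanned_ext (f := push j H k t34 (N x) (bm b m)) (h := fun u => cop_test x (bm b m) (ucop u))).
- exact: pl.
- exact: (lin_comp (ct_lin x _) ucl).
- move=> v [a [h [b' ->]]].
  rewrite (push_val char0 jh jf bx byy hS hsig hH hk ht34 t34b (Nl x) (Nr x) hq).
  by rewrite ct_im // ct_il.
Qed.
Let ct_xf x f Z z : cop_test (x * ugen (vm f)) Z z =
  cop_test x Z ((tpure (ugen (vm f)) 1 + tpure 1 (ugen (vm f))) * z) -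
  e2 (ugen (vm f)) * cop_test x Z z.
Proof.
move: z; apply: tens_lin_ext.
- exact: ct_lin.
- apply: lin_B; last by apply: lin_Ml; exact: ct_lin.
  exact: (lin_comp (ct_lin x Z) (lin_tens_Ml _)).
- move=> u v; rewrite mulrDl !tpureM !mul1r (linD (ct_lin x Z)) !ct_pure e2M !mulrA.
  by rewrite addrK.
Qed.

Let F x := clift3 (fun a b m => N x a (bm b m)) k.
Let Nct x a Z : N x a Z = cop_test x Z (ucop (ip a)). Proof. by []. Qed.
Let mulB (Z : C) : exists q, bdd q (fun Y : C => Z * Y).
Proof.
have [q hq] := fil_exh Z; exists q; split; first by apply: lin_Ml; exact: lin_id.
by move=> r Y rY; rewrite addrC; exact: fil_M.
Qed.
Let ct_e3 x w z Z : cop_test x (e3 w * Z) z = e3 w * cop_test x Z z.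
Proof.
move: z; apply: tens_lin_ext.
- exact: ct_lin.
- by apply: lin_Ml; exact: ct_lin.
- by move=> u v; rewrite !ct_pure !mulrA e3e2.
Qed.
(** By [push_cop] the coproduct of $f$ splits the pushed letter between the test element and the
    strand 2, and [push_invariance] turns it into $-e_3(f)$. Altogether $f$ comes out as
    $-(e_2(f)+e_3(f))$. *)
Let F_f x f : F (x * ugen (vm f)) = - DB (ugen (vm f)) * F x.
Proof.
have [q hq] := Nb x.
have ht := fam_tri he3 e30 ht34 t34b (Nl x) (Nr x) hq.
have hp := push_tri char0 jh jf bx byy hS hsig hH hk he3 e30 ht34 t34b (Nl x) (Nr x) hq (vm f).
have inv := push_invariance char0 jh jf bx byy hS hsig hH hk he3 e30 ht34 t34b (Nl x) (Nr x) hq f.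
have [r2 h2] := mulB (- e2 (ugen (vm f))).
have [r3 h3] := mulB (- e3 (ugen (vm f))).
have t2 := tri_comp h2 ht.
have t1' : tri (Order.max (1 + q) (q + r2))
    (fun a b m => push j H k t34 (N x) (bm b m) (ugen (vm f) * ip a)).
  by apply: tri_mono hp; rewrite le_max lexx.
have t2' : tri (Order.max (1 + q) (q + r2)) (fun a b m => - e2 (ugen (vm f)) * N x a (bm b m)).
  by apply: tri_mono t2; rewrite le_max lexx orbT.
have e1 : F (x * ugen (vm f)) =
  clift3 (fun a b m => push j H k t34 (N x) (bm b m) (ugen (vm f) * ip a)) k +
  - e2 (ugen (vm f)) * F x.
  refine (eq_trans _ (eq_trans (clift3_D t1' t2' k) (congr1 _ (esym (clift3_comp h2 ht k))))).
  by apply: clift3_eq => a b m; rewrite push_cop !Nct ct_xf ucM ucop_gen mulNr.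
rewrite e1 inv DB_gen opprD mulrDl addrC; congr (_ + _).
refine (eq_trans _ (esym (clift3_comp h3 ht k))); apply: clift3_eq => a b m.
by rewrite !Nct !mulNr (linN (ct_Z x _)) ct_e3.
Qed.
(** Tested against 1, the first leg of the coproduct of $a$ reduces to its counit, so $a$ itself
    lands on the strand 2. *)
Let F_1 : F 1 = J4.
Proof.
apply: clift3_eq => a b m; rewrite Nct ucop_ip.
have tl := tmap_lin ipl ipl.
have cu : tlift (fun u v => (ueps u : K) *: v) (ucop a) = a.
  have bl : bilin (fun (u v : env Lp) => (ueps u : K) *: v).
    have [el _ _] := ueps_hom Lp; split=> u; first by apply: lin_Z; exact: lin_id.
    by move=> c v w /=; rewrite el scalerDl scalerA.
  have [_ u1 uM] := ucop_hom Lp.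
  move: a; apply: (env_hom_ext (f := fun a => tlift (fun u v => (ueps u : K) *: v) (ucop a)) (h := id)).
  - split; first exact: (lin_comp (tlift_linear bl) (@lin_ucop K Lp)).
      by rewrite u1 (tlift_pure _ _ bl) ueps_1 scale1r.
    move=> u v; rewrite uM; have [s ->] := tensE (ucop u); have [s' ->] := tensE (ucop v).
    have tll := tlift_linear bl.
    rewrite mulr_suml !(lin_sum tll) mulr_suml; apply: eq_bigr => p _.
    rewrite mulr_sumr (lin_sum tll) mulr_sumr; apply: eq_bigr => r _.
    have [_ _ eM] := ueps_hom Lp.
    by rewrite tpureM !(tlift_pure _ _ bl) eM -scalerAl -scalerAr scalerA.
  - by split.
  - move=> e; rewrite ucop_gen (linD (tlift_linear bl)) !(tlift_pure _ _ bl).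
    by rewrite ueps_gen ueps_1 scale0r scale1r add0r.
rewrite -{2}cu; move: (ucop a); apply: tens_lin_ext.
- exact: (lin_comp (ct_lin 1 _) tl).
- apply: lin_Mr; apply: (lin_comp e2l); apply: (lin_comp ipl).
  apply: tlift_linear; have [el _ _] := ueps_hom Lp.
  split=> u; first by apply: lin_Z; exact: lin_id.
  by move=> c v w /=; rewrite el scalerDl scalerA.
- move=> u v; rewrite tmap_pure // ct_pure mul1r tlift_pure; last first.
    have [el _ _] := ueps_hom Lp.
    split=> w; first by apply: lin_Z; exact: lin_id.
    by move=> c w1 w2 /=; rewrite el scalerDl scalerA.
  have -> : BA (ip u) = (ueps u : K) *: 1.
    rewrite -[ip u]mulr1 (Bh_1p rv he2 e20 htA tAb rl).
    by rewrite (Bh_1 jh rv he2 e20 htA tAb).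
  by rewrite -scalerAr mulr1 (linZ ipl) (linZ e2l) -scalerAl.
Qed.

Let F_lin : linear F.
Proof.
move=> c u v; have [q1 h1] := Nb u; have [q2 h2] := Nb v.
have t1 := fam_tri he3 e30 ht34 t34b (Nl u) (Nr u) h1.
have t2 := fam_tri he3 e30 ht34 t34b (Nl v) (Nr v) h2.
have t1' : tri (Order.max q1 q2) (fun a b m => N u a (bm b m)).
  by apply: tri_mono t1; rewrite le_max lexx.
have t2' : tri (Order.max q1 q2) (fun a b m => N v a (bm b m)).
  by apply: tri_mono t2; rewrite le_max lexx orbT.
refine (eq_trans _ (clift3_lin c t1' t2' k)); apply: clift3_eq => a b m; rewrite !Nct.
move: (ucop (ip a)); apply: tens_lin_ext.
- exact: ct_lin.
- by apply: lin_D; [apply: lin_Z|]; exact: ct_lin.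
- by move=> w w'; rewrite !ct_pure mulrDl -scalerAl BAl mulrDr -scalerAr.
Qed.

(** The coproduct of $a$ on legs 1 and 2, with leg 1 kept in $U(\mathfrak u_+)$ so that tests still
    apply. *)
Definition copin (a : env Lp) : E := tlift (fun u v => in1 u * in2 (e2 (ip v))) (ucop a).
Lemma copin_bilin : bilin (fun (u v : env Lp) => in1 u * in2 (e2 (ip v))).
Proof. exact: (bilin_mul in1l (lin_comp in2l (lin_comp e2l ipl))). Qed.
Let copin_lin : linear copin.
Proof. exact: (lin_comp (tlift_linear copin_bilin) (@lin_ucop K Lp)). Qed.
Let in2f q Z : fil q Z -> fil q (in2 Z).
Proof. by move=> qZ; have := in2b.2 _ _ qZ; rewrite addr0. Qed.
Let copin_fil a : fil 0 (copin a).
Proof.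
rewrite /copin; move: (ucop a); apply: tens_ind.
  have tl := tlift_linear copin_bilin; split; first by rewrite (lin0 tl); exact: fil_0.
  by move=> c u v eu ev; rewrite tl; exact: fil_L.
move=> u v; rewrite (tlift_pure _ _ copin_bilin) -[0]add0r; apply: fil_M => //.
exact: in2f.
Qed.
Definition J12 : E := clift3 (fun a b m => copin a * in2 (bm b m)) k.
Lemma J12_tri : tri 0 (fun a b m => copin a * in2 (bm b m)).
Proof.
split.
- by move=> a m; apply: lin_Ml; apply: (lin_comp in2l); exact: bmul_l.
- by move=> b m; apply: lin_Mr.
- by move=> a b; apply: lin_Ml; apply: (lin_comp in2l); exact: bmul_r.
- move=> a b q m qm; rewrite addrC; apply: fil_M => //; apply: in2f.
  exact: bmul_fil.
Qed.
Local Notation JA := (Jp k e2 tA in1 in2).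
Local Notation JB := (Jp k DB tB in1 in2).
Let PrEA u a Z : Pr u (in1 a * in2 Z) = Z * tA (j (H (u * ip a))).
Proof. by rewrite tAB PrE. Qed.
Let Prl u : linear (Pr u) := bnd_lin (Prb u).
Let PrJA u : Pr u JA = BA u.
Proof. exact: (Pr_J k jh jf hH he2 e20 htA tAb in1h in10 in2h in2b Prb PrEA). Qed.
Let Pr_copin u a Z : Pr u (copin a * in2 Z * JA) = N u a Z.
Proof.
rewrite Nct ucop_ip /copin; move: (ucop a); apply: tens_lin_ext.
- apply: (lin_comp (Prl u)); do 2 apply: lin_Mr; exact: tlift_linear copin_bilin.
- exact: (lin_comp (ct_lin u Z) (tmap_lin ipl ipl)).
- move=> v w; rewrite (tlift_pure _ _ copin_bilin) (tmap_pure ipl ipl) ct_pure.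
  by rewrite -(mulrA (in1 v)) -in2M Pr_in PrJA.
Qed.
Let Pr_J12 u : Pr u (J12 * JA) = F u.
Proof.
have [r hr] : bnd (fun X : E => Pr u (X * JA)).
  by apply: (bnd_comp (Prb u)); apply: bnd_Mr; exact: bnd_id.
refine (eq_trans (clift3_comp hr J12_tri k) _); apply: clift3_eq => a b m.
exact: Pr_copin.
Qed.

(** Against $b$ the right side gives $D(S(b))\,J^{2,3,4}$ with $D$ the sum of the strands 2 and 3,
    by [Pr_JB] and the $\mathfrak l$-invariance of $J^{2,3,4}$. The left side has the same value at
    1 by [F_1] and obeys the same recursion on letters of $\mathfrak u_-$ by [F_f]. *)
Theorem twist_cocycle : J12 * JA = JB * in2 J4.
Proof.
apply/eqP; rewrite -subr_eq0; apply/eqP; apply: nd => b.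
rewrite (linB (Prl _)) Pr_J12.
rewrite (Pr_JB k jh jf hH hDB DB0 htB tBb in1h in10 in2h in2b Prb PrE (im b) J4c).
rewrite (Bh_m jh rv hDB DB0 htB tBb); apply/eqP; rewrite subr_eq0; apply/eqP.
have [iml im1 imM] := uincl_hom (pv P); have [Sl S1 SM] := uant_antihom g.
have [DBl DB1 DBM] := hDB.
move: b; apply: env_ind_r => [||f b IH].
- split; first by rewrite (lin0 iml) (lin0 F_lin) (lin0 (beta_lin hDB)) mul0r.
  by move=> c u v eu ev; rewrite iml F_lin eu ev (beta_lin hDB) mulrDl -scalerAl.
- by rewrite im1 F_1 /beta im1 S1 DB1 mul1r.
- by rewrite imM uincl_gen F_f IH beta_r // mulrA.
Qed.
Lemma copin_map (B : compFilAlgType K) (G : E -> B) : alg_hom G ->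
  forall a, G (copin a) = tlift (fun u v => G (in1 u) * G (in2 (e2 (ip v)))) (ucop a).
Proof.
move=> [Gl _ GM] a; rewrite /copin (tlift_comp Gl copin_bilin).
by apply: tlift_eq => u v; rewrite GM.
Qed.
End Cocycle.
End Push.

(** * Tests with $\mathfrak l$ acting through a twisted antipode *)

Section Twisted.
Variables (K : fieldType) (g : lieAlgType K) (P : polarized g).
Local Notation Lp := (lie_of (pu P)).
Local Notation Lm := (lie_of (pv P)).
Local Notation Ll := (lie_of (pl P)).
Local Notation U := (env g).
Local Notation ip := (@uincl K g (pu P)).
Local Notation im := (@uincl K g (pv P)).
Local Notation il := (@uincl K g (pl P)).
Local Notation vp := (@lval K g (pu P)).
Local Notation vm := (@lval K g (pv P)).
Local Notation vl := (@lval K g (pl P)).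
Variables (d : nat) (xs ys : d.-tuple g).
Variables (M : compFilAlgType K) (j : env Ll -> M).
Variables (S : comAlgType K) (i : Ll -> S) (sigma : int -> M -> S).
Hypothesis char0 : forall n, n.+1%:R != 0 :> K.
Hypothesis jh : alg_hom j.
Hypothesis jf : forall n u, ufil n u -> fil n (j u).
Hypotheses (bx : basis_of (pu P) xs) (byy : basis_of (pv P) ys).
Hypotheses (hS : is_loc_sym xs ys i) (hsig : is_symbol xs ys j i sigma).
Variable H : U -> env Ll.
Hypothesis hH : is_HC H.


Variables (W : algType K) (tau : M -> ctens W M) (nu : Ll -> W).
Hypotheses (htau : alg_antihom tau) (taub : bdd 0 tau).
Hypothesis tau_gen : forall z,
  tau (j (ugen z)) = - (cpure (nu z) 1 + cpure 1 (j (ugen z))).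
Local Notation C := (ctens W M).
Local Notation E := (ctens (tens (env Lp) W) M).
Local Notation i1 := (@in1 K g P M W).
Local Notation i2 := (@in2 K g P M W).
Let tl : linear tau. Proof. by case: htau. Qed.
Let tM u v : tau (u * v) = tau v * tau u. Proof. by case: htau. Qed.
Let jl : linear j. Proof. by case: jh. Qed.
Let jM u v : j (u * v) = j u * j v. Proof. by case: jh. Qed.

Definition tact (u : env Ll) (Z : C) : C := Z * tau (j u).
Let tactl Z : linear (tact^~ Z).
Proof. by apply: lin_Ml; exact: (lin_comp tl jl). Qed.
Let tactr u : linear (tact u). Proof. by apply: lin_Mr; exact: lin_id. Qed.
Let tactb n q u Z : ufil n u -> fil q Z -> fil (q + n) (tact u Z).
Proof.
by move=> un qZ; apply: fil_M => //; have := taub.2 _ _ (jf un); rewrite addr0.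
Qed.
Definition tpr (u : U) : E -> C := pr H tact u.
Lemma tpr_bnd u : bnd (tpr u). Proof. exact: (pr_bnd hH tactl tactr tactb). Qed.
Lemma tpr_in12 u a Z : tpr u (i1 a * i2 Z) = Z * tau (j (H (u * ip a))).
Proof. exact: (pr_in12 hH tactl tactr tactb). Qed.
Lemma tpr_in u a Z Y : tpr u (i1 a * i2 Z * Y) = Z * tpr (u * ip a) Y.
Proof.
have [_ _ ipM] := uincl_hom (pu P).
have [_ _ i1M] := @in1_hom _ _ P M W; have [_ _ i2M] := @in2_hom _ _ P M W.
move: Y; apply: ctens2_ext.
- by apply: (bnd_comp (tpr_bnd u)); apply: bnd_Ml; exact: bnd_id.
- by apply: bnd_Ml; exact: tpr_bnd.
- move=> a' w m.
  have -> : i1 a * i2 Z * cpure (tpure a' w) m = i1 (a * a') * i2 (Z * cpure w m).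
    by rewrite i1M i2M -in12_pure !mulrA -(mulrA (i1 a) (i1 a') (i2 Z)) (in12 a' Z) !mulrA.
  by rewrite -in12_pure !tpr_in12 ipM !mulrA.
Qed.
(** Since $\tau(z)=-(\nu(z)+z)$ with $\nu(z)$ of degree 0 and the graded algebra is commutative,
    right multiplication by $\tau(z)$ is minus left multiplication by $z$ up to lower degree. *)
Lemma tpr_nd X : (forall b, tpr (im b) X = 0) -> X = 0.
Proof.
have [_ j1 _] := jh; have [_ t1 _] := htau.
apply: (nd_left char0 jh jf bx byy hS hsig hH (eps := -1)) => //.
- by rewrite mulrNN mulr1.
- by move=> Z; rewrite /tact j1 t1 mulr1.
- by move=> u v Z; rewrite /tact jM tM mulrA.
- move=> z q Z qZ; rewrite /tact tau_gen scaleN1r opprK.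
  have -> : Z * - (cpure (nu z) 1 + cpure 1 (j (ugen z))) + cpure 1 (j (ugen z)) * Z =
    (cpure 1 (j (ugen z)) * Z - Z * cpure 1 (j (ugen z))) - Z * cpure (nu z) 1.
    by rewrite mulrN mulrDr; zmod_tac.
  apply: fil_B.
    have -> : q = 1 + q - 1 by rewrite addrC addrA addNr add0r.
    apply: (@cpure_comm_gr _ M) => //; first by move=> *; exact: (gr_comm hsig).
    by apply: jf; exact: degle_gen.
  rewrite -[q]addr0; apply: fil_M => //; apply: cpure_fil; exact: fil_1.
Qed.
End Twisted.

(** * Formal series in $\hbar$ and their inverses *)

Section SeriesMonoid.
Variables (K : fieldType) (A : algType K).
Implicit Types f h : nat -> A.

(** A coefficient of a product depends on finitely many others, so associativity is inherited from
    polynomials. *)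
Let trunc (N : nat) f : {poly A} := \poly_(i < N.+1) f i.
Let truncE N f i : (i <= N)%N -> (trunc N f)`_i = f i.
Proof. by move=> iN; rewrite coef_poly ltnS iN. Qed.

Lemma smul_coef N f h n : (n <= N)%N -> smul f h n = (trunc N f * trunc N h)`_n.
Proof.
move=> nN; rewrite coefM; apply: eq_bigr => i _; rewrite !truncE //.
  exact: leq_trans (leq_subr _ _) nN.
by apply: leq_trans nN; rewrite -ltnS.
Qed.
Lemma smulA f h k : smul f (smul h k) = smul (smul f h) k.
Proof.
apply/funext=> n; have le_n (i : 'I_n.+1) : (i <= n)%N by rewrite -ltnS.
transitivity ((trunc n f * (trunc n h * trunc n k))`_n).
  rewrite coefM; apply: eq_bigr => i _.
  by rewrite truncE // (smul_coef _ _ (leq_subr i n)).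
rewrite mulrA coefM; apply: eq_bigr => i _.
by rewrite truncE ?leq_subr // (smul_coef _ _ (le_n i)).
Qed.
(* The constant series, so that products with a fixed element are [smul]s. *)
Definition scst (a : A) : nat -> A := fun n => if n == 0%N then a else 0.
Lemma smul_scstl a f : smul (scst a) f = fun n => a * f n.
Proof.
apply/funext=> n; rewrite /smul big_ord_recl subn0 big1 ?addr0 // => i _.
by rewrite /scst /= mul0r.
Qed.
Lemma smul_scstr a f : smul f (scst a) = fun n => f n * a.
Proof.
apply/funext=> n; rewrite /smul big_ord_recr /= subnn big1 => [|i _]; first exact: add0r.
by rewrite /scst subn_eq0 leqNgt ltn_ord mulr0.
Qed.
Lemma sone_scst : @sone K A = scst 1.
Proof. by apply/funext=> -[|n]. Qed.
Lemma smul1 f : smul f (@sone K A) = f.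
Proof. by rewrite sone_scst smul_scstr; apply/funext=> n; rewrite mulr1. Qed.
Lemma sone_mul f : smul (@sone K A) f = f.
Proof. by rewrite sone_scst smul_scstl; apply/funext=> n; rewrite mul1r. Qed.
Lemma smulBl f h k : smul (fun n => f n - h n) k = fun n => smul f k n - smul h k n.
Proof.
by apply/funext=> n; rewrite /smul -sumrB; apply: eq_bigr => i _; rewrite mulrBl.
Qed.
Lemma smulBr f h k : smul k (fun n => f n - h n) = fun n => smul k f n - smul k h n.
Proof.
by apply/funext=> n; rewrite /smul -sumrB; apply: eq_bigr => i _; rewrite mulrBr.
Qed.

Section Inverse.
Variable f : nat -> A.
Hypothesis f0 : f 0%N = 1.
Let h : nat -> A := fun m => @sone K A m - f m.
Let pw k := iter k (smul h) (@sone K A).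
Let pw_van k n : (n < k)%N -> pw k n = 0.
Proof.
elim: k n => // k IH n nk; rewrite /pw /= -/(pw k) /smul big1 // => i _.
case: (posnP i) => [->|i0]; first by rewrite /h f0 subrr mul0r.
have i_n : (i <= n)%N by rewrite -ltnS.
have nk' : (n <= k)%N by rewrite -ltnS.
rewrite IH ?mulr0 //; apply: leq_trans nk'.
by rewrite ltn_subrL i0 (leq_trans i0 i_n).
Qed.
(** The $k$-th power of a series without constant term starts in degree $k$; adding further powers
    does not change the coefficient, and sums of a common length can be exchanged and telescoped. *)
Let sinvE N n : (n < N)%N -> sinv f n = \sum_(k < N) pw k n.
Proof.
move=> nN; rewrite /sinv -!(big_mkord xpredT (fun k => pw k n)).
rewrite (big_cat_nat (leq0n n.+1) nN) [X in _ = _ + X]big_nat [X in _ = _ + X]big1 ?addr0 //.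
by move=> i /andP[ni _]; exact: pw_van.
Qed.
Let fE : f = fun n => @sone K A n - h n.
Proof. by apply/funext=> n; rewrite /h subKr. Qed.
Let pw_comm k : smul (pw k) h = pw k.+1.
Proof.
elim: k => [|k IH]; first by rewrite /pw /= smul1 sone_mul.
by rewrite [pw k.+1]/= -smulA -/(pw k) IH.
Qed.
Let smul_sum_r n : smul h (sinv f) n = \sum_(k < n.+1) pw k.+1 n.
Proof.
rewrite /smul; transitivity (\sum_(i < n.+1) \sum_(k < n.+1) h i * pw k (n - i)%N).
  by apply: eq_bigr => i _; rewrite -mulr_sumr -sinvE // ltnS leq_subr.
by rewrite exchange_big.
Qed.
Let smul_sum_l n : smul (sinv f) h n = \sum_(k < n.+1) pw k.+1 n.
Proof.
rewrite /smul; transitivity (\sum_(i < n.+1) \sum_(k < n.+1) pw k i * h (n - i)%N).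
  by apply: eq_bigr => i _; rewrite -mulr_suml -sinvE.
by rewrite exchange_big; apply: eq_bigr => k _; rewrite -pw_comm.
Qed.
Let tele n : \sum_(k < n.+1) pw k n - \sum_(k < n.+1) pw k.+1 n = @sone K A n.
Proof.
rewrite -opprB -sumrB -(big_mkord xpredT (fun k => pw k.+1 n - pw k n)).
by rewrite (telescope_sumr (fun k => pw k n)) // pw_van // sub0r opprK.
Qed.
Lemma smulV : smul f (sinv f) = @sone K A.
Proof.
by rewrite {1}fE smulBl sone_mul; apply/funext=> n; rewrite smul_sum_r (@sinvE n.+1) // tele.
Qed.
Lemma sVmul : smul (sinv f) f = @sone K A.
Proof.
by rewrite {2}fE smulBr smul1; apply/funext=> n; rewrite smul_sum_l (@sinvE n.+1) // tele.
Qed.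
End Inverse.

Lemma smul_0 f h : f 0%N = 1 -> h 0%N = 1 -> smul f h 0%N = 1.
Proof. by move=> f0 h0; rewrite /smul big_ord1 f0 h0 mulr1. Qed.
Lemma sinvM f h : f 0%N = 1 -> h 0%N = 1 -> sinv (smul f h) = smul (sinv h) (sinv f).
Proof.
move=> f0 h0; rewrite -[LHS]smul1 -(smulV f0) -[X in smul _ (smul X _)]smul1 -(smulV h0).
rewrite (smulA f) -(smulA _ (sinv h)) smulA sVmul; last exact: smul_0.
by rewrite sone_mul.
Qed.
Lemma sinv_comm a f h : f 0%N = 1 -> h 0%N = 1 -> (forall n, a * f n = h n * a) ->
  forall n, a * sinv f n = sinv h n * a.
Proof.
move=> f0 h0 e n.
have e' : smul (scst a) f = smul h (scst a).
  by rewrite smul_scstl smul_scstr; apply/funext.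
suff : smul (scst a) (sinv f) = smul (sinv h) (scst a).
  by rewrite smul_scstl smul_scstr => /(congr1 (fun F => F n)).
rewrite -[LHS]sone_mul -(sVmul h0) -smulA (smulA h) -e' -(smulA _ f) (smulV f0).
by rewrite smul1.
Qed.
End SeriesMonoid.

Section SeriesMaps.
Variables (K : fieldType) (A B : algType K) (F : A -> B).
Hypothesis hF : alg_hom F.
Let Fl : linear F. Proof. by case: hF. Qed.
Let F1 : F 1 = 1. Proof. by case: hF. Qed.
Let FM u v : F (u * v) = F u * F v. Proof. by case: hF. Qed.

Lemma smul_hom f h n : F (smul f h n) = smul (fun n => F (f n)) (fun n => F (h n)) n.
Proof. by rewrite /smul (lin_sum Fl); apply: eq_bigr => i _; rewrite FM. Qed.
Lemma sone_hom n : F (@sone K A n) = @sone K B n.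
Proof. by case: n => [|n]; rewrite /sone /= ?F1 ?(lin0 Fl). Qed.
Lemma sinv_hom f n : F (sinv f n) = sinv (fun n => F (f n)) n.
Proof.
have key k : forall n, F (iter k (smul (fun m => @sone K A m - f m)) (@sone K A) n) =
    iter k (smul (fun m => @sone K B m - F (f m))) (@sone K B) n.
  elim: k => [|k IH] m /=; first exact: sone_hom.
  rewrite smul_hom; congr (smul _ _ m); apply/funext=> i; last exact: IH.
  by rewrite (linB Fl) sone_hom.
by rewrite /sinv (lin_sum Fl); apply: eq_bigr => k _; exact: key.
Qed.
Lemma prod_hom (I : Type) (s : seq I) (G : I -> A) : F (\prod_(i <- s) G i) = \prod_(i <- s) F (G i).
Proof. by elim: s => [|i s IH]; rewrite ?big_nil // !big_cons FM IH. Qed.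
Lemma ncev_hom Phi a b n : F (ncev Phi a b n) = ncev Phi (F a) (F b) n.
Proof.
rewrite /ncev (lin_sum Fl); apply: eq_bigr => w _; rewrite (linZ Fl) prod_hom.
by congr (_ *: _); apply: eq_bigr => c _; case: c.
Qed.
Lemma Phi_inv_hom Phi c a b n : F (Phi_inv Phi c a b n) = Phi_inv Phi c (F a) (F b) n.
Proof.
rewrite /Phi_inv sinv_hom; congr (sinv _ n); apply/funext=> i.
by rewrite (linZ Fl) ncev_hom.
Qed.
End SeriesMaps.

Section PhiSeries.
Variables (K : fieldType) (A : algType K) (Phi : ncs K) (c : K).
Hypothesis Phi0 : Phi [::] = 1.

Definition sPhi (a b : A) : nat -> A := fun n => c ^+ n *: ncev Phi a b n.
Lemma sPhi_0 a b : sPhi a b 0%N = 1.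
Proof.
rewrite /sPhi expr0 scale1r /ncev (big_pred1 [tuple]) => [|w].
  by rewrite Phi0 big_nil scale1r.
by apply/esym/eqP/val_inj; case: w => -[].
Qed.
(** $J$ passes a word letter by letter, hence passes $\Phi$ and then its inverse. *)
Lemma Phi_inv_comm (a b a' b' J : A) : J * a = a' * J -> J * b = b' * J -> forall n,
  J * Phi_inv Phi c a b n = Phi_inv Phi c a' b' n * J.
Proof.
move=> ea eb; apply: (sinv_comm (sPhi_0 a b) (sPhi_0 a' b')) => n; rewrite /sPhi.
rewrite -scalerAr -scalerAl /ncev mulr_sumr mulr_suml; congr (_ *: _).
apply: eq_bigr => w _; rewrite -scalerAr -scalerAl; congr (_ *: _).
elim: (tval w) => [|x s IH]; first by rewrite !big_nil mulr1 mul1r.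
by rewrite !big_cons mulrA; case: x; rewrite ?ea ?eb -!mulrA IH.
Qed.
Lemma smul_scale (f h : nat -> A) :
  smul (fun n => c ^+ n *: f n) (fun n => c ^+ n *: h n) = fun n => c ^+ n *: smul f h n.
Proof.
apply/funext=> n; rewrite /smul scaler_sumr; apply: eq_bigr => i _.
rewrite -scalerAl -scalerAr scalerA -exprD subnKC //.
by rewrite -ltnS.
Qed.
End PhiSeries.

(** * The inverted pentagon in a representation *)

Section Pentagon.
Variables (R : realType) (Phi : ncs R[i]) (c : R[i]) (A : algType R[i]).
Hypothesis hPhi : associator Phi.

Lemma associator_1 : Phi [::] = 1.
Proof.
case: (assoc_grouplike hPhi) => phi [_ _ ->].
by rewrite /ncexp big_ord1 /= /ncone eqxx fact0 invr1 mulr1.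
Qed.

Variable t : 'I_4 * 'I_4 -> A.
Hypothesis ht : dk_rel t.
Local Notation P := (Phi_inv Phi c).
Let o i : 'I_4 := inord i.-1.
Let T i j : A := t (o i, o j).

(** The pentagon is mapped to $A$, rescaled by $c^n$ in degree $n$, which respects products, and
    inverted; inversion reverses the order of the factors. *)
Lemma pentagon_inv :
  smul (P (T 1 3 + T 2 3) (T 3 4)) (P (T 1 2) (T 2 3 + T 2 4)) =
  smul (P (T 1 2) (T 2 3)) (smul (P (T 1 2 + T 1 3) (T 2 4 + T 3 4)) (P (T 2 3) (T 3 4))).
Proof.
have P0 := associator_1.
pose F : dk R[i] 4 -> A := @plift _ (Presentation (dk_rel_ok R[i] 4)) A t.
have hF : alg_hom F by exact: plift_hom.
have FT i j : F (@tau R[i] 3 i j) = T i j.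
  exact: (@plift_gen _ (Presentation (dk_rel_ok R[i] 4)) A t _ ht).
have Fl : linear F by case: hF.
have e0 := assoc_pentagon hPhi; cbv zeta in e0.
have e : smul (ncev Phi (T 1 2) (T 2 3 + T 2 4)) (ncev Phi (T 1 3 + T 2 3) (T 3 4)) =
  smul (ncev Phi (T 2 3) (T 3 4))
   (smul (ncev Phi (T 1 2 + T 1 3) (T 2 4 + T 3 4)) (ncev Phi (T 1 2) (T 2 3))).
  have Fs f h : (fun n => F (smul f h n)) = smul (fun n => F (f n)) (fun n => F (h n)).
    by apply/funext=> n; exact: smul_hom.
  have Fn u v : (fun n => F (ncev Phi u v n)) = ncev Phi (F u) (F v).
    by apply/funext=> n; exact: ncev_hom.
  have := congr1 (fun f n => F (f n)) e0.
  by rewrite !Fs !Fn !(linD Fl) !FT.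
have e1 : smul (sPhi Phi c (T 1 2) (T 2 3 + T 2 4)) (sPhi Phi c (T 1 3 + T 2 3) (T 3 4)) =
  smul (sPhi Phi c (T 2 3) (T 3 4))
   (smul (sPhi Phi c (T 1 2 + T 1 3) (T 2 4 + T 3 4)) (sPhi Phi c (T 1 2) (T 2 3))).
  by rewrite /sPhi !smul_scale e.
have S0 a b := sPhi_0 c P0 a b : sPhi Phi c a b 0%N = 1.
have V a b a' b' : smul (P a b) (P a' b') =
    sinv (smul (sPhi Phi c a' b') (sPhi Phi c a b)) by rewrite sinvM.
rewrite V e1 sinvM ?S0 //; last exact: smul_0.
by rewrite sinvM ?S0 // -smulA.
Qed.
End Pentagon.

Lemma comm_pair (K : fieldType) (A : algType K) (a b u v u' v' : A) :
  a * u = u * a + u' -> b * v = v * b + v' -> b * u = u * b -> a * v = v * a ->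
  (a + b) * (u * v) - u * v * (a + b) = u' * v + u * v'.
Proof.
move=> au bv bu av; rewrite mulrDl !mulrA au bu mulrDl -(mulrA u a) av -(mulrA u b) bv.
rewrite !mulrDr !mulrA; zmod_tac.
Qed.

(** * A representation of the four-strand relations *)

Section DrinfeldKohno.
Variables (K : fieldType) (g : lieAlgType K) (A : algType K).
Variables (e : 'I_4 -> g -> A) (E : g -> A) (pp : g -> g) (tt : seq (g * g)).
Hypotheses (el : forall i, linear (e i)) (El : linear E).
Hypothesis ee : forall i k z w, i != k -> e i z * e k w = e k w * e i z.
Hypothesis eL : forall i z w, e i z * e i w = e i w * e i z + e i (lie z w).
Hypothesis Ee : forall i z w, E z * e i w = e i w * E z - e i (lie (pp z) w).
Hypothesis EE : forall z w,
  E z * E w = E w * E z + E (lie z w - lie (pp z) w - lie z (pp w)).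
Hypothesis tinv : forall (V : lmodType K) (F : g -> g -> V), bilin F -> forall z,
  \sum_(p <- tt) (F (lie z p.1) p.2 + F p.1 (lie z p.2)) = 0.
Hypothesis tsym : forall (V : lmodType K) (F : g -> g -> V), bilin F ->
  \sum_(p <- tt) F p.1 p.2 = \sum_(p <- tt) F p.2 p.1.

Definition tij i k : A := \sum_(p <- tt) e i p.1 * e k p.2.
(** [E] replaces a fourth copy of $\mathfrak g$. It differs from a commuting Lie map by corrections
    along [pp], the projection to $\mathfrak u_+$: these letters act on the other strands
    instead. *)
Definition ti4 i : A := \sum_(p <- tt) e i p.1 * E p.2.

Let bl (f h : g -> A) : linear f -> linear h -> bilin (fun z w => f z * h w).
Proof. exact: bilin_mul. Qed.
Let inv1 (f h : g -> A) : linear f -> linear h -> forall z,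
  \sum_(p <- tt) f (lie z p.1) * h p.2 = - \sum_(p <- tt) f p.1 * h (lie z p.2).
Proof.
move=> fl hl z; apply/eqP; rewrite -addr_eq0 -big_split; apply/eqP.
exact: (tinv (bl fl hl) z).
Qed.
Lemma tijC i k : i != k -> tij i k = tij k i.
Proof.
move=> ik; rewrite /tij (tsym (bl (el i) (el k))); apply: eq_bigr => p _.
exact: ee.
Qed.
Lemma tij_e3 i k n z : n != i -> n != k -> e n z * tij i k = tij i k * e n z.
Proof.
move=> ni nk; rewrite /tij mulr_sumr mulr_suml; apply: eq_bigr => p _.
by rewrite mulrA ee // -!mulrA ee.
Qed.
Lemma tij_e i k z : i != k -> (e i z + e k z) * tij i k = tij i k * (e i z + e k z).
Proof.
move=> ik; apply/eqP; rewrite -subr_eq0; apply/eqP.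
have inv := tinv (bl (el i) (el k)) z.
apply: eq_trans inv; rewrite /tij mulr_sumr mulr_suml; apply: sub_sums => p.
have ki : k != i by rewrite eq_sym.
exact: comm_pair (eL _ _ _) (eL _ _ _) (ee _ _ ki) (ee _ _ ik).
Qed.
(** On strands $i$ and $k$, $E(z)$ acts by the diagonal bracket with minus [pp z], which fixes an
    invariant tensor. *)
Lemma tij_E i k z : i != k -> E z * tij i k = tij i k * E z.
Proof.
move=> ik; apply/eqP; rewrite -subr_eq0; apply/eqP.
have inv := tinv (bl (el i) (el k)) (pp z).
rewrite -oppr0; apply: (canRL (@opprK _)); rewrite opprB.
apply: eq_trans inv; rewrite /tij mulr_sumr mulr_suml; apply: sub_sums => p.
rewrite (mulrA (E z)) Ee mulrBl -(mulrA _ (E z)) Ee mulrBr !mulrA; zmod_tac.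
Qed.
Lemma tij_ti4 i k n : i != k -> n != i -> n != k -> tij i k * ti4 n = ti4 n * tij i k.
Proof.
move=> ik ni nk; rewrite /ti4 mulr_sumr mulr_suml; apply: eq_bigr => p _.
by rewrite mulrA -tij_e3 // -!mulrA tij_E.
Qed.
Lemma tij_tij4 i k n : i != k -> i != n -> k != n ->
  (tij i k + tij i n) * tij k n = tij k n * (tij i k + tij i n).
Proof.
move=> ik iN kn.
have -> : tij i k + tij i n = \sum_(p <- tt) e i p.1 * (e k p.2 + e n p.2).
  by rewrite -big_split; apply: eq_bigr => p _; rewrite mulrDr.
rewrite mulr_sumr mulr_suml; apply: eq_bigr => p _.
by rewrite -mulrA tij_e // mulrA tij_e3 // mulrA.
Qed.
Lemma ti4_tij i k : i != k -> (ti4 i + ti4 k) * tij i k = tij i k * (ti4 i + ti4 k).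
Proof.
move=> ik.
have -> : ti4 i + ti4 k = \sum_(p <- tt) (e i p.1 + e k p.1) * E p.2.
  by rewrite -big_split; apply: eq_bigr => p _; rewrite mulrDl.
rewrite mulr_sumr mulr_suml; apply: eq_bigr => p _.
by rewrite -mulrA tij_E // mulrA tij_e // -mulrA.
Qed.
(** All terms are brought to the form [S X], with $e_ie_k$ in front and brackets moved onto the
    second legs by invariance. The relation then reduces to the commutation rule [EE], whose two
    corrections match those produced by [Ee]. *)
Lemma tij_ti4_r i k : i != k -> (tij i k + ti4 i) * ti4 k = ti4 k * (tij i k + ti4 i).
Proof.
move=> ik.
pose S (X : g -> g -> A) := \sum_(p <- tt) \sum_(r <- tt) e i p.1 * e k r.1 * X p.2 r.2.
have h1 : ti4 i * ti4 k = S (fun q s => E q * E s) + S (fun q s => E (lie (pp q) s)).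
  rewrite /ti4 mulr_suml /S -big_split; apply: eq_bigr => p _ /=; rewrite mulr_sumr.
  transitivity (\sum_(r <- tt) e i p.1 * e k r.1 * (E p.2 * E r.2) -
     e i p.1 * \sum_(r <- tt) e k (lie (pp p.2) r.1) * E r.2).
    rewrite mulr_sumr -sumrB; apply: eq_bigr => r _.
    by rewrite mulrA -(mulrA (e i p.1)) Ee mulrBr mulrBl !mulrA.
  rewrite (inv1 (el k) El) mulrN opprK mulr_sumr; congr (_ + _).
  by apply: eq_bigr => r _; rewrite mulrA.
have h2 : ti4 k * ti4 i = S (fun q s => E s * E q) - S (fun q s => E (lie q (pp s))).
  rewrite /ti4 mulr_suml /S exchange_big /= [X in _ - X]exchange_big /= -sumrB.
  apply: eq_bigr => r _ /=; rewrite mulr_sumr.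
  transitivity (\sum_(p <- tt) e i p.1 * e k r.1 * (E r.2 * E p.2) -
     e k r.1 * \sum_(p <- tt) e i (lie (pp r.2) p.1) * E p.2).
    rewrite mulr_sumr -sumrB; apply: eq_bigr => p _.
    rewrite mulrA -(mulrA (e k r.1)) Ee mulrBr mulrBl !mulrA.
    by rewrite (ee r.1 p.1) 1?eq_sym.
  rewrite (inv1 (el i) El) mulrN opprK mulr_sumr -sumrN; congr (_ + _).
  apply: eq_bigr => p _; rewrite mulrA (ee r.1 p.1) 1?eq_sym // lie_anti (linN El).
  by rewrite mulrN.
have h3 : tij i k * ti4 k - ti4 k * tij i k = - S (fun q s => E (lie q s)).
  rewrite /ti4 mulr_sumr mulr_suml -sumrB.
  transitivity (\sum_(r <- tt) (tij i k * e k r.1 - e k r.1 * tij i k) * E r.2).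
    by apply: eq_bigr => r _; rewrite mulrBl -!mulrA tij_E.
  transitivity (\sum_(p <- tt) \sum_(r <- tt) e i p.1 * e k (lie p.2 r.1) * E r.2).
    rewrite exchange_big; apply: eq_bigr => r _; rewrite -mulr_suml; congr (_ * _).
    rewrite /tij mulr_suml mulr_sumr; apply: sub_sums => p.
    rewrite -(mulrA (e i p.1)) eL mulrDr (mulrA (e k r.1)) (ee r.1 p.1) 1?eq_sym //.
    by rewrite mulrA addrAC subrr add0r.
  rewrite /S -sumrN; apply: eq_bigr => p _.
  under eq_bigr do rewrite -mulrA.
  rewrite -mulr_sumr (inv1 (el k) El) mulrN mulr_sumr; congr (- _).
  by apply: eq_bigr => r _; rewrite mulrA.
have h4 : S (fun q s => E q * E s) - S (fun q s => E s * E q) =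
    S (fun q s => E (lie q s)) - S (fun q s => E (lie (pp q) s)) - S (fun q s => E (lie q (pp s))).
  rewrite /S -!sumrB; apply: eq_bigr => p _; rewrite -!sumrB; apply: eq_bigr => r _.
  rewrite -!mulrBr; congr (_ * _); rewrite EE !(linB El); zmod_tac.
apply/eqP; rewrite -subr_eq0 mulrDl mulrDr opprD addrACA h3 h1 h2; apply/eqP.
move: h4; set s1 := S _; set s2 := S _; set s3 := S _; set s4 := S _; set s5 := S _ => h4.
have -> : s1 = s2 + (s3 - s4 - s5) by rewrite -h4 addrC subrK.
zmod_tac.
Qed.

Definition dk_map (p : 'I_4 * 'I_4) : A :=
  if p.1 == p.2 then 0 else if p.1 == ord_max then ti4 p.2
  else if p.2 == ord_max then ti4 p.1 else tij p.1 p.2.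

Theorem dk_map_rel : dk_rel dk_map.
Proof.
split.
- by move=> i; rewrite /dk_map eqxx.
- move=> i k; rewrite /dk_map /= (eq_sym k i); case: eqVneq => // ik.
  case: (eqVneq i ord_max) => [im|im]; case: (eqVneq k ord_max) => [km|km] //.
    by move: ik; rewrite im km eqxx.
  exact: tijC.
- move=> i k n m; rewrite /= !inE !negb_or !andbT => /and3P[/and3P[ik iN im] /andP[kn km] nm].
  rewrite /dk_map /= (negbTE ik) (negbTE nm).
  have neq4 (a b : 'I_4) : a != b -> a = ord_max -> b != ord_max.
    by move=> ab e4; rewrite -e4 eq_sym.
  case: (eqVneq i ord_max) => [e4|i4].
    rewrite (negbTE (neq4 _ _ iN e4)) (negbTE (neq4 _ _ im e4)).
    by rewrite tij_ti4 // 1?eq_sym.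
  case: (eqVneq k ord_max) => [e4|k4].
    rewrite (negbTE (neq4 _ _ kn e4)) (negbTE (neq4 _ _ km e4)).
    by rewrite tij_ti4 // 1?eq_sym.
  case: (eqVneq n ord_max) => [e4|n4]; first by rewrite tij_ti4 // eq_sym.
  case: (eqVneq m ord_max) => [e4|m4]; first by rewrite tij_ti4 // eq_sym.
  rewrite {2 3}/tij mulr_sumr mulr_suml; apply: eq_bigr => p _.
  by rewrite mulrA -tij_e3 1?eq_sym // -!mulrA tij_e3 // eq_sym.
- move=> i k n; rewrite /= !inE !negb_or !andbT => /andP[/andP[ik iN] kn].
  rewrite /dk_map /= (negbTE ik) (negbTE iN) (negbTE kn).
  have neq4 (a b : 'I_4) : a != b -> a = ord_max -> b != ord_max.
    by move=> ab e4; rewrite -e4 eq_sym.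
  case: (eqVneq i ord_max) => [e4|i4].
    by rewrite (negbTE (neq4 _ _ ik e4)) (negbTE (neq4 _ _ iN e4)) ti4_tij.
  case: (eqVneq k ord_max) => [e4|k4].
    by rewrite (negbTE (neq4 _ _ kn e4)) addrC tij_ti4_r.
  case: (eqVneq n ord_max) => [e4|n4]; first exact: tij_ti4_r.
  exact: tij_tij4.
Qed.
End DrinfeldKohno.

Lemma ctens_antihom (K : fieldType) (M : compFilAlgType K) (A : algType K) (B : compFilAlgType K)
  d (f : A -> B) (h : M -> B) :
  alg_antihom f -> alg_antihom h -> (forall a, fil 0 (f a)) -> bdd d h ->
  (forall a m, f a * h m = h m * f a) -> alg_antihom (clift (fun a m => f a * h m)).
Proof.
move=> [fl f1 fM] [hl h1 hM] f0 hb cm.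
have hbb : bbd d (fun a m => f a * h m).
  split; first exact: bilin_mul.
  by move=> a q m qm; rewrite -[q + d]add0r; apply: fil_M => //; apply: hb.2.
have hb' : bnd (clift (fun a m => f a * h m)) := clift_bnd hbb.
split; first exact: bdd_lin (clift_bdd hbb).
- by rewrite -(@cpure1 _ M A) (clift_pure hbb) f1 h1 mulr1.
- move=> X Y; move: X; apply: ctens_ext.
  + by apply: (bnd_comp hb'); apply: bnd_Mr; exact: bnd_id.
  + exact: bnd_Ml.
  + move=> a m; move: Y; apply: ctens_ext.
    * by apply: (bnd_comp hb'); apply: bnd_Ml; exact: bnd_id.
    * exact: bnd_Mr.
    * move=> a' m'; rewrite cpureM !(clift_pure hbb) fM hM !mulrA; congr (_ * _).
      by rewrite -!mulrA cm.
Qed.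

Lemma hom_commutator (K : fieldType) (A B : algType K) (F : A -> B) a b a' b' :
  alg_hom F -> F a = a' -> F b = b' -> F (a * b - b * a) = a' * b' - b' * a'.
Proof. by move=> [Fl _ FM] <- <-; rewrite (linB Fl) !FM. Qed.

(** * Legs and shifts of completed tensor products *)

Section Legs.
Variables (K : fieldType) (V : algType K) (M : compFilAlgType K).
Local Notation W2 := (ctens (tens V V) M).
Definition leg1 (u : V) : W2 := cpure (tpure u 1) 1.
Definition leg2 (u : V) : W2 := cpure (tpure 1 u) 1.
Definition up2 : ctens V M -> W2 := cmapl (fun u => tpure 1 u).

Lemma leg1_hom : alg_hom leg1.
Proof. exact: alg_hom_comp (@cpurel_hom K M (tens V V)) (tpurel_hom V V). Qed.
Lemma leg2_hom : alg_hom leg2.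
Proof. exact: alg_hom_comp (@cpurel_hom K M (tens V V)) (tpurer_hom V V). Qed.
Lemma up2_hom : alg_hom up2.
Proof. exact: cmapl_hom (tpurer_hom V V). Qed.
Lemma up2_bdd : bdd 0 up2.
Proof. by apply: cmapl_bdd; exact: lin_tpurer. Qed.
Lemma up2_pure u m : up2 (cpure u m) = cpure (tpure 1 u) m.
Proof. by rewrite /up2 cmapl_pure //; exact: lin_tpurer. Qed.
End Legs.

Section TwistMaps.
Variables (K : fieldType) (g : lieAlgType K) (P : polarized g).
Local Notation Lp := (lie_of (pu P)).
Local Notation Lm := (lie_of (pv P)).
Local Notation Ll := (lie_of (pl P)).
Local Notation U := (env g).
Local Notation ip := (@uincl K g (pu P)).
Local Notation im := (@uincl K g (pv P)).
Local Notation il := (@uincl K g (pl P)).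
Variables (M : compFilAlgType K) (k : ctens (tens (env Lp) (env Lm)) M).

Section J1map.
Variables (B : compFilAlgType K) (D1 D3 : U -> B) (t : M -> B).
Hypotheses (hD1 : alg_hom D1) (D10 : forall u, fil 0 (D1 u)).
Hypotheses (hD3 : alg_hom D3) (D30 : forall u, fil 0 (D3 u)).
Hypotheses (ht : alg_antihom t) (tb : bdd 0 t).

Lemma J1_tri : tri 0 (fun a b m => D1 (ip a) * bmul (P := P) D3 t b m).
Proof.
have [D1l _ _] := hD1; have [ipl _ _] := uincl_hom (pu P).
apply: (fam_tri hD3 D30 ht tb (N := fun a Z => D1 (ip a) * Z)).
- by move=> Z; apply: lin_Mr; exact: (lin_comp D1l ipl).
- by move=> a; apply: lin_Ml; exact: lin_id.
- by move=> q a Z qZ; rewrite addrC; exact: fil_M.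
Qed.
(** Naturality of the twist in its legs; it identifies the images of $J$ under the leg maps. *)
Lemma J1_map (B' : compFilAlgType K) d (F : B -> B') (D1' D3' : U -> B') (t' : M -> B') :
  bdd d F -> alg_hom F -> (forall u, F (D1 u) = D1' u) -> (forall u, F (D3 u) = D3' u) ->
  (forall m, F (t m) = t' m) -> F (J1 k D1 D3 t) = J1 k D1' D3' t'.
Proof.
move=> Fb [_ _ FM] e1 e3 et.
refine (eq_trans (clift3_comp Fb J1_tri k) _); apply: clift3_eq => a b m.
by rewrite /bmul !FM e1 e3 et.
Qed.
End J1map.

Lemma Jp_map (C E B : compFilAlgType K) (D : U -> C) (tau : M -> C) (in1 : env Lp -> E)
    (in2 : C -> E) d (F : E -> B) (D1 D3 : U -> B) (t : M -> B) :
  alg_hom D -> (forall u, fil 0 (D u)) -> alg_antihom tau -> bdd 0 tau ->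
  alg_hom in1 -> (forall a, fil 0 (in1 a)) -> alg_hom in2 -> bdd 0 in2 ->
  bdd d F -> alg_hom F -> (forall a, F (in1 a) = D1 (ip a)) ->
  (forall u, F (in2 (D u)) = D3 u) -> (forall m, F (in2 (tau m)) = t m) ->
  F (Jp k D tau in1 in2) = J1 k D1 D3 t.
Proof.
move=> hD D0 htau taub i1h i10 i2h i2b Fb [_ _ FM] e1 e3 et.
refine (eq_trans (clift3_comp Fb (Jf_tri hD D0 htau taub i1h i10 i2h i2b) k) _).
by apply: clift3_eq => a b m; rewrite /Jf /bmul /beta !FM e1 e3 et mulrA.
Qed.

End TwistMaps.

Section Units.
Variables (K : fieldType) (M : compFilAlgType K) (L : lieAlgType K) (j : env L -> M).
Definition wgen (W : algType K) (z : L) : ctens W M := cpure 1 (j (ugen z)).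
Definition cunit (W : algType K) (w : W) : ctens W M := cpure w 1.
Lemma cunit_hom W : alg_hom (@cunit W). Proof. exact: cpurel_hom. Qed.
Lemma cunit_fil W w : fil 0 (@cunit W w). Proof. by apply: cpure_fil; exact: fil_1. Qed.
Lemma wgen_cunit W z w : wgen W z * cunit w = cunit w * wgen W z.
Proof. exact: cpure_comm. Qed.
End Units.

Section Shift.
Variables (K : fieldType) (V W : algType K) (M : compFilAlgType K).
Local Notation C := (ctens W M).
Local Notation B := (ctens (tens V W) M).
Definition shift : C -> B := cmapl (fun w => tpure (1 : V) w).
Lemma shift_hom : alg_hom shift. Proof. exact: cmapl_hom (tpurer_hom V W). Qed.
Lemma shift_bdd : bdd 0 shift. Proof. by apply: cmapl_bdd; exact: lin_tpurer. Qed.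
Lemma shift_pure w m : shift (cpure w m) = cpure (tpure 1 w) m.
Proof. by rewrite /shift cmapl_pure //; exact: lin_tpurer. Qed.

Lemma shift_comm (Z : C) a : shift Z * cpure (tpure a 1) 1 = cpure (tpure a 1) 1 * shift Z.
Proof.
move: Z; apply: ctens_ext.
- by apply: bnd_Mr; exact: bdd_bnd shift_bdd.
- by apply: bnd_Ml; exact: bdd_bnd shift_bdd.
- by move=> w m; rewrite shift_pure !cpureM !tpureM !mulr1 !mul1r.
Qed.
End Shift.

Section Lift.
Variables (K : fieldType) (g : lieAlgType K) (P : polarized g) (M : compFilAlgType K).
Variables (V W : algType K) (io : env g -> V).
Hypothesis hio : alg_hom io.
Local Notation Lp := (lie_of (pu P)).
Local Notation ip := (@uincl K g (pu P)).
Local Notation B := (ctens (tens V W) M).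
Local Notation E := (ctens (tens (env Lp) W) M).

Let iph : alg_hom (tmap (fun a => io (ip a)) (@id W)).
Proof.
exact: tmap_hom (alg_hom_comp hio (uincl_hom (pu P))) (And3 (@lin_id K W) erefl (fun _ _ => erefl)).
Qed.
Let ipl : linear (fun a => io (ip a)) :=
  lin_comp (let: And3 h _ _ := hio in h) (let: And3 h _ _ := uincl_hom (pu P) in h).
(** Tests require $U(\mathfrak u_+)$ as the first leg. Identities proved there are carried by this
    map to a full first leg. *)
Definition unlift : E -> B := cmapl (tmap (fun a => io (ip a)) (@id W)).
Lemma unlift_hom : alg_hom unlift. Proof. exact: cmapl_hom iph. Qed.
Lemma unlift_bdd : bdd 0 unlift.
Proof. by apply: cmapl_bdd; exact: (tmap_lin ipl (@lin_id K W)). Qed.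
Lemma unlift_pure a w m : unlift (cpure (tpure a w) m) = cpure (tpure (io (ip a)) w) m.
Proof.
rewrite /unlift (cmapl_pure _ _ (tmap_lin ipl (@lin_id K W))).
by rewrite (tmap_pure ipl (@lin_id K W)).
Qed.
Lemma unlift_in1 a : unlift (@in1 K g P M W a) = cpure (tpure (io (ip a)) 1) 1.
Proof. exact: unlift_pure. Qed.
Lemma unlift_in2 Z : unlift (@in2 K g P M W Z) = shift V Z.
Proof.
have [_ ip1 _] := uincl_hom (pu P); have [_ io1 _] := hio.
move: Z; apply: ctens_ext.
- exact: bnd_comp (bdd_bnd unlift_bdd) (bdd_bnd (@in2_bdd K g P M W)).
- exact: bdd_bnd (@shift_bdd K V W M).
- by move=> w m; rewrite in2_pure unlift_pure shift_pure ip1 io1.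
Qed.
End Lift.

Lemma antihom_commute (K : fieldType) (L : lieAlgType K) (A : algType K) (t : env L -> A) (X : A) :
  alg_antihom t -> (forall z, X * t (ugen z) = t (ugen z) * X) -> forall h, X * t h = t h * X.
Proof.
move=> [tl t1 tM] e; apply: env_ind_l => [||z h IH].
- split; first by rewrite (lin0 tl) mulr0 mul0r.
  by move=> c u v eu ev; rewrite tl mulrDr mulrDl -scalerAr -scalerAl eu ev.
- by rewrite t1 mulr1 mul1r.
- by rewrite tM mulrA IH -!mulrA e.
Qed.
(** $D_1(z)$ commutes with the other legs, so its commutator with the twist differentiates the first
    leg; by assumption the commutator with $c$ is the same. *)
Lemma J1_total (K : fieldType) (g : lieAlgType K) (P : polarized g) (M B : compFilAlgType K)
  (k : ctens (tens (env (lie_of (pu P))) (env (lie_of (pv P)))) M)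
  (D1 D3 : env g -> B) (t : M -> B) (z : g) (c : B)
  (Dz : env (lie_of (pu P)) -> env (lie_of (pu P))) :
  alg_hom D1 -> (forall u, fil 0 (D1 u)) -> alg_hom D3 -> (forall u, fil 0 (D3 u)) ->
  alg_antihom t -> bdd 0 t -> (forall u v, D3 u * D1 v = D1 v * D3 u) ->
  (forall m u, t m * D1 u = D1 u * t m) ->
  (forall a, uincl (Dz a) = ugen z * uincl a - uincl a * ugen z) ->
  clift3 (fun a b m => D1 (uincl (Dz a)) * bmul (P := P) D3 t b m) k =
    c * J1 k D1 D3 t - J1 k D1 D3 t * c ->
  J1 k D1 D3 t * (D1 (ugen z) - c) = (D1 (ugen z) - c) * J1 k D1 D3 t.
Proof.
move=> h1 h10 h3 h30 ht tb D31 tD1 DzE e; have [D1l _ D1M] := h1.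
have [q hq] : bnd (fun X : B => D1 (ugen z) * X - X * D1 (ugen z)).
  by apply: bnd_B; [apply: bnd_Ml|apply: bnd_Mr]; exact: bnd_id.
have e2 := clift3_comp hq (J1_tri P h1 h10 h3 h30 ht tb) k.
have e3 : D1 (ugen z) * J1 k D1 D3 t - J1 k D1 D3 t * D1 (ugen z) =
    c * J1 k D1 D3 t - J1 k D1 D3 t * c.
  refine (eq_trans e2 (eq_trans _ e)); apply: clift3_eq => a b m.
  rewrite DzE (linB D1l) !D1M mulrBl /bmul -!mulrA tD1.
  by rewrite (mulrA (D3 _)) D31 -!mulrA.
rewrite mulrBr mulrBl; apply/eqP; rewrite eq_sym subr_eq; apply/eqP.
by move/eqP: e3; rewrite subr_eq => /eqP ->; zmod_tac.
Qed.

(** * The twist J on two strands and the dynamical leg *)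

Section Concrete.
Variables (K : fieldType) (g : lieAlgType K) (P : polarized g).
Local Notation Lp := (lie_of (pu P)).
Local Notation Lm := (lie_of (pv P)).
Local Notation Ll := (lie_of (pl P)).
Local Notation U := (env g).
Local Notation ip := (@uincl K g (pu P)).
Local Notation im := (@uincl K g (pv P)).
Local Notation il := (@uincl K g (pl P)).
Local Notation vp := (@lval K g (pu P)).
Local Notation vm := (@lval K g (pv P)).
Local Notation vl := (@lval K g (pl P)).
Variables (d : nat) (xs ys : d.-tuple g).
Variables (M : compFilAlgType K) (j : env Ll -> M).
Variables (S : comAlgType K) (i : Ll -> S) (sigma : int -> M -> S).
Hypothesis char0 : forall n, n.+1%:R != 0 :> K.
Hypothesis jh : alg_hom j.
Hypothesis jf : forall n u, ufil n u -> fil n (j u).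
Hypotheses (bx : basis_of (pu P) xs) (byy : basis_of (pv P) ys).
Hypotheses (hS : is_loc_sym xs ys i) (hsig : is_symbol xs ys j i sigma).
Variable H : U -> env Ll.
Hypothesis hH : is_HC H.
Variable k : ctens (tens (env Lp) (env Lm)) M.
Hypothesis hk : is_K j H k.
Variables (V : algType K) (io : U -> V).
Hypothesis hio : alg_hom io.
Variables (A : M -> M) (DR DL : M -> ctens (env Ll) M).
Hypotheses (hDR : alg_hom DR) (DRb : bdd 0 DR).
Hypothesis DR_gen : forall z, DR (j (ugen z)) = cpure (ugen z) 1 + cpure 1 (j (ugen z)).
Hypotheses (hDL : alg_hom DL) (DLb : bdd 0 DL).
Hypothesis DL_gen : forall z, DL (j (ugen z)) = cpure (ugen z) 1 + cpure 1 (j (ugen z)).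
Hypotheses (hA : alg_antihom A) (Ab : bdd 0 A).
Hypothesis A_gen : forall z, A (j (ugen z)) = - j (ugen z).
Variables (cop : V -> tens V V).
Hypothesis hcop : alg_hom cop.
Hypothesis cop_gen : forall z, cop (io (ugen z)) = tpure (io (ugen z)) 1 + tpure 1 (io (ugen z)).
Let rv := rho_tri_val char0 jh jf bx byy hS hsig hH hk.
Let rl := rho_lin jh jf hH k.
Let iol : linear io. Proof. by case: hio. Qed.

Local Notation W2 := (ctens (tens V V) M).
Local Notation l1 := (fun u => @leg1 K V M (io u)).
Local Notation l2 := (fun u => @leg2 K V M (io u)).
Local Notation cu := (fun u => @cunit K M V (io u)).

Let f1h : alg_antihom (fun u => cunit M (io (uant (il u)))).
Proof.
have h : alg_antihom (fun u : env Ll => uant (il u)).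
  exact: alg_antihom_comp (uant_antihom g) (uincl_hom (pl P)).
exact: alg_hom_anticomp (@cunit_hom K M V) (alg_hom_anticomp hio h).
Qed.
Let f2h : alg_antihom (fun m => cpure (1 : V) (A m)).
Proof. exact: alg_hom_anticomp (@cpurer_hom K M V) hA. Qed.
Let f2b : bdd 0 (fun m => cpure (1 : V) (A m)).
Proof. by have := bdd_comp (bdd_cpurer M (1 : V)) Ab; rewrite addr0. Qed.
Let f10 u : fil 0 (cunit M (io (uant (il u)))) := cunit_fil M _.
Let f12 u m : cunit M (io (uant (il u))) * cpure 1 (A m) = cpure 1 (A m) * cunit M (io (uant (il u))).
Proof. by rewrite /cunit cpure_comm. Qed.
Lemma dant_bbd : bbd 0 (fun m2 m1 => cunit M (io (uant (il m2))) * cpure 1 (A m1)).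
Proof.
split; first by case: f1h => fl _ _; exact: (bilin_mul fl (bdd_lin f2b)).
by move=> a q m qm; rewrite -[q + 0]add0r; apply: fil_M => //; apply: f2b.2.
Qed.
(* The antipode of U(l)^, twisted by the coproduct: m |-> S(m^(2)) (x) S(m^(1)). *)
Definition dant (m : M) : ctens V M :=
  clift (fun m2 m1 => cunit M (io (uant (il m2))) * cpure 1 (A m1)) (DR m).
Lemma dant_antihom : alg_antihom dant.
Proof. exact: alg_antihom_comp (ctens_antihom f1h f2h f10 f2b f12) hDR. Qed.
Lemma dant_bdd : bdd 0 dant.
Proof. by have := bdd_comp (clift_bdd dant_bbd) DRb; rewrite addr0. Qed.
Lemma dant_gen z : dant (j (ugen z)) = - (cu (ugen (vl z)) + wgen j V z).
Proof.
have [cl c1 _] := f1h; have [_ A1 _] := hA.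
have [cl' _ _] := @cpurer_hom K M V; have [ul _ _] := @cunit_hom K M V.
rewrite /dant DR_gen (linD (bdd_lin (clift_bdd dant_bbd))) !(clift_pure dant_bbd).
rewrite uincl_gen uant_gen A_gen A1 c1 cpure1 mulr1 mul1r (linN iol) (linN ul) (linN cl').
by rewrite opprD.
Qed.
Local Notation dnt2 := (fun m => up2 (dant m)).
Let dntb := dant_bdd.
Let dnth := dant_antihom.
Lemma dant2_antihom : alg_antihom dnt2.
Proof. exact: alg_hom_anticomp (@up2_hom K V M) dant_antihom. Qed.
Lemma dant2_bdd : bdd 0 dnt2.
Proof. by have := bdd_comp (@up2_bdd K V M) dant_bdd; rewrite addr0. Qed.
Lemma dant2_gen z : dnt2 (j (ugen z)) = - (l2 (ugen (vl z)) + wgen j _ z).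
Proof.
have [l _ _] := @up2_hom K V M.
by cbv beta; rewrite dant_gen (linN l) (linD l) !up2_pure.
Qed.
Let cuh : alg_hom cu := alg_hom_comp (@cunit_hom K M V) hio.
Let cu0 u : fil 0 (cu u) := cunit_fil M _.
Let l1h : alg_hom l1 := alg_hom_comp (@leg1_hom K V M) hio.
Let l2h : alg_hom l2 := alg_hom_comp (@leg2_hom K V M) hio.
Let l10 u : fil 0 (l1 u) := cunit_fil M _.
Let l20 u : fil 0 (l2 u) := cunit_fil M _.
Let wcu z u : wgen j V z * cu u = cu u * wgen j V z := wgen_cunit j z (io u).

Local Notation J := (J1 k l1 l2 dnt2).
Local Notation i1 := (@in1 K g P M V).
Local Notation i2 := (@in2 K g P M V).
Let J_unlift : unlift io (Jp k cu dant i1 i2) = J.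
Proof.
refine (Jp_map k cuh cu0 dnth dntb (@in1_hom K g P M V) (@in1_fil K g P M V)
  (@in2_hom K g P M V) (@in2_bdd K g P M V) (unlift_bdd P M V hio) (unlift_hom P M V hio)
    (unlift_in1 M V hio) _ _) => [u|m]; rewrite unlift_in2 //.
exact: shift_pure.
Qed.
Lemma J_ad z : exists Dz : env Lp -> env Lp, [/\ linear Dz,
  forall a, ip (Dz a) = ugen (vl z) * ip a - ip a * ugen (vl z) &
  clift3 (fun a b m => l1 (ip (Dz a)) * bmul l2 dnt2 b m) k =
    dnt2 (j (ugen z)) * J - J * dnt2 (j (ugen z))].
Proof.
have [Dz [Dl DzE e]] := Jp_ad jh jf hH rv cuh cu0 dnth dntb dant_gen
  wcu rl (@in1_hom K g P M V) (@in1_fil K g P M V) (@in2_hom K g P M V)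
  (@in2_bdd K g P M V) (tpr_bnd jh jf hH dnth dntb) (tpr_in12 jh jf hH dnth dntb)
  (tpr_in jh jf hH dnth dntb)
  (fun X => @tpr_nd K g P d xs ys M j S i sigma char0 jh jf bx byy hS hsig H hH V dant
    (fun z => io (ugen (vl z))) dnth dntb dant_gen X) z.
exists Dz; split; [exact: Dl | exact: DzE |].
have uh := unlift_hom P M V hio; have ub := unlift_bdd P M V hio.
have [ul _ uM] := uh.
have [h1 h2 h3 h4] := Jf_tri cuh cu0 dnth dntb
  (@in1_hom K g P M V) (@in1_fil K g P M V) (@in2_hom K g P M V) (@in2_bdd K g P M V).
have t1 : tri 0 (fun a b m => Jf cu dant i1 i2 (Dz a) b m).
  split.
  - by move=> a m; exact: h1.
  - by move=> b m; exact: (lin_comp (h2 b m) Dl).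
  - by move=> a b; exact: h3.
  - by move=> a b q m; exact: h4.
refine (eq_trans _ (eq_trans (congr1 (unlift io) e)
  (hom_commutator uh (unlift_in2 P hio _) J_unlift))).
refine (esym (eq_trans (clift3_comp ub t1 k) _)); apply: clift3_eq => a b m.
by rewrite /Jf !uM (unlift_in1 _ _ hio) !(unlift_in2 _ hio) /bmul mulrA /beta shift_pure.
Qed.

Lemma l2l1 u v : l2 u * l1 v = l1 v * l2 u.
Proof. by rewrite !cpureM !tpureM !mulr1 !mul1r. Qed.
Lemma dnt2l1 m u : dnt2 m * l1 u = l1 u * dnt2 m.
Proof. exact: (shift_comm (dant m)). Qed.

Local Notation l12 := (fun u => @cunit K M (tens V V) (cop (io u))).
Lemma l12_hom : alg_hom l12.
Proof. exact: alg_hom_comp (@cunit_hom K M (tens V V)) (alg_hom_comp hcop hio). Qed.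
Lemma l12_gen z : l12 (ugen z) = l1 (ugen z) + l2 (ugen z).
Proof. by cbv beta; rewrite cop_gen /cunit (linD (lin_cpurel (1 : M))). Qed.
Local Notation dnt12 := (fun m => cmapl cop (dant m)).
Let copl : linear cop. Proof. by case: hcop. Qed.
Let cph : alg_hom (@cmapl K V (tens V V) M cop) := cmapl_hom M hcop.
Let cpb : bdd 0 (@cmapl K V (tens V V) M cop) := cmapl_bdd M copl.
Lemma dnt12_antihom : alg_antihom dnt12.
Proof. exact: alg_hom_anticomp cph dnth. Qed.
Lemma dnt12_bdd : bdd 0 dnt12.
Proof. by have := bdd_comp cpb dntb; rewrite addr0. Qed.
Lemma dnt12_gen z : dnt12 (j (ugen z)) = - (l12 (ugen (vl z)) + wgen j _ z).
Proof.
have [cl _ _] := cph; have [_ cop1 _] := hcop.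
by cbv beta; rewrite dant_gen (linN cl) (linD cl) /cunit /wgen !(cmapl_pure _ _ copl) cop1.
Qed.
(** The total $\mathfrak l$-invariance of $J$: [J_ad] differentiates the first leg and [J1_total]
    turns this into a commutation with the sum over all three legs. *)
Lemma J_comm h : J * dnt12 (j h) = dnt12 (j h) * J.
Proof.
apply: (antihom_commute (alg_antihom_comp dnt12_antihom jh)) => z.
have [Dz [Dl DzE e]] := J_ad z.
have e3 := J1_total l1h l10 l2h l20 dant2_antihom dant2_bdd l2l1 dnt2l1 DzE e.
have -> : dnt12 (j (ugen z)) = - (l1 (ugen (vl z)) - dnt2 (j (ugen z))).
  by rewrite dnt12_gen dant2_gen l12_gen opprK addrA.
by rewrite mulrN mulNr e3.
Qed.

Let il2h : alg_hom (fun v => tpure (1 : V) (io (il v))).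
Proof.
have h : alg_hom (fun v : env Ll => io (il v)) := alg_hom_comp hio (uincl_hom (pl P)).
exact: alg_hom_comp (tpurer_hom V V) h.
Qed.
Let il2l : linear (fun v => tpure (1 : V) (io (il v))). Proof. by case: il2h. Qed.
Definition dl (m : M) : W2 := cmapl (fun v => tpure 1 (io (il v))) (DL m).
Lemma dl_hom : alg_hom dl. Proof. exact: alg_hom_comp (cmapl_hom M il2h) hDL. Qed.
Lemma dl_bdd : bdd 0 dl.
Proof. by have := bdd_comp (cmapl_bdd M il2l) DLb; rewrite addr0. Qed.
Lemma dl_gen z : dl (j (ugen z)) = l2 (ugen (vl z)) + wgen j _ z.
Proof.
have [_ il1 _] := uincl_hom (pl P); have [_ io1 _] := hio.
rewrite /dl DL_gen (linD (bdd_lin (cmapl_bdd M il2l))) !(cmapl_pure _ _ il2l).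
by rewrite uincl_gen il1 io1.
Qed.
Lemma dl_l1 v m : leg1 M v * dl m = dl m * leg1 M v.
Proof.
rewrite /dl; move: (DL m); apply: ctens_ext.
- by apply: bnd_Ml; exact: cmapl_bnd.
- by apply: bnd_Mr; exact: cmapl_bnd.
- by move=> a m'; rewrite (cmapl_pure _ _ il2l) !cpureM !tpureM !mulr1 !mul1r.
Qed.
Let s34_bbd : bbd 0 (fun v m => leg1 M v * dl m).
Proof.
split; first by case: (@leg1_hom K V M) => a _ _; exact: (bilin_mul a (bdd_lin dl_bdd)).
move=> a q m qm; rewrite -[q + 0]add0r; apply: fil_M; last exact: dl_bdd.2.
exact: cunit_fil.
Qed.
Definition split34 : ctens V M -> W2 := clift (fun v m => leg1 M v * dl m).
Lemma split34_hom : alg_hom split34.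
Proof. exact: (ctens_hom (@leg1_hom K V M) dl_hom (fun v => cunit_fil M _) dl_bdd dl_l1). Qed.
Lemma split34_bdd : bdd 0 split34. Proof. exact: clift_bdd s34_bbd. Qed.
Lemma split34_pure v m : split34 (cpure v m) = leg1 M v * dl m.
Proof. exact: (clift_pure s34_bbd). Qed.
Local Notation dntl := (fun m => split34 (dant m)).
Lemma dntl_antihom : alg_antihom dntl.
Proof. exact: alg_hom_anticomp split34_hom dnth. Qed.
Lemma dntl_bdd : bdd 0 dntl.
Proof. by have := bdd_comp split34_bdd dntb; rewrite addr0. Qed.
Lemma dntl_gen z :
  dntl (j (ugen z)) = - (l1 (ugen (vl z)) + (l2 (ugen (vl z)) + wgen j _ z)).
Proof.
have [sl _ _] := split34_hom; have [_ l11 _] := @leg1_hom K V M; have [_ dl1 _] := dl_hom.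
by cbv beta; rewrite dant_gen (linN sl) (linD sl) !split34_pure dl_gen dl1 l11 mulr1 mul1r.
Qed.
(** Coassociativity, checked on generators: both sides are minus the sum over the three legs.
    Agreement on the image of $U(\mathfrak l)$ suffices, since tests evaluate only there. *)
Lemma dntl_j h : dntl (j h) = dnt12 (j h).
Proof.
move: h; apply: env_antihom_ext.
- exact: alg_antihom_comp dntl_antihom jh.
- exact: alg_antihom_comp dnt12_antihom jh.
- by move=> z; rewrite dntl_gen dnt12_gen l12_gen addrA.
Qed.
End Concrete.

Lemma mul_commute (K : fieldType) (A : algType K) (a b z : A) :
  a * z = z * a -> b * z = z * b -> a * b * z = z * (a * b).
Proof. by move=> az bz; rewrite -mulrA bz !mulrA az. Qed.
Lemma hom_commute (K : fieldType) (A B : algType K) (F : A -> B) (a b : A) :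
  alg_hom F -> a * b = b * a -> F a * F b = F b * F a.
Proof. by move=> [_ _ FM] ab; rewrite -!FM ab. Qed.

(** * The leg maps into $V^{\otimes3}\widehat\otimes\widehat U_{\mathfrak l}$ *)

Section FourStrands.
Variables (K : fieldType) (V : algType K) (M : compFilAlgType K).
Variable cop : V -> tens V V.
Hypothesis hcop : alg_hom cop.
Local Notation V2 := (tens V V).
Local Notation V3 := (tens V V2).
Local Notation W2 := (ctens V2 M).
Local Notation W3 := (ctens V3 M).
Local Notation l1 := (@leg1 K V M).
Local Notation l2 := (@leg2 K V M).
Local Notation up := (@shift K V V2 M).
Let copl : linear cop. Proof. by case: hcop. Qed.

Definition tleg12 (z : V2) : V3 := tlift (fun a b => tpure a (tpure b 1)) z.
Definition s1 (u : V) : W3 := cunit M (tpure u (1 : V2)).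
Definition s2 (u : V) : W3 := up (l1 u).
Definition s3 (u : V) : W3 := up (l2 u).
Definition s12 (u : V) : W3 := cunit M (tleg12 (cop u)).
Definition s23 (u : V) : W3 := up (cunit M (cop u)).

Lemma s1_hom : alg_hom s1.
Proof. exact: alg_hom_comp (@cunit_hom K M V3) (tpurel_hom V V2). Qed.
Lemma s2_hom : alg_hom s2.
Proof. exact: alg_hom_comp (@shift_hom K V V2 M) (@leg1_hom K V M). Qed.
Lemma s3_hom : alg_hom s3.
Proof. exact: alg_hom_comp (@shift_hom K V V2 M) (@leg2_hom K V M). Qed.
Lemma s23_hom : alg_hom s23.
Proof.
exact: alg_hom_comp (@shift_hom K V V2 M) (alg_hom_comp (@cunit_hom K M V2) hcop).
Qed.
Lemma up_fil q Z : fil q Z -> fil q (up Z).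
Proof. by move=> /(@shift_bdd K V V2 M).2; rewrite addr0. Qed.
Lemma s1_fil u : fil 0 (s1 u). Proof. exact: cunit_fil. Qed.
Lemma s2_fil u : fil 0 (s2 u). Proof. by apply: up_fil; exact: cunit_fil. Qed.
Lemma s3_fil u : fil 0 (s3 u). Proof. by apply: up_fil; exact: cunit_fil. Qed.
Lemma s12_fil u : fil 0 (s12 u). Proof. exact: cunit_fil. Qed.
Lemma s23_fil u : fil 0 (s23 u). Proof. by apply: up_fil; exact: cunit_fil. Qed.
Lemma s2E u : s2 u = cunit M (tpure 1 (tpure u 1)). Proof. exact: shift_pure. Qed.
Lemma s3E u : s3 u = cunit M (tpure 1 (tpure 1 u)). Proof. exact: shift_pure. Qed.
Lemma up_s1 Z u : up Z * s1 u = s1 u * up Z. Proof. exact: shift_comm. Qed.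
Lemma s2_s1 u v : s2 u * s1 v = s1 v * s2 u. Proof. exact: up_s1. Qed.
Lemma s3_s1 u v : s3 u * s1 v = s1 v * s3 u. Proof. exact: up_s1. Qed.
Lemma l2_l1 u v : l2 u * l1 v = l1 v * l2 u.
Proof. by rewrite !cpureM !tpureM !mulr1 !mul1r. Qed.
Let upM X Y : up (X * Y) = up X * up Y.
Proof. by case: (@shift_hom K V V2 M). Qed.
Lemma s3_s2 u v : s3 u * s2 v = s2 v * s3 u.
Proof. exact: (hom_commute (@shift_hom K V V2 M) (l2_l1 u v)). Qed.

Let l12b : bilin (fun (a b : V) => tpure a (tpure b 1) : V3).
Proof.
split=> u; first exact: (lin_comp (@lin_tpurer _ V V2 u) (@lin_tpurel _ V V 1)).
exact: (@lin_tpurel _ V V2 _).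
Qed.
Lemma tleg12_pure a b : tleg12 (tpure a b) = tpure a (tpure b 1) :> V3.
Proof. exact: (tlift_pure _ _ l12b). Qed.
Lemma tleg12_lin : linear tleg12. Proof. exact: tlift_linear l12b. Qed.
Lemma tleg12_hom : alg_hom tleg12.
Proof.
have h1 : alg_hom (fun a : V => tpure a (1 : V2)) := tpurel_hom V V2.
have h2 : alg_hom (fun b : V => tpure (1 : V) (tpure b (1 : V))).
  exact: alg_hom_comp (tpurer_hom V V2) (tpurel_hom V V).
have cm (a b : V) : tpure a (1 : V2) * tpure (1 : V) (tpure b (1 : V)) =
    tpure (1 : V) (tpure b (1 : V)) * tpure a (1 : V2).
  by rewrite !tpureM !mulr1 !mul1r.
have -> : tleg12 = tlift (fun a b => tpure a (1 : V2) * tpure (1 : V) (tpure b (1 : V))).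
  apply/funext=> z; apply: tlift_eq => a b.
  by rewrite tpureM mulr1 mul1r.
exact: tens_hom.
Qed.
Lemma s12_hom : alg_hom s12.
Proof.
exact: alg_hom_comp (@cunit_hom K M V3) (alg_hom_comp tleg12_hom hcop).
Qed.
Lemma cunit_tleg12 a b : cunit M (tleg12 (tpure a b)) = s1 a * s2 b.
Proof. by rewrite tleg12_pure s2E cpureM tpureM !mulr1 mul1r. Qed.
Let cuV3 : linear (@cunit K M V3). Proof. by case: (@cunit_hom K M V3). Qed.
Lemma tleg12_tmap (X : lmodType K) (f h : X -> V) : linear f -> linear h -> forall z : tens X X,
  tlift (fun u v => s1 (f u) * s2 (h v)) z = cunit M (tleg12 (tmap f h z)).
Proof.
move=> fl hl; have [s1l _ _] := s1_hom; have [s2l _ _] := s2_hom.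
have bl : bilin (fun u v => s1 (f u) * s2 (h v)).
  exact: bilin_mul (lin_comp s1l fl) (lin_comp s2l hl).
apply: tens_lin_ext; first exact: tlift_linear.
  exact: lin_comp cuV3 (lin_comp tleg12_lin (tmap_lin fl hl)).
by move=> u v; rewrite (tlift_pure _ _ bl) (tmap_pure fl hl) cunit_tleg12.
Qed.
Lemma s12_gen u : cop u = tpure u 1 + tpure 1 u -> s12 u = s1 u + s2 u.
Proof.
have [_ s11 _] := s1_hom; have [_ s21 _] := s2_hom.
by rewrite /s12 => ->; rewrite (linD tleg12_lin) (linD cuV3) !cunit_tleg12 s11 s21 mul1r mulr1.
Qed.
Lemma s12_up Y u : s12 u * up (up2 Y) = up (up2 Y) * s12 u.
Proof.
rewrite /s12; move: (cop u); apply: tens_lin_ext.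
- by apply: lin_Mr; exact: lin_comp cuV3 tleg12_lin.
- by apply: lin_Ml; exact: lin_comp cuV3 tleg12_lin.
- move=> a b; rewrite cunit_tleg12; apply: mul_commute; first exact: esym (up_s1 _ a).
  exact: (hom_commute (@shift_hom K V V2 M) (esym (shift_comm Y b))).
Qed.
Lemma s12_s3 u v : s12 u * s3 v = s3 v * s12 u.
Proof. by have := s12_up (cunit M v) u; rewrite /s3 /l2 up2_pure. Qed.

Let f12h : alg_hom (tlift (fun a b => tleg12 (cop a) * tpure (1 : V) (tpure (1 : V) b)) : V2 -> V3).
Proof.
have h2 : alg_hom (fun b : V => tpure (1 : V) (tpure (1 : V) b)).
  exact: alg_hom_comp (tpurer_hom V V2) (tpurer_hom V V).
apply: (tens_hom (alg_hom_comp tleg12_hom hcop) h2) => a b.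
move: (cop a); apply: tens_lin_ext.
- by apply: lin_Mr; exact: tleg12_lin.
- by apply: lin_Ml; exact: tleg12_lin.
- by move=> u v; rewrite tleg12_pure !tpureM !mulr1 !mul1r.
Qed.
Let f12l1 u : tlift (fun a b => tleg12 (cop a) * tpure (1 : V) (tpure (1 : V) b)) (tpure u 1) =
  tleg12 (cop u) :> V3.
Proof.
have [fl _ _] := alg_hom_comp tleg12_hom hcop.
have [hl h1 _] : alg_hom (fun b : V => tpure (1 : V) (tpure (1 : V) b)).
  exact: alg_hom_comp (tpurer_hom V V2) (tpurer_hom V V).
by rewrite (tlift_pure _ _ (bilin_mul fl hl)) h1 mulr1.
Qed.
Let f12l2 u : tlift (fun a b => tleg12 (cop a) * tpure (1 : V) (tpure (1 : V) b)) (tpure 1 u) =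
  tpure 1 (tpure 1 u) :> V3.
Proof.
have [fl f1 _] := alg_hom_comp tleg12_hom hcop.
have [hl _ _] : alg_hom (fun b : V => tpure (1 : V) (tpure (1 : V) b)).
  exact: alg_hom_comp (tpurer_hom V V2) (tpurer_hom V V).
by rewrite (tlift_pure _ _ (bilin_mul fl hl)) f1 mul1r.
Qed.

(** [Y12], [Y23], [Y34] and [shift] are the four leg maps of the pseudotwist equation for an algebra
    $V$ with a multiplicative map [cop]; eventually $V=U(\mathfrak g)$ with its coproduct. *)
Definition Y12 : W2 -> W3 :=
  cmapl (tlift (fun a b => tleg12 (cop a) * tpure 1 (tpure 1 b))).
Lemma X12_hom : alg_hom (Y12). Proof. exact: cmapl_hom f12h. Qed.
Lemma X12_bdd : bdd 0 (Y12). Proof. by apply: cmapl_bdd; case: f12h. Qed.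
Let X12_pure w m : Y12 (cpure w (m : M)) =
  cpure (tlift (fun a b => tleg12 (cop a) * tpure (1 : V) (tpure (1 : V) b)) w : V3) m.
Proof. by apply: cmapl_pure; case: f12h. Qed.
Lemma X12_l1 u : Y12 (l1 u) = s12 u.
Proof. exact: etrans (X12_pure _ _) (congr1 (@cunit K M V3) (f12l1 u)). Qed.
Lemma X12_up2 (Y : ctens V M) : Y12 (up2 Y) = up (up2 Y).
Proof.
move: Y; apply: ctens_ext.
- exact: bnd_comp (bdd_bnd X12_bdd) (bdd_bnd (@up2_bdd K V M)).
- exact: bnd_comp (bdd_bnd (@shift_bdd K V V2 M)) (bdd_bnd (@up2_bdd K V M)).
- move=> u m; rewrite !up2_pure shift_pure.
  exact: etrans (X12_pure _ _) (congr1 (fun w => cpure w m) (f12l2 u)).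
Qed.

Let f23h : alg_hom (tmap (@id V) cop : V2 -> V3).
Proof. exact: tmap_hom (And3 (@lin_id K V) erefl (fun _ _ => erefl)) hcop. Qed.
Let f23p u v : tmap (@id V) cop (tpure u v) = tpure u (cop v).
Proof. exact: (tmap_pure (@lin_id K V) copl). Qed.
Definition Y23 : W2 -> W3 := cmapl (tmap (@id V) cop).
Lemma X23_hom : alg_hom (Y23). Proof. exact: cmapl_hom f23h. Qed.
Lemma X23_bdd : bdd 0 (Y23). Proof. by apply: cmapl_bdd; case: f23h. Qed.
Let X23_pure w m : Y23 (cpure w (m : M)) = cpure (tmap (@id V) cop w) m.
Proof. by apply: cmapl_pure; case: f23h. Qed.
Lemma X23_l1 u : Y23 (l1 u) = s1 u.
Proof.
apply: etrans (X23_pure _ _) (congr1 (@cunit K M V3) _).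
by rewrite f23p; case: hcop => _ -> _.
Qed.
Lemma X23_up2 (Y : ctens V M) : Y23 (up2 Y) = up (cmapl cop Y).
Proof.
move: Y; apply: ctens_ext.
- exact: bnd_comp (bdd_bnd X23_bdd) (bdd_bnd (@up2_bdd K V M)).
- exact: bnd_comp (bdd_bnd (@shift_bdd K V V2 M)) (cmapl_bnd M copl).
- move=> u m; rewrite !up2_pure (cmapl_pure _ _ copl) shift_pure.
  exact: etrans (X23_pure _ _) (congr1 (fun w => cpure w m) (f23p _ _)).
Qed.

Lemma X12_l2 u : Y12 (l2 u) = s3 u.
Proof.
have -> : l2 u = up2 (cunit M u) by rewrite up2_pure.
by rewrite X12_up2 up2_pure.
Qed.
Lemma X23_l2 u : Y23 (l2 u) = s23 u.
Proof.
have -> : l2 u = up2 (cunit M u) by rewrite up2_pure.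
by rewrite X23_up2 (cmapl_pure _ _ copl).
Qed.
Lemma X12_w m : Y12 (cpure 1 m) = cpure 1 m.
Proof.
rewrite -[cpure 1 m](up2_pure 1 m) X12_up2 up2_pure; exact: shift_pure.
Qed.
Lemma X23_w m : Y23 (cpure 1 m) = cpure 1 m.
Proof.
rewrite -[cpure 1 m](up2_pure 1 m) X23_up2 (cmapl_pure _ _ copl) shift_pure.
by case: hcop => _ -> _.
Qed.

Variable dl : M -> W2.
Hypotheses (hdl : alg_hom dl) (dlb : bdd 0 dl).
Hypothesis dl_l1 : forall v m, l1 v * dl m = dl m * l1 v.
Definition Y34 : W2 -> W3 := clift (fun z m => cunit M (tleg12 z) * up (dl m)).
Let updl m : W3 := up (dl m).
Let updlh : alg_hom updl. Proof. exact: alg_hom_comp (@shift_hom K V V2 M) hdl. Qed.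
Let updlb : bdd 0 updl.
Proof. by have := bdd_comp (@shift_bdd K V V2 M) dlb; rewrite addr0. Qed.
Let cu12h : alg_hom (fun z => cunit M (tleg12 z)).
Proof. exact: alg_hom_comp (@cunit_hom K M V3) tleg12_hom. Qed.
Let cu12_dl z m : cunit M (tleg12 z) * updl m = updl m * cunit M (tleg12 z).
Proof.
move: z; apply: tens_lin_ext.
- by apply: lin_Mr; case: cu12h.
- by apply: lin_Ml; case: cu12h.
- move=> a b; rewrite cunit_tleg12; apply: mul_commute; first exact: esym (up_s1 _ a).
  exact: (hom_commute (@shift_hom K V V2 M) (dl_l1 b m)).
Qed.
Lemma X34_hom : alg_hom Y34.
Proof. exact: (ctens_hom cu12h updlh (fun z => cunit_fil M _) updlb cu12_dl). Qed.
Let X34_bbd : bbd 0 (fun z m => cunit M (tleg12 z) * up (dl m)).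
Proof.
split; first by case: cu12h => a _ _; exact: (bilin_mul a (bdd_lin updlb)).
move=> a q m qm; rewrite -[q + 0]add0r; apply: fil_M; last exact: updlb.2.
exact: cunit_fil.
Qed.
Lemma X34_bdd : bdd 0 Y34. Proof. exact: clift_bdd X34_bbd. Qed.
Let X34_pure z m : Y34 (cpure z m) = cunit M (tleg12 z) * up (dl m).
Proof. exact: (clift_pure X34_bbd). Qed.
Let up1 : up 1 = 1. Proof. by case: (@shift_hom K V V2 M). Qed.
Let dl1 : dl 1 = 1. Proof. by case: hdl. Qed.
Lemma X34_l1 u : Y34 (l1 u) = s1 u.
Proof.
have [_ s21 _] := s2_hom.
by rewrite /l1 X34_pure dl1 up1 mulr1 cunit_tleg12 s21 mulr1.
Qed.
Lemma X34_up2 (Y : ctens V M) : Y34 (up2 Y) = up (clift (fun v m => l1 v * dl m) Y).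
Proof.
have [_ s11 _] := s1_hom.
have hb : bbd 0 (fun v m => l1 v * dl m).
  split; first by case: (@leg1_hom K V M) => a _ _; exact: (bilin_mul a (bdd_lin dlb)).
  move=> a q m qm; rewrite -[q + 0]add0r; apply: fil_M; last exact: dlb.2.
  exact: cunit_fil.
move: Y; apply: ctens_ext.
- exact: bnd_comp (bdd_bnd X34_bdd) (bdd_bnd (@up2_bdd K V M)).
- exact: bnd_comp (bdd_bnd (@shift_bdd K V V2 M)) (clift_bnd hb).
- move=> u m; rewrite up2_pure X34_pure (clift_pure hb) upM cunit_tleg12 s11 mul1r.
  by [].
Qed.
Lemma X34_l2 u : Y34 (l2 u) = s2 u.
Proof.
have [_ s11 _] := s1_hom.
by rewrite /l2 X34_pure dl1 up1 mulr1 cunit_tleg12 s11 mul1r.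
Qed.
Lemma X34_w m : Y34 (cpure 1 m) = up (dl m).
Proof.
have [_ c1 _] := cu12h.
by rewrite X34_pure c1 mul1r.
Qed.
End FourStrands.

Lemma hom_mul_eq (K : fieldType) (A B : compFilAlgType K) (F : A -> B) a b c d a' b' c' d' :
  alg_hom F -> F a = a' -> F b = b' -> F c = c' -> F d = d' -> a * b = c * d -> a' * b' = c' * d'.
Proof. by move=> [_ _ FM] <- <- <- <-; rewrite -!FM => ->. Qed.

(** * The twist equation on three strands and the dynamical leg *)

Section FourStrandTwist.
Variables (K : fieldType) (g : lieAlgType K) (P : polarized g).
Local Notation Lp := (lie_of (pu P)).
Local Notation Lm := (lie_of (pv P)).
Local Notation Ll := (lie_of (pl P)).
Local Notation U := (env g).
Local Notation ip := (@uincl K g (pu P)).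
Local Notation im := (@uincl K g (pv P)).
Local Notation il := (@uincl K g (pl P)).
Local Notation vp := (@lval K g (pu P)).
Local Notation vm := (@lval K g (pv P)).
Local Notation vl := (@lval K g (pl P)).
Variables (d : nat) (xs ys : d.-tuple g).
Variables (M : compFilAlgType K) (j : env Ll -> M).
Variables (S : comAlgType K) (i : Ll -> S) (sigma : int -> M -> S).
Hypothesis char0 : forall n, n.+1%:R != 0 :> K.
Hypothesis jh : alg_hom j.
Hypothesis jf : forall n u, ufil n u -> fil n (j u).
Hypotheses (bx : basis_of (pu P) xs) (byy : basis_of (pv P) ys).
Hypotheses (hS : is_loc_sym xs ys i) (hsig : is_symbol xs ys j i sigma).
Variable H : U -> env Ll.
Hypothesis hH : is_HC H.
Variable k : ctens (tens (env Lp) (env Lm)) M.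
Hypothesis hk : is_K j H k.
Variables (V : algType K) (io : U -> V).
Hypothesis hio : alg_hom io.
Variables (A : M -> M) (DR DL : M -> ctens (env Ll) M).
Hypotheses (hDR : alg_hom DR) (DRb : bdd 0 DR).
Hypothesis DR_gen : forall z, DR (j (ugen z)) = cpure (ugen z) 1 + cpure 1 (j (ugen z)).
Hypotheses (hDL : alg_hom DL) (DLb : bdd 0 DL).
Hypothesis DL_gen : forall z, DL (j (ugen z)) = cpure (ugen z) 1 + cpure 1 (j (ugen z)).
Hypotheses (hA : alg_antihom A) (Ab : bdd 0 A).
Hypothesis A_gen : forall z, A (j (ugen z)) = - j (ugen z).
Variables (cop : V -> tens V V).
Hypothesis hcop : alg_hom cop.
Hypothesis cop_gen : forall z, cop (io (ugen z)) = tpure (io (ugen z)) 1 + tpure 1 (io (ugen z)).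
Let rv := rho_tri_val char0 jh jf bx byy hS hsig hH hk.
Let rl := rho_lin jh jf hH k.
Let iol : linear io. Proof. by case: hio. Qed.

Local Notation W2 := (ctens (tens V V) M).
Local Notation l1 := (fun u => @leg1 K V M (io u)).
Local Notation l2 := (fun u => @leg2 K V M (io u)).
Local Notation cu := (fun u => @cunit K M V (io u)).

Local Notation V2 := (tens V V).
Local Notation W3 := (ctens (tens V V2) M).
Local Notation up := (@shift K V V2 M).
Local Notation dnt := (dant io A DR).
Local Notation dnt2 := (fun m => up2 (dnt m)).
Local Notation dnt12 := (fun m => cmapl cop (dnt m)).
Local Notation dntl := (fun m => split34 io DL (dnt m)).
Local Notation l12 := (fun u => @cunit K M V2 (cop (io u))).
Let l1h : alg_hom l1 := alg_hom_comp (@leg1_hom K V M) hio.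
Let l2h : alg_hom l2 := alg_hom_comp (@leg2_hom K V M) hio.
Let l12h : alg_hom l12 := l12_hom M hio hcop.
Let l10 u : fil 0 (l1 u) := cunit_fil M _.
Let l20 u : fil 0 (l2 u) := cunit_fil M _.
Let l120 u : fil 0 (l12 u) := cunit_fil M _.
Let d2h : alg_antihom dnt2 := dant2_antihom hio hDR hA Ab.
Let d2b : bdd 0 dnt2 := dant2_bdd hio DRb Ab.
Let d2g z : dnt2 (j (ugen z)) = - (l2 (ugen (vl z)) + wgen j V2 z) :=
  dant2_gen hio DR_gen hA Ab A_gen z.
Let d12h : alg_antihom dnt12 := dnt12_antihom hio hDR hA Ab hcop.
Let d12b : bdd 0 dnt12 := dnt12_bdd hio DRb Ab hcop.
Let d12g z : dnt12 (j (ugen z)) = - (l12 (ugen (vl z)) + wgen j V2 z) :=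
  dnt12_gen hio DR_gen hA Ab A_gen hcop z.
Let dlh : alg_antihom dntl := dntl_antihom hio hDR hDL DLb hA Ab.
Let dlb : bdd 0 dntl := dntl_bdd hio DRb DLb Ab.
Let dlg z : dntl (j (ugen z)) = - (l1 (ugen (vl z)) + (l2 (ugen (vl z)) + wgen j V2 z)) :=
  dntl_gen hio DR_gen hDL DLb DL_gen hA Ab A_gen z.
Let dlj h : dntl (j h) = dnt12 (j h) :=
  dntl_j jh hio hDR DR_gen hDL DLb DL_gen hA Ab A_gen hcop cop_gen h.
Let l12g z : l12 (ugen z) = l1 (ugen z) + l2 (ugen z) := l12_gen M cop_gen z.
Let l21 u v : l2 u * l1 v = l1 v * l2 u := l2_l1 M (io u) (io v).
Let w1 z u : wgen j V2 z * l1 u = l1 u * wgen j V2 z := wgen_cunit j z _.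
Let w2 z u : wgen j V2 z * l2 u = l2 u * wgen j V2 z := wgen_cunit j z _.
Let w12 z u : wgen j V2 z * l12 u = l12 u * wgen j V2 z := wgen_cunit j z _.
Let d21 m u : dnt2 m * l1 u = l1 u * dnt2 m := dnt2l1 io A DR m u.
Local Notation J := (J1 k l1 l2 dnt2).
Let Jc h : J * dnt12 (j h) = dnt12 (j h) * J :=
  J_comm char0 jh jf bx byy hS hsig hH hk hio hDR DRb DR_gen hA Ab A_gen hcop cop_gen h.
Local Notation i1 := (@in1 K g P M V2).
Local Notation i2 := (@in2 K g P M V2).
Let i1h := @in1_hom K g P M V2.
Let i10 := @in1_fil K g P M V2.
Let i2h := @in2_hom K g P M V2.
Let i2b := @in2_bdd K g P M V2.
Local Notation Pr := (tpr (P := P) j H dnt12).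
Let Prb := tpr_bnd jh jf hH d12h d12b.
Let PrE := tpr_in12 jh jf hH d12h d12b.
Let Pri := tpr_in jh jf hH d12h d12b.
Let nd X := @tpr_nd K g P d xs ys M j S i sigma char0 jh jf bx byy hS hsig H hH V2 dnt12
  (fun z => cop (io (ugen (vl z)))) d12h d12b d12g X.

Let cocycle_E : J12 k l1 l2 dnt2 i1 i2 * Jp k l1 dntl i1 i2 = Jp k l12 dnt12 i1 i2 * i2 J.
Proof.
exact: (twist_cocycle char0 jh jf bx byy hS hsig hH hk l1h l10 l2h l20 l12h l120 dlh dlb d12h d12b
  d2h d2b l12g dlg d2g dlj l21 w1 d21 i1h i10 i2h i2b Prb PrE Pri nd Jc).
Qed.

Local Notation S1 := (fun u => s1 M (io u)).
Local Notation S2 := (fun u => s2 M (io u)).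
Local Notation S3 := (fun u => s3 M (io u)).
Local Notation S12 := (fun u => s12 M cop (io u)).
Local Notation S23 := (fun u => s23 M cop (io u)).
Local Notation ul := (@unlift K g P M V V2 io).
Let uh : alg_hom ul := unlift_hom P M V2 hio.
Let ub : bdd 0 ul := unlift_bdd P M V2 hio.
Let ui1 a : ul (i1 a) = S1 (ip a) := unlift_in1 M V2 hio a.
Let ui2 Z : ul (i2 Z) = up Z := unlift_in2 P hio Z.

Lemma cop_ip a : cop (io (ip a)) = tmap (fun a => io (ip a)) (fun a => io (ip a)) (ucop a).
Proof.
have hh : alg_hom (fun a => io (ip a)) := alg_hom_comp hio (uincl_hom (pu P)).
have [hl h1 _] := hh.
apply: (env_hom_ext (f := fun a => cop (io (ip a)))
  (h := fun a => tmap (fun a => io (ip a)) (fun a => io (ip a)) (ucop a))).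
- exact: alg_hom_comp hcop hh.
- exact: alg_hom_comp (tmap_hom hh hh) (ucop_hom _).
- move=> e; rewrite uincl_gen cop_gen ucop_gen (linD (tmap_lin hl hl)).
  by rewrite !(tmap_pure hl hl) uincl_gen h1.
Qed.
Let ul_copin a : ul (copin l1 i1 i2 a) = S12 (ip a).
Proof.
have hl : linear (fun a => io (ip a)).
  by have [a1 _ _] := hio; have [a2 _ _] := uincl_hom (pu P); exact: (lin_comp a1 a2).
refine (eq_trans (copin_map l1h i1h i2h uh a) _).
refine (eq_trans _ (eq_trans (tleg12_tmap M hl hl (ucop a))
  (congr1 (fun z => cunit M (tleg12 z)) (esym (cop_ip a))))).
by apply: tlift_eq => u v; rewrite ui1 ui2.
Qed.

(** [K1], [K2] and [K3] are $J^{12,3,4}$, $J^{1,2,34}$ and $J^{1,23,4}$. *)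
Definition K1 := J1 k S12 S3 (fun m => up (dnt2 m)).
Definition K2 := J1 k S1 S2 (fun m => up (dntl m)).
Definition K3 := J1 k S1 S23 (fun m => up (dnt12 m)).
Let ulK1 : ul (J12 k l1 l2 dnt2 i1 i2) = K1.
Proof.
have [_ _ ulM] := uh.
refine (eq_trans (clift3_comp ub (J12_tri l1h l10 l2h l20 d2h d2b i1h i10 i2h i2b) k) _).
apply: clift3_eq => a b m; rewrite ulM ul_copin ui2 /bmul.
by case: (@shift_hom K V V2 M) => _ _ ->.
Qed.
Let ulK2 : ul (Jp k l1 dntl i1 i2) = K2.
Proof.
exact: (Jp_map k l1h l10 dlh dlb i1h i10 i2h i2b ub uh ui1 (fun u => ui2 _) (fun m => ui2 _)).
Qed.
Let ulK3 : ul (Jp k l12 dnt12 i1 i2) = K3.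
Proof.
exact: (Jp_map k l12h l120 d12h d12b i1h i10 i2h i2b ub uh ui1 (fun u => ui2 _) (fun m => ui2 _)).
Qed.
(** The image under [unlift] of the twist equation with $U(\mathfrak u_+)$ in the first leg. *)
Theorem cocycle_W3 : K1 * K2 = K3 * up J.
Proof.
exact: (hom_mul_eq uh ulK1 ulK2 ulK3 (ui2 J) cocycle_E).
Qed.

(* The images of Jbar's J under the four leg maps. *)
Lemma Y12_J : Y12 cop J = K1.
Proof.
exact: (J1_map k l1h l10 l2h l20 d2h d2b (X12_bdd M hcop) (X12_hom M hcop)
  (fun u => X12_l1 M hcop (io u)) (fun u => X12_l2 M hcop (io u)) (fun m => X12_up2 hcop (dnt m))).
Qed.
Lemma Y23_J : Y23 cop J = K3.
Proof.
exact: (J1_map k l1h l10 l2h l20 d2h d2b (X23_bdd M hcop) (X23_hom M hcop)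
  (fun u => X23_l1 M hcop (io u)) (fun u => X23_l2 M hcop (io u)) (fun m => X23_up2 hcop (dnt m))).
Qed.
Local Notation dlm := (dl io DL).
Let dlmh := dl_hom hio hDL.
Let dlmb := dl_bdd hio DLb.
Let dlm1 := dl_l1 hio DL.
Lemma Y34_J : Y34 dlm J = K2.
Proof.
exact: (J1_map k l1h l10 l2h l20 d2h d2b (X34_bdd dlmb) (X34_hom dlmh dlmb dlm1)
  (fun u => X34_l1 dlmh dlmb (io u)) (fun u => X34_l2 dlmh dlmb (io u))
  (fun m => X34_up2 dlmb (dnt m))).
Qed.
End FourStrandTwist.

Lemma sum_lie2 (K : fieldType) (g : lieAlgType K) (A : algType K) (e1 e2 : env g -> A) :
  alg_hom e2 -> (forall u v, e2 u * e1 v = e1 v * e2 u) -> forall z w,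
  (e1 (ugen z) + e2 (ugen z)) * e2 (ugen w) =
  e2 (ugen w) * (e1 (ugen z) + e2 (ugen z)) + e2 (ugen (lie z w)).
Proof.
move=> h c z w; have [_ hl] := hom_lie h; rewrite hl mulrDl mulrDr c; zmod_tac.
Qed.
Lemma hom_star (K : fieldType) (A B : compFilAlgType K) (F : A -> B) (I : Type) (s : seq I)
    (f h : I -> A) (f' h' : I -> B) a b a' b' :
  alg_hom F -> F a = a' -> F b = b' -> (forall p, F (f p) = f' p) -> (forall p, F (h p) = h' p) ->
  a * b = b * a - (\sum_(p <- s) f p * h p) * a ->
  a' * b' = b' * a' - (\sum_(p <- s) f' p * h' p) * a'.
Proof.
move=> [Fl _ FM] <- <- ef eh e; rewrite -!FM e (linB Fl) !FM (lin_sum Fl); congr (_ - _ * _).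
by apply: eq_bigr => p _; rewrite FM ef eh.
Qed.
Lemma J1_ad_map (K : fieldType) (g : lieAlgType K) (P : polarized g) (M B B' : compFilAlgType K)
  (k : ctens (tens (env (lie_of (pu P))) (env (lie_of (pv P)))) M)
  (D1 D3 : env g -> B) (t : M -> B) (c : B) (d : int) (F : B -> B')
  (D1' D3' : env g -> B') (t' : M -> B') (c' : B')
  (Dz : env (lie_of (pu P)) -> env (lie_of (pu P))) :
  alg_hom D1 -> (forall u, fil 0 (D1 u)) -> alg_hom D3 -> (forall u, fil 0 (D3 u)) ->
  alg_antihom t -> bdd 0 t -> linear Dz ->
  bdd d F -> alg_hom F -> (forall u, F (D1 u) = D1' u) -> (forall u, F (D3 u) = D3' u) ->
  (forall m, F (t m) = t' m) -> F c = c' ->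
  clift3 (fun a b m => D1 (uincl (Dz a)) * bmul (P := P) D3 t b m) k =
    c * J1 k D1 D3 t - J1 k D1 D3 t * c ->
  clift3 (fun a b m => D1' (uincl (Dz a)) * bmul (P := P) D3' t' b m) k =
    c' * J1 k D1' D3' t' - J1 k D1' D3' t' * c'.
Proof.
move=> h1 h10 h3 h30 ht tb Dl Fb Fh e1 e3 et ec e.
have [q1 q2 q3 q4] := J1_tri P h1 h10 h3 h30 ht tb.
have t1 : tri 0 (fun a b m => D1 (uincl (Dz a)) * bmul (P := P) D3 t b m).
  split.
  - by move=> a m; exact: q1.
  - by move=> b m; exact: (lin_comp (q2 b m) Dl).
  - by move=> a b; exact: q3.
  - by move=> a b q m; exact: q4.
have eJ := J1_map k h1 h10 h3 h30 ht tb Fb Fh e1 e3 et.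
refine (eq_trans _ (eq_trans (congr1 F e) (hom_commutator Fh ec eJ))).
refine (esym (eq_trans (clift3_comp Fb t1 k) _)); apply: clift3_eq => a b m.
by have [_ _ FM] := Fh; rewrite /bmul !FM e1 e3 et.
Qed.

(** * Exchange relations on three strands and the dynamical leg *)

Section TwistBarg.
Variables (K : fieldType) (g : lieAlgType K) (P : polarized g).
Local Notation Lp := (lie_of (pu P)).
Local Notation Lm := (lie_of (pv P)).
Local Notation Ll := (lie_of (pl P)).
Local Notation U := (env g).
Local Notation ip := (@uincl K g (pu P)).
Local Notation im := (@uincl K g (pv P)).
Local Notation il := (@uincl K g (pl P)).
Local Notation vp := (@lval K g (pu P)).
Local Notation vm := (@lval K g (pv P)).
Local Notation vl := (@lval K g (pl P)).
Variables (d : nat) (xs ys : d.-tuple g).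
Variables (M : compFilAlgType K) (j : env Ll -> M).
Variables (S : comAlgType K) (i : Ll -> S) (sigma : int -> M -> S).
Hypothesis char0 : forall n, n.+1%:R != 0 :> K.
Hypothesis jh : alg_hom j.
Hypothesis jf : forall n u, ufil n u -> fil n (j u).
Hypotheses (bx : basis_of (pu P) xs) (byy : basis_of (pv P) ys).
Hypotheses (hS : is_loc_sym xs ys i) (hsig : is_symbol xs ys j i sigma).
Variable H : U -> env Ll.
Hypothesis hH : is_HC H.
Variable k : ctens (tens (env Lp) (env Lm)) M.
Hypothesis hk : is_K j H k.
Variables (V : algType K) (io : U -> V).
Hypothesis hio : alg_hom io.
Variables (A : M -> M) (DR DL : M -> ctens (env Ll) M).
Hypotheses (hDR : alg_hom DR) (DRb : bdd 0 DR).
Hypothesis DR_gen : forall z, DR (j (ugen z)) = cpure (ugen z) 1 + cpure 1 (j (ugen z)).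
Hypotheses (hDL : alg_hom DL) (DLb : bdd 0 DL).
Hypothesis DL_gen : forall z, DL (j (ugen z)) = cpure (ugen z) 1 + cpure 1 (j (ugen z)).
Hypotheses (hA : alg_antihom A) (Ab : bdd 0 A).
Hypothesis A_gen : forall z, A (j (ugen z)) = - j (ugen z).
Variables (cop : V -> tens V V).
Hypothesis hcop : alg_hom cop.
Hypothesis cop_gen : forall z, cop (io (ugen z)) = tpure (io (ugen z)) 1 + tpure 1 (io (ugen z)).
Let rv := rho_tri_val char0 jh jf bx byy hS hsig hH hk.
Let rl := rho_lin jh jf hH k.
Let iol : linear io. Proof. by case: hio. Qed.

Local Notation W2 := (ctens (tens V V) M).
Local Notation l1 := (fun u => @leg1 K V M (io u)).
Local Notation l2 := (fun u => @leg2 K V M (io u)).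
Local Notation cu := (fun u => @cunit K M V (io u)).

Local Notation V2 := (tens V V).
Local Notation W3 := (ctens (tens V V2) M).
Local Notation up := (@shift K V V2 M).
Local Notation dnt := (dant io A DR).
Local Notation dnt2 := (fun m => up2 (dnt m)).
Local Notation dnt12 := (fun m => cmapl cop (dnt m)).
Local Notation dntl := (fun m => split34 io DL (dnt m)).
Local Notation l12 := (fun u => @cunit K M V2 (cop (io u))).
Let l1h : alg_hom l1 := alg_hom_comp (@leg1_hom K V M) hio.
Let l2h : alg_hom l2 := alg_hom_comp (@leg2_hom K V M) hio.
Let l12h : alg_hom l12 := l12_hom M hio hcop.
Let l10 u : fil 0 (l1 u) := cunit_fil M _.
Let l20 u : fil 0 (l2 u) := cunit_fil M _.
Let l120 u : fil 0 (l12 u) := cunit_fil M _.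
Let d2h : alg_antihom dnt2 := dant2_antihom hio hDR hA Ab.
Let d2b : bdd 0 dnt2 := dant2_bdd hio DRb Ab.
Let d2g z : dnt2 (j (ugen z)) = - (l2 (ugen (vl z)) + wgen j V2 z) :=
  dant2_gen hio DR_gen hA Ab A_gen z.
Let d12h : alg_antihom dnt12 := dnt12_antihom hio hDR hA Ab hcop.
Let d12b : bdd 0 dnt12 := dnt12_bdd hio DRb Ab hcop.
Let d12g z : dnt12 (j (ugen z)) = - (l12 (ugen (vl z)) + wgen j V2 z) :=
  dnt12_gen hio DR_gen hA Ab A_gen hcop z.
Let dlh : alg_antihom dntl := dntl_antihom hio hDR hDL DLb hA Ab.
Let dlb : bdd 0 dntl := dntl_bdd hio DRb DLb Ab.
Let dlg z : dntl (j (ugen z)) = - (l1 (ugen (vl z)) + (l2 (ugen (vl z)) + wgen j V2 z)) :=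
  dntl_gen hio DR_gen hDL DLb DL_gen hA Ab A_gen z.
Let dlj h : dntl (j h) = dnt12 (j h) :=
  dntl_j jh hio hDR DR_gen hDL DLb DL_gen hA Ab A_gen hcop cop_gen h.
Let l12g z : l12 (ugen z) = l1 (ugen z) + l2 (ugen z) := l12_gen M cop_gen z.
Let l21 u v : l2 u * l1 v = l1 v * l2 u := l2_l1 M (io u) (io v).
Let w1 z u : wgen j V2 z * l1 u = l1 u * wgen j V2 z := wgen_cunit j z _.
Let w2 z u : wgen j V2 z * l2 u = l2 u * wgen j V2 z := wgen_cunit j z _.
Let w12 z u : wgen j V2 z * l12 u = l12 u * wgen j V2 z := wgen_cunit j z _.
Let d21 m u : dnt2 m * l1 u = l1 u * dnt2 m := dnt2l1 io A DR m u.
Local Notation J := (J1 k l1 l2 dnt2).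
Let Jc h : J * dnt12 (j h) = dnt12 (j h) * J :=
  J_comm char0 jh jf bx byy hS hsig hH hk hio hDR DRb DR_gen hA Ab A_gen hcop cop_gen h.
Local Notation i1 := (@in1 K g P M V2).
Local Notation i2 := (@in2 K g P M V2).
Let i1h := @in1_hom K g P M V2.
Let i10 := @in1_fil K g P M V2.
Let i2h := @in2_hom K g P M V2.
Let i2b := @in2_bdd K g P M V2.
Local Notation Pr := (tpr (P := P) j H dnt12).
Let Prb := tpr_bnd jh jf hH d12h d12b.
Let PrE := tpr_in12 jh jf hH d12h d12b.
Let Pri := tpr_in jh jf hH d12h d12b.
Let nd X := @tpr_nd K g P d xs ys M j S i sigma char0 jh jf bx byy hS hsig H hH V2 dnt12
  (fun z => cop (io (ugen (vl z)))) d12h d12b d12g X.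

Local Notation S1 := (fun u => s1 M (io u)).
Local Notation S2 := (fun u => s2 M (io u)).
Local Notation S3 := (fun u => s3 M (io u)).
Local Notation S12 := (fun u => s12 M cop (io u)).
Local Notation S23 := (fun u => s23 M cop (io u)).
Local Notation ul := (@unlift K g P M V V2 io).
Let uh : alg_hom ul := unlift_hom P M V2 hio.
Let ub : bdd 0 ul := unlift_bdd P M V2 hio.
Let ui1 a : ul (i1 a) = S1 (ip a) := unlift_in1 M V2 hio a.
Let ui2 Z : ul (i2 Z) = up Z := unlift_in2 P hio Z.


Variables (tt : seq (g * g)) (ls : seq (Ll * Ll)) (ss : seq (Lp * Lm)).
Hypothesis ttE : tt = [seq (vl p.1, vl p.2) | p <- ls] ++
  ([seq (vp p.1, vm p.2) | p <- ss] ++ [seq (vm p.2, vp p.1) | p <- ss]).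
Hypothesis tinv : forall (V : lmodType K) (F : g -> g -> V), bilin F -> forall z,
  \sum_(p <- tt) (F (lie z p.1) p.2 + F p.1 (lie z p.2)) = 0.
Hypothesis lsym : forall (V : lmodType K) (F : Ll -> Ll -> V), bilin F ->
  \sum_(p <- ls) F p.1 p.2 = \sum_(p <- ls) F p.2 p.1.
Let wl : linear (wgen j V2).
Proof.
have [jl _ _] := jh.
exact: (lin_comp (@lin_cpurer K M V2 1) (lin_comp jl (@lin_ugen K Ll))).
Qed.
Let De3 z w : l12 (ugen z) * l2 (ugen w) = l2 (ugen w) * l12 (ugen z) + l2 (ugen (lie z w)).
Proof. by cbv beta; rewrite l12g; exact: (sum_lie2 l2h l21). Qed.
Let Kthree := K3 k io A DR cop.
Let Kone := K1 k io A DR cop.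
Let eta12 : ul (Jp k l12 dnt12 i1 i2) = Kthree.
Proof.
exact: (Jp_map k l12h l120 d12h d12b i1h i10 i2h i2b ub uh ui1 (fun u => ui2 _) (fun m => ui2 _)).
Qed.
(** [Jp_barg] with $D$ the sum of the strands 2 and 3, carried over by [unlift]. *)
Theorem K3_barg : Kthree * up (barg l12 (wgen j V2) l2 ls ss) =
  up (barg l12 (wgen j V2) l2 ls ss) * Kthree -
  (\sum_(p <- ss) S1 (ugen (vp p.1)) * S3 (ugen (vm p.2))) * Kthree.
Proof.
have e := Jp_barg jh jf hH rv l12h l120 d12h d12b d12g w12 rl i1h i10 i2h i2b Prb PrE Pri nd
  ttE tinv lsym l2h De3 w2 wl.
refine (hom_star (s := ss) (f := fun p => i1 (ugen p.1)) (h := fun p => i2 (l2 (ugen (vm p.2))))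
  (f' := fun p => S1 (ugen (vp p.1))) (h' := fun p => S3 (ugen (vm p.2)))
  uh eta12 (ui2 _) _ (fun p => ui2 _) e) => p.
by rewrite ui1 uincl_gen.
Qed.

Local Notation w4 := (wgen j (tens V V2)).
Local Notation t4 := (fun m => up (dnt2 m)).
Let S1h : alg_hom S1 := alg_hom_comp (@s1_hom K V M) hio.
Let S2h : alg_hom S2 := alg_hom_comp (@s2_hom K V M) hio.
Let S3h : alg_hom S3 := alg_hom_comp (@s3_hom K V M) hio.
Let S12h : alg_hom S12 := alg_hom_comp (s12_hom M hcop) hio.
Let S120 u : fil 0 (S12 u) := s12_fil M cop _.
Let S30 u : fil 0 (S3 u) := s3_fil M _.
Let t4h : alg_antihom t4 := alg_hom_anticomp (@shift_hom K V V2 M) d2h.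
Let t4b : bdd 0 t4.
Proof. by have := bdd_comp (@shift_bdd K V V2 M) d2b; rewrite addr0. Qed.
Let t4g z : t4 (j (ugen z)) = - (S3 (ugen (vl z)) + w4 z).
Proof.
have [hl _ _] := @shift_hom K V V2 M; cbv beta.
rewrite d2g (linN hl) (linD hl); congr (- (_ + _)); exact: shift_pure.
Qed.
Let S12g z : S12 (ugen z) = S1 (ugen z) + S2 (ugen z).
Proof. exact: (s12_gen M (cop_gen z)). Qed.
Let D1e2 z w : S12 (ugen z) * S2 (ugen w) = S2 (ugen w) * S12 (ugen z) + S2 (ugen (lie z w)).
Proof. by cbv beta; rewrite S12g; exact: (sum_lie2 S2h (fun u v => s2_s1 M (io u) (io v))). Qed.
Let D1e3 u v : S12 u * S3 v = S3 v * S12 u := s12_s3 M cop (io u) (io v).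
Let e2e3 u v : S2 u * S3 v = S3 v * S2 u := esym (s3_s2 M (io v) (io u)).
Let e2t4 u m : S2 u * t4 m = t4 m * S2 u.
Proof. exact: (hom_commute (@shift_hom K V V2 M) (esym (d21 m u))). Qed.
Let D1t4 u m : S12 u * t4 m = t4 m * S12 u := s12_up cop (dnt m) (io u).
Let F2 z : exists Dz : env Lp -> env Lp, [/\ linear Dz,
  forall a, ip (Dz a) = ugen (vl z) * ip a - ip a * ugen (vl z) &
  clift3 (fun a b m => S12 (ip (Dz a)) * bmul S3 t4 b m) k =
    t4 (j (ugen z)) * J1 k S12 S3 t4 - J1 k S12 S3 t4 * t4 (j (ugen z))].
Proof.
have [Dz [Dl DzE e]] := J_ad char0 jh jf bx byy hS hsig hH hk hio hDR DRb DR_gen hA Ab A_gen z.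
exists Dz; split; [exact: Dl | exact: DzE |].
exact: (J1_ad_map l1h l10 l2h l20 d2h d2b Dl (X12_bdd M hcop) (X12_hom M hcop)
  (fun u => X12_l1 M hcop (io u)) (fun u => X12_l2 M hcop (io u)) (fun m => X12_up2 hcop (dnt m))
  (X12_up2 hcop _) e).
Qed.
(** [J1_barg] with $D_1$ the sum of the strands 1 and 2; its invariance hypothesis is the image of
    [J_ad] under the first leg map. *)
Theorem K1_barg : Kone * barg2 S12 S2 S3 w4 ls ss = barg2 S12 S2 S3 w4 ls ss * Kone +
  (\sum_(p <- ss) S2 (ugen (vp p.1)) * S3 (ugen (vm p.2))) * Kone.
Proof.
exact: (J1_barg char0 jh jf bx byy hS hsig hH hk S12h S120 S2h S3h S30 t4h t4b t4g D1e2 D1e3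
  e2e3 e2t4 D1t4 F2 ttE tinv).
Qed.
End TwistBarg.

(** * The projections to $\mathfrak u_+$ and $\mathfrak l$ *)

Section Projection.
Variables (K : fieldType) (g : lieAlgType K) (P : polarized g).
Local Notation Lp := (lie_of (pu P)).
Local Notation Lm := (lie_of (pv P)).
Local Notation Ll := (lie_of (pl P)).
Local Notation vp := (@lval K g (pu P)).
Local Notation vm := (@lval K g (pv P)).
Local Notation vl := (@lval K g (pl P)).

Definition pproj (z : g) : g := daddv_pi (pu P) (pl P + pv P)%VS z.
Let dir_u : (pu P :&: (pl P + pv P) = 0)%VS.
Proof.
have : directv (pu P + (pl P + pv P)).
  rewrite directvE /= addvA (addvC (pu P)) addnA (addnC (\dim (pu P))).
  by have := p_direct P; rewrite directvE.
by rewrite directv_addE => /and3P[_ _ /eqP].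
Qed.
Lemma pproj_lin : linear pproj. Proof. exact: linearP. Qed.
Lemma pproj_p a : pproj (vp a) = vp a.
Proof. by rewrite /pproj daddv_pi_id // ?dir_u // lval_in. Qed.
Let pproj_0 z : z \in (pl P + pv P)%VS -> pproj z = 0.
Proof.
move=> zin; have := daddv_pi_add dir_u (subvP (addvSr (pu P) _) _ zin).
have dir' : ((pl P + pv P) :&: pu P = 0)%VS by rewrite capvC dir_u.
by rewrite (daddv_pi_id dir' zin) -[RHS]add0r => /addIr.
Qed.
Lemma pproj_l z : pproj (vl z) = 0.
Proof. by apply: pproj_0; apply: (subvP (addvSl _ _)); exact: lval_in. Qed.
Lemma pproj_m z : pproj (vm z) = 0.
Proof. by apply: pproj_0; apply: (subvP (addvSr _ _)); exact: lval_in. Qed.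
Let dir_l : (pl P :&: (pu P + pv P) = 0)%VS := p_direct_l P.
Lemma lproj_l z : lproj P (vl z) = z.
Proof. by apply: (@lval_inj _ _ (pl P)); rewrite /lproj daddv_pi_id ?lval_in // /lval vsprojK ?lval_in. Qed.
Lemma lproj_0 z : z \in (pu P + pv P)%VS -> lproj P z = 0.
Proof.
move=> zin; have := daddv_pi_add dir_l (subvP (addvSr (pl P) _) _ zin).
have dir' : ((pu P + pv P) :&: pl P = 0)%VS by rewrite capvC dir_l.
rewrite (daddv_pi_id dir' zin) -[RHS]add0r => /addIr e.
by rewrite /lproj e linear0.
Qed.
Lemma lproj_p z : lproj P (vp z) = 0.
Proof. by apply: lproj_0; apply: (subvP (addvSl _ _)); exact: lval_in. Qed.
Lemma lproj_m z : lproj P (vm z) = 0.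
Proof. by apply: lproj_0; apply: (subvP (addvSr _ _)); exact: lval_in. Qed.
End Projection.

(** The pentagon in the form used by the assembly: it holds for every family that satisfies the
    four-strand relations. *)
Definition inv_pentagon (K : fieldType) (Phi : ncs K) (c : K) : Prop :=
  forall (A : algType K) (t : 'I_4 * 'I_4 -> A), dk_rel t ->
  let T i j := t (inord i.-1, inord j.-1) in
  let P := Phi_inv Phi c in
  smul (P (T 1 3 + T 2 3) (T 3 4)) (P (T 1 2) (T 2 3 + T 2 4)) =
  smul (P (T 1 2) (T 2 3)) (smul (P (T 1 2 + T 1 3) (T 2 4 + T 3 4)) (P (T 2 3) (T 3 4))).

(** * Assembly of twist equation, exchange relations and pentagon *)

Section Assembly.
Variables (K : fieldType) (g : lieAlgType K) (P : polarized g) (A : algType K).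
Local Notation Lp := (lie_of (pu P)).
Local Notation Lm := (lie_of (pv P)).
Local Notation Ll := (lie_of (pl P)).
Local Notation vp := (@lval K g (pu P)).
Local Notation vm := (@lval K g (pv P)).
Local Notation vl := (@lval K g (pl P)).
Variables (S1 S2 S3 : g -> A) (w : Ll -> A).
Hypotheses (S1l : linear S1) (S2l : linear S2) (S3l : linear S3) (wl : linear w).
Definition lie_gen (L : lieAlgType K) (S : L -> A) :=
  forall z y, S z * S y = S y * S z + S (lie z y).
Hypotheses (S1g : lie_gen S1) (S2g : lie_gen S2) (S3g : lie_gen S3) (wg : lie_gen w).
Hypotheses (S21 : forall z y, S2 z * S1 y = S1 y * S2 z)
  (S31 : forall z y, S3 z * S1 y = S1 y * S3 z) (S32 : forall z y, S3 z * S2 y = S2 y * S3 z).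
Hypotheses (w1 : forall z y, w z * S1 y = S1 y * w z) (w2 : forall z y, w z * S2 y = S2 y * w z)
  (w3 : forall z y, w z * S3 y = S3 y * w z).
Variables (tt : seq (g * g)) (ls : seq (Ll * Ll)) (ss : seq (Lp * Lm)).
Hypothesis ttE : tt = [seq (vl p.1, vl p.2) | p <- ls] ++
  ([seq (vp p.1, vm p.2) | p <- ss] ++ [seq (vm p.2, vp p.1) | p <- ss]).
Hypothesis tinv : forall (V : lmodType K) (F : g -> g -> V), bilin F -> forall z,
  \sum_(p <- tt) (F (lie z p.1) p.2 + F p.1 (lie z p.2)) = 0.
Hypothesis tsym : forall (V : lmodType K) (F : g -> g -> V), bilin F ->
  \sum_(p <- tt) F p.1 p.2 = \sum_(p <- tt) F p.2 p.1.

(** The last index is filled with 0, since the fourth strand enters only through [E]. *)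
Let e (i : 'I_4) : g -> A :=
  match val i with 0 => S1 | 1 => S2 | 2 => S3 | _ => fun=> 0 end.
Let D z := S1 z + S2 z + S3 z.
(** On the fourth strand $\mathfrak l$ acts by its own letters, $\mathfrak u_-$ by 0, and $\mathfrak
    u_+$ by minus the other three strands, as if the total action of $\mathfrak u_+$ were
    trivial. *)
Let E z := w (lproj P z) - D (pproj P z).
Let el i : linear (e i).
Proof. by case: i => -[|[|[|[|]]]] // ?; exact: lin_cst0. Qed.
Let Dl : linear D. Proof. by apply: lin_D => //; apply: lin_D. Qed.
Let El : linear E.
Proof.
by apply: lin_B; [exact: (lin_comp wl (lin_lproj P)) | exact: (lin_comp Dl (pproj_lin P))].
Qed.
Let ee i k z y : i != k -> e i z * e k y = e k y * e i z.
Proof.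
case: i k => -[|[|[|[|]]]] // hi [[|[|[|[|]]]]] // hk; rewrite -val_eqE //= => _;
  by rewrite /e /= ?mul0r ?mulr0 // ?S21 ?S31 ?S32.
Qed.
Let eL i z y : e i z * e i y = e i y * e i z + e i (lie z y).
Proof.
case: i => -[|[|[|[|]]]] // ?; rewrite /e /=;
  first [exact: S1g | exact: S2g | exact: S3g | by rewrite mulr0 addr0].
Qed.
Let De i z y : D z * e i y = e i y * D z + e i (lie z y).
Proof.
case: i => -[|[|[|[|i]]]] hi //; rewrite /e /D /=.
- by rewrite !mulrDl !mulrDr S1g S21 S31; zmod_tac.
- by rewrite !mulrDl !mulrDr S2g -S21 S32; zmod_tac.
- by rewrite !mulrDl !mulrDr S3g -S31 -S32; zmod_tac.
- by rewrite mulr0 mul0r addr0.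
Qed.
Let we i z y : w z * e i y = e i y * w z.
Proof. by case: i => -[|[|[|[|]]]] // ?; rewrite /e /= ?mulr0 ?mul0r. Qed.
Let Ee i z y : E z * e i y = e i y * E z - e i (lie (pproj P z) y).
Proof. by rewrite /E mulrBl mulrBr De we; zmod_tac. Qed.
Let DD z y : D z * D y = D y * D z + D (lie z y).
Proof.
have h0 : D z * S1 y = S1 y * D z + S1 (lie z y) := De (Ordinal (isT : (0 < 4)%N)) z y.
have h1 : D z * S2 y = S2 y * D z + S2 (lie z y) := De (Ordinal (isT : (1 < 4)%N)) z y.
have h2 : D z * S3 y = S3 y * D z + S3 (lie z y) := De (Ordinal (isT : (2 < 4)%N)) z y.
rewrite [D y]/D [D (lie _ _)]/D; move: h0 h1 h2; move: (D z) => X h0 h1 h2.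
rewrite !mulrDr h0 h1 h2 !mulrDl; zmod_tac.
Qed.
Let wD z y : w z * D y = D y * w z.
Proof. by rewrite /D !mulrDr !mulrDl w1 w2 w3. Qed.
Let E_l z : E (vl z) = w z.
Proof. by rewrite /E lproj_l pproj_l (lin0 Dl) subr0. Qed.
Let E_p z : E (vp z) = - D (vp z).
Proof. by rewrite /E lproj_p pproj_p (lin0 wl) sub0r. Qed.
Let E_m z : E (vm z) = 0.
Proof. by rewrite /E lproj_m pproj_m (lin0 wl) (lin0 Dl) subrr. Qed.
(** Two letters of $\mathfrak u_+$ give $D([z,y])=-E([z,y])$, which is the bracket minus both
    corrections; with one letter in $\mathfrak u_+$ a single correction cancels the bracket. *)
Let EE z y : E z * E y = E y * E z + E (lie z y - lie (pproj P z) y - lie z (pproj P y)).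
Proof.
have [a [b ->]] := polarized_decomp P z; move: (lproj P z) => x.
have [a' [b' ->]] := polarized_decomp P y; move: (lproj P y) => x'.
have pl := pproj_lin P.
rewrite !(linD pl) !pproj_p !pproj_l !pproj_m !addr0 !(linD El) !E_p !E_l !E_m !addr0.
have [a1 ea1] := lie_lp x a'; have [a2 ea2] := lie_lp x' a.
have [b1 eb1] := lie_lm x b'; have [b2 eb2] := lie_lm x' b.
rewrite !lie_Dl !lie_Dr !(linD El, linN El).
rewrite (lie_anti (vp a) (vl x')) (lie_anti (vm b) (vl x')) ea1 ea2 eb1 eb2 !(linN El).
rewrite -!lval_lie !E_p !E_l !E_m.
have := DD (vp a) (vp a'); have := wg x x'; have := wD x (vp a'); have := wD x' (vp a).
rewrite !lval_lie; move: (D _) (D _) => X Y; move: (D _) (w _) (w _) => Z u v h1 h2 h3 h4.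
rewrite !mulrDl !mulrDr !mulrNN !mulrN !mulNr h1 h2 h3 h4. zmod_tac.
Qed.

Definition cas (X Y : g -> A) : A := \sum_(p <- tt) X p.1 * Y p.2.
Definition crs (X Y : g -> A) : A := \sum_(p <- ss) X (vp p.1) * Y (vm p.2).
Definition crsr (X Y : g -> A) : A := \sum_(p <- ss) X (vm p.2) * Y (vp p.1).
Definition cal (X : g -> A) (Y : Ll -> A) : A := \sum_(p <- ls) X (vl p.1) * Y p.2.
Let casE X Y : cas X Y = cal X (fun z => Y (vl z)) + (crs X Y + crsr X Y).
Proof. by rewrite /cas ttE !big_cat !big_map. Qed.
Let crsr_D X Y Z : crsr X (fun z => Y z + Z z) = crsr X Y + crsr X Z.
Proof. by rewrite /crsr -big_split; apply: eq_bigr => p _; rewrite mulrDr. Qed.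
Let tau4 (i : 'I_4) : ti4 e E tt i = cal (e i) w - crsr (e i) D.
Proof.
have -> : ti4 e E tt i = cas (e i) E by [].
rewrite casE /cal /crs /crsr; congr (_ + _).
  by apply: eq_bigr => p _; rewrite E_l.
rewrite big1 ?add0r -?sumrN; last by move=> p _; rewrite E_m mulr0.
by apply: eq_bigr => p _; rewrite E_p mulrN.
Qed.
Let o1 : 'I_4 := inord 0. Let o2 : 'I_4 := inord 1.
Let o3 : 'I_4 := inord 2. Let o4 : 'I_4 := inord 3.
Let vo1 : nat_of_ord o1 = 0. Proof. exact: inordK. Qed.
Let eo1 : e o1 = S1. Proof. by rewrite /e /= vo1. Qed.
Let vo2 : nat_of_ord o2 = 1. Proof. exact: inordK. Qed.
Let eo2 : e o2 = S2. Proof. by rewrite /e /= vo2. Qed.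
Let vo3 : nat_of_ord o3 = 2. Proof. exact: inordK. Qed.
Let eo3 : e o3 = S3. Proof. by rewrite /e /= vo3. Qed.
Let t := dk_map e E tt.
Let tdk : dk_rel t := dk_map_rel el El ee eL Ee EE tinv tsym.
Let om4 : o4 = ord_max. Proof. by apply: val_inj; rewrite /= inordK. Qed.
Let tE (i k : 'I_4) : (i < k)%N -> (k < 3)%N -> t (i, k) = cas (e i) (e k).
Proof.
move=> ik k3; rewrite /t /dk_map -!val_eqE /= (ltn_eqF ik) (ltn_eqF k3).
by rewrite (ltn_eqF (ltn_trans ik k3)).
Qed.
Let tE4 (i : 'I_4) : (i < 3)%N -> t (i, o4) = cal (e i) w - crsr (e i) D.
Proof.
move=> i3; have i4 : (i == ord_max) = false by rewrite -val_eqE /= ltn_eqF.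
by rewrite -tau4 /t /dk_map om4 /= i4 ?eqxx.
Qed.

(* The images of [B_arg] under the four leg maps. *)
Definition B34 := cal S3 w - crs (fun z => S1 z + S2 z) S3 - crsr S3 S3.
Definition B2 := cal S2 (fun z => S3 (vl z) + w z) - crs S1 S2 - crsr S2 S2.
Definition B3 := cal (fun z => S2 z + S3 z) w - crs S1 (fun z => S2 z + S3 z) -
  crsr (fun z => S2 z + S3 z) (fun z => S2 z + S3 z).
Definition B4 := cal S3 w - crs S2 S3 - crsr S3 S3.

Let crs_sw X Y : (forall z y, X z * Y y = Y y * X z) -> crs X Y = crsr Y X.
Proof. by move=> c; apply: eq_bigr => p _. Qed.
Let sw21 z y : S1 z * S2 y = S2 y * S1 z. Proof. by rewrite S21. Qed.
Let sw31 z y : S1 z * S3 y = S3 y * S1 z. Proof. by rewrite S31. Qed.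
Let sw32 z y : S2 z * S3 y = S3 y * S2 z. Proof. by rewrite S32. Qed.
Let DE X : crsr X D = crsr X S1 + crsr X S2 + crsr X S3.
Proof. by rewrite /D !crsr_D. Qed.
Let crs_Dl X Y Z : crs (fun z => X z + Y z) Z = crs X Z + crs Y Z.
Proof. by rewrite /crs -big_split; apply: eq_bigr => p _; rewrite mulrDl. Qed.
Let crs_Dr X Y Z : crs X (fun z => Y z + Z z) = crs X Y + crs X Z.
Proof. by rewrite /crs -big_split; apply: eq_bigr => p _; rewrite mulrDr. Qed.
Let crsr_Dl X Y Z : crsr (fun z => X z + Y z) Z = crsr X Z + crsr Y Z.
Proof. by rewrite /crsr -big_split; apply: eq_bigr => p _; rewrite mulrDl. Qed.
Let cal_Dl X Y Z : cal (fun z => X z + Y z) Z = cal X Z + cal Y Z.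
Proof. by rewrite /cal -big_split; apply: eq_bigr => p _; rewrite mulrDl. Qed.
Let cal_Dr X Y Z : cal X (fun z => Y z + Z z) = cal X Y + cal X Z.
Proof. by rewrite /cal -big_split; apply: eq_bigr => p _; rewrite mulrDr. Qed.
Let t34 : t (o3, o4) = B34.
Proof.
rewrite tE4 ?vo3 // eo3 DE /B34 crs_Dl (crs_sw sw31) (crs_sw sw32); zmod_tac.
Qed.
Let t24 : t (o2, o4) = cal S2 w - (crsr S2 S1 + crsr S2 S2 + crsr S2 S3).
Proof. by rewrite tE4 ?vo2 // eo2 DE. Qed.
Let t12 : t (o1, o2) = cas S1 S2. Proof. by rewrite tE ?vo1 ?vo2 // eo1 eo2. Qed.
Let t13 : t (o1, o3) = cas S1 S3. Proof. by rewrite tE ?vo1 ?vo3 // eo1 eo3. Qed.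
Let t23 : t (o2, o3) = cas S2 S3. Proof. by rewrite tE ?vo2 ?vo3 // eo2 eo3. Qed.
(** The terms with $s_-$ on strand 2 and $s_+$ on strand 3 cancel; the surviving $s^{2,3}$ is what
    $J^{12,3,4}$ creates when it passes $B^{1,2,34}$. *)
Let t23_24 : t (o2, o3) + t (o2, o4) = B2 + crs S2 S3.
Proof.
rewrite t23 t24 casE /B2 cal_Dr (crs_sw sw21).
by zmod_tac.
Qed.
Let t24_34 : t (o2, o4) + t (o3, o4) = B3.
Proof.
rewrite t24 t34 /B3 /B34 cal_Dl crs_Dr crs_Dl crsr_Dl !crsr_D (crs_sw sw21) (crs_sw sw31).
rewrite (crs_sw sw32); zmod_tac.
Qed.
(** $B^{12,3,4}$ and $B^{2,3,4}$ differ by $s^{1,3}$, which is what $J^{1,23,4}$ creates when it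
    passes $B^{2,3,4}$. *)
Let t34_4 : t (o3, o4) = B4 - crs S1 S3.
Proof. by rewrite t34 /B34 /B4 crs_Dl; zmod_tac. Qed.

(** The exchange relations carry [K1] past its series into $(\tau_{12},\tau_{23}+\tau_{24})$ and
    [K3] past its series into $(\tau_{23},\tau_{34})$. Both sides are then a product of series times
    [K1 * K2], respectively [K3 * K4], and the series agree by the pentagon. *)
Theorem pseudotwist_assembly (Phi : ncs K) (c : K) (K1 K2 K3 K4 : A) :
  Phi [::] = 1 -> inv_pentagon Phi c -> K1 * K2 = K3 * K4 ->
  K1 * cas S1 S2 = cas S1 S2 * K1 -> K1 * B2 = B2 * K1 + crs S2 S3 * K1 ->
  K3 * cas S2 S3 = cas S2 S3 * K3 -> K3 * B4 = B4 * K3 - crs S1 S3 * K3 ->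
  let PI := Phi_inv Phi c in
  smul (fun n => PI (cas S1 S3 + cas S2 S3) B34 n * K1) (fun n => PI (cas S1 S2) B2 n * K2) =
  smul (PI (cas S1 S2) (cas S2 S3))
    (smul (fun n => PI (cas S1 S2 + cas S1 S3) B3 n * K3) (fun n => PI (cas S2 S3) B4 n * K4)).
Proof.
move=> P0 hPhi e0 c1 c2 c3 c4 PI.
have c2' : K1 * B2 = (t (o2, o3) + t (o2, o4)) * K1 by rewrite t23_24 mulrDl.
have c4' : K3 * B4 = t (o3, o4) * K3 by rewrite t34_4 mulrBl.
have m1 := Phi_inv_comm c P0 c1 c2'; have m3 := Phi_inv_comm c P0 c3 c4'.
(* Elements without $\hbar$ are treated as constant series, so that moving [Y] past [F] is
   associativity of [smul]. *)
have mv X Y F Y' : (forall n, Y * F n = X n * Y) -> forall L : nat -> A,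
    smul (fun n => L n * Y) (fun n => F n * Y') = smul (smul L X) (scst (Y * Y')).
  move=> m L; rewrite -(smul_scstr Y L) -(smul_scstr Y' F) -smulA (smulA (scst Y)).
  have -> : smul (scst Y) F = smul X (scst Y).
    by rewrite smul_scstl smul_scstr; apply/funext.
  have eK : smul (scst Y) (scst Y') = scst (Y * Y').
    by rewrite smul_scstl; apply/funext=> -[|n]; rewrite /scst //= mulr0.
  by rewrite -(smulA X) eK smulA.
rewrite (mv _ _ _ _ m1) (mv _ _ _ _ m3) smulA e0; congr (smul _ _).
have := hPhi A t tdk.
by rewrite /= -/o1 -/o2 -/o3 -/o4 t23_24 t24_34 t13 t23 t12 t34.
Qed.
End Assembly.

Lemma J1_commute (K : fieldType) (g : lieAlgType K) (P : polarized g) (M B : compFilAlgType K)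
  (k : ctens (tens (env (lie_of (pu P))) (env (lie_of (pv P)))) M)
  (D1 D3 : env g -> B) (t : M -> B) (X : B) :
  alg_hom D1 -> (forall u, fil 0 (D1 u)) -> alg_hom D3 -> (forall u, fil 0 (D3 u)) ->
  alg_antihom t -> bdd 0 t -> (forall u, X * D1 u = D1 u * X) -> (forall u, X * D3 u = D3 u * X) ->
  (forall m, X * t m = t m * X) -> J1 k D1 D3 t * X = X * J1 k D1 D3 t.
Proof.
move=> h1 h10 h3 h30 ht tb c1 c3 ct.
have [q hq] : bnd (fun Y : B => Y * X - X * Y).
  by apply: bnd_B; [apply: bnd_Mr|apply: bnd_Ml]; exact: bnd_id.
apply/eqP; rewrite -subr_eq0; apply/eqP.
refine (eq_trans (clift3_comp hq (J1_tri P h1 h10 h3 h30 ht tb) k) _).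
refine (eq_trans _ (@clift3_0 K M (env (lie_of (pu P))) (env (lie_of (pv P))) B k)).
apply: clift3_eq => a b m; rewrite /bmul.
by rewrite !mulrA c1 -(mulrA _ X) c3 -!mulrA ct subrr.
Qed.
Lemma env_commute (K : fieldType) (L : lieAlgType K) (A : algType K) (F : env L -> A) X :
  alg_hom F -> (forall z, X * F (ugen z) = F (ugen z) * X) -> forall u, X * F u = F u * X.
Proof.
move=> [Fl F1 FM] e; apply: env_ind_l => [||z u IH].
- split; first by rewrite (lin0 Fl) mulr0 mul0r.
  by move=> c u v eu ev; rewrite Fl mulrDr mulrDl -scalerAr -scalerAl eu ev.
- by rewrite F1 mulr1 mul1r.
- by rewrite FM mulrA e -!mulrA IH.
Qed.
Lemma Phi_inv_map (K : fieldType) (A B : algType K) (F : A -> B) (Phi : ncs K) c a b J a' b' J' :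
  alg_hom F -> F a = a' -> F b = b' -> F J = J' -> forall n,
  F (Phi_inv Phi c a b n * J) = Phi_inv Phi c a' b' n * J'.
Proof. by move=> h <- <- <- n; have [_ _ ->] := h; rewrite Phi_inv_hom. Qed.
Lemma lin_gen (K : fieldType) (L : lieAlgType K) (A : algType K) (F : env L -> A) :
  alg_hom F -> linear (fun z => F (ugen z)).
Proof. by move=> [Fl _ _]; exact: (lin_comp Fl (@lin_ugen K L)). Qed.

Lemma gen_lie (K : fieldType) (L : lieAlgType K) (A : algType K) (F : env L -> A) :
  alg_hom F -> lie_gen (fun z => F (ugen z)).
Proof. by move=> h z y; have [_ e] := hom_lie h; rewrite e; zmod_tac. Qed.
Lemma shift_wgen (K : fieldType) (L : lieAlgType K) (M : compFilAlgType K) (j : env L -> M)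
  (V W : algType K) z : shift V (wgen j W z) = wgen j (tens V W) z.
Proof. exact: shift_pure. Qed.

(** * Behaviour of $t$ and $B$ under algebra maps *)

Section Exchange.
Variables (K : fieldType) (g : lieAlgType K) (P : polarized g).
Variables (tt : seq (g * g)) (ls : seq (lie_of (pl P) * lie_of (pl P))).
Variable ss : seq (lie_of (pu P) * lie_of (pv P)).
Local Notation vl := (@lval K g (pl P)).
Lemma cas_map (A B : algType K) (F : A -> B) (X Y : g -> A) (X' Y' : g -> B) :
  alg_hom F -> (forall z, F (X z) = X' z) -> (forall z, F (Y z) = Y' z) ->
  F (cas tt X Y) = cas tt X' Y'.
Proof.
move=> [Fl _ FM] eX eY; rewrite /cas (lin_sum Fl); apply: eq_bigr => p _.
by rewrite FM eX eY.
Qed.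
Definition bexp (A : algType K) (X Y : g -> A) (Z : lie_of (pl P) -> A) : A :=
  cal ls Y Z - crs ss X Y - crsr ss Y Y.
Lemma bexp_map (A B : algType K) (F : A -> B) (X Y : g -> A) (X' Y' : g -> B)
    (Z : lie_of (pl P) -> A) (Z' : lie_of (pl P) -> B) :
  alg_hom F -> (forall z, F (X z) = X' z) -> (forall z, F (Y z) = Y' z) ->
  (forall z, F (Z z) = Z' z) -> F (bexp X Y Z) = bexp X' Y' Z'.
Proof.
move=> [Fl _ FM] eX eY eZ; rewrite /bexp !(linB Fl) /cal /crs /crsr !(lin_sum Fl).
by congr (_ - _ - _); apply: eq_bigr => p _; rewrite FM ?eX ?eY ?eZ.
Qed.
(** As the two strands commute, $s^{1,2}+m(\bar s)^{(2)}$ is one sum in which $s_+$ acts on both;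
    this is the shape met in [barg] and [barg2]. *)
Lemma bexp_alt (A : algType K) (X Y : g -> A) Z : (forall z y, Y z * X y = X y * Y z) ->
  bexp X Y Z = cal ls Y Z - crsr ss Y (fun z => X z + Y z).
Proof.
move=> YX; rewrite /bexp -addrA -opprD /crs /crsr -big_split /=.
by congr (_ - _); apply: eq_bigr => p _; rewrite mulrDr YX.
Qed.
Lemma barg_bexp (C : compFilAlgType K) (D e3 : env g -> C) e4 (X Y : g -> C) :
  (forall z, Y z = e3 (ugen z)) -> (forall z, D (ugen z) = X z + Y z) ->
  (forall z y, Y z * X y = X y * Y z) -> barg D e4 e3 ls ss = bexp X Y e4.
Proof.
move=> eY eD YX; rewrite (bexp_alt _ YX) /barg.
by congr (_ - _); apply: eq_bigr => p _; rewrite -?eD eY.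
Qed.
Lemma barg2_bexp (C : compFilAlgType K) (D e2 e3 : env g -> C) e4 (X Y Z : g -> C) :
  (forall z, Y z = e2 (ugen z)) -> (forall z, Z z = e3 (ugen z)) ->
  (forall z, D (ugen z) = X z + Y z) -> (forall z y, Y z * X y = X y * Y z) ->
  barg2 D e2 e3 e4 ls ss = bexp X Y (fun z => Z (vl z) + e4 z).
Proof.
move=> eY eZ eD YX; rewrite (bexp_alt _ YX) /barg2.
by congr (_ - _); apply: eq_bigr => p _; rewrite -?eD eY ?eZ.
Qed.
Lemma cas_commute (A : algType K) (X Y : g -> A) T : (forall z, X z * T = T * X z) ->
  (forall z, Y z * T = T * Y z) -> cas tt X Y * T = T * cas tt X Y.
Proof.
move=> XT YT; rewrite /cas mulr_suml mulr_sumr; apply: eq_bigr => p _.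
by rewrite -mulrA YT !mulrA XT.
Qed.
Lemma cas_Dl (A : algType K) (X Y Z : g -> A) :
  cas tt (fun z => X z + Y z) Z = cas tt X Z + cas tt Y Z.
Proof. by rewrite /cas -big_split; apply: eq_bigr => p _; rewrite mulrDl. Qed.
Lemma cas_Dr (A : algType K) (X Y Z : g -> A) :
  cas tt X (fun z => Y z + Z z) = cas tt X Y + cas tt X Z.
Proof. by rewrite /cas -big_split; apply: eq_bigr => p _; rewrite mulrDr. Qed.
Hypothesis tinv : forall (V : lmodType K) (F : g -> g -> V), bilin F -> forall z,
  \sum_(p <- tt) (F (lie z p.1) p.2 + F p.1 (lie z p.2)) = 0.
Lemma cas_inv (A : algType K) (X Y : g -> A) : linear X -> linear Y ->
  lie_gen X -> lie_gen Y -> (forall z y, Y z * X y = X y * Y z) ->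
  forall z, (X z + Y z) * cas tt X Y = cas tt X Y * (X z + Y z).
Proof.
move=> Xl Yl Xg Yg YX z; apply/eqP; rewrite -subr_eq0; apply/eqP.
have inv := tinv (bilin_mul Xl Yl) z.
apply: eq_trans inv; rewrite /cas mulr_sumr mulr_suml; apply: sub_sums => p.
exact: comm_pair (Xg _ _) (Yg _ _) (YX _ _) (esym (YX _ _)).
Qed.
End Exchange.

(** * The pseudotwist equation for sums over lists *)

Section TwistPentagon.
Variables (K : fieldType).
Variables (g : lieAlgType K) (P : polarized g).
Local Notation Lp := (lie_of (pu P)).
Local Notation Lm := (lie_of (pv P)).
Local Notation Ll := (lie_of (pl P)).
Local Notation U := (env g).
Local Notation ip := (@uincl K g (pu P)).
Local Notation im := (@uincl K g (pv P)).
Local Notation il := (@uincl K g (pl P)).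
Local Notation vp := (@lval K g (pu P)).
Local Notation vm := (@lval K g (pv P)).
Local Notation vl := (@lval K g (pl P)).
Variables (d : nat) (xs ys : d.-tuple g).
Variables (M : compFilAlgType K) (j : env Ll -> M).
Variables (S : comAlgType K) (i : Ll -> S) (sigma : int -> M -> S).
Hypothesis char0 : forall n, n.+1%:R != 0 :> K.
Hypothesis jh : alg_hom j.
Hypothesis jf : forall n u, ufil n u -> fil n (j u).
Hypotheses (bx : basis_of (pu P) xs) (byy : basis_of (pv P) ys).
Hypotheses (hS : is_loc_sym xs ys i) (hsig : is_symbol xs ys j i sigma).
Variable H : U -> env Ll.
Hypothesis hH : is_HC H.
Variable k : ctens (tens (env Lp) (env Lm)) M.
Hypothesis hk : is_K j H k.
Variables (V : algType K) (io : U -> V).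
Hypothesis hio : alg_hom io.
Variables (A : M -> M) (DR DL : M -> ctens (env Ll) M).
Hypotheses (hDR : alg_hom DR) (DRb : bdd 0 DR).
Hypothesis DR_gen : forall z, DR (j (ugen z)) = cpure (ugen z) 1 + cpure 1 (j (ugen z)).
Hypotheses (hDL : alg_hom DL) (DLb : bdd 0 DL).
Hypothesis DL_gen : forall z, DL (j (ugen z)) = cpure (ugen z) 1 + cpure 1 (j (ugen z)).
Hypotheses (hA : alg_antihom A) (Ab : bdd 0 A).
Hypothesis A_gen : forall z, A (j (ugen z)) = - j (ugen z).
Variables (cop : V -> tens V V).
Hypothesis hcop : alg_hom cop.
Hypothesis cop_gen : forall z, cop (io (ugen z)) = tpure (io (ugen z)) 1 + tpure 1 (io (ugen z)).
Let rv := rho_tri_val char0 jh jf bx byy hS hsig hH hk.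
Let rl := rho_lin jh jf hH k.
Let iol : linear io. Proof. by case: hio. Qed.

Local Notation W2 := (ctens (tens V V) M).
Local Notation l1 := (fun u => @leg1 K V M (io u)).
Local Notation l2 := (fun u => @leg2 K V M (io u)).
Local Notation cu := (fun u => @cunit K M V (io u)).

Local Notation V2 := (tens V V).
Local Notation W3 := (ctens (tens V V2) M).
Local Notation up := (@shift K V V2 M).
Local Notation dnt := (dant io A DR).
Local Notation dnt2 := (fun m => up2 (dnt m)).
Local Notation dnt12 := (fun m => cmapl cop (dnt m)).
Local Notation dntl := (fun m => split34 io DL (dnt m)).
Local Notation l12 := (fun u => @cunit K M V2 (cop (io u))).
Let l1h : alg_hom l1 := alg_hom_comp (@leg1_hom K V M) hio.
Let l2h : alg_hom l2 := alg_hom_comp (@leg2_hom K V M) hio.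
Let l12h : alg_hom l12 := l12_hom M hio hcop.
Let l10 u : fil 0 (l1 u) := cunit_fil M _.
Let l20 u : fil 0 (l2 u) := cunit_fil M _.
Let l120 u : fil 0 (l12 u) := cunit_fil M _.
Let d2h : alg_antihom dnt2 := dant2_antihom hio hDR hA Ab.
Let d2b : bdd 0 dnt2 := dant2_bdd hio DRb Ab.
Let d2g z : dnt2 (j (ugen z)) = - (l2 (ugen (vl z)) + wgen j V2 z) :=
  dant2_gen hio DR_gen hA Ab A_gen z.
Let d12h : alg_antihom dnt12 := dnt12_antihom hio hDR hA Ab hcop.
Let d12b : bdd 0 dnt12 := dnt12_bdd hio DRb Ab hcop.
Let d12g z : dnt12 (j (ugen z)) = - (l12 (ugen (vl z)) + wgen j V2 z) :=
  dnt12_gen hio DR_gen hA Ab A_gen hcop z.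
Let dlh : alg_antihom dntl := dntl_antihom hio hDR hDL DLb hA Ab.
Let dlb : bdd 0 dntl := dntl_bdd hio DRb DLb Ab.
Let dlg z : dntl (j (ugen z)) = - (l1 (ugen (vl z)) + (l2 (ugen (vl z)) + wgen j V2 z)) :=
  dntl_gen hio DR_gen hDL DLb DL_gen hA Ab A_gen z.
Let dlj h : dntl (j h) = dnt12 (j h) :=
  dntl_j jh hio hDR DR_gen hDL DLb DL_gen hA Ab A_gen hcop cop_gen h.
Let l12g z : l12 (ugen z) = l1 (ugen z) + l2 (ugen z) := l12_gen M cop_gen z.
Let l21 u v : l2 u * l1 v = l1 v * l2 u := l2_l1 M (io u) (io v).
Let w1 z u : wgen j V2 z * l1 u = l1 u * wgen j V2 z := wgen_cunit j z _.
Let w2 z u : wgen j V2 z * l2 u = l2 u * wgen j V2 z := wgen_cunit j z _.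
Let w12 z u : wgen j V2 z * l12 u = l12 u * wgen j V2 z := wgen_cunit j z _.
Let d21 m u : dnt2 m * l1 u = l1 u * dnt2 m := dnt2l1 io A DR m u.
Local Notation J := (J1 k l1 l2 dnt2).
Let Jc h : J * dnt12 (j h) = dnt12 (j h) * J :=
  J_comm char0 jh jf bx byy hS hsig hH hk hio hDR DRb DR_gen hA Ab A_gen hcop cop_gen h.
Local Notation S1 := (fun u => s1 M (io u)).
Local Notation S2 := (fun u => s2 M (io u)).
Local Notation S3 := (fun u => s3 M (io u)).
Local Notation S12 := (fun u => s12 M cop (io u)).
Local Notation S23 := (fun u => s23 M cop (io u)).
Variables (tt : seq (g * g)) (ls : seq (Ll * Ll)) (ss : seq (Lp * Lm)).
Hypothesis ttE : tt = [seq (vl p.1, vl p.2) | p <- ls] ++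
  ([seq (vp p.1, vm p.2) | p <- ss] ++ [seq (vm p.2, vp p.1) | p <- ss]).
Hypothesis tinv : forall (V : lmodType K) (F : g -> g -> V), bilin F -> forall z,
  \sum_(p <- tt) (F (lie z p.1) p.2 + F p.1 (lie z p.2)) = 0.
Hypothesis lsym : forall (V : lmodType K) (F : Ll -> Ll -> V), bilin F ->
  \sum_(p <- ls) F p.1 p.2 = \sum_(p <- ls) F p.2 p.1.

Hypothesis tsym : forall (V : lmodType K) (F : g -> g -> V), bilin F ->
  \sum_(p <- tt) F p.1 p.2 = \sum_(p <- tt) F p.2 p.1.
Hypothesis io_surj : forall v, exists u, v = io u.
Local Notation w4 := (wgen j (tens V V2)).
Local Notation dlm := (dl io DL).
Let S1h : alg_hom S1 := alg_hom_comp (@s1_hom K V M) hio.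
Let S2h : alg_hom S2 := alg_hom_comp (@s2_hom K V M) hio.
Let S3h : alg_hom S3 := alg_hom_comp (@s3_hom K V M) hio.
Let S12h : alg_hom S12 := alg_hom_comp (s12_hom M hcop) hio.
Let S23h : alg_hom S23 := alg_hom_comp (s23_hom M hcop) hio.
Let g1 z := l1 (ugen z).
Let g2 z := l2 (ugen z).
Let G1 z := S1 (ugen z).
Let G2 z := S2 (ugen z).
Let G3 z := S3 (ugen z).
Definition casimir2 : W2 := cas tt (fun z => l1 (ugen z)) (fun z => l2 (ugen z)).
Definition bexp2 : W2 :=
  bexp ls ss (fun z => l1 (ugen z)) (fun z => l2 (ugen z)) (wgen j V2).

Let S12g z : S12 (ugen z) = G1 z + G2 z := s12_gen M (cop_gen z).
Let S23g z : S23 (ugen z) = G2 z + G3 z.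
Proof.
have [hl _ _] := @shift_hom K V V2 M.
exact: (eq_trans (congr1 up (l12g z)) (linD hl _ _)).
Qed.
Let Y12h := X12_hom M hcop.
Let Y23h := X23_hom M hcop.
Let dlmh := dl_hom hio hDL.
Let dlmb := dl_bdd hio DLb.
Let Y34h : alg_hom (Y34 dlm) := X34_hom dlmh dlmb (dl_l1 hio DL).
Let uph : alg_hom up := @shift_hom K V V2 M.

Let y12_1 z : Y12 cop (g1 z) = G1 z + G2 z.
Proof. by rewrite -S12g; exact: (X12_l1 M hcop). Qed.
Let y12_2 z : Y12 cop (g2 z) = G3 z. Proof. exact: (X12_l2 M hcop). Qed.
Let y12_w z : Y12 cop (wgen j V2 z) = w4 z. Proof. exact: (X12_w hcop). Qed.
Let y23_1 z : Y23 cop (g1 z) = G1 z. Proof. exact: (X23_l1 M hcop). Qed.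
Let y23_2 z : Y23 cop (g2 z) = G2 z + G3 z.
Proof. by rewrite -S23g; exact: (X23_l2 M hcop). Qed.
Let y23_w z : Y23 cop (wgen j V2 z) = w4 z. Proof. exact: (X23_w hcop). Qed.
Let y34_1 z : Y34 dlm (g1 z) = G1 z. Proof. exact: (X34_l1 dlmh dlmb). Qed.
Let y34_2 z : Y34 dlm (g2 z) = G2 z. Proof. exact: (X34_l2 dlmh dlmb). Qed.
Let y34_w z : Y34 dlm (wgen j V2 z) = G3 (vl z) + w4 z.
Proof.
have [hl _ _] := uph.
rewrite /wgen (X34_w dlmb) (dl_gen hio DL_gen) (linD hl); congr (_ + _).
exact: shift_wgen.
Qed.
Let up_w z : up (wgen j V2 z) = w4 z. Proof. exact: shift_wgen. Qed.

Let cas12 : Y12 cop casimir2 = cas tt G1 G3 + cas tt G2 G3.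
Proof. by rewrite -cas_Dl; exact: (cas_map tt Y12h y12_1 y12_2). Qed.
Let cas23 : Y23 cop casimir2 = cas tt G1 G2 + cas tt G1 G3.
Proof. by rewrite -cas_Dr; exact: (cas_map tt Y23h y23_1 y23_2). Qed.
Let cas34 : Y34 dlm casimir2 = cas tt G1 G2.
Proof. exact: (cas_map tt Y34h y34_1 y34_2). Qed.
Let cas4 : up casimir2 = cas tt G2 G3.
Proof. exact: (cas_map tt uph (fun z => erefl) (fun z => erefl)). Qed.
Let bexp12 : Y12 cop bexp2 = B34 G1 G2 G3 w4 ls ss.
Proof. exact: (bexp_map ls ss Y12h y12_1 y12_2 y12_w). Qed.
Let bexp23 : Y23 cop bexp2 = B3 G1 G2 G3 w4 ls ss.
Proof. exact: (bexp_map ls ss Y23h y23_1 y23_2 y23_w). Qed.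
Let bexp34 : Y34 dlm bexp2 = B2 G1 G2 G3 w4 ls ss.
Proof. exact: (bexp_map ls ss Y34h y34_1 y34_2 y34_w). Qed.
Let bexp4 : up bexp2 = B4 G2 G3 w4 ls ss.
Proof. exact: (bexp_map ls ss uph (fun z => erefl) (fun z => erefl) up_w). Qed.

Let l1g' : lie_gen g1 := gen_lie l1h.
Let l2g' : lie_gen g2 := gen_lie l2h.
Let cas2_inv z : (g1 z + g2 z) * casimir2 = casimir2 * (g1 z + g2 z).
Proof.
exact: (cas_inv tinv (lin_gen l1h) (lin_gen l2h) l1g' l2g' (fun x y => l21 (ugen x) (ugen y))).
Qed.
(** Invariance of $t$: it commutes with coproducts. *)
Let cas2_l12 u : casimir2 * l12 u = l12 u * casimir2.
Proof.
apply: (env_commute l12h) => z; have -> : l12 (ugen z) = g1 z + g2 z := l12g z.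
exact: esym (cas2_inv z).
Qed.
Let cas2_cpure m : casimir2 * cpure 1 m = cpure 1 m * casimir2.
Proof. by apply: cas_commute => z; exact: esym (cpure_comm _ _). Qed.
Let copl : linear cop. Proof. by case: hcop. Qed.
Let cas2_cop Z : casimir2 * cmapl cop Z = cmapl cop Z * casimir2.
Proof.
move: Z; apply: ctens_ext.
- by apply: bnd_Ml; exact: cmapl_bnd.
- by apply: bnd_Mr; exact: cmapl_bnd.
(* [cop] is known only on the image of [io], which surjectivity makes everything. *)
- move=> v m; have [u ->] := io_surj v; rewrite (cmapl_pure _ _ copl).
  have -> : cpure (cop (io u)) m = l12 u * cpure 1 m.
    by rewrite cpureM mulr1 mul1r.
  exact: esym (mul_commute (esym (cas2_l12 u)) (esym (cas2_cpure m))).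
Qed.
Let S1g : lie_gen G1 := gen_lie S1h.
Let S2g : lie_gen G2 := gen_lie S2h.
Let S3g : lie_gen G3 := gen_lie S3h.
Let w4g : lie_gen w4.
Proof.
exact: (gen_lie (alg_hom_comp (@cpurer_hom K M (tens V V2)) jh)).
Qed.
Let S1l : linear G1 := lin_gen S1h.
Let S2l : linear G2 := lin_gen S2h.
Let S3l : linear G3 := lin_gen S3h.
Let w4l : linear w4 := lin_gen (alg_hom_comp (@cpurer_hom K M (tens V V2)) jh).
Let S21 z y : G2 z * G1 y = G1 y * G2 z. Proof. exact: s2_s1. Qed.
Let S31 z y : G3 z * G1 y = G1 y * G3 z. Proof. exact: s3_s1. Qed.
Let S32 z y : G3 z * G2 y = G2 y * G3 z. Proof. exact: s3_s2. Qed.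
Let w41 z y : w4 z * G1 y = G1 y * w4 z := wgen_cunit j z _.
Let up_wc z u : up (wgen j V2 z) * up (cunit M u) = up (cunit M u) * up (wgen j V2 z).
Proof. exact: (hom_commute uph (wgen_cunit j z u)). Qed.
Let w42 z y : w4 z * G2 y = G2 y * w4 z.
Proof. by rewrite -up_w; exact: up_wc. Qed.
Let w43 z y : w4 z * G3 y = G3 y * w4 z.
Proof. by rewrite -up_w; exact: up_wc. Qed.
Let t4 m := up (dnt2 m).
Let t4h : alg_antihom t4 := alg_hom_anticomp (@shift_hom K V V2 M) d2h.
Let t4b : bdd 0 t4.
Proof. by have := bdd_comp (@shift_bdd K V V2 M) d2b; rewrite addr0. Qed.
Let t12 m := up (dnt12 m).
Let t12h : alg_antihom t12 := alg_hom_anticomp (@shift_hom K V V2 M) d12h.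
Let t12b : bdd 0 t12.
Proof. by have := bdd_comp (@shift_bdd K V V2 M) d12b; rewrite addr0. Qed.
Local Notation Kone := (K1 k io A DR cop).
Local Notation Ktwo := (K2 k io A DR DL).
Local Notation Kthree := (K3 k io A DR cop).
(** $J^{12,3,4}$ meets the strands 1 and 2 only through their diagonal, with which $t^{1,2}$
    commutes. *)
Let Kone_cas : Kone * cas tt G1 G2 = cas tt G1 G2 * Kone.
Proof.
apply: (J1_commute k S12h (fun u => s12_fil M cop _) S3h (fun u => s3_fil M _) t4h t4b).
- apply: (env_commute S12h) => z; have -> : S12 (ugen z) = G1 z + G2 z := S12g z.
  exact: esym (cas_inv tinv S1l S2l S1g S2g S21 z).
- move=> u; have c1 z : G1 z * S3 u = S3 u * G1 z := esym (s3_s1 M (io u) (io (ugen z))).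
  have c2 z : G2 z * S3 u = S3 u * G2 z := esym (s3_s2 M (io u) (io (ugen z))).
  exact: (cas_commute tt c1 c2).
- move=> m; have c1 z : G1 z * t4 m = t4 m * G1 z := esym (up_s1 (dnt2 m) (io (ugen z))).
  have c2 z : G2 z * t4 m = t4 m * G2 z := hom_commute uph (esym (d21 m (ugen z))).
  exact: (cas_commute tt c1 c2).
Qed.
(** $J^{1,23,4}$ meets the strands 2 and 3 only through coproducts, including the one inside its
    dynamical part. *)
Let Kthree_cas : Kthree * cas tt G2 G3 = cas tt G2 G3 * Kthree.
Proof.
rewrite -cas4.
apply: (J1_commute k S1h (fun u => s1_fil M _) S23h (fun u => s23_fil M cop _) t12h t12b).
- by move=> u; exact: up_s1.
- by move=> u; exact: (hom_commute uph (cas2_l12 u)).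
- by move=> m; exact: (hom_commute uph (cas2_cop (dnt m))).
Qed.

Let Kone_B2 : Kone * B2 G1 G2 G3 w4 ls ss =
  B2 G1 G2 G3 w4 ls ss * Kone + crs ss G2 G3 * Kone.
Proof.
have e := K1_barg char0 jh jf bx byy hS hsig hH hk hio hDR DRb DR_gen hA Ab A_gen hcop cop_gen
  ttE tinv.
have eB : barg2 S12 S2 S3 w4 ls ss = B2 G1 G2 G3 w4 ls ss.
  exact: (@barg2_bexp K g P ls ss W3 S12 S2 S3 w4 G1 G2 G3 (fun z => erefl) (fun z => erefl) S12g S21).
by move: e; rewrite eB.
Qed.
Let Kthree_B4 : Kthree * B4 G2 G3 w4 ls ss =
  B4 G2 G3 w4 ls ss * Kthree - crs ss G1 G3 * Kthree.
Proof.
have e := K3_barg char0 jh jf bx byy hS hsig hH hk hio hDR DRb DR_gen hA Ab A_gen hcop cop_gen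
  ttE tinv lsym.
have eB : barg l12 (wgen j V2) l2 ls ss = bexp2.
  exact: (@barg_bexp K g P ls ss W2 l12 l2 (wgen j V2) g1 g2 (fun z => erefl) l12g
    (fun x y => l21 (ugen x) (ugen y))).
by move: e; rewrite eB bexp4.
Qed.
Theorem pentagon_twist (Phi : ncs K) c : Phi [::] = 1 -> inv_pentagon Phi c ->
  smul (fun n => Y12 cop (Phi_inv Phi c casimir2 bexp2 n * J))
       (fun n => Y34 dlm (Phi_inv Phi c casimir2 bexp2 n * J)) =
  smul (Phi_inv Phi c (cas tt G1 G2) (cas tt G2 G3))
    (smul (fun n => Y23 cop (Phi_inv Phi c casimir2 bexp2 n * J))
          (fun n => up (Phi_inv Phi c casimir2 bexp2 n * J))).
Proof.
move=> P0 hPhi.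
have J12 := Y12_J k hio hDR DRb hA Ab hcop.
have J23 := Y23_J k hio hDR DRb hA Ab hcop.
have J34 := Y34_J k hio hDR DRb hDL DLb hA Ab.
have -> : (fun n => Y12 cop (Phi_inv Phi c casimir2 bexp2 n * J)) = _ :=
  funext (Phi_inv_map Phi c Y12h cas12 bexp12 J12).
have -> : (fun n => Y34 dlm (Phi_inv Phi c casimir2 bexp2 n * J)) = _ :=
  funext (Phi_inv_map Phi c Y34h cas34 bexp34 J34).
have -> : (fun n => Y23 cop (Phi_inv Phi c casimir2 bexp2 n * J)) = _ :=
  funext (Phi_inv_map Phi c Y23h cas23 bexp23 J23).
have -> : (fun n => up (Phi_inv Phi c casimir2 bexp2 n * J)) = _ :=
  funext (Phi_inv_map Phi c uph cas4 bexp4 erefl).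
have e0 := cocycle_W3 char0 jh jf bx byy hS hsig hH hk hio hDR DRb DR_gen hDL DLb DL_gen hA Ab
  A_gen hcop cop_gen.
have h0 := @pseudotwist_assembly K g P W3 G1 G2 G3 w4 S1l S2l S3l w4l S1g S2g S3g w4g S21 S31 S32.
have h1 := h0 w41 w42 w43 tt ls ss ttE tinv tsym Phi c Kone Ktwo Kthree (up J) P0 hPhi.
have h2 := h1 e0.
have h3 := h2 Kone_cas.
have h4 := h3 Kone_B2.
have h5 := h4 Kthree_cas Kthree_B4.
exact: h5.
Qed.
End TwistPentagon.

(** * Tensors as explicit sums *)

Section TensorLists.
Variables (K : fieldType) (g : lieAlgType K) (P : polarized g).
Local Notation Lp := (lie_of (pu P)).
Local Notation Lm := (lie_of (pv P)).
Local Notation Ll := (lie_of (pl P)).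
Local Notation vp := (@lval K g (pu P)).
Local Notation vm := (@lval K g (pv P)).
Local Notation vl := (@lval K g (pl P)).
Variables (t : tens g g) (tl : tens Ll Ll) (s : tens Lp Lm).
(** One list of pure tensors serves all of $t$; its three blocks are $t_{\mathfrak l}$, $s$ and
    $s^{2,1}$, so that arguments may use invariance of the whole or treat the parts separately. *)
Definition tlist (ls : seq (Ll * Ll)) (ss : seq (Lp * Lm)) : seq (g * g) :=
  [seq (vl p.1, vl p.2) | p <- ls] ++
  ([seq (vp p.1, vm p.2) | p <- ss] ++ [seq (vm p.2, vp p.1) | p <- ss]).
Hypothesis tq : pol_quadratic t tl s.
Variables (ls : seq (Ll * Ll)) (ss : seq (Lp * Lm)).
Hypothesis lsE : tl = \sum_(p <- ls) tpure p.1 p.2.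
Hypothesis ssE : s = \sum_(p <- ss) tpure p.1 p.2.
Local Notation tt := (tlist ls ss).
Lemma tlistE : t = \sum_(p <- tt) tpure p.1 p.2.
Proof.
have [vpl vml vll] : [/\ linear vp, linear vm & linear vl] by split; exact: lvalL.
have e : tmap vp vm s = \sum_(p <- ss) tpure (vp p.1) (vm p.2).
  rewrite ssE (lin_sum (tmap_lin vpl vml)); apply: eq_bigr => p _; exact: tmap_pure.
case: tq => _ _ _ ->; rewrite e lsE (lin_sum (tmap_lin vll vll)) (lin_sum (@tflip_lin K g g)).
rewrite !big_cat !big_map /= -addrA; congr (_ + (_ + _)).
  by apply: eq_bigr => p _; rewrite tmap_pure.
by apply: eq_bigr => p _; rewrite tflip_pure.
Qed.
Lemma tlist_inv (X : lmodType K) (F : g -> g -> X) : bilin F -> forall z,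
  \sum_(p <- tt) (F (lie z p.1) p.2 + F p.1 (lie z p.2)) = 0.
Proof.
move=> hF z; case: tq => _ inv _ _.
have [Ll Il] : linear (lie z) /\ linear (@id g) by split; [exact: lin_lier | exact: lin_id].
have := congr1 (tlift F) (inv z); rewrite (lin0 (tlift_linear hF)) => e; apply: eq_trans e.
rewrite tlistE !(lin_sum (tmap_lin Ll Il)) !(lin_sum (tmap_lin Il Ll)) -big_split /=.
rewrite (lin_sum (tlift_linear hF)); apply: eq_bigr => p _.
by rewrite !tmap_pure // (linD (tlift_linear hF)) !tlift_pure.
Qed.
Lemma tlist_sym (X : lmodType K) (F : g -> g -> X) : bilin F ->
  \sum_(p <- tt) F p.1 p.2 = \sum_(p <- tt) F p.2 p.1.
Proof.
move=> hF; case: tq => sym _ _ _.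
have := congr1 (tlift F) sym; rewrite tlistE (lin_sum (@tflip_lin K g g)).
rewrite !(lin_sum (tlift_linear hF)) => e; symmetry; apply: etrans (etrans e _).
  by apply: eq_bigr => p _; rewrite tflip_pure tlift_pure.
by apply: eq_bigr => p _; rewrite tlift_pure.
Qed.
Lemma llist_sym (X : lmodType K) (F : Ll -> Ll -> X) : bilin F ->
  \sum_(p <- ls) F p.1 p.2 = \sum_(p <- ls) F p.2 p.1.
Proof.
move=> hF; case: tq => _ _ sym _.
have := congr1 (tlift F) sym; rewrite lsE (lin_sum (@tflip_lin K Ll Ll)).
rewrite !(lin_sum (tlift_linear hF)) => e; symmetry; apply: etrans (etrans e _).
  by apply: eq_bigr => p _; rewrite tflip_pure tlift_pure.
by apply: eq_bigr => p _; rewrite tlift_pure.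
Qed.
Lemma cas_tens (V B : algType K) (ug : g -> V) (L : tens V V -> B) (X Y : g -> B) :
  linear ug -> linear L -> (forall x y, L (tpure (ug x) (ug y)) = X x * Y y) ->
  L (tmap ug ug t) = cas tt X Y.
Proof.
move=> ul Ll e; rewrite tlistE (lin_sum (tmap_lin ul ul)) (lin_sum Ll).
by apply: eq_bigr => p _; rewrite tmap_pure.
Qed.
Lemma bexp_tens (V : algType K) (B : algType K) (ug : g -> V) (L : tens V V -> B)
    (X Y : g -> B) (Z : Ll -> B) :
  linear ug -> linear L -> linear Y -> linear Z ->
  (forall x y, L (tpure (ug x) (ug y)) = X x * Y y) ->
  (forall x y, L (tpure 1 (ug x * ug y)) = Y x * Y y) ->
  tlift (fun x y => Y (vl x) * Z y) tl - L (tmap ug ug (tmap vp vm s)) -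
    L (tpure 1 (tlift (fun a b => a * b) (tmap ug ug (tflip (tmap vp vm s))))) =
  bexp ls ss X Y Z.
Proof.
move=> ul Ll Yl Zl e e'; have [vpl vml vll] : [/\ linear vp, linear vm & linear vl].
  by split; exact: lvalL.
have bz := bilin_mul (lin_comp Yl vll) Zl.
have bm : bilin (fun a b : V => a * b) := bilin_mul (@lin_id K V) (@lin_id K V).
rewrite lsE ssE (lin_sum (tlift_linear bz)) (lin_sum (tmap_lin vpl vml)).
rewrite (lin_sum (@tflip_lin K g g)) !(lin_sum (tmap_lin ul ul)) (lin_sum (tlift_linear bm)).
rewrite (lin_sum (@lin_tpurer K V V 1)) !(lin_sum Ll).
congr (_ - _ - _); apply: eq_bigr => p _; first exact: tlift_pure.
  by rewrite !tmap_pure.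
by rewrite tmap_pure // tflip_pure tmap_pure // tlift_pure.
Qed.
End TensorLists.

Lemma clift_ext (K : fieldType) (A : algType K) (M : compFilAlgType K) (B : filAlgType K)
  (b b' : A -> M -> B) X : (forall a m, b a m = b' a m) -> clift b X = clift b' X.
Proof. by move=> e; congr (clift _ X); apply/funext=> a; apply/funext=> m. Qed.

(** * Identification of J and of the last leg map with their defining formulas *)

Section Legs.
Variables (K : fieldType) (g : lieAlgType K) (P : polarized g).
Local Notation Lp := (lie_of (pu P)).
Local Notation Lm := (lie_of (pv P)).
Local Notation Ll := (lie_of (pl P)).
Local Notation U := (env g).
Local Notation ip := (@uincl K g (pu P)).
Local Notation im := (@uincl K g (pv P)).
Local Notation il := (@uincl K g (pl P)).
Variables (M : compFilAlgType K) (V : algType K) (io : U -> V).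
Hypothesis hio : alg_hom io.
Variables (A : M -> M) (DR DL : M -> ctens (env Ll) M).
Hypothesis Ab : bdd 0 A.
Local Notation W2 := (ctens (tens V V) M).
Local Notation l1 := (fun u => @leg1 K V M (io u)).
Local Notation l2 := (fun u => @leg2 K V M (io u)).
Local Notation dnt2 := (fun m => up2 (dant io A DR m)).
Let iol : linear io. Proof. by case: hio. Qed.
Let al : linear (@uant K g). Proof. by case: (uant_antihom g). Qed.
Let ipl : linear ip. Proof. by case: (uincl_hom (pu P)). Qed.
Let iml : linear im. Proof. by case: (uincl_hom (pv P)). Qed.
Let ill : linear il. Proof. by case: (uincl_hom (pl P)). Qed.
Lemma dant2E m :
  clift (fun m2 m1 => cpure (tpure 1 (io (uant (il m2)))) (A m1) : W2) (DR m) =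
  up2 (dant io A DR m).
Proof.
have b1 : bbd 0 (fun m2 m1 => cpure (tpure 1 (io (uant (il m2)))) (A m1) : W2).
  split; last by move=> a q u qu; apply: cpure_fil; exact: Ab.2.
  split=> u; first exact: (lin_comp (@lin_cpurer _ M _ _) (bdd_lin Ab)).
  apply: (lin_comp (lin_cpurel _)); apply: (lin_comp (@lin_tpurer _ _ _ _)).
  exact: (lin_comp iol (lin_comp al ill)).
have db := dant_bbd P hio Ab.
rewrite /dant; move: (DR m); apply: ctens_ext.
- exact: (clift_bnd b1).
- exact: (bnd_comp (bdd_bnd (@up2_bdd K V M)) (clift_bnd db)).
- by move=> u m'; rewrite (clift_pure db) /cunit -cpure_split up2_pure (clift_pure b1).
Qed.
(** The explicit formula for the dynamical twist agrees with [J1]: $S(b)$ and $S(\ell^{(2)})$ share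
    leg 2, and [dant] packs $S(\ell^{(2)})\otimes S(\ell^{(1)})$. *)
Lemma J1_E (k : ctens (tens (env Lp) (env Lm)) M) :
  clift (fun z m => cpure (tmap (fun a => io (ip a)) (fun b => io (uant (im b))) z) 1 *
    clift (fun m2 m1 => cpure (tpure 1 (io (uant (il m2)))) (A m1) : W2) (DR m)) k =
  J1 k l1 l2 dnt2.
Proof.
have pl : linear (fun a => io (ip a)) := lin_comp iol ipl.
have ml : linear (fun b => io (uant (im b))) := lin_comp iol (lin_comp al iml).
have [l1l _ _] := alg_hom_comp (@leg1_hom K V M) hio.
have [l2l _ _] := alg_hom_comp (@leg2_hom K V M) hio.
rewrite /J1 /clift3; congr (clift _ k); apply/funext=> z; apply/funext=> m.
rewrite dant2E; pose X := up2 (dant io A DR m).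
have bl : bilin (fun a b => l1 (ip a) * (l2 (uant (im b)) * X)).
  apply: (bilin_mul (lin_comp l1l ipl)); apply: lin_Mr; exact: (lin_comp l2l (lin_comp al iml)).
move: z; apply: (tens_lin_ext (f := fun z => cpure (tmap (fun a => io (ip a))
  (fun b => io (uant (im b))) z) 1 * X)
  (h := tlift (fun a b => l1 (ip a) * (l2 (uant (im b)) * X)))).
- by apply: lin_Mr; apply: (lin_comp (lin_cpurel _)); exact: tmap_lin.
- exact: tlift_linear bl.
- move=> a b; rewrite (tlift_pure _ _ bl) tmap_pure // mulrA; congr (_ * _).
  by rewrite cpureM tpureM !mulr1 mul1r.
Qed.
Let up_dl m : shift V (dl io DL m) = cmapl (fun u => tpure 1 (tpure 1 (io (il u)))) (DL m).
Proof.
have l0 : linear (fun u => tpure (1 : V) (io (il u))).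
  exact: lin_comp (@lin_tpurer K V V 1) (lin_comp iol ill).
have l0' : linear (fun u => tpure (1 : V) (tpure (1 : V) (io (il u)))).
  exact: lin_comp (@lin_tpurer K V _ 1) l0.
rewrite /dl; move: (DL m); apply: ctens_ext.
- exact: bnd_comp (bdd_bnd (@shift_bdd K V _ M)) (cmapl_bnd M l0).
- exact: (@cmapl_bnd K M _ _ _ l0').
- by move=> u m'; rewrite !cmapl_pure // shift_pure.
Qed.
Lemma Y34_E z : Y34 (dl io DL) z =
  clift (fun z m => cunit M (tleg12 z) *
    cmapl (fun u => tpure 1 (tpure 1 (io (il u)))) (DL m)) z.
Proof.
exact: (clift_ext z (fun w m => congr1 (fun X => cunit M (tleg12 w) * X) (up_dl m))).
Qed.
End Legs.

(** * The pseudotwist equation for tensors *)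

Section Twist.
Variables (K : fieldType) (g : lieAlgType K) (P : polarized g).
Local Notation Lp := (lie_of (pu P)).
Local Notation Lm := (lie_of (pv P)).
Local Notation Ll := (lie_of (pl P)).
Local Notation U := (env g).
Local Notation ip := (@uincl K g (pu P)).
Local Notation im := (@uincl K g (pv P)).
Local Notation il := (@uincl K g (pl P)).
Local Notation vp := (@lval K g (pu P)).
Local Notation vm := (@lval K g (pv P)).
Local Notation vl := (@lval K g (pl P)).
Variables (d : nat) (xs ys : d.-tuple g).
Variables (M : compFilAlgType K) (j : env Ll -> M).
Variables (S : comAlgType K) (i : Ll -> S) (sigma : int -> M -> S).
Hypothesis char0 : forall n, n.+1%:R != 0 :> K.
Hypothesis jh : alg_hom j.
Hypothesis jf : forall n u, ufil n u -> fil n (j u).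
Hypotheses (bx : basis_of (pu P) xs) (byy : basis_of (pv P) ys).
Hypotheses (hS : is_loc_sym xs ys i) (hsig : is_symbol xs ys j i sigma).
Variable H : U -> env Ll.
Hypothesis hH : is_HC H.
Variable k : ctens (tens (env Lp) (env Lm)) M.
Hypothesis hk : is_K j H k.
Variables (V : algType K) (io : U -> V).
Hypothesis hio : alg_hom io.
Variables (A : M -> M) (DR DL : M -> ctens (env Ll) M).
Hypotheses (hDR : alg_hom DR) (DRb : bdd 0 DR).
Hypothesis DR_gen : forall z, DR (j (ugen z)) = cpure (ugen z) 1 + cpure 1 (j (ugen z)).
Hypotheses (hDL : alg_hom DL) (DLb : bdd 0 DL).
Hypothesis DL_gen : forall z, DL (j (ugen z)) = cpure (ugen z) 1 + cpure 1 (j (ugen z)).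
Hypotheses (hA : alg_antihom A) (Ab : bdd 0 A).
Hypothesis A_gen : forall z, A (j (ugen z)) = - j (ugen z).
Variables (cop : V -> tens V V).
Hypothesis hcop : alg_hom cop.
Hypothesis cop_gen : forall z, cop (io (ugen z)) = tpure (io (ugen z)) 1 + tpure 1 (io (ugen z)).
Hypothesis io_surj : forall v, exists u, v = io u.
Variables (t : tens g g) (tl : tens Ll Ll) (s : tens Lp Lm).
Hypothesis tq : pol_quadratic t tl s.
Local Notation V2 := (tens V V).
Local Notation W2 := (ctens V2 M).
Local Notation W3 := (ctens (tens V V2) M).
Local Notation ug := (fun z => io (ugen z)).
Local Notation g1 := (fun z => leg1 M (ug z)).
Local Notation g2 := (fun z => leg2 M (ug z)).
Let iol : linear io. Proof. by case: hio. Qed.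
Let ugl : linear ug := lin_comp iol (@lin_ugen K g).
Let G1 z := s1 M (ug z).
Let G2 z := s2 M (ug z).
Let G3 z := s3 M (ug z).
Let cul : linear (@cunit K M V2). Proof. by case: (@cunit_hom K M V2). Qed.
Let cul3 : linear (@cunit K M (tens V V2)). Proof. by case: (@cunit_hom K M (tens V V2)). Qed.
Let cunit12 (x y : V) : cunit M (tpure x y) = leg1 M x * leg2 M y.
Proof. by rewrite cpureM tpureM !mulr1 mul1r. Qed.
Let cunit2 (x y : V) : cunit M (tpure (1 : V) (x * y)) = leg2 M x * leg2 M y.
Proof. by rewrite cpureM tpureM !mulr1. Qed.
Let cunit2w (x : V) (m : M) : cpure (tpure (1 : V) x) m = leg2 M x * cpure 1 m.
Proof. by rewrite cpureM mulr1 mul1r. Qed.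
Let cunit23 (x y : V) : cunit M (tpure (1 : V) (tpure x y)) = s2 M x * s3 M y.
Proof. by rewrite s2E s3E cpureM !tpureM !mulr1 mul1r. Qed.
Let g2l : linear g2 := lin_comp (let: And3 h _ _ := @leg2_hom K V M in h) ugl.
Let wl : linear (wgen j V2).
Proof.
by case: jh => jl _ _; exact: (lin_comp (@lin_cpurer K M V2 1) (lin_comp jl (@lin_ugen K Ll))).
Qed.
Definition legJ : W2 :=
  clift (fun z m => cpure (tmap (fun a => io (ip a)) (fun b => io (uant (im b))) z) 1 *
    clift (fun m2 m1 => cpure (tpure 1 (io (uant (il m2)))) (A m1) : W2) (DR m)) k.
Definition legB : W2 :=
  tlift (fun x y => cpure (tpure 1 (ug (vl x))) (j (ugen y)) : W2) tl -
  cpure (tmap ug ug (tmap vp vm s)) 1 -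
  cpure (tpure 1 (tlift (fun a b => a * b) (tmap ug ug (tflip (tmap vp vm s))))) 1.
Definition Z34 : W2 -> W3 := clift (fun z m => cunit M (tleg12 z) *
  cmapl (fun u => tpure 1 (tpure 1 (io (il u)))) (DL m)).
Theorem legs_twist (Phi : ncs K) c : Phi [::] = 1 -> inv_pentagon Phi c ->
  let J n := Phi_inv Phi c (cpure (tmap ug ug t) 1) legB n * legJ in
  smul (fun n => Y12 cop (J n)) (fun n => Z34 (J n)) =
  smul (Phi_inv Phi c (cpure (tleg12 (tmap ug ug t)) 1 : W3) (cpure (tpure 1 (tmap ug ug t)) 1))
    (smul (fun n => Y23 cop (J n)) (fun n => shift V (J n))).
Proof.
move=> P0 hPhi.
have [ls lsE] := tensE tl; have [ss ssE] := tensE s.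
pose tt := tlist ls ss.
have tinv := tlist_inv tq lsE ssE.
have tsym := tlist_sym tq lsE ssE.
have lsym := llist_sym tq lsE.
have e := pentagon_twist char0 jh jf bx byy hS hsig hH hk hio hDR DRb DR_gen hDL DLb DL_gen
  hA Ab A_gen hcop cop_gen (erefl tt) tinv lsym tsym io_surj P0 hPhi.
have eJ := J1_E hio DR Ab k.
have eC : cpure (tmap ug ug t) 1 = casimir2 M io tt.
  exact: (@cas_tens K g P t tl s tq ls ss lsE ssE V W2 ug (@cunit K M V2) g1 g2 ugl cul
    (fun x y => cunit12 (ug x) (ug y))).
have eB : legB = bexp2 j io ls ss.
  have := @bexp_tens K g P tl s ls ss lsE ssE V W2 ug (@cunit K M V2) g1 g2 (wgen j V2) ugl cul
    g2l wl (fun x y => cunit12 (ug x) (ug y)) (fun x y => cunit2 (ug x) (ug y)).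
  apply: eq_trans; congr (_ - _ - _); apply: tlift_eq => x y; exact: cunit2w.
have e12 : cpure (tleg12 (tmap ug ug t)) 1 = cas tt G1 G2.
  exact: (@cas_tens K g P t tl s tq ls ss lsE ssE V W3 ug (fun z => cunit M (tleg12 z)) G1 G2 ugl
    (lin_comp cul3 (@tleg12_lin K V)) (fun x y => cunit_tleg12 M (ug x) (ug y))).
have e23 : cpure (tpure 1 (tmap ug ug t)) 1 = cas tt G2 G3.
  exact: (@cas_tens K g P t tl s tq ls ss lsE ssE V W3 ug (fun z => cunit M (tpure 1 z)) G2 G3 ugl
    (lin_comp cul3 (@lin_tpurer K V V2 1)) (fun x y => cunit23 (ug x) (ug y))).
have eZ : Z34 = Y34 (dl io DL) by apply/funext=> X; symmetry; exact: Y34_E.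
have eJ' : legJ = J1 k (fun u => leg1 M (io u)) (fun u => leg2 M (io u))
  (fun m => up2 (dant io A DR m)) := eJ.
rewrite /= eC eB e12 e23 eZ eJ'.
exact: e.
Qed.
End Twist.

Lemma pentagon_inverse (R : realType) (Phi : ncs R[i]) c : associator Phi -> inv_pentagon Phi c.
Proof. by move=> hPhi A t ht; exact: (@pentagon_inv R Phi c A hPhi t ht). Qed.

Section CopExt.
Variables (K : fieldType) (L : lieAlgType K) (M : compFilAlgType K).
Variable j : {lrmorphism env L -> M}.
Lemma cop_ext_gen (delta : env L -> tens (env L) (env L)) (D : {lrmorphism M -> ctens (env L) M}) :
  is_cop_ext j delta D -> (forall z, delta (ugen z) = tpure (ugen z) 1 + tpure 1 (ugen z)) ->
  forall z, D (j (ugen z)) = cpure (ugen z) 1 + cpure 1 (j (ugen z)).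
Proof.
move=> [_ e] dg z; have [jl j1 _] := alg_hom_lrm j.
have il := @lin_id K (env L).
rewrite e dg (linD (tmap_lin il jl)) (linD (@lin_cin K (ftens (env L) M))).
by rewrite !(tmap_pure il jl) j1.
Qed.
Lemma cop_ext_bdd (delta : env L -> tens (env L) (env L)) (D : {lrmorphism M -> ctens (env L) M}) :
  is_cop_ext j delta D -> bdd 0 D.
Proof.
move=> [f _]; have [Dl _ _] := alg_hom_lrm D; split=> // q x qx; rewrite addr0; exact: f.
Qed.
End CopExt.

Section Enveloping.
Variables (K : fieldType) (g : lieAlgType K) (P : polarized g).
Local Notation Ll := (lie_of (pl P)).
Variables (t : tens g g) (tl : tens Ll Ll) (s : tens (lie_of (pu P)) (lie_of (pv P))).
Variables (M : compFilAlgType K) (j : env Ll -> M).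
Variables (DL DR : M -> ctens (env Ll) M) (A : M -> M).
Variable k : ctens (tens (env (lie_of (pu P))) (env (lie_of (pv P)))) M.
Lemma legJ_env : legJ k (@id (env g)) A DR = Jlg DR A k. Proof. by []. Qed.
Lemma legB_env : legB j (@id (env g)) tl s = B_arg j tl s. Proof. by []. Qed.
Lemma X12_env : @X_12_3_4 _ g M = Y12 (@ucop _ g). Proof. by []. Qed.
Lemma X23_env : @X_1_23_4 _ g M = Y23 (@ucop _ g). Proof. by []. Qed.
Lemma X4_env : @X_2_3_4 K g M = @shift K (env g) (tens (env g) (env g)) M.
Proof. exact: (congr1 (fun f => clift f)). Qed.
Lemma X34_env : X_1_2_34 DL = Z34 (@id (env g)) DL.
Proof. exact: (congr1 (fun f => clift f)). Qed.
End Enveloping.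
Theorem theorem3p2 (R : realType) (g : lieAlgType R[i]) (P : polarized g)
  (t : tens g g) (tl : tens (lie_of (pl P)) (lie_of (pl P)))
  (s : tens (lie_of (pu P)) (lie_of (pv P)))
  (d : nat) (x y : d.-tuple g) (D : env (lie_of (pl P)))
  (M : compFilAlgType R[i]) (j : {lrmorphism env (lie_of (pl P)) -> M})
  (H : env g -> env (lie_of (pl P)))
  (DeltaL DeltaR : {lrmorphism M -> ctens (env (lie_of (pl P))) M})
  (S : M -> M)
  (k : ctens (tens (env (lie_of (pu P))) (env (lie_of (pv P)))) M)
  (Phi : ncs R[i]) (c : R[i]) :
  pol_nondegenerate P ->
  pol_quadratic t tl s ->
  basis_of (pu P) x -> basis_of (pv P) y ->
  is_lift x y D ->
  is_microloc x y j D ->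
  is_HC H ->
  is_cop_ext j (@ucop _ _) DeltaL ->
  is_cop_ext j (fun u => tflip (ucop u)) DeltaR ->
  is_ant_ext j S ->
  is_K j H k ->
  associator Phi ->
  pseudotwist DeltaL Phi c t (Jbar j Phi c t tl s (Jlg DeltaR S k)).
Proof.
move=> _ tq bx by_ _ [_ [jf _] [L [i [sigma [hL hsig]]]] _] hH hDL hDR [Sl S1 SM Sf Sj] hk hPhi.
have char0 n : n.+1%:R != 0 :> R[i] by rewrite pnatr_eq0.
have DLg := cop_ext_gen hDL (@ucop_gen _ _).
(* Generators are primitive, so the flip in the right-hand coproduct does not change their image. *)
have DRg : forall z, DeltaR (j (ugen z)) = cpure (ugen z) 1 + cpure 1 (j (ugen z)).
  apply: (cop_ext_gen hDR) => z.
  by rewrite ucop_gen (linD (@tflip_lin _ _ _)) !tflip_pure addrC.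
have Sh : alg_antihom S by split.
have Sb : bdd 0 S by split=> // q u qu; rewrite addr0; exact: Sf.
have Sg z : S (j (ugen z)) = - j (ugen z).
  by rewrite Sj uant_gen (linN (let: And3 h _ _ := alg_hom_lrm j in h)).
(* Here $V=U(\mathfrak g)$, [io] is the identity and [cop] is the coproduct. *)
have := legs_twist char0 (alg_hom_lrm j) jf bx by_ hL hsig hH hk (@alg_hom_id _ (env g))
  (alg_hom_lrm DeltaR) (cop_ext_bdd hDR) DRg (alg_hom_lrm DeltaL) (cop_ext_bdd hDL) DLg Sh Sb Sg
  (@ucop_hom _ g) (@ucop_gen _ g) (fun v => ex_intro _ v erefl) tq (associator_1 hPhi)
  (pentagon_inverse c hPhi).
rewrite legJ_env legB_env.
rewrite /pseudotwist X12_env X23_env X4_env X34_env /Jbar.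
exact.
Qed.
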